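(* Suppose that for any initial condition $x\in\mathbb R^d$ the stochastic differential equation $$dX(t)=b(X(t))\,dt+\sigma(X(t))\,dW(t)+\int_U c(X(t-),u)\,\widetilde N(dt,du)$$ has a non-exploding weak solution $X^x$ which is unique in the sense of probability law. Suppose moreover that there exist $\delta_0>0$ and a nondecreasing concave function $\varrho:[0,\infty)\to[0,\infty)$ with $0<\varrho(r)\le(1+r)^2\varrho\big(\tfrac r{1+r}\big)$ for all $r>0$ and $\int_{0+}\frac{dr}{\varrho(r)}=\infty$ such that for every $R>0$ there is a constant $\kappa_R>0$ such that for all $x,z\in\mathbb R^d$ with $|x|\vee|z|\le R$ and $|x-z|\le\delta_0$, $$\int_U\big[|c(x,u)-c(z,u)|^2\wedge(4|x-z|\cdot|c(x,u)-c(z,u)|)\big]\nu(du)+2\langle x-z,b(x)-b(z)\rangle+|\sigma(x)-\sigma(z)|^2\le2\kappa_R|x-z|\,\varrho(|x-z|).$$ Then the process $X$ is Feller continuous.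
   Context: Let $d\ge2$, $(U,\mathfrak U)$ a measurable space, $\nu$ a $\sigma$-finite measure on $U$. The functions $b:\mathbb R^d\to\mathbb R^d$, $\sigma:\mathbb R^d\to\mathbb R^{d\times d}$, $c:\mathbb R^d\times U\to\mathbb R^d$ are Borel measurable; $b$, $\sigma$ and $c(\cdot,u)$ (for each $u\in U$) are continuous, and $x\mapsto\int_U|c(x,u)|^2\nu(du)$ is continuous. For a matrix or vector $A$, $|A|=\sqrt{\mathrm{tr}(AA^T)}$. $W$ is a standard $d$-dimensional Brownian motion, $N$ a Poisson random measure on $[0,\infty)\times U$ with intensity $dt\,\nu(du)$ independent of $W$, and $\widetilde N$ its compensated measure, on a filtered probability space satisfying the usual hypotheses. For a bounded measurable $f:\mathbb R^d\to\mathbb R$ put $P_tf(x)=\mathbb E[f(X^x(t))]$, $t\ge0$. The process $X$ is Feller continuous if $P_t$ maps the set $C_b(\mathbb R^d)$ of bounded continuous functions into itself for every $t\ge0$. *)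

(* Defs.v *)
From mathcomp Require Export all_boot all_order all_algebra.
From mathcomp Require Export all_classical all_reals all_analysis.
From mathcomp Require Export measurable_realfun.
Export Order.TTheory GRing.Theory Num.Theory.
Export numFieldNormedType.Exports.

Set Implicit Arguments.
Unset Strict Implicit.
Unset Printing Implicit Defensive.

Local Open Scope classical_set_scope.
Local Open Scope ring_scope.

(* |A| = sqrt (tr (A A^T)); the library norm on matrices is the maximum of the
   absolute values of the entries. *)
Definition enorm (R : realType) (m n : nat) (A : 'M[R]_(m, n)) : R :=
  Num.sqrt (\tr (A *m A^T)).

Definition dotv (R : realType) (d : nat) (x y : 'cV[R]_d) : R :=
  \sum_(i < d) x i ord0 * y i ord0.

(* A topological space seen as a measurable space with its Borel sets. *)
Notation borel T := (g_sigma_algebraType (@open T)).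

(* In the definitions below, Omega carries the probability P, times are real
   numbers of which only the nonnegative ones matter, and a family of sets of
   type set (set Omega) stands for a sub-sigma-algebra. *)

Definition measurable_wrt (Omega : Type) disp' (E : measurableType disp')
    (G : set (set Omega)) (Y : Omega -> E) : Prop :=
  preimage_set_system setT Y measurable `<=` G.

Definition generated (I Omega : Type) disp' (E : measurableType disp')
    (D : set I) (Y : I -> Omega -> E) : set (set Omega) :=
  <<s \bigcup_(i in D) preimage_set_system setT (Y i) measurable >>.

Definition independent disp (Omega : measurableType disp) (R : realType)
    (P : probability Omega R) (G H : set (set Omega)) : Prop :=
  forall A B, G A -> H B -> P (A `&` B) = (P A * P B)%E.

Definition usual_filtration disp (Omega : measurableType disp) (R : realType)
    (P : probability Omega R) (F : R -> set (set Omega)) : Prop :=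
  [/\ forall t : R, 0 <= t -> sigma_algebra setT (F t) /\ F t `<=` measurable,
      forall s t : R, 0 <= s -> s <= t -> F s `<=` F t,
      forall t : R, 0 <= t -> \bigcap_(s in `]t, +oo[) F s `<=` F t
    & P.-negligible `<=` F 0].

Section processes.
Context (R : realType) (d : nat) (disp : measure_display)
  (Omega : measurableType disp) (P : probability Omega R)
  (F : R -> set (set Omega)).

Definition adapted (X : R -> Omega -> 'cV[R]_d) : Prop :=
  forall t : R, 0 <= t -> measurable_wrt (F t) (X t : Omega -> borel 'cV[R]_d).

Definition cadlag (x : R -> 'cV[R]_d) : Prop :=
  (forall t : R, 0 <= t -> x r @[r --> t^'+] --> x t) /\
  (forall t : R, 0 < t -> cvg (x r @[r --> t^'-])).

Definition left_limit (x : R -> 'cV[R]_d) (t : R) : 'cV[R]_d :=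
  lim (x r @[r --> t^'-]).

Definition cvg_probability_0 (Y : nat -> Omega -> \bar R) : Prop :=
  forall e : R, 0 < e -> P [set w | (e%:E <= Y n w)%E] @[n --> \oo] --> 0%E.

Record brownian_motion (W : R -> Omega -> 'cV[R]_d) : Prop := {
  bm_adapted : adapted W ;
  bm_start : forall w, W 0 w = 0 ;
  bm_continuous : forall w, {within `[0, +oo[, continuous (W ^~ w)} ;
  bm_independent : forall s t : R, 0 <= s -> s < t ->
    independent P (F s)
      (preimage_set_system setT (fun w => W t w - W s w : borel 'cV[R]_d)
         measurable) ;
  (* the increment has law N(0, (t - s) Id) *)
  bm_normal : forall s t : R, 0 <= s -> s < t ->
    forall B : 'I_d -> set R, (forall i, measurable (B i)) ->
    P [set w | forall i, B i ((W t w - W s w) i ord0)] =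
    (\prod_(i < d) normal_prob 0 (Num.sqrt (t - s)) (B i))%E }.

(* Ito integral of a matrix-valued integrand: the limit in probability of
   the integrals of the simple predictable integrands
   s |-> sum_i coef_i 1_]from_i, to_i](s). *)
Record simple_integrand := {
  si_size : nat ;
  si_from : 'I_si_size -> R ;
  si_to : 'I_si_size -> R ;
  si_coef : 'I_si_size -> Omega -> 'M[R]_d ;
  si_from_ge0 : forall i, 0 <= si_from i ;
  si_from_to : forall i, si_from i <= si_to i ;
  si_adapted : forall i,
    measurable_wrt (F (si_from i)) (si_coef i : Omega -> borel 'M[R]_d) ;
  si_bounded : forall i, exists M, forall w, enorm (si_coef i w) <= M }.

Definition si_val (H : simple_integrand) (r : R) (w : Omega) : 'M[R]_d :=
  \sum_(i < si_size H | si_from i < r <= si_to i) si_coef i w.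

Definition si_integral (H : simple_integrand) (W : R -> Omega -> 'cV[R]_d)
    (t : R) (w : Omega) : 'cV[R]_d :=
  \sum_(i < si_size H) si_coef i w *m
    (W (Num.min (si_to i) t) w - W (Num.min (si_from i) t) w).

Definition is_ito_integral (W : R -> Omega -> 'cV[R]_d)
    (H : R -> Omega -> 'M[R]_d) (I : R -> Omega -> 'cV[R]_d) : Prop :=
  [/\ adapted I,
      forall w, {within `[0, +oo[, continuous (I ^~ w)}
    & exists Hn : nat -> simple_integrand, forall t : R, 0 <= t ->
      cvg_probability_0 (fun n w => \int[lebesgue_measure]_(r in `[0%R, t])
        (enorm (si_val (Hn n) r w - H r w) ^+ 2)%:E)%E /\
      cvg_probability_0 (fun n w =>
        (enorm (si_integral (Hn n) W t w - I t w))%:E)].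

Context (dispU : measure_display) (U : measurableType dispU)
  (nu : {sigma_finite_measure set U -> \bar R}).

(* dt nu(du) on [0, +oo[ x U, extended by 0 to negative times *)
Definition intensity (A : set (R * U)) : \bar R :=
  (lebesgue_measure \x nu)%E (A `&` (`[0%R, +oo[ `*` setT)).

Record poisson_random_measure (N : R.-ker Omega ~> (R * U)%type) : Prop := {
  (* the second argument of poisson_prob is a dummy *)
  prm_poisson : forall A, measurable A -> (intensity A < +oo)%E ->
    forall k : nat, P [set w | N w A = (k%:R)%:E] =
                    poisson_prob (fine (intensity A)) 0%N [set k] ;
  prm_infinite : forall A, measurable A -> intensity A = +oo%E ->
    {ae P, forall w, N w A = +oo%E} ;
  prm_independent : forall n (A : 'I_n -> set (R * U)),
    (forall i, measurable (A i)) -> trivIset setT A ->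
    forall B : 'I_n -> set (\bar R), (forall i, measurable (B i)) ->
    P [set w | forall i, B i (N w (A i))] =
    (\prod_(i < n) P [set w | B i (N w (A i))])%E ;
  prm_adapted : forall (t : R) (A : set (R * U)), 0 <= t -> measurable A ->
    A `<=` `[0, t] `*` setT -> measurable_wrt (F t) (fun w => N w A) ;
  prm_future : forall t : R, 0 <= t ->
    independent P (F t)
      (generated [set A : set (R * U) | measurable A /\ A `<=` `]t, +oo[ `*` setT]
                 (fun A w => N w A)) }.

(* Integrands s, u |-> sum_i coef_i 1_(]from_i, to_i] x set_i)(s, u) for the
   compensated measure. *)
Record simple_jump_integrand := {
  sj_size : nat ;
  sj_from : 'I_sj_size -> R ;
  sj_to : 'I_sj_size -> R ;
  sj_set : 'I_sj_size -> set U ;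
  sj_coef : 'I_sj_size -> Omega -> 'cV[R]_d ;
  sj_from_ge0 : forall i, 0 <= sj_from i ;
  sj_from_to : forall i, sj_from i <= sj_to i ;
  sj_measurable : forall i, measurable (sj_set i) ;
  sj_finite : forall i, (nu (sj_set i) < +oo)%E ;
  sj_adapted : forall i,
    measurable_wrt (F (sj_from i)) (sj_coef i : Omega -> borel 'cV[R]_d) ;
  sj_bounded : forall i, exists M, forall w, enorm (sj_coef i w) <= M }.

Definition sj_val (H : simple_jump_integrand) (r : R) (u : U) (w : Omega) :
    'cV[R]_d :=
  \sum_(i < sj_size H | (sj_from i < r <= sj_to i) && (u \in sj_set i))
    sj_coef i w.

Definition compensated (N : R.-ker Omega ~> (R * U)%type) (A : set (R * U))
    (w : Omega) : R :=
  fine (N w A) - fine (intensity A).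

Definition sj_integral (H : simple_jump_integrand)
    (N : R.-ker Omega ~> (R * U)%type) (t : R) (w : Omega) : 'cV[R]_d :=
  \sum_(i < sj_size H)
    compensated N (`]Num.min (sj_from i) t, Num.min (sj_to i) t] `*` sj_set i) w
      *: sj_coef i w.

Definition is_jump_integral (N : R.-ker Omega ~> (R * U)%type)
    (H : R -> U -> Omega -> 'cV[R]_d) (J : R -> Omega -> 'cV[R]_d) : Prop :=
  [/\ adapted J,
      forall w, cadlag (J ^~ w)
    & exists Hn : nat -> simple_jump_integrand, forall t : R, 0 <= t ->
      cvg_probability_0 (fun n w => \int[lebesgue_measure]_(r in `]0%R, t])
        \int[nu]_u (enorm (sj_val (Hn n) r u w - H r u w) ^+ 2)%:E)%E /\
      cvg_probability_0 (fun n w =>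
        (enorm (sj_integral (Hn n) N t w - J t w))%:E)].

Record solves_sde (b : 'cV[R]_d -> 'cV[R]_d) (sigma : 'cV[R]_d -> 'M[R]_d)
    (c : 'cV[R]_d -> U -> 'cV[R]_d) (x : 'cV[R]_d)
    (W : R -> Omega -> 'cV[R]_d) (N : R.-ker Omega ~> (R * U)%type)
    (X : R -> Omega -> 'cV[R]_d) : Prop := {
  sde_filtration : usual_filtration P F ;
  sde_brownian : brownian_motion W ;
  sde_poisson : poisson_random_measure N ;
  sde_independent :
    independent P
      (generated `[0, +oo[ (W : R -> Omega -> borel 'cV[R]_d))
      (generated [set A : set (R * U) | measurable A] (fun A w => N w A)) ;
  sde_adapted : adapted X ;
  sde_cadlag : forall w, cadlag (X ^~ w) ;
  sde_start : {ae P, forall w, X 0 w = x} ;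
  sde_equation : exists I J : R -> Omega -> 'cV[R]_d,
    [/\ is_ito_integral W (fun t w => sigma (X t w)) I,
        is_jump_integral N (fun t u w => c (left_limit (X ^~ w) t) u) J
      & {ae P, forall w, forall t : R, 0 <= t ->
          X t w = x
            + \col_(i < d) (\int[lebesgue_measure]_(r in `[0, t])
                              (b (X r w) i ord0))%R
            + I t w + J t w}] }.

End processes.

(* The process takes its values in R^d at all times, hence does not explode. *)
Record weak_solution (R : realType) (d : nat) (dispU : measure_display)
    (U : measurableType dispU) (nu : {sigma_finite_measure set U -> \bar R})
    (b : 'cV[R]_d -> 'cV[R]_d) (sigma : 'cV[R]_d -> 'M[R]_d)
    (c : 'cV[R]_d -> U -> 'cV[R]_d) (x : 'cV[R]_d) := {
  ws_disp : measure_display ;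
  ws_space : measurableType ws_disp ;
  ws_prob : probability ws_space R ;
  ws_filtration : R -> set (set ws_space) ;
  ws_brownian : R -> ws_space -> 'cV[R]_d ;
  ws_poisson : R.-ker ws_space ~> (R * U)%type ;
  ws_process :> R -> ws_space -> 'cV[R]_d ;
  ws_solves : solves_sde ws_prob ws_filtration nu b sigma c x
                ws_brownian ws_poisson ws_process }.

(* Equality of the laws on the path space with the sigma-algebra generated by
   the coordinates at nonnegative times; on cadlag paths it is the Borel
   sigma-algebra of the Skorokhod topology. *)
Definition same_law (R : realType) (d : nat) disp disp'
    (Omega : measurableType disp) (Omega' : measurableType disp')
    (P : probability Omega R) (P' : probability Omega' R)
    (X : R -> Omega -> 'cV[R]_d) (X' : R -> Omega' -> 'cV[R]_d) : Prop :=
  forall A : set (R -> 'cV[R]_d),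
    generated `[0, +oo[ (fun t (x : R -> 'cV[R]_d) => x t : borel 'cV[R]_d) A ->
    P [set w | A (X ^~ w)] = P' [set w | A (X' ^~ w)].

Definition unique_in_law (R : realType) (d : nat) (dispU : measure_display)
    (U : measurableType dispU) (nu : {sigma_finite_measure set U -> \bar R})
    (b : 'cV[R]_d -> 'cV[R]_d) (sigma : 'cV[R]_d -> 'M[R]_d)
    (c : 'cV[R]_d -> U -> 'cV[R]_d) (x : 'cV[R]_d) : Prop :=
  forall Y Z : weak_solution nu b sigma c x,
    same_law (ws_prob Y) (ws_prob Z) Y Z.

Definition bounded_continuous (R : realType) (d : nat) (f : 'cV[R]_d -> R) :=
  continuous f /\ exists M, forall x, `|f x| <= M.

Section feller.
Context (R : realType) (d : nat) (dispU : measure_display)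
  (U : measurableType dispU) (nu : {sigma_finite_measure set U -> \bar R})
  (b : 'cV[R]_d -> 'cV[R]_d) (sigma : 'cV[R]_d -> 'M[R]_d)
  (c : 'cV[R]_d -> U -> 'cV[R]_d) (X : forall x, weak_solution nu b sigma c x).

Definition semigroup (t : R) (f : 'cV[R]_d -> R) (x : 'cV[R]_d) : R :=
  fine ('E_(ws_prob (X x))[f \o X x t])%E.

Definition Feller_continuous : Prop :=
  forall t : R, 0 <= t -> forall f, bounded_continuous f ->
    bounded_continuous (semigroup t f).

End feller.

(* Main.v *)
Require Import Defs.
From mathcomp Require Import ring lra.

(* All weak solutions are compared with a common Euler scheme whose coefficients
   take countably many values and whose jumps are compensated Poisson counts of
   finitely many sets of marks.  Driven by the noise of a weak solution and
   started at y, the scheme is a fixed measurable function of finitely many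
   Gaussian and Poisson increments, so its law depends neither on the
   probability space nor on the starting point of that solution.  Hence, if the
   scheme started at z is close in probability at time t to every weak solution
   started near z, then the laws of X^x(t) and X^z(t) are close for z near x.

   For this closeness, one interposes the shadow of X: the scheme with the same
   noise and the coefficients evaluated along X.  The shadow converges to X by
   Lenglart's inequality and the convergence of Riemann sums of cadlag paths.
   The distance D from the shadow to the scheme is controlled through
   E sqrt(|D|^2 + e^2): over one step of length h the concavity of the square
   root bounds the effect of a jump g by min(|g|^2 / (2 |D|), 2 |g|), which is
   the integrand of the coefficient condition, and a discrete form of Osgood's
   lemma keeps the expectation small up to time t. *)

Set Implicit Arguments.
Unset Strict Implicit.
Unset Printing Implicit Defensive.

Local Open Scope classical_set_scope.
Local Open Scope ring_scope.

(** * Euclidean norm and Borel maps of matrices *)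

Section frobenius.
Context {R : realType}.
Implicit Types m n : nat.

(** Solutions started at different points live on unrelated probability spaces and have no joint
    law, so the comparison has to pass through a law that both can produce. The accuracy asked of
    the scheme depends on the solution it follows; hence the neighbourhood of x is fixed by X^x
    alone, and only then, for each z in it, one scheme is chosen that is fine enough for X^x and X^z
    at once. The constants of the coefficient condition are those of the smoothed norm: divided by
    2r with r = |x - z|, its integrand is min(|g|^2 / (2r), 2|g|), where 2|g| collects one |g| from
    the triangle inequality and one from the first-order term that compensates the jump. The
    coefficients are compared at X and at the scheme, whereas D is measured from the shadow. The
    parameter e bridges this: if the shadow error is at most e^2 / 3 and |D| at most 1, then
    sqrt(|D|^2 + e^2) dominates the distance from X to the scheme, and the jump and diffusion terms,
    which decrease in that quantity, stay under the condition. The drift term has no sign and is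
    handled by the continuity of b. *)

Definition mdot m n (A B : 'M[R]_(m, n)) : R := \sum_i \sum_j A i j * B i j.

Lemma mdotC m n (A B : 'M[R]_(m, n)) : mdot A B = mdot B A.
Proof. by apply: eq_bigr => i _; apply: eq_bigr => j _; rewrite mulrC. Qed.

Lemma mdotDr m n (A B C : 'M[R]_(m, n)) : mdot A (B + C) = mdot A B + mdot A C.
Proof.
rewrite -big_split; apply: eq_bigr => i _.
by rewrite -big_split; apply: eq_bigr => j _; rewrite !mxE mulrDr.
Qed.

Lemma mdotZr m n a (A B : 'M[R]_(m, n)) : mdot A (a *: B) = a * mdot A B.
Proof.
rewrite mulr_sumr; apply: eq_bigr => i _.
by rewrite mulr_sumr; apply: eq_bigr => j _; rewrite !mxE mulrCA.
Qed.

Lemma mdotDl m n (A B C : 'M[R]_(m, n)) : mdot (A + B) C = mdot A C + mdot B C.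
Proof. by rewrite mdotC mdotDr !(mdotC C). Qed.

Lemma mdotZl m n a (A B : 'M[R]_(m, n)) : mdot (a *: A) B = a * mdot A B.
Proof. by rewrite mdotC mdotZr mdotC. Qed.

Lemma mdotNr m n (A B : 'M[R]_(m, n)) : mdot A (- B) = - mdot A B.
Proof. by rewrite -scaleN1r mdotZr mulN1r. Qed.

Lemma mdotNl m n (A B : 'M[R]_(m, n)) : mdot (- A) B = - mdot A B.
Proof. by rewrite mdotC mdotNr mdotC. Qed.

Lemma mdotBr m n (A B C : 'M[R]_(m, n)) : mdot A (B - C) = mdot A B - mdot A C.
Proof. by rewrite mdotDr mdotNr. Qed.

Lemma mdotBl m n (A B C : 'M[R]_(m, n)) : mdot (A - B) C = mdot A C - mdot B C.
Proof. by rewrite mdotDl mdotNl. Qed.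

Lemma mdot0r m n (A : 'M[R]_(m, n)) : mdot A 0 = 0.
Proof. by rewrite -(scale0r 0) mdotZr mul0r. Qed.

Lemma mdot_sumr m n I (r : seq I) (P : pred I) (A : 'M[R]_(m, n)) F :
  mdot A (\sum_(i <- r | P i) F i) = \sum_(i <- r | P i) mdot A (F i).
Proof.
apply: (big_morph (mdot A)); [exact: mdotDr | exact: mdot0r].
Qed.

Lemma mdot_ge0 m n (A : 'M[R]_(m, n)) : 0 <= mdot A A.
Proof. by apply: sumr_ge0 => i _; apply: sumr_ge0 => j _; rewrite -expr2 sqr_ge0. Qed.

Lemma dotvE d (x y : 'cV[R]_d) : dotv x y = mdot x y.
Proof. by apply: eq_bigr => i _; rewrite big_ord1. Qed.

Lemma enormE m n (A : 'M[R]_(m, n)) : enorm A = Num.sqrt (mdot A A).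
Proof.
congr Num.sqrt; apply: eq_bigr => i _; rewrite mxE.
by apply: eq_bigr => j _; rewrite mxE.
Qed.

Lemma enorm_ge0 m n (A : 'M[R]_(m, n)) : 0 <= enorm A.
Proof. by rewrite enormE sqrtr_ge0. Qed.

Lemma sqr_enorm m n (A : 'M[R]_(m, n)) : enorm A ^+ 2 = mdot A A.
Proof. by rewrite enormE sqr_sqrtr ?mdot_ge0. Qed.

Lemma sqr_enormE m n (A : 'M[R]_(m, n)) :
  enorm A ^+ 2 = \sum_i \sum_j A i j ^+ 2.
Proof.
by rewrite sqr_enorm; apply: eq_bigr => i _; apply: eq_bigr => j _; rewrite expr2.
Qed.

Lemma enorm0 m n : enorm (0 : 'M[R]_(m, n)) = 0.
Proof. by rewrite enormE mdot0r sqrtr0. Qed.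

Lemma enormN m n (A : 'M[R]_(m, n)) : enorm (- A) = enorm A.
Proof. by rewrite !enormE mdotNr mdotNl opprK. Qed.

Lemma enormB m n (A B : 'M[R]_(m, n)) : enorm (A - B) = enorm (B - A).
Proof. by rewrite -enormN opprB. Qed.

Lemma enormZ m n a (A : 'M[R]_(m, n)) : enorm (a *: A) = `|a| * enorm A.
Proof.
rewrite !enormE mdotZr mdotZl mulrA -expr2 sqrtrM ?sqr_ge0//.
by rewrite sqrtr_sqr.
Qed.

(** Cauchy-Schwarz: expand |bA - aB|^2 at a = |A|, b = |B| and divide by |A||B|. If one of the norms
    is 0 there is nothing to divide by; other multipliers then turn the expansion into a negative
    multiple of <A,B>^2 that must be nonnegative, so <A,B> = 0. *)
Lemma mdot_le m n (A B : 'M[R]_(m, n)) : mdot A B <= enorm A * enorm B.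
Proof.
have h (a b : R) : 0 <= b ^+ 2 * mdot A A - 2 * (a * b) * mdot A B + a ^+ 2 * mdot B B.
  have := mdot_ge0 (b *: A - a *: B).
  rewrite mdotBr !mdotBl !mdotZr !mdotZl (mdotC B A) => h; lra.
have := h (enorm A) (enorm B); rewrite -!sqr_enorm.
have := enorm_ge0 A; have := enorm_ge0 B.
rewrite le0r => /orP[/eqP b0|b0]; last first.
  rewrite le0r => /orP[/eqP a0|a0]; last first.
    move=> h1; have ab : 0 < enorm A * enorm B by rewrite mulr_gt0.
    rewrite -(ler_pM2l ab); move: h1.
    set a := enorm A; set b := enorm B; set c := mdot A B => h1; nra.
  move=> _; have := h (mdot A B) 1; have := h 1 (mdot A B).
  have := sqr_enorm A; rewrite a0 => <-.
  set c := mdot A B; set bb := mdot B B => _ _.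
  have := h (c / 2) (bb + 1); rewrite -sqr_enorm a0 -/c -/bb.
  have := mdot_ge0 B; rewrite -/bb => ? ?; nra.
move=> _ _.
have := h (mdot A A + 1) (mdot A B / 2); rewrite -(sqr_enorm B) b0.
set c := mdot A B; set aa := mdot A A.
have := mdot_ge0 A; rewrite -/aa => ? ?; nra.
Qed.

Lemma normr_mdot_le m n (A B : 'M[R]_(m, n)) : `|mdot A B| <= enorm A * enorm B.
Proof.
rewrite ler_norml mdot_le andbT lerNl -mdotNr -(enormN B); exact: mdot_le.
Qed.

Lemma sqr_enormD m n (A B : 'M[R]_(m, n)) :
  enorm (A + B) ^+ 2 = enorm A ^+ 2 + 2 * mdot A B + enorm B ^+ 2.
Proof. by rewrite !sqr_enorm mdotDr !mdotDl (mdotC B A); ring. Qed.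

Lemma ler_enormD m n (A B : 'M[R]_(m, n)) : enorm (A + B) <= enorm A + enorm B.
Proof.
rewrite -(ler_pXn2r (ltn0Sn 1)) ?nnegrE ?enorm_ge0 ?addr_ge0 ?enorm_ge0//.
rewrite sqr_enormD; have := mdot_le A B; lra.
Qed.

Lemma ler_enormB m n (A B : 'M[R]_(m, n)) : enorm (A - B) <= enorm A + enorm B.
Proof. by rewrite -(enormN B) ler_enormD. Qed.

Lemma ler_enorm_distD m n (A B C : 'M[R]_(m, n)) :
  enorm (A - C) <= enorm (A - B) + enorm (B - C).
Proof. by rewrite (le_trans _ (ler_enormD _ _))// addrA subrK. Qed.

Lemma ler_enorm_sum m n I (r : seq I) (P : pred I) (F : I -> 'M[R]_(m, n)) :
  enorm (\sum_(i <- r | P i) F i) <= \sum_(i <- r | P i) enorm (F i).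
Proof.
elim/big_ind2 : _ => [|x1 x2 y1 y2 h1 h2|//]; first by rewrite enorm0.
by rewrite (le_trans (ler_enormD _ _))// lerD.
Qed.

Lemma ler_enorm_sub m n (A B : 'M[R]_(m, n)) : enorm A - enorm B <= enorm (A - B).
Proof. by rewrite lerBlDr (le_trans _ (ler_enormD _ _))// subrK. Qed.

Lemma ler_dist_enorm m n (A B : 'M[R]_(m, n)) :
  `|enorm A - enorm B| <= enorm (A - B).
Proof. by rewrite ler_norml ler_enorm_sub lerNl opprB enormB ler_enorm_sub. Qed.

Lemma sqr_enormD_le m n (A B : 'M[R]_(m, n)) :
  enorm (A + B) ^+ 2 <= 2 * enorm A ^+ 2 + 2 * enorm B ^+ 2.
Proof. have := sqr_enormD A B; have := sqr_enormD A (- B); rewrite mdotNr enormN.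
have := sqr_ge0 (enorm (A - B)); lra. Qed.

Lemma ler_entry_enorm m n (A : 'M[R]_(m, n)) i j : `|A i j| <= enorm A.
Proof.
rewrite -(ler_pXn2r (ltn0Sn 1)) ?nnegrE ?enorm_ge0// real_normK ?num_real//.
rewrite sqr_enormE (bigD1 i)//= (bigD1 j)//= -addrA lerDl addr_ge0//.
  by apply: sumr_ge0 => *; exact: sqr_ge0.
by apply: sumr_ge0 => *; apply: sumr_ge0 => *; exact: sqr_ge0.
Qed.

Lemma ler_enorm_entries m n (A : 'M[R]_(m, n)) :
  enorm A <= \sum_i \sum_j `|A i j|.
Proof.
rewrite {1}(matrix_sum_delta A) (le_trans (ler_enorm_sum _ _ _))//.
apply: ler_sum => i _; rewrite (le_trans (ler_enorm_sum _ _ _))//.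
apply: ler_sum => j _; rewrite enormZ ler_piMr//.
rewrite -(ler_pXn2r (ltn0Sn 1)) ?nnegrE ?enorm_ge0// sqr_enormE expr1n.
rewrite (bigD1 i)//= (bigD1 j)//= mxE !eqxx expr1n big1 ?big1 ?addr0//.
  move=> k ki; apply: big1 => l _; rewrite mxE (negbTE ki).
  by rewrite expr0n.
by move=> k kj; rewrite mxE (negbTE kj) andbF expr0n.
Qed.

End frobenius.

Section frobenius_topology.
Context {R : realType}.
Implicit Types m n p : nat.

(** The topology of matrices comes from the maximum of the entries; the Euclidean norm is at most
    the sum of the mn entries, each made smaller than e / (mn + 1). The extra 1 keeps the divisor
    positive for an empty matrix. *)
Lemma near_enorm m n (x : 'M[R]_(m, n)) (e : R) : 0 < e ->
  \forall y \near x, enorm (x - y) < e.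
Proof.
move=> e0; have k0 : 0 < e / (m * n).+1%:R by rewrite divr_gt0.
apply/nbhs_ballP; exists (e / (m * n).+1%:R) => //= y [_ xy].
rewrite (le_lt_trans (ler_enorm_entries _))//.
apply: (@le_lt_trans _ _ (\sum_(i < m) \sum_(j < n) e / (m * n).+1%:R)).
  apply: ler_sum => i _; apply: ler_sum => j _; rewrite !mxE ltW//.
  exact: xy.
rewrite !sumr_const !card_ord -mulrnA -[X in X < _]mulr_natr -mulrA.
by rewrite gtr_pMr// mulrC ltr_pdivrMr// mul1r ltr_nat mulnC.
Qed.

Lemma nbhs_enorm m n (x : 'M[R]_(m, n)) (A : set 'M[R]_(m, n)) : nbhs x A ->
  exists2 e : R, 0 < e & forall y, enorm (x - y) < e -> A y.
Proof.
move=> /nbhs_ballP[e /= e0 eA]; exists e => // y xy; apply: eA; split => // i j.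
rewrite /ball/= (le_lt_trans _ xy)//.
by have := ler_entry_enorm (x - y) i j; rewrite !mxE.
Qed.

Lemma cvg_enormP m n T (F : set_system T) {FF : Filter F} (f : T -> 'M[R]_(m, n)) (l : 'M[R]_(m, n)) :
  f @ F --> l <-> forall e : R, 0 < e -> \forall t \near F, enorm (l - f t) < e.
Proof.
split=> [fl e e0|fl A /nbhs_enorm[e e0 eA]].
  exact: fl (near_enorm _ e0).
by near do apply: eA; exact: fl.
Unshelve. all: by end_near. Qed.

Lemma continuous_enormP m n p q (f : 'M[R]_(m, n) -> 'M[R]_(p, q)) :
  continuous f -> forall x (e : R), 0 < e ->
  exists2 r : R, 0 < r & forall y, enorm (x - y) < r -> enorm (f x - f y) < e.
Proof.
move=> cf x e e0; have /cvg_enormP/(_ _ e0) := cf x.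
exact: nbhs_enorm.
Qed.

Lemma cvg_entry m n T (F : set_system T) {FF : Filter F} (f : T -> 'M[R]_(m, n)) (l : 'M[R]_(m, n)) i j :
  f @ F --> l -> f t i j @[t --> F] --> l i j.
Proof.
move=> /cvg_enormP fl; apply/cvgrPdist_lt => e e0; near=> t.
apply: (@le_lt_trans _ _ (enorm (l - f t))); last by near: t; exact: fl.
by have := ler_entry_enorm (l - f t) i j; rewrite !mxE.
Unshelve. all: by end_near. Qed.

Lemma cvg_entries m n T (F : set_system T) {FF : Filter F} (f : T -> 'M[R]_(m, n)) (l : 'M[R]_(m, n)) :
  (forall i j, f t i j @[t --> F] --> l i j) -> f @ F --> l.
Proof.
move=> fl A /nbhs_ballP[e /= e0 eA].
have : \forall t \near F, forall i j, ball (l i j) e (f t i j).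
  apply: filter_forall => i; apply: filter_forall => j.
  exact: fl (nbhsx_ballx _ _ e0).
by apply: filterS => t h; apply: eA; split.
Qed.

Lemma continuous_enorm m n : continuous (@enorm R m n).
Proof.
move=> x; apply/(@cvgrPdist_lt _ _ _ (nbhs x) (nbhs_filter x)) => e e0; near=> y.
rewrite (le_lt_trans (ler_dist_enorm _ _))//.
by near: y; exact: near_enorm.
Unshelve. all: by end_near. Qed.

Lemma continuous_entry m n i j : continuous (fun A : 'M[R]_(m, n) => A i j).
Proof. by move=> A; exact: (@cvg_entry _ _ _ (nbhs A) _ id A i j (@cvg_id _ (nbhs A))). Qed.

Lemma compact_cube d (K : R) :
  compact [set x : 'cV[R]_d | forall i, `[- K, K]%classic (x i ord0)].
Proof.
have -> : [set x : 'cV[R]_d | forall i, `[- K, K]%classic (x i ord0)] =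
    (trmx : 'rV_d -> 'cV_d) @` [set v : 'rV[R]_d | forall i, `[- K, K]%classic (v ord0 i)].
  apply/seteqP; split=> [x h|_ [v h <-] i]; last by rewrite mxE; exact: h.
  by exists x^T; [move=> i; rewrite mxE; exact: h | rewrite trmxK].
apply: continuous_compact; last first.
  by apply: (@rV_compact R d (fun=> `[- K, K]%classic)) => i; exact: segment_compact.
apply: continuous_subspaceT => v.
apply: (@cvg_entries _ _ _ (nbhs v) (nbhs_filter v)) => i j.
under eq_fun do rewrite mxE.
by rewrite mxE; exact: continuous_entry.
Qed.

(** Compactness in the form used below: the radius may depend on the centre, so a modulus of
    continuity at each point can be inserted as it is. The interiors of the balls serve as the open
    cover. *)
Lemma ball_net d (K : R) (r : 'cV[R]_d -> R) : (forall z, 0 < r z) ->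
  exists s : seq 'cV[R]_d, forall x, enorm x <= K ->
    exists2 z, z \in s & enorm (z - x) < r z.
Proof.
move=> r0; have := @compact_cube d K; rewrite compact_cover.
pose D z := interior [set x | enorm (z - x) < r z].
move=> /(_ _ setT D)[|x _|F _ FD].
- by move=> z _; exact: open_interior.
- by exists x => //; exact: near_enorm.
exists (finmap.enum_fset F) => x xK; have [|z /= zF xz] := FD x.
  move=> i /=; rewrite in_itv/= -ler_norml.
  exact: le_trans (ler_entry_enorm _ _ _) xK.
by exists z => //; exact: (interior_subset xz).
Qed.

Lemma continuous_ball_bounded d m n (f : 'cV[R]_d -> 'M[R]_(m, n)) (K : R) :
  continuous f -> exists2 M : R, 0 < M & forall x, enorm x <= K -> enorm (f x) <= M.
Proof.
move=> /continuous_enormP cf.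
have /choice[r r0] : forall z, exists r : R, 0 < r /\
    forall y, enorm (z - y) < r -> enorm (f z - f y) < 1.
  by move=> z; have [r ? ?] := cf z 1 ltr01; exists r.
have [s h] := @ball_net d K r (fun z => (r0 z).1).
exists (1 + \sum_(z <- s) enorm (f z)).
  by rewrite ltr_wpDr// sumr_ge0// => *; exact: enorm_ge0.
move=> x /h[z zs /(r0 z).2 zx].
rewrite (le_trans (_ : _ <= enorm (f z - f x) + enorm (f z)))//.
  by rewrite -lerBlDr (le_trans (ler_enorm_sub _ _))// enormB.
rewrite (big_rem z)//=.
apply: lerD; first exact: ltW.
by rewrite lerDl sumr_ge0// => *; exact: enorm_ge0.
Qed.

(** Only [x] is restricted to the ball; halving the radii of the net leaves room for [y] next to the
    same centre. *)
Lemma continuous_ball_unif d m n (f : 'cV[R]_d -> 'M[R]_(m, n)) (K e : R) :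
  continuous f -> 0 < e -> exists2 r : R, 0 < r &
    forall x y, enorm x <= K -> enorm (x - y) < r -> enorm (f x - f y) < e.
Proof.
move=> /continuous_enormP cf e0; have e20 : 0 < e / 2 by rewrite divr_gt0.
have /choice[r r0] : forall z, exists r : R, 0 < r /\
    forall y, enorm (z - y) < r -> enorm (f z - f y) < e / 2.
  by move=> z; have [r ? ?] := cf z _ e20; exists r.
have r20 z : 0 < r z / 2 by rewrite divr_gt0// (r0 z).1.
have [s h] := @ball_net d K _ r20.
have [r1 r10 r1s] : exists2 r1, 0 < r1 & forall z, z \in s -> r1 <= r z / 2.
  elim: s {h} => [|z s [r1 r10 r1s]]; first by exists 1.
  exists (Num.min (r z / 2) r1); first by rewrite lt_min r20.
  move=> z'; rewrite inE => /orP[/eqP ->|/r1s zs]; first by rewrite ge_min lexx.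
  by rewrite ge_min zs orbT.
exists r1 => // x y /h[z zs zx] xy.
have zx2 : enorm (f z - f x) < e / 2.
  by apply: (r0 z).2; rewrite (lt_trans zx)// ltr_pdivrMr// ltr_pMr ?(r0 z).1// ltr1n.
have zy2 : enorm (f z - f y) < e / 2.
  apply: (r0 z).2; rewrite (le_lt_trans (ler_enorm_distD _ x _))//.
  rewrite (splitr (r z)) ltrD// (lt_le_trans xy)//; exact: r1s.
rewrite (le_lt_trans (ler_enorm_distD _ (f z) _))// (splitr e) ltrD//.
by rewrite enormB.
Qed.

End frobenius_topology.

Section borel_matrix.
Context {R : realType}.

Lemma measurable_borel_comp m n p q d (T : measurableType d)
    (g : 'M[R]_(m, n) -> 'M[R]_(p, q)) (f : T -> borel 'M[R]_(m, n)) :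
  continuous g -> measurable_fun setT f ->
  measurable_fun setT (fun t => g (f t) : borel 'M[R]_(p, q)).
Proof.
move=> cg mf.
apply: (@measurability _ _ T (borel 'M[R]_(p, q)) setT _ open erefl).
move=> _ [B oB <-]; rewrite setTI -[X in measurable X]setTI.
apply: (mf measurableT (g @^-1` B)); apply: sub_sigma_algebra.
by move/continuousP : cg; exact.
Qed.

Lemma measurable_borel_real m n d (T : measurableType d)
    (g : 'M[R]_(m, n) -> R) (f : T -> borel 'M[R]_(m, n)) :
  continuous g -> measurable_fun setT f -> measurable_fun setT (fun t => g (f t)).
Proof.
move=> cg mf; apply: (measurability _ (RGenOpens.measurableE R)) => //.
move=> _ [B [a [b ->] <-]]; rewrite setTI -[X in measurable X]setTI.
apply: (mf measurableT (g @^-1` `]a, b[)); apply: sub_sigma_algebra.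
by move/continuousP : cg; apply; exact: interval_open.
Qed.

Lemma measurable_entry m n d (T : measurableType d) (f : T -> borel 'M[R]_(m, n)) i j :
  measurable_fun setT f -> measurable_fun setT (fun t => (f t : 'M[R]_(m, n)) i j).
Proof. exact: measurable_borel_real (@continuous_entry R m n i j). Qed.

(** An open set is the union of the rational boxes that it contains, a countable family, and a box
    is a finite intersection of conditions on single entries. Borel measurability of a matrix-valued
    map is thereby checked entry by entry. *)
Lemma measurable_entries m n d (T : measurableType d) (f : T -> 'M[R]_(m, n)) :
  (forall i j, measurable_fun setT (fun t => f t i j)) ->
  measurable_fun setT (f : T -> borel 'M[R]_(m, n)).
Proof.
move=> mf.
apply: (@measurability _ _ T (borel 'M[R]_(m, n)) setT _ open erefl).
move=> _ [V oV <-]; rewrite setTI.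
pose box (qr : 'M[rat]_(m, n) * rat) : set 'M[R]_(m, n) :=
  [set x | forall i j, `|x i j - ratr (qr.1 i j)| < ratr qr.2].
have -> : f @^-1` V = \bigcup_qr
    (if `[< box qr `<=` V >] then f @^-1` (box qr) else set0).
  apply/seteqP; split => [t /= Vft|t [qr _]]; last first.
    by case: asboolP => // + bt; exact.
  have /nbhs_ballP[e /= e0 eV] : nbhs (f t) V by exact: open_nbhs_nbhs.
  have [s /andP[s0 se]] : exists s : rat, 0 < (ratr s : R) < e / 2.
    have := @rat_in_itvoo R 0 (e / 2); rewrite divr_gt0// => /(_ isT)[s].
    by rewrite in_itv/=; exists s.
  have /choice[q hq] : forall ij : 'I_m * 'I_n, exists q : rat,
      `|f t ij.1 ij.2 - ratr q| < ratr s.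
    move=> ij; have := @rat_in_itvoo R (f t ij.1 ij.2 - ratr s) (f t ij.1 ij.2 + ratr s).
    rewrite ltrD2l gtrN// => /(_ isT)[q]; rewrite in_itv/= => /andP[q1 q2].
    by exists q; rewrite ltr_norml; apply/andP; split; lra.
  exists (\matrix_(i, j) q (i, j), s) => //.
  case: asboolP => [_ i j|]; first by rewrite /= mxE; exact: hq (i, j).
  case=> x bx; apply: eV; split => // i j; rewrite /ball/=.
  have := bx i j; have := hq (i, j); rewrite /= mxE => h1 h2.
  rewrite (_ : f t i j - x i j = (f t i j - ratr (q (i, j))) - (x i j - ratr (q (i, j)))); last by ring.
  rewrite (le_lt_trans (ler_normB _ _))//; lra.
apply: countable_bigcupT_measurable => [|qr]; first exact: countableP.
case: asboolP => _; last exact: measurable0.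
rewrite (_ : _ @^-1` _ = \bigcap_(ij in [set: 'I_m * 'I_n])
    [set t | `|f t ij.1 ij.2 - ratr (qr.1 ij.1 ij.2)| < ratr qr.2]).
  apply: fin_bigcap_measurable => // ij _.
  rewrite -[X in measurable X]setTI.
  apply: (measurable_fun_ltr _ (measurable_cst _)) => //.
  by apply: measurableT_comp => //; apply: measurable_funB.
apply/seteqP; split => [t h [i j] _|t h i j]; first exact: h.
exact: h (i, j) I.
Qed.

End borel_matrix.

(** * The smoothed norm *)

Section smoothed_norm.
Context {R : realType} (d : nat) (e : R) (e0 : 0 < e).
Implicit Types v a : 'cV[R]_d.

(* A smooth majorant of the Euclidean norm; below, the concavity of the square
   root replaces Ito's formula. *)
Definition snorm v : R := Num.sqrt (mdot v v + e ^+ 2).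

Lemma sqr_snorm v : snorm v ^+ 2 = mdot v v + e ^+ 2.
Proof. by rewrite sqr_sqrtr// addr_ge0 ?mdot_ge0 ?sqr_ge0. Qed.

Lemma snorm_gt0 v : 0 < snorm v.
Proof. by rewrite sqrtr_gt0 ltr_wpDl ?mdot_ge0 ?exprn_gt0. Qed.

Lemma snorm_ge0 v : 0 <= snorm v. Proof. exact/ltW/snorm_gt0. Qed.

Lemma ler_enorm_snorm v : enorm v <= snorm v.
Proof. by rewrite enormE ler_wsqrtr// lerDl sqr_ge0. Qed.

Lemma ler_snorm v : e <= snorm v.
Proof.
rewrite -(ler_pXn2r (ltn0Sn 1)) ?nnegrE ?snorm_ge0 ?(ltW e0)// sqr_snorm.
by rewrite lerDr mdot_ge0.
Qed.

Lemma snorm_le v : snorm v <= enorm v + e.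
Proof.
rewrite -(ler_pXn2r (ltn0Sn 1)) ?nnegrE ?snorm_ge0 ?addr_ge0 ?enorm_ge0 ?(ltW e0)//.
rewrite sqr_snorm sqrrD sqr_enorm lerD2r lerDl mulrn_wge0//.
by rewrite mulr_ge0 ?enorm_ge0 ?(ltW e0).
Qed.

Lemma sqr_snormD v a :
  snorm (v + a) ^+ 2 = snorm v ^+ 2 + 2 * mdot v a + enorm a ^+ 2.
Proof. by rewrite !sqr_snorm sqr_enorm mdotDr !mdotDl (mdotC a v); ring. Qed.

Lemma snormD_le v a : snorm (v + a) <= snorm v + enorm a.
Proof.
rewrite -(ler_pXn2r (ltn0Sn 1)) ?nnegrE ?snorm_ge0 ?addr_ge0 ?enorm_ge0 ?snorm_ge0//.
rewrite sqr_snormD; have := mdot_le v a; have := ler_enorm_snorm v.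
have := enorm_ge0 a; have := enorm_ge0 v; nra.
Qed.

(** Concavity of the square root at p^2 with p = [snorm v]: with q = [snorm (v + a)], the claim
    multiplied by 2p is 2pq <= p^2 + q^2. *)
Lemma snormD_taylor v a :
  snorm (v + a) <= snorm v + mdot v a / snorm v + enorm a ^+ 2 / (2 * snorm v).
Proof.
have p0 := snorm_gt0 v.
rewrite -(ler_pM2l (mulr_gt0 (ltr0Sn _ 1) p0)).
have -> : 2 * snorm v * (snorm v + mdot v a / snorm v + enorm a ^+ 2 / (2 * snorm v))
    = snorm v ^+ 2 + snorm (v + a) ^+ 2.
  by rewrite sqr_snormD; field; exact: lt0r_neq0.
have := sqr_ge0 (snorm v - snorm (v + a)); lra.
Qed.

Lemma normr_mdot_div_snorm v a : `|mdot v a / snorm v| <= enorm a.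
Proof.
rewrite normrM normfV (gtr0_norm (snorm_gt0 v)) ler_pdivrMr ?snorm_gt0//.
rewrite (le_trans (normr_mdot_le _ _))// mulrC ler_wpM2l ?enorm_ge0//.
exact: ler_enorm_snorm.
Qed.

End smoothed_norm.

(** * Effect of jumps on the smoothed norm *)

Section jump_increment.
Context {R : realType}.

(** The integrand of the coefficient condition divided by 2p, see [jump_sizeE]: p stands for the
    size of the gap before the jump and a for the size of the jump. *)
Definition jump_size (p a : R) : R := Num.min (a ^+ 2 / (2 * p)) (2 * a).

Lemma jump_size_ge0 p a : 0 < p -> 0 <= a -> 0 <= jump_size p a.
Proof.
move=> p0 a0; rewrite le_min divr_ge0 ?sqr_ge0 ?mulr_ge0//; exact: ltW.
Qed.

Lemma jump_size_le p a : jump_size p a <= a ^+ 2 / (2 * p).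
Proof. by rewrite ge_min lexx. Qed.

Lemma jump_size_anti p q a : 0 < p -> p <= q -> jump_size q a <= jump_size p a.
Proof.
move=> p0 pq; have q0 := lt_le_trans p0 pq.
rewrite /jump_size le_min !ge_min lexx orbT andbT; apply/orP; left.
by rewrite ler_wpM2l ?sqr_ge0// lef_pV2 ?posrE ?mulr_gt0// ler_pM2l.
Qed.

Lemma jump_sizeE p a : 0 < p ->
  jump_size p a = Num.min (a ^+ 2) (4 * p * a) / (2 * p).
Proof.
move=> p0; rewrite minr_pMl ?invr_ge0 ?mulr_ge0 ?(ltW p0)//.
by congr Num.min; field; exact: lt0r_neq0.
Qed.

(** The error is that of the quadratic branch alone. Where the linear branch is the smaller one for
    a > 0, a > 4p, and then the linear error 2b is below 2ab / (2p). *)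
Lemma jump_sizeD p a b : 0 < p -> 0 <= a -> 0 <= b ->
  jump_size p (a + b) <= jump_size p a + (2 * a * b + b ^+ 2) / (2 * p).
Proof.
move=> p0 a0 b0; have ip : 0 <= (2 * p)^-1 by rewrite invr_ge0 mulr_ge0// ltW.
rewrite [in leRHS]/jump_size; have [h|h] := leP (a ^+ 2 / (2 * p)) (2 * a).
  by rewrite (le_trans (jump_size_le _ _))// -mulrDl ler_wpM2r//; lra.
rewrite (@le_trans _ _ (2 * (a + b)))//; first by rewrite ge_min lexx orbT.
rewrite mulrDr lerD2l ler_pdivlMr ?mulr_gt0//.
have : 4 * p * a <= a ^+ 2.
  move: h; rewrite ltr_pdivlMr ?mulr_gt0// => /ltW; lra.
have [a00|an0] := eqVneq a 0; last first.
  have ap : 0 < a by rewrite lt_def an0.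
  rewrite expr2 ler_pM2r// => h1; nra.
by move: h; rewrite a00 expr2 !mul0r mulr0 ltxx.
Qed.

Lemma jump_size_mono p a b : 0 < p -> 0 <= a -> a <= b ->
  jump_size p a <= jump_size p b.
Proof.
move=> p0 a0 ab; rewrite /jump_size le_min !ge_min; apply/andP; split; apply/orP.
  left; rewrite ler_wpM2r ?invr_ge0 ?mulr_ge0 ?(ltW p0)//.
  by rewrite ler_pXn2r ?nnegrE// (le_trans a0).
by right; rewrite ler_wpM2l.
Qed.

End jump_increment.

Section one_step.
Context {R : realType} (d : nat) (e : R) (e0 : 0 < e).
Implicit Types v a : 'cV[R]_d.
Local Notation snorm := (snorm e).

(** When the jump is large the Taylor bound is replaced by the Lipschitz bound; since the
    first-order term is kept on the right and may be as low as -|a|, this costs |a| twice. *)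
Lemma snormD_jump v a :
  snorm (v + a) <= snorm v + mdot v a / snorm v + jump_size (snorm v) (enorm a).
Proof.
rewrite /jump_size; have [_|_] := leP (enorm a ^+ 2 / (2 * snorm v)) (2 * enorm a).
  exact: snormD_taylor.
rewrite (le_trans (snormD_le e0 v a))// -addrA lerD2l.
have := normr_mdot_div_snorm e0 v a; rewrite ler_norml => /andP[+ _]; lra.
Qed.

(* [n j] counts the jumps of size [gam j] during one time step and [a0] is the
   rest of the increment. *)
Lemma snorm_one_step (J : finType) (n : J -> nat) (gam : J -> 'cV[R]_d) v a a0 (C N : R) :
  0 <= C -> (forall j, enorm (gam j) <= C) ->
  a = a0 + \sum_j (n j)%:R *: gam j -> N = \sum_j (n j)%:R ->
  snorm (v + a) <= snorm v + mdot v a / snorm v + enorm a0 ^+ 2 / (2 * snorm v)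
     + \sum_j (n j)%:R * jump_size (snorm v) (enorm (gam j))
     + 2 * N * enorm a0 + 2 * C * (N * (N - 1)).
Proof.
move=> C0 gC aE0 NE0; have p0 := snorm_gt0 e0 v.
have sq0 : 0 <= enorm a0 ^+ 2 / (2 * snorm v).
  by rewrite divr_ge0 ?sqr_ge0// mulr_ge0// ltW.
have js0 : 0 <= \sum_j (n j)%:R * jump_size (snorm v) (enorm (gam j)).
  by apply: sumr_ge0 => j _; rewrite mulr_ge0// jump_size_ge0 ?enorm_ge0.
have a00 := enorm_ge0 a0.
have NE : N = (\sum_j n j)%:R by rewrite NE0 natr_sum.
(* No jump: the increment is [a0] and the Taylor bound suffices. *)
case: (posnP (\sum_j n j)%N) => [N0|Npos].
  have nj j : n j = 0%N.
    by apply/eqP; rewrite -leqn0 -N0 (bigD1 j)//= leq_addr.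
  have -> : a = a0.
    by rewrite aE0 big1 ?addr0// => j _; rewrite nj scale0r.
  rewrite NE N0 big1 => [|j _]; last by rewrite nj mul0r.
  by have := snormD_taylor e0 v a0; lra.
(* At least two jumps: the Lipschitz bound with |a| <= |a0| + CN costs 2|a0| + 2CN, which for N >= 2
   is covered by 2N|a0| + 2CN(N - 1). *)
case: (ltnP 1 (\sum_j n j)%N) => [N2|N1].
  have N2' : 2 <= N by rewrite NE ler_nat.
  have := snormD_le e0 v a; have := normr_mdot_div_snorm e0 v a.
  rewrite ler_norml => /andP[+ _].
  have : enorm a <= enorm a0 + C * N.
    rewrite aE0 (le_trans (ler_enormD _ _))// lerD2l (le_trans (ler_enorm_sum _ _ _))//.
    rewrite NE0 mulr_sumr; apply: ler_sum => j _.
    by rewrite enormZ normr_nat mulrC ler_wpM2r.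
  move=> h1 h2 h3.
  have h4 : 0 <= C * N * (N - 2) by rewrite !mulr_ge0//; lra.
  have h5 : 0 <= (N - 1) * enorm a0 by rewrite mulr_ge0//; lra.
  nra.
(* Exactly one jump: it gets the refined bound, and [a0] is added afterwards by the Lipschitz bound;
   the first-order term of [a0], present on the right, doubles the cost to 2|a0|, and N(N - 1) =
   0. *)
have /eqP sn1 : (\sum_j n j == 1)%N by rewrite eqn_leq N1 Npos.
have [j0 nj0] : exists j, n j = 1%N.
  have [j nj] : exists j, (0 < n j)%N.
    apply/existsP; apply: contraTT Npos => /existsPn h.
    by rewrite -leqNgt leqn0; apply/eqP; apply: big1 => j _; move: (h j); case: (n j).
  exists j; apply/eqP; rewrite eqn_leq nj andbT.
  by rewrite (leq_trans _ N1)// (bigD1 j)//= leq_addr.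
have nj j : j != j0 -> n j = 0%N.
  move=> jj0; apply/eqP; rewrite -leqn0 -ltnS.
  move: sn1; rewrite (bigD1 j0)//= nj0 (bigD1 j)//= => /eqP.
  by rewrite add1n eqSS addn_eq0 => /andP[/eqP -> _].
have sumE (V : lmodType R) (F : J -> V) : \sum_j (n j)%:R *: F j = F j0.
  rewrite (bigD1 j0)//= nj0 scale1r big1 ?addr0// => j /nj ->.
  by rewrite scale0r.
have aE : a = gam j0 + a0 by rewrite aE0 sumE addrC.
have -> : \sum_j (n j)%:R * jump_size (snorm v) (enorm (gam j)) =
   jump_size (snorm v) (enorm (gam j0)) by exact: (sumE R^o).
rewrite NE sn1 aE mdotDr mulrDl.
have := snormD_le e0 (v + gam j0) a0; rewrite -addrA.
have := snormD_jump v (gam j0); have := normr_mdot_div_snorm e0 v a0.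
by rewrite ler_norml => /andP[+ _]; lra.
Qed.

End one_step.

(** * Osgood moduli *)

Section osgood.
Context {R : realType} (rho : R -> R).
Hypothesis rho_nondecreasing : forall r s : R, 0 <= r -> r <= s -> rho r <= rho s.
Hypothesis rho_gt0 : forall r : R, 0 < r -> 0 < rho r.

(** 1 / rho is known to be monotone on positive arguments only; replacing r by max(a, r) makes it
    monotone on the whole line without changing it on the interval. *)
Lemma measurable_inv_modulus a b : 0 < a ->
  measurable_fun (`]a, b] : set R) (fun r => ((rho r)^-1)%:E).
Proof.
move=> a0; apply/measurable_EFinP.
apply: (@eq_measurable_fun _ _ _ _ _ (fun r => (rho (Num.max a r))^-1)).
  move=> r; rewrite inE/= in_itv/= => /andP[ar _].
  by rewrite max_r// ltW.
apply: nonincreasing_measurable => // x y xy.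
have m0 z : 0 < Num.max a z by rewrite lt_max a0.
rewrite lef_pV2 ?posrE ?rho_gt0//; apply: rho_nondecreasing; first exact: ltW.
by rewrite ge_max !le_max lexx/= xy orbT.
Qed.

Lemma integral_inv_modulus_le a b : 0 < a -> a <= b ->
  (\int[lebesgue_measure]_(r in `]a, b]) ((rho r)^-1)%:E <= ((b - a) / rho a)%:E)%E.
Proof.
move=> a0 ab.
apply: (@le_trans _ _ (\int[lebesgue_measure]_(r in `]a, b]) (cst ((rho a)^-1)%:E r))%E).
  apply: ge0_le_integral => //.
  - move=> r /=; rewrite in_itv/= => /andP[ar _].
    by rewrite lee_fin invr_ge0 ltW// rho_gt0// (lt_trans a0).
  - exact: measurable_inv_modulus.
  - move=> r /=; rewrite in_itv/= => /andP[ar _]; rewrite lee_fin.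
    have r0 := lt_trans a0 ar.
    by rewrite lef_pV2 ?posrE ?rho_gt0// rho_nondecreasing// ltW.
rewrite integral_cst//= lebesgue_measure_itv/= lte_fin.
have ra0 := rho_gt0 a0.
case: ifP => _; first by rewrite -EFinB -EFinM mulrC.
by rewrite mule0 lee_fin divr_ge0 ?subr_ge0 ?(ltW ra0).
Qed.

Lemma integral_inv_modulus_cat a b c : 0 < a -> a <= b -> b <= c ->
  (\int[lebesgue_measure]_(r in `]a, c]) ((rho r)^-1)%:E =
   \int[lebesgue_measure]_(r in `]a, b]) ((rho r)^-1)%:E +
   \int[lebesgue_measure]_(r in `]b, c]) ((rho r)^-1)%:E)%E.
Proof.
move=> a0 ab bc.
have E : `]a, c]%classic = `]a, b]%classic `|` `]b, c]%classic :> set R.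
  apply/seteqP; split=> r /=; rewrite !in_itv/=.
    by move=> /andP[ar rc]; case: (leP r b) => rb; [left | right]; apply/andP.
  case=> /andP[h1 h2]; apply/andP; split => //.
    exact: le_trans bc.
  exact: le_lt_trans h1.
rewrite E ge0_integral_setU//.
- by rewrite -E; exact: measurable_inv_modulus.
- rewrite -E => r /=; rewrite in_itv/= => /andP[ar _].
  by rewrite lee_fin invr_ge0 ltW// rho_gt0// (lt_trans a0).
- apply/disj_setPS => r [] /=; rewrite !in_itv/= => /andP[_ rb] /andP[br _].
  by have := le_lt_trans rb br; rewrite ltxx.
Qed.

Hypothesis rho_osgood : forall e : R, 0 < e ->
  (\int[lebesgue_measure]_(r in `]0%R, e]) ((rho r)^-1)%:E = +oo)%E.

Lemma integral_inv_modulus_large (tau M : R) : 0 < tau ->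
  exists2 a, 0 < a < tau &
    (M%:E < \int[lebesgue_measure]_(r in `]a, tau]) ((rho r)^-1)%:E)%E.
Proof.
move=> tau0; pose F (n : nat) : set R := `]tau / n.+1%:R, tau]%classic.
have aP n : 0 < tau / n.+1%:R by rewrite divr_gt0.
have FE : \bigcup_n F n = `]0%R, tau]%classic.
  apply/seteqP; split=> [r [n _]|r].
    rewrite /F /= !in_itv/= => /andP[h1 ->].
    by rewrite (lt_trans (aP n)).
  rewrite /= in_itv/= => /andP[h1 h2].
  exists (Num.bound (tau / r)) => //; rewrite /F /= in_itv/= h2 andbT.
  rewrite ltr_pdivrMr// mulrC -ltr_pdivrMr//.
  apply: (lt_trans (archi_boundP (ltW (divr_gt0 tau0 h1)))).
  by rewrite ltr_nat.
have : (\int[lebesgue_measure]_(r in F n) ((rho r)^-1)%:E @[n --> \oo] --> +oo)%E.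
  rewrite -(rho_osgood tau0) -FE; apply: ge0_nondecreasing_set_cvg_integral.
  - move=> m n mn; apply/subsetPset => r; rewrite /F /= !in_itv/= => /andP[h ->].
    rewrite andbT (le_lt_trans _ h)// ler_pM2l// lef_pV2 ?posrE//.
    by rewrite ler_nat.
  - by move=> n; exact: measurable_itv.
  - by move=> n; exact: measurable_inv_modulus.
  - move=> n r; rewrite /F /= in_itv/= => /andP[h _].
    by rewrite lee_fin invr_ge0 ltW// rho_gt0// (lt_trans (aP n)).
(* The index is at least 1 so that the lower end is strictly below [tau]. *)
move=> /cvgeyPgt /(_ M)[n0 _ h]; exists (tau / (maxn n0 1).+1%:R).
  by rewrite aP/= ltr_pdivrMr// ltr_pMr// ltr1n ltnS leq_max leqnn orbT.
by apply: (h (maxn n0 1)); rewrite /= leq_maxl.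
Qed.

(** Discrete Osgood lemma: the two thresholds depend on C, T and [tau], not on the number or the
    length of the steps. The comparison sequence below raises the integral of 1 / rho from [a] by at
    most 2Ch per step, because 1 / rho is nonincreasing; over the total time T this is at most 2CT,
    and [a] is chosen so that this is too little for reaching [tau]. *)
Lemma osgood_iteration (C T tau : R) : 0 < C -> 0 < T -> 0 < tau ->
  exists2 ae : R * R, 0 < ae.1 /\ 0 < ae.2 &
    forall (m : nat) (h : R) (u : nat -> R), 0 <= h -> m%:R * h <= T ->
      u 0%N <= ae.1 -> (forall k, 0 <= u k) ->
      (forall k, (k < m)%N -> u k.+1 <= u k + h * (C * rho (u k) + ae.2)) ->
      u m <= tau.
Proof.
move=> C0 T0 tau0.
have [a /andP[a0 atau] ha] := integral_inv_modulus_large (2 * C * T) tau0.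
exists (a, C * rho a); first by split => //=; rewrite mulr_gt0// rho_gt0.
move=> m h u h0 mhT /= u0 uge0 uS.
(* The doubled rate absorbs the error [ae.2], which is C rho(a): v never falls below [a], so C
   rho(v) + C rho(a) <= 2C rho(v). *)
pose v := fix v k := if k is k'.+1 then v k' + h * (2 * C * rho (v k')) else a.
have va k : a <= v k.
  elim: k => //= k ih; rewrite (le_trans ih)// lerDl !mulr_ge0//; first exact: ltW.
  by rewrite ltW// rho_gt0// (lt_le_trans a0).
have vS k : v k <= v k.+1.
  rewrite lerDl !mulr_ge0//; first exact: ltW.
  by rewrite ltW// rho_gt0// (lt_le_trans a0).
have uv k : (k <= m)%N -> u k <= v k.
  elim: k => // k ih km; rewrite (le_trans (uS _ km))//= lerD ?ih// 1?ltnW//.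
  apply: ler_wpM2l => //.
  have h1 : rho (u k) <= rho (v k) by rewrite rho_nondecreasing// ih// ltnW.
  have h2 : rho a <= rho (v k) by rewrite rho_nondecreasing// ltW.
  by rewrite -mulrA mulr_natl mulr2n lerD// ler_pM2l.
have intv k : (\int[lebesgue_measure]_(r in `]a, v k]) ((rho r)^-1)%:E
    <= (k%:R * h * (2 * C))%:E)%E.
  elim: k => [|k ih].
    by rewrite (le_trans (integral_inv_modulus_le a0 _))//= subrr !mul0r.
  rewrite (@integral_inv_modulus_cat a (v k))//.
  have vk0 : 0 < rho (v k) by rewrite rho_gt0// (lt_le_trans a0).
  have := integral_inv_modulus_le (lt_le_trans a0 (va k)) (vS k).
  have -> : (v k.+1 - v k) / rho (v k) = h * (2 * C).
    rewrite /= addrAC subrr add0r; field; exact: lt0r_neq0.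
  move=> /(leeD ih); rewrite -EFinD => /le_trans; apply.
  by rewrite lee_fin -natr1; lra.
rewrite leNgt; apply/negP => tu.
have tv : tau <= v m by rewrite ltW// (lt_le_trans tu)// uv.
have := intv m; rewrite (@integral_inv_modulus_cat a tau) ?(ltW atau)//.
apply/negP; rewrite -ltNge.
apply: (@lt_le_trans _ _ (\int[lebesgue_measure]_(r in `]a, tau]) ((rho r)^-1)%:E)%E).
  apply: le_lt_trans ha; rewrite lee_fin [leRHS]mulrC ler_pM2r// mulr_gt0//.
rewrite leeDl// integral_ge0// => r /=; rewrite in_itv/= => /andP[ar _].
by rewrite lee_fin invr_ge0 ltW// rho_gt0// (lt_trans tau0).
Qed.

End osgood.

Section concave_modulus.
Context {R : realType} (rho : R -> R).
Hypothesis rho_ge0 : forall r : R, 0 <= r -> 0 <= rho r.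
Hypothesis rho_nondecreasing : forall r s : R, 0 <= r -> r <= s -> rho r <= rho s.
Hypothesis rho_concave :
  convex_function (`[0%R, +oo[ : set (convex_lmodType R^o)) (fun r => - rho r).

(** Substitute for Jensen's inequality: with s = E Z and r = Z, taking expectations yields E rho(Z)
    <= 2 rho(E Z). For r > s, concavity on [0, r] and rho(0) >= 0 give (s / r) rho(r) <= rho(s); for
    r <= s monotonicity is enough. *)
Lemma concave_modulus_le (r s : R) : 0 <= r -> 0 < s ->
  rho r <= rho s * (1 + r / s).
Proof.
move=> r0 s0; have rs0 : 0 <= rho s by rewrite rho_ge0// ltW.
case: (leP r s) => rs.
  rewrite (le_trans (rho_nondecreasing r0 rs))// ler_peMr// lerDl.
  by rewrite divr_ge0// (ltW s0).
have rp : 0 < r by exact: lt_trans s0 rs.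
have t0 : 0 <= s / r by rewrite divr_ge0// ltW.
have t1 : s / r <= 1 by rewrite ler_pdivrMr// mul1r ltW.
have := @rho_concave (@Itv01 R (s / r) t0 t1) r 0.
rewrite !inE/= !in_itv/= !andbT => /(_ (ltW rp) (lexx 0)).
rewrite /conv/= scaler0 addr0 (_ : (s / r) *: r = s); last first.
  by rewrite /GRing.scale/= mulfVK// lt0r_neq0.
have -> : conv (Itv01 t0 t1) (- rho r : convex_lmodType R^o) (- rho 0) =
  s / r * - rho r + (1 - s / r) * - rho 0 by [].
move=> h; have {h} : s / r * rho r <= rho s.
  have := rho_ge0 (lexx 0); have : 0 <= 1 - s / r by rewrite subr_ge0.
  move: h; set q := s / r; set t := rho 0; nra.
rewrite mulrAC ler_pdivrMr// => h.
rewrite mulrDr mulr1 (@le_trans _ _ (rho s * (r / s)))//.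
  by rewrite mulrA ler_pdivlMr// mulrC.
by rewrite lerDr.
Qed.

End concave_modulus.

(** * The generator of the coupling *)

Lemma enorm_eq0 (R : realType) m n (A : 'M[R]_(m, n)) : enorm A = 0 -> A = 0.
Proof.
move=> A0; apply/matrixP => i j; rewrite mxE; apply/eqP.
by rewrite -normr_le0 (le_trans (ler_entry_enorm _ _ _))// A0.
Qed.

Section ereal_ball_bounded.
Context {R : realType} (d : nat) (f : 'cV[R]_d -> \bar R).
Hypothesis f_ge0 : forall x, (0 <= f x)%E.
Hypothesis f_finite : forall x, (f x < +oo)%E.
Hypothesis f_continuous : continuous f.

Lemma continuous_ereal_ball_bounded (K : R) :
  exists2 M : R, 0 < M & forall x, enorm x <= K -> (f x <= M%:E)%E.
Proof.
have /choice[r r0] : forall z, exists r : R, 0 < r /\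
    forall y, enorm (z - y) < r -> (f y < (fine (f z) + 1)%:E)%E.
  move=> z; have fz : f z \is a fin_num by rewrite ge0_fin_numE.
  have : nbhs (f z) [set t | (t < (fine (f z) + 1)%:E)%E].
    apply: open_nbhs_nbhs; split; first exact: open_ereal_lt_ereal.
    by rewrite /= -[ltLHS]fineK// lte_fin ltrDl.
  by move=> /(f_continuous)/nbhs_enorm[e ? ?]; exists e.
have [s h] := @ball_net R d K r (fun z => (r0 z).1).
exists (1 + \sum_(z <- s) fine (f z)).
  by rewrite ltr_wpDr// sumr_ge0// => *; rewrite fine_ge0.
move=> x /h[z zs /(r0 z).2 zx]; rewrite (le_trans (ltW zx))// lee_fin addrC.
rewrite lerD2l (big_rem z)//= lerDl sumr_ge0// => *; exact: fine_ge0.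
Qed.

End ereal_ball_bounded.

Section generator.
Context {R : realType} (d : nat) (dispU : measure_display)
  (U : measurableType dispU) (nu : {measure set U -> \bar R})
  (b : 'cV[R]_d -> 'cV[R]_d) (sigma : 'cV[R]_d -> 'M[R]_d)
  (c : 'cV[R]_d -> U -> 'cV[R]_d).
Hypothesis b_continuous : continuous b.
Hypothesis sigma_continuous : continuous sigma.
Hypothesis c_measurable_section :
  forall x, measurable_fun setT (c x : U -> borel 'cV[R]_d).
Variables (delta0 : R) (rho : R -> R).
Hypothesis delta0_gt0 : 0 < delta0.
Hypothesis rho_nondecreasing : forall r s : R, 0 <= r -> r <= s -> rho r <= rho s.
Hypothesis rho_ge0 : forall r : R, 0 <= r -> 0 <= rho r.
Variables (K kappa : R).
Hypothesis kappa_gt0 : 0 < kappa.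
Hypothesis coef_bound : forall x z : 'cV[R]_d,
  Num.max (enorm x) (enorm z) <= K -> enorm (x - z) <= delta0 ->
  (\int[nu]_u (Num.min (enorm (c x u - c z u) ^+ 2)
                       (4 * enorm (x - z) * enorm (c x u - c z u)))%:E
    + (2 * dotv (x - z) (b x - b z) + enorm (sigma x - sigma z) ^+ 2)%:E
   <= (2 * kappa * enorm (x - z) * rho (enorm (x - z)))%:E)%E.

Lemma measurable_enormB p q (f g : U -> 'M[R]_(p, q)) :
  measurable_fun setT (f : U -> borel 'M[R]_(p, q)) ->
  measurable_fun setT (g : U -> borel 'M[R]_(p, q)) ->
  measurable_fun setT (fun u => enorm (f u - g u)).
Proof.
move=> mf mg; apply: (@measurable_borel_real R p q _ U (@enorm R p q)).
  exact: continuous_enorm.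
apply: measurable_entries => i j; under eq_fun do rewrite !mxE.
by apply: measurable_funB; exact: measurable_entry.
Qed.

Lemma measurable_jump_size p (f g : U -> 'cV[R]_d) :
  measurable_fun setT (f : U -> borel 'cV[R]_d) ->
  measurable_fun setT (g : U -> borel 'cV[R]_d) ->
  measurable_fun setT (fun u => jump_size p (enorm (f u - g u))).
Proof.
move=> mf mg; have mfg := measurable_enormB mf mg.
apply: measurable_minr; last by apply: measurable_funM.
by apply: measurable_funM => //; exact: measurable_funX.
Qed.

(** Here x, y are the arguments of the coefficients and v is a vector near x - y whose smoothed norm
    p divides. As p >= |x - y|, passing from |x - y| to p only lowers the jump and diffusion terms.
    The inner product with the drift can have either sign, and its change is estimated
    separately. *)
Lemma generator_bound err : 0 < err -> exists2 e1 : R, 0 < e1 &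
  forall e eta : R, 0 < e -> e <= e1 -> 3 * eta <= e ^+ 2 ->
  forall x y v : 'cV[R]_d, enorm x <= K -> enorm y <= K ->
    enorm (x - y) <= delta0 -> enorm v <= 1 -> enorm (v - (x - y)) <= eta ->
    forall p, p = snorm e v ->
    (\int[nu]_u (jump_size p (enorm (c x u - c y u)))%:E +
      (mdot (x - y) (b x - b y) / p + enorm (sigma x - sigma y) ^+ 2 / (2 * p))%:E
      <= (kappa * rho p + err)%:E)%E.
Proof.
move=> err0; have [M M0 bM] := continuous_ball_bounded K b_continuous.
have [theta theta0 btheta] := continuous_ball_unif K b_continuous err0.
(* Comes from the last case of the proof: the drift difference is at most 2M and is multiplied by at
   most 2e / theta. *)
pose e1 := Num.min 1 (theta * err / (4 * M)).
have e1P : 0 < e1 by rewrite lt_min ltr01 divr_gt0// mulr_gt0.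
exists e1 => // e eta e0 ee1 etae x y v xK yK xyd v1 vxy p pE.
have p0 : 0 < p by rewrite pE snorm_gt0.
have le1 : e <= 1 by rewrite (le_trans ee1)// ge_min lexx.
have eM : e * (4 * M) <= theta * err.
  by rewrite -ler_pdivlMr ?mulr_gt0// (le_trans ee1)// ge_min lexx orbT.
set r := enorm (x - y).
have r_ge0 : 0 <= r := enorm_ge0 _.
have eta0 : 0 <= eta := le_trans (enorm_ge0 _) vxy.
have ev0 := enorm_ge0 v.
have rv : r <= enorm v + eta.
  have := ler_enorm_sub (x - y) v; rewrite (enormB (x - y) v) -/r; lra.
have vr : enorm v <= r + eta by have := ler_enorm_sub v (x - y); rewrite -/r; lra.
(* (|v| + eta)^2 <= |v|^2 + 3 eta because |v| and eta are at most 1; the assumption on eta turns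
   this into |v|^2 + e^2 = p^2. *)
have rp : r <= p.
  rewrite -(ler_pXn2r (ltn0Sn 1)) ?nnegrE ?(ltW p0)// pE sqr_snorm -sqr_enorm.
  have eta1 : eta <= 1 by nra.
  apply: (@le_trans _ _ ((enorm v + eta) ^+ 2)).
    by rewrite ler_pXn2r ?nnegrE// addr_ge0.
  have : enorm v * eta <= eta by rewrite ler_piMl.
  have : eta * eta <= eta by rewrite ler_piMl.
  lra.
have pr : p <= r + eta + e by rewrite pE (le_trans (snorm_le e0 v))// lerD2r.
(* For x = y every term on the left vanishes; afterwards division by r is allowed. *)
have [r0|rn0] := eqVneq r 0.
  have xy : x = y by apply/eqP; rewrite -subr_eq0; apply/eqP; exact: enorm_eq0.
  rewrite xy integral0_eq; last first.
    move=> u _; rewrite subrr enorm0 /jump_size mulr0 minC expr0n/= mul0r.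
    by rewrite minxx.
  rewrite !subrr mdot0r mul0r enorm0 expr0n/= mul0r addr0 add0e lee_fin.
  by rewrite addr_ge0 ?(ltW err0)// mulr_ge0 ?(ltW kappa_gt0)// rho_ge0// ltW.
have rgt0 : 0 < r by rewrite lt_def rn0.
have := coef_bound (x := x) (z := y); rewrite ge_max xK yK => /(_ isT xyd).
rewrite dotvE -/r; set I := (\int[nu]_u _)%E; set B := mdot _ _; set S := _ ^+ 2.
move=> H.
have IE : (\int[nu]_u (jump_size r (enorm (c x u - c y u)))%:E =
    I * ((2 * r)^-1)%:E)%E.
  rewrite -ge0_integralZr//.
  - by apply: eq_integral => u _; rewrite jump_sizeE.
  - apply/measurable_EFinP; apply: measurable_minr.
      by apply: measurable_funX; exact: measurable_enormB.
    by apply: measurable_funM => //; exact: measurable_enormB.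
  - move=> u _; rewrite lee_fin le_min sqr_ge0 !mulr_ge0//; exact: enorm_ge0.
  - by rewrite lee_fin invr_ge0 mulr_ge0.
have I0 : (0 <= I)%E.
  apply: integral_ge0 => u _; rewrite lee_fin le_min sqr_ge0 !mulr_ge0//.
  exact: enorm_ge0.
have Ifin : I \is a fin_num.
  by rewrite ge0_fin_numE//; move: H; case: I I0 {IE} => [t|//|//] _ _; exact: ltry.
move: H IE; rewrite -(fineK Ifin) -EFinD lee_fin -EFinM; set J := fine I => H IE.
apply: (@le_trans _ _ ((J / (2 * r))%:E + (B / p + S / (2 * p))%:E)%E).
  rewrite leeD2r// -IE; apply: ge0_le_integral => //.
  - by move=> u _; rewrite lee_fin jump_size_ge0 ?enorm_ge0.
  - by apply/measurable_EFinP; exact: measurable_jump_size.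
  - by apply/measurable_EFinP; exact: measurable_jump_size.
  - by move=> u _; rewrite lee_fin jump_size_anti ?enorm_ge0.
rewrite -EFinD lee_fin.
have S0 : 0 <= S by exact: sqr_ge0.
have h1 : S / (2 * p) <= S / (2 * r).
  by rewrite ler_wpM2l// lef_pV2 ?posrE ?mulr_gt0// ler_pM2l.
have h2 : J / (2 * r) + (B / r + S / (2 * r)) <= kappa * rho p.
  have -> : J / (2 * r) + (B / r + S / (2 * r)) = (J + (2 * B + S)) / (2 * r).
    by field.
  rewrite ler_pdivrMr ?mulr_gt0// (le_trans H)//.
  rewrite (_ : kappa * _ * _ = 2 * kappa * r * rho p); last by ring.
  by rewrite ler_wpM2l ?mulr_ge0 ?(ltW kappa_gt0)// rho_nondecreasing.
suff h3 : B / p - B / r <= err by lra.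
have Bb : `|B| <= r * enorm (b x - b y) by exact: normr_mdot_le.
have -> : B / p - B / r = - B * ((p - r) / (p * r)).
  by field; rewrite rn0 lt0r_neq0.
apply: (@le_trans _ _ (r * enorm (b x - b y) * ((p - r) / (p * r)))).
  rewrite ler_wpM2r//; first by rewrite divr_ge0 ?subr_ge0// mulr_ge0// ltW.
  by rewrite (le_trans _ Bb)// -normrN ler_norm.
have -> : r * enorm (b x - b y) * ((p - r) / (p * r)) =
   enorm (b x - b y) * ((p - r) / p) by field; rewrite rn0 lt0r_neq0.
have q0 : 0 <= (p - r) / p by rewrite divr_ge0 ?subr_ge0// ltW.
have q1 : (p - r) / p <= 1 by rewrite ler_pdivrMr// mul1r gerBl.
have bb0 := enorm_ge0 (b x - b y).
(* Near the diagonal the drift difference itself is small; away from it the relative gap (p - r) / p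
   is small, since p - r <= eta + e <= 2e and p >= theta. *)
case: (ltP r theta) => rtheta.
  have h : enorm (b x - b y) < err by exact: btheta.
  by rewrite (le_trans _ (ltW h))// ler_piMr.
have h4 : enorm (b x - b y) <= 2 * M.
  rewrite (le_trans (ler_enormB _ _))// mulr_natl mulr2n lerD//; exact: bM.
have h5 : (p - r) / p <= 2 * e / theta.
  rewrite ler_pdivrMr// mulrAC ler_pdivlMr//.
  have h6 : p - r <= 2 * e by nra.
  rewrite (@le_trans _ _ (2 * e * theta))//; first by rewrite ler_wpM2r// ltW.
  by rewrite ler_wpM2l ?mulr_ge0 ?(ltW e0)// (le_trans rtheta).
apply: (@le_trans _ _ (2 * M * (2 * e / theta))).
  by apply: ler_pM.
rewrite mulrA ler_pdivrMr//; lra.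
Qed.

Hypothesis c2_finite : forall x, (\int[nu]_u (enorm (c x u) ^+ 2)%:E < +oo)%E.
Hypothesis c2_continuous :
  continuous (fun x => \int[nu]_u (enorm (c x u) ^+ 2)%:E)%E.

(** Young's inequality with weight delta: the squared true coefficients get the small factor delta,
    while the approximation errors get the large factor 1 / delta + 1, harmless because their
    integrals will be at most delta^2. *)
Lemma jump_size_approx p e delta (cx cy gx gy : 'cV[R]_d) :
  0 < e -> e <= p -> 0 < delta ->
  jump_size p (enorm (gx - gy)) <= jump_size p (enorm (cx - cy)) +
    (delta / e * enorm cx ^+ 2 + delta / e * enorm cy ^+ 2 +
     (delta^-1 + 1) / e * enorm (gx - cx) ^+ 2 +
     (delta^-1 + 1) / e * enorm (gy - cy) ^+ 2).
Proof.
move=> e0 ep d0; have p0 := lt_le_trans e0 ep.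
set A := enorm (cx - cy); set B := enorm (gx - cx); set D := enorm (gy - cy).
have [A0 B0 D0] : [/\ 0 <= A, 0 <= B & 0 <= D] by split; exact: enorm_ge0.
have gA : enorm (gx - gy) <= A + (B + D).
  have -> : gx - gy = (cx - cy) + ((gx - cx) - (gy - cy)).
    by rewrite [in RHS]addrC !opprB -!addrA addrCA [X in _ = _ + X]addrCA; apply/matrixP => i j; rewrite !mxE; lra.
  by rewrite (le_trans (ler_enormD _ _))// lerD2l ler_enormB.
rewrite (le_trans (jump_size_mono p0 (enorm_ge0 _) gA))//.
rewrite (le_trans (jump_sizeD p0 A0 (addr_ge0 B0 D0)))// lerD2l.
have q : (2 * A * (B + D) + (B + D) ^+ 2) / (2 * p) <=
   (2 * A * (B + D) + (B + D) ^+ 2) / (2 * e).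
  rewrite ler_wpM2l//; first by rewrite addr_ge0 ?sqr_ge0// !mulr_ge0// addr_ge0.
  by rewrite lef_pV2 ?posrE ?mulr_gt0// ler_pM2l.
rewrite (le_trans q)// ler_pdivrMr ?mulr_gt0//.
have -> : (delta / e * enorm cx ^+ 2 + delta / e * enorm cy ^+ 2 +
     (delta^-1 + 1) / e * B ^+ 2 + (delta^-1 + 1) / e * D ^+ 2) * (2 * e) =
  delta * (2 * enorm cx ^+ 2 + 2 * enorm cy ^+ 2) +
    (delta^-1 + 1) * (2 * B ^+ 2 + 2 * D ^+ 2).
  by field; rewrite !lt0r_neq0.
have A2 : A ^+ 2 <= 2 * enorm cx ^+ 2 + 2 * enorm cy ^+ 2.
  by rewrite -(enormN cy) sqr_enormD_le.
have BD : (B + D) ^+ 2 <= 2 * B ^+ 2 + 2 * D ^+ 2.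
  by have := sqr_ge0 (B - D); lra.
have AM : 2 * A * (B + D) <= delta * A ^+ 2 + delta^-1 * (B + D) ^+ 2.
  rewrite -(ler_pM2l d0); have := sqr_ge0 (delta * A - (B + D)).
  have -> : delta * (delta * A ^+ 2 + delta^-1 * (B + D) ^+ 2) =
     delta ^+ 2 * A ^+ 2 + (B + D) ^+ 2 by field; rewrite lt0r_neq0.
  nra.
have := ler_wpM2l (ltW d0) A2.
have di0 : 0 <= delta^-1 + 1 by rewrite addr_ge0// invr_ge0 ltW.
have := ler_wpM2l di0 BD; lra.
Qed.

(** Transfers the estimate to the values [bx], [sx], [gx] that a scheme uses in place of the
    coefficients. The allowance is spent as err / 2 on the exact coefficients, err / 8 on the jumps,
    err / 8 on the diffusion and err / 4 on the drift. The order of the quantifiers matters: the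
    accuracy may depend on e. *)
Lemma generator_bound_approx err : 0 < err -> exists2 e1 : R, 0 < e1 &
  forall e : R, 0 < e -> e <= e1 ->
  exists2 etad : R * R, 0 < etad.1 /\ 0 < etad.2 &
  forall x y v : 'cV[R]_d, enorm x <= K -> enorm y <= K ->
    enorm (x - y) <= delta0 -> enorm v <= 1 -> enorm (v - (x - y)) <= etad.1 ->
  forall (bx bY : 'cV[R]_d) (sx sy : 'M[R]_d) (gx gy : U -> 'cV[R]_d),
    measurable_fun setT (gx : U -> borel 'cV[R]_d) ->
    measurable_fun setT (gy : U -> borel 'cV[R]_d) ->
    enorm (bx - b x) <= etad.2 -> enorm (bY - b y) <= etad.2 ->
    enorm (sx - sigma x) <= etad.2 -> enorm (sy - sigma y) <= etad.2 ->
    (\int[nu]_u (enorm (gx u - c x u) ^+ 2)%:E <= (etad.2 ^+ 2)%:E)%E ->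
    (\int[nu]_u (enorm (gy u - c y u) ^+ 2)%:E <= (etad.2 ^+ 2)%:E)%E ->
    forall p, p = snorm e v ->
    (\int[nu]_u (jump_size p (enorm (gx u - gy u)))%:E +
      (mdot v (bx - bY) / p + enorm (sx - sy) ^+ 2 / (2 * p))%:E
      <= (kappa * rho p + err)%:E)%E.
Proof.
move=> err0; have err20 : 0 < err / 2 by rewrite divr_gt0.
have [e1 e10 H] := generator_bound err20; exists e1 => // e e0 ee1.
have [M M0 bM] := continuous_ball_bounded K b_continuous.
have [Ms Ms0 sM] := continuous_ball_bounded K sigma_continuous.
have c2_ge0 x : (0 <= \int[nu]_u (enorm (c x u) ^+ 2)%:E)%E.
  by apply: integral_ge0 => u _; rewrite lee_fin sqr_ge0.
have [M2 M20 cM] := continuous_ereal_ball_bounded c2_ge0 c2_finite c2_continuous K.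
(* The first entry is the condition of [generator_bound]; the second makes the drift error 2M eta /
   e at most err / 8. *)
pose eta := Num.min (e ^+ 2 / 3) (err * e / (16 * M)).
(* In this order the entries serve: delta <= 1, the drift error 2 delta <= err / 8, the diffusion
   error (8 Ms + 4) delta / (2e) <= err / 8, and the jump error delta (2 M2 + 4) / e <= err / 8. *)
pose delta := Num.min (Num.min 1 (err / 16))
  (Num.min (err * e / (32 * Ms + 16)) (err * e / (16 * M2 + 32))).
have eta0 : 0 < eta by rewrite lt_min !divr_gt0 ?mulr_gt0// exprn_gt0.
have d0 : 0 < delta.
  by rewrite !lt_min ltr01 !divr_gt0 ?addr_gt0 ?mulr_gt0.
exists (eta, delta) => //= x y v xK yK xyd v1 vxy bx bY sx sy gx gy mgx mgy
  hbx hby hsx hsy hgx hgy p pE.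
have eta1 : 3 * eta <= e ^+ 2.
  by rewrite mulrC -ler_pdivlMr// ge_min lexx.
have eta2 : eta * (16 * M) <= err * e.
  by rewrite -ler_pdivlMr ?mulr_gt0// ge_min lexx orbT.
have d1 : delta <= 1 by rewrite !ge_min lexx.
have d2 : 16 * delta <= err.
  by rewrite mulrC -ler_pdivlMr// !ge_min lexx orbT.
have d3 : delta * (32 * Ms + 16) <= err * e.
  by rewrite -ler_pdivlMr ?addr_gt0 ?mulr_gt0// !ge_min lexx !orbT.
have d4 : delta * (16 * M2 + 32) <= err * e.
  by rewrite -ler_pdivlMr ?addr_gt0 ?mulr_gt0// !ge_min lexx !orbT.
clearbody eta delta.
have p0 : 0 < p by rewrite pE snorm_gt0.
have ep : e <= p by rewrite pE ler_snorm.
have {}H := H e eta e0 ee1 eta1 x y v xK yK xyd v1 vxy p pE.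
have jump0 (f g : U -> 'cV[R]_d) u : (0 <= (jump_size p (enorm (f u - g u)))%:E)%E.
  by rewrite lee_fin jump_size_ge0 ?enorm_ge0.
have mjump (f g : U -> 'cV[R]_d) : measurable_fun setT (f : U -> borel 'cV[R]_d) ->
    measurable_fun setT (g : U -> borel 'cV[R]_d) ->
    measurable_fun setT (fun u => (jump_size p (enorm (f u - g u)))%:E).
  by move=> *; apply/measurable_EFinP; exact: measurable_jump_size.
pose k1 := delta / e; pose k2 := (delta^-1 + 1) / e.
have k10 : 0 <= k1 by rewrite divr_ge0// ltW.
have k20 : 0 <= k2 by rewrite divr_ge0 ?addr_ge0 ?invr_ge0// ltW.
have msq (f : U -> 'cV[R]_d) : measurable_fun setT (f : U -> borel 'cV[R]_d) ->
    measurable_fun setT (fun u => (enorm (f u) ^+ 2)%:E).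
  move=> mf; apply/measurable_EFinP; apply: measurable_funX.
  apply: (@measurable_borel_real R d 1 _ U (@enorm R d 1)) => //.
  exact: continuous_enorm.
have msqB (f g : U -> 'cV[R]_d) : measurable_fun setT (f : U -> borel 'cV[R]_d) ->
    measurable_fun setT (g : U -> borel 'cV[R]_d) ->
    measurable_fun setT (fun u => (enorm (f u - g u) ^+ 2)%:E).
  by move=> mf mg; apply/measurable_EFinP; apply: measurable_funX; exact: measurable_enormB.
have jle : (\int[nu]_u (jump_size p (enorm (gx u - gy u)))%:E <=
    \int[nu]_u (jump_size p (enorm (c x u - c y u)))%:E + (err / 8)%:E)%E.
  apply: (@le_trans _ _ (\int[nu]_u ((jump_size p (enorm (c x u - c y u)))%:E +
      (k1%:E * (enorm (c x u) ^+ 2)%:E + k1%:E * (enorm (c y u) ^+ 2)%:E +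
       k2%:E * (enorm (gx u - c x u) ^+ 2)%:E +
       k2%:E * (enorm (gy u - c y u) ^+ 2)%:E)))%E).
    apply: ge0_le_integral => //.
    - exact: mjump.
    - apply: emeasurable_funD; first exact: mjump.
      by repeat apply: emeasurable_funD; apply: emeasurable_funM => //;
         solve [exact: msq | exact: msqB].
    - move=> u _; rewrite -!EFinM -!EFinD lee_fin; exact: jump_size_approx.
  have kge0 k (f : U -> 'cV[R]_d) u : 0 <= k -> (0 <= k%:E * (enorm (f u) ^+ 2)%:E)%E.
    by move=> k0; rewrite -EFinM lee_fin mulr_ge0// sqr_ge0.
  have mk (k : R) (f : U -> \bar R) : measurable_fun setT f ->
     measurable_fun setT (fun u => k%:E * f u)%E.
    by move=> mf; apply: emeasurable_funM.
  have [m1 m2 m3 m4] : [/\ measurable_fun setT (fun u => (enorm (c x u) ^+ 2)%:E),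
      measurable_fun setT (fun u => (enorm (c y u) ^+ 2)%:E),
      measurable_fun setT (fun u => (enorm (gx u - c x u) ^+ 2)%:E) &
      measurable_fun setT (fun u => (enorm (gy u - c y u) ^+ 2)%:E)].
    by split; solve [exact: msq | exact: msqB].
  have Ek k (f : U -> 'cV[R]_d) : 0 <= k ->
      measurable_fun setT (fun u => (enorm (f u) ^+ 2)%:E) ->
      (\int[nu]_u (k%:E * (enorm (f u) ^+ 2)%:E) =
       k%:E * \int[nu]_u (enorm (f u) ^+ 2)%:E)%E.
    by move=> k0 mf; rewrite ge0_integralZl// => u _; rewrite lee_fin sqr_ge0.
  have [p1 p2 p3 p4] : [/\ forall u, (0 <= k1%:E * (enorm (c x u) ^+ 2)%:E)%E,
      forall u, (0 <= k1%:E * (enorm (c y u) ^+ 2)%:E)%E,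
      forall u, (0 <= k2%:E * (enorm (gx u - c x u) ^+ 2)%:E)%E &
      forall u, (0 <= k2%:E * (enorm (gy u - c y u) ^+ 2)%:E)%E].
    split => u; [exact: (kge0 _ (c x)) | exact: (kge0 _ (c y))
      |exact: (kge0 _ (fun u => gx u - c x u)) | exact: (kge0 _ (fun u => gy u - c y u))].
  rewrite ge0_integralD//; last 3 first.
  - exact: mjump.
  - by move=> u _; rewrite !adde_ge0.
  - by repeat apply: emeasurable_funD; apply: mk.
  rewrite leeD2l//.
  rewrite ge0_integralD//; last 3 first.
  - by move=> u _; rewrite !adde_ge0.
  - by repeat apply: emeasurable_funD; apply: mk.
  - exact: mk.
  rewrite ge0_integralD//; last 3 first.
  - by move=> u _; rewrite !adde_ge0.
  - by repeat apply: emeasurable_funD; apply: mk.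
  - exact: mk.
  rewrite ge0_integralD//; last 2 first.
  - exact: mk.
  - exact: mk.
  rewrite (Ek _ (c x))// (Ek _ (c y))// (Ek _ (fun u => gx u - c x u))//.
  rewrite (Ek _ (fun u => gy u - c y u))//.
  apply: (@le_trans _ _ (k1%:E * M2%:E + k1%:E * M2%:E + k2%:E * (delta ^+ 2)%:E +
     k2%:E * (delta ^+ 2)%:E)%E).
    apply: leeD; [apply: leeD; [apply: leeD|]|].
    - by apply: lee_wpmul2l; [rewrite lee_fin | exact: cM].
    - by apply: lee_wpmul2l; [rewrite lee_fin | exact: cM].
    - by apply: lee_wpmul2l; [rewrite lee_fin | exact: hgx].
    - by apply: lee_wpmul2l; [rewrite lee_fin | exact: hgy].
  rewrite -!EFinM -!EFinD lee_fin.
  have -> : k1 * M2 + k1 * M2 + k2 * delta ^+ 2 + k2 * delta ^+ 2 =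
     delta * (2 * M2 + 2 + 2 * delta) / e.
    by rewrite /k1 /k2; field; rewrite !lt0r_neq0.
  rewrite ler_pdivrMr//.
  have : delta * (2 * M2 + 2 + 2 * delta) <= delta * (2 * M2 + 4).
    by rewrite ler_wpM2l ?(ltW d0)//; lra.
  lra.
have s1 : enorm (sx - sy) ^+ 2 / (2 * p) <=
    enorm (sigma x - sigma y) ^+ 2 / (2 * p) + err / 8.
  have n0 := enorm_ge0 (sigma x - sigma y).
  have nM : enorm (sigma x - sigma y) <= 2 * Ms.
    rewrite (le_trans (ler_enormB _ _))// mulr_natl mulr2n lerD//; exact: sM.
  have nn : enorm (sx - sy) <= enorm (sigma x - sigma y) + 2 * delta.
    have -> : sx - sy = (sigma x - sigma y) + ((sx - sigma x) - (sy - sigma y)).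
      by apply/matrixP => i j; rewrite !mxE; ring.
    rewrite (le_trans (ler_enormD _ _))// lerD2l (le_trans (ler_enormB _ _))//.
    by rewrite mulr_natl mulr2n lerD.
  have n1 := enorm_ge0 (sx - sy).
  have h : enorm (sx - sy) ^+ 2 <= enorm (sigma x - sigma y) ^+ 2 + (8 * Ms + 4) * delta.
    by nra.
  have ip : 0 <= (2 * p)^-1 by rewrite invr_ge0 mulr_ge0// ltW.
  rewrite (le_trans (ler_wpM2r ip h))// mulrDl lerD2l.
  apply: (@le_trans _ _ ((8 * Ms + 4) * delta / (2 * e))).
    rewrite ler_wpM2l//; last by rewrite lef_pV2 ?posrE ?mulr_gt0// ler_pM2l.
    by rewrite mulr_ge0 ?(ltW d0)// addr_ge0// mulr_ge0// ltW.
  rewrite ler_pdivrMr ?mulr_gt0//; lra.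
have s2 : mdot v (bx - bY) / p <= mdot (x - y) (b x - b y) / p + err / 4.
  have -> : mdot v (bx - bY) = mdot (x - y) (b x - b y) +
      mdot (v - (x - y)) (b x - b y) + mdot v ((bx - b x) - (bY - b y)).
    rewrite (mdotBl v (x - y)) [mdot (x - y) _ + _]addrC subrK -mdotDr; congr mdot.
    by apply/matrixP => i j; rewrite !mxE; ring.
  rewrite 2!mulrDl -addrA lerD2l.
  have t1 : mdot v (bx - b x - (bY - b y)) / p <= err / 8.
    have := normr_mdot_div_snorm e0 v (bx - b x - (bY - b y)); rewrite -pE.
    move=> /ler_normlW; have := ler_enormB (bx - b x) (bY - b y); lra.
  have t2 : mdot (v - (x - y)) (b x - b y) / p <= err / 8.
    apply: (@le_trans _ _ (eta * (2 * M) / e)).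
      apply: (@le_trans _ _ (eta * (2 * M) / p)).
        rewrite ler_wpM2r ?invr_ge0 ?(ltW p0)// (le_trans (mdot_le _ _))//.
        apply: ler_pM => //; try exact: enorm_ge0.
        rewrite (le_trans (ler_enormB _ _))// mulr_natl mulr2n lerD//; exact: bM.
      rewrite ler_wpM2l ?mulr_ge0 ?(ltW eta0) ?(ltW M0)// lef_pV2 ?posrE//.
    rewrite ler_pdivrMr//; lra.
  lra.
apply: (@le_trans _ _ (\int[nu]_u (jump_size p (enorm (c x u - c y u)))%:E + (err / 8)%:E +
  (mdot (x - y) (b x - b y) / p + enorm (sigma x - sigma y) ^+ 2 / (2 * p) + 3 * err / 8)%:E)%E).
  by rewrite leeD// lee_fin; lra.
rewrite (_ : (kappa * rho p + err)%:E = ((kappa * rho p + err / 2)%:E + (err / 8)%:E + (3 * err / 8)%:E)%E).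
  rewrite [X in (_ + X <= _)%E]EFinD addeA; apply: leeD2r.
  by rewrite addeAC; exact: leeD2r.
by rewrite -!EFinD; congr EFin; field.
Qed.

End generator.

(** * Expectations, independence and moments *)

Section expectation.
Context d (T : measurableType d) (R : realType) (P : probability T R).
Implicit Types (Y Z : T -> R) (a k M : R).

Definition intg Y := P.-integrable setT (EFin \o Y).
Definition Ex Y : R := \int[P]_w Y w.

Lemma intg_measurable Y : intg Y -> measurable_fun setT Y.
Proof. by move=> /measurable_int/measurable_EFinP. Qed.

Lemma intg_le Y Z : measurable_fun setT Y -> (forall w, `|Y w| <= Z w) ->
  intg Z -> intg Y.
Proof.
move=> mY YZ; apply: le_integrable => //; first exact/measurable_EFinP.
move=> w _ /=; rewrite lee_fin; apply: le_trans (YZ w) _; exact: ler_norm.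
Qed.

Lemma intg_cst k : intg (cst k).
Proof. exact: finite_measure_integrable_cst. Qed.

Lemma intg_bounded Y M : measurable_fun setT Y -> (forall w, `|Y w| <= M) -> intg Y.
Proof. by move=> mY YM; apply: (@intg_le Y (cst M)) => //; exact: intg_cst. Qed.

Lemma intgD Y Z : intg Y -> intg Z -> intg (fun w => Y w + Z w).
Proof. by move=> iY iZ; have := integrableD measurableT iY iZ. Qed.

Lemma intgZ k Y : intg Y -> intg (fun w => k * Y w).
Proof. by move=> iY; have := integrableZl measurableT k iY. Qed.

Lemma intgN Y : intg Y -> intg (fun w => - Y w).
Proof. by move=> iY; have := integrableN iY. Qed.

Lemma intgB Y Z : intg Y -> intg Z -> intg (fun w => Y w - Z w).
Proof. by move=> iY iZ; apply: intgD => //; exact: intgN. Qed.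

Lemma intg_sum I (s : seq I) (F : I -> T -> R) :
  (forall i, intg (F i)) -> intg (fun w => \sum_(i <- s) F i w).
Proof.
move=> iF; elim: s => [|i s ih].
  by rewrite (_ : (fun _ => _) = cst 0); [exact: intg_cst | apply/funext => w; rewrite big_nil].
rewrite (_ : (fun _ => _) = (fun w => F i w + \sum_(j <- s) F j w)).
  exact: intgD.
by apply/funext => w; rewrite big_cons.
Qed.

Lemma intg_norm Y : intg Y -> intg (fun w => `|Y w|).
Proof. by move=> /integrable_norm. Qed.

Lemma intg_mul_bounded Z Y M : measurable_fun setT Z -> (forall w, `|Z w| <= M) ->
  intg Y -> intg (fun w => Z w * Y w).
Proof.
move=> mZ ZM iY; apply: (@intg_le _ (fun w => M * `|Y w|)).
- by apply: measurable_funM => //; exact: intg_measurable.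
- by move=> w; rewrite normrM ler_wpM2r.
- exact/intgZ/intg_norm.
Qed.

Lemma intg_mul_sqr Y Z : measurable_fun setT Y -> measurable_fun setT Z ->
  intg (fun w => Y w ^+ 2) -> intg (fun w => Z w ^+ 2) ->
  intg (fun w => Y w * Z w).
Proof.
move=> mY mZ iY iZ; apply: (@intg_le _ (fun w => Y w ^+ 2 + Z w ^+ 2)).
- exact: measurable_funM.
- move=> w; have := sqr_ge0 (Y w - Z w); have := sqr_ge0 (Y w + Z w).
  have := sqr_ge0 (Y w); have := sqr_ge0 (Z w).
  by rewrite ler_norml => *; apply/andP; split; nra.
- exact: intgD.
Qed.

Lemma intg_sqr Y : measurable_fun setT Y -> intg (fun w => Y w ^+ 2) -> intg Y.
Proof.
move=> mY iY; have := @intg_mul_sqr Y (cst 1) mY (measurable_cst _) iY.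
rewrite (_ : (fun w => Y w * _) = Y); last by apply/funext => w; rewrite mulr1.
by apply; rewrite (_ : (fun _ => _) = cst 1); [exact: intg_cst | apply/funext => w; rewrite expr1n].
Qed.

Lemma ExD Y Z : intg Y -> intg Z -> Ex (fun w => Y w + Z w) = Ex Y + Ex Z.
Proof. exact: RintegralD. Qed.

Lemma ExZ k Y : intg Y -> Ex (fun w => k * Y w) = k * Ex Y.
Proof. by move=> iY; exact: RintegralZl. Qed.

Lemma ExN Y : intg Y -> Ex (fun w => - Y w) = - Ex Y.
Proof.
move=> iY; rewrite -mulN1r -ExZ//; congr Ex; apply/funext => w.
by rewrite mulN1r.
Qed.

Lemma ExB Y Z : intg Y -> intg Z -> Ex (fun w => Y w - Z w) = Ex Y - Ex Z.
Proof. by move=> iY iZ; rewrite ExD ?ExN//; exact: intgN. Qed.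

Lemma Ex_cst k : Ex (cst k) = k.
Proof. by rewrite /Ex Rintegral_cst//= probability_setT mulr1. Qed.

Lemma Ex_sum I (s : seq I) (F : I -> T -> R) : (forall i, intg (F i)) ->
  Ex (fun w => \sum_(i <- s) F i w) = \sum_(i <- s) Ex (F i).
Proof.
move=> iF; elim: s => [|i s ih].
  by rewrite big_nil -[RHS](Ex_cst 0); congr Ex; apply/funext => w; rewrite big_nil.
rewrite big_cons -ih -ExD//; last exact: intg_sum.
by congr Ex; apply/funext => w; rewrite big_cons.
Qed.

Lemma Ex_le Y Z : intg Y -> intg Z -> (forall w, Y w <= Z w) -> Ex Y <= Ex Z.
Proof. by move=> iY iZ YZ; apply: le_Rintegral. Qed.

Lemma Ex_ge0 Y : (forall w, 0 <= Y w) -> 0 <= Ex Y.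
Proof. by move=> Y0; apply: Rintegral_ge0. Qed.

Lemma Ex_ae Y Z : measurable_fun setT Y -> measurable_fun setT Z ->
  {ae P, forall w, Y w = Z w} -> intg Y -> intg Z /\ Ex Z = Ex Y.
Proof.
move=> mY mZ YZ iY.
have e : ae_eq P setT (EFin \o Y) (EFin \o Z).
  by apply: filterS YZ => w h _ /=; rewrite h.
have mY' : measurable_fun setT (EFin \o Y) by exact/measurable_EFinP.
have mZ' : measurable_fun setT (EFin \o Z) by exact/measurable_EFinP.
have iZ : intg Z.
  move: iY => /integrableP[_ h]; apply/integrableP; split => //.
  apply: le_lt_trans h; rewrite (@ae_eq_integral _ _ _ P setT (fun x => `|(EFin \o Y) x|)%E)//.
  - exact: measurableT_comp.
  - exact: measurableT_comp.
  - by apply: filterS e => w h _; rewrite h.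
split => //; rewrite /Ex /Rintegral; congr fine.
by apply: ae_eq_integral => //; exact: ae_eq_sym.
Qed.

Lemma Ex_fin Y : intg Y -> (\int[P]_w (Y w)%:E)%E = (Ex Y)%:E.
Proof. by move=> iY; rewrite /Ex /Rintegral fineK//; exact: integrable_fin_num. Qed.

Lemma Ex_eq Y (r : R) : (\int[P]_w (Y w)%:E)%E = r%:E -> Ex Y = r.
Proof. by rewrite /Ex /Rintegral => ->. Qed.

Lemma intg_ge0 Y : measurable_fun setT Y -> (forall w, 0 <= Y w) ->
  (\int[P]_w (Y w)%:E < +oo)%E -> intg Y.
Proof.
move=> mY Y0 h; apply/integrableP; split; first exact/measurable_EFinP.
by under eq_integral do rewrite /= ger0_norm//.
Qed.

Lemma markov_Ex Y a : intg Y -> (forall w, 0 <= Y w) -> 0 < a ->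
  (P [set w | (a <= Y w)%R] <= (Ex Y / a)%:E)%E.
Proof.
move=> iY Y0 a0; have mY := intg_measurable iY.
have mA : measurable [set w | a <= Y w].
  by rewrite -[X in measurable X]setTI; exact: (measurable_fun_ler (measurable_cst _) mY).
have : (a%:E * P [set w | (a <= Y w)%R] <= (Ex Y)%:E)%E.
  rewrite -Ex_fin// -integral_cst//.
  apply: (@le_trans _ _ (\int[P]_(w in [set w | (a <= Y w)%R]) (Y w)%:E)%E).
    apply: ge0_le_integral => //.
    - by move=> *; rewrite lee_fin ltW.
    - by apply/measurable_EFinP; exact: measurable_funTS.
  apply: ge0_subset_integral => //.
    exact/measurable_EFinP.
  by move=> *; rewrite lee_fin.
rewrite EFinM lee_pdivlMr//; by rewrite muleC.
Qed.

Lemma measurable_ge_set Y a : measurable_fun setT Y -> measurable [set w | a <= Y w].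
Proof.
by move=> mY; rewrite -[X in measurable X]setTI; exact: (measurable_fun_ler (measurable_cst _) mY).
Qed.

End expectation.

Section independence.
Context d (T : measurableType d) (R : realType) (P : probability T R).

(** The joint law is the product of the marginal laws by uniqueness of product measures, and
    Fubini's theorem factorizes the expectation. Integrability of the product is a conclusion: it
    comes from the same computation for absolute values, where Tonelli's theorem applies. *)
Lemma independent_Ex (G H : set (set T)) (Y Z : T -> R) :
  independent P G H -> measurable_wrt G Y -> measurable_wrt H Z ->
  intg P Y -> intg P Z ->
  intg P (fun w => Y w * Z w) /\ Ex P (fun w => Y w * Z w) = Ex P Y * Ex P Z.
Proof.
move=> ind YG ZH iY iZ.
have mY := intg_measurable iY; have mZ := intg_measurable iZ.
have mYZ : measurable_fun setT (fun w => (Y w, Z w)) by exact: measurable_fun_pair.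
pose Y' : {RV P >-> R} := mfun_Sub (mem_set mY).
pose Z' : {RV P >-> R} := mfun_Sub (mem_set mZ).
pose YZ' : {RV P >-> (R * R)%type} := mfun_Sub (mem_set mYZ).
pose m1 := distribution P Y'; pose m2 := distribution P Z'.
pose m := distribution P YZ'.
have mE X : measurable X -> (m1 \x m2)%E X = m X.
  apply: product_measure_unique => A B mA mB.
  have := ind (Y @^-1` A) (Z @^-1` B) _ _.
  rewrite /m /m1 /m2 /distribution /pushforward/= => <- //.
  - by apply: YG; exists A => //; rewrite setTI.
  - by apply: ZH; exists B => //; rewrite setTI.
have mprod : measurable_fun setT (fun z : (R * R)%type => z.1 * z.2).
  exact: measurable_funM.
have absE : (\int[P]_w `|(Y w * Z w)%:E| =
    \int[P]_w `|(Y w)%:E| * \int[P]_w `|(Z w)%:E|)%E.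
  transitivity (\int[m]_z `|(z.1 * z.2)%:E|)%E.
    rewrite ge0_integral_distribution//.
    by apply: measurableT_comp => //; exact/measurable_EFinP.
  transitivity (\int[m1 \x m2]_z `|(z.1 * z.2)%:E|)%E.
    by apply: eq_measure_integral => A mA _; exact/esym/mE.
  rewrite fubini_tonelli1//; last first.
    by apply: measurableT_comp => //; exact/measurable_EFinP.
  rewrite /fubini_F.
  under eq_integral => x _.
    under eq_integral => y _ do rewrite /= normrM EFinM.
    rewrite ge0_integralZl//; last first.
      by apply/measurable_EFinP; exact: normr_measurable.
    over.
  rewrite ge0_integralZr//; last 2 first.
  - by apply/measurable_EFinP; exact: normr_measurable.
  - exact: integral_ge0.
  have mn : measurable_fun setT (fun y : R => (`|y|)%:E).
    by apply/measurable_EFinP; exact: normr_measurable.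
  by rewrite !ge0_integral_distribution.
have iYZ : intg P (fun w => Y w * Z w).
  apply/integrableP; split; first by apply/measurable_EFinP; exact: measurable_funM.
  rewrite [ltLHS]absE.
  have -> := Ex_fin (intg_norm iY); have -> := Ex_fin (intg_norm iZ).
  by rewrite -EFinM ltry.
split => //; apply: Ex_eq.
transitivity (\int[m]_z (z.1 * z.2)%:E)%E.
  by rewrite integral_distribution//; exact/measurable_EFinP.
transitivity (\int[m1 \x m2]_z (z.1 * z.2)%:E)%E.
  by apply: eq_measure_integral => A mA _; exact/esym/mE.
have im : (m1 \x m2)%E.-integrable setT (fun z => (z.1 * z.2)%:E).
  apply/integrableP; split; first exact/measurable_EFinP.
  rewrite (_ : (\int[_]_z _)%E = (\int[m]_z `|(z.1 * z.2)%:E|)%E); last first.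
    by apply: eq_measure_integral => A mA _; exact: mE.
  rewrite ge0_integral_distribution//; last first.
    by apply: measurableT_comp => //; exact/measurable_EFinP.
  by move: iYZ => /integrableP[].
rewrite -integral12_prod_meas1// /fubini_F.
have iZ2 : m2.-integrable setT (fun y : R => y%:E).
  apply/integrableP; split; first exact/measurable_EFinP.
  rewrite ge0_integral_distribution//; last first.
    by apply: measurableT_comp => //; exact/measurable_EFinP.
  by move: iZ => /integrableP[].
have iY1 : m1.-integrable setT (fun y : R => y%:E).
  apply/integrableP; split; first exact/measurable_EFinP.
  rewrite ge0_integral_distribution//; last first.
    by apply: measurableT_comp => //; exact/measurable_EFinP.
  by move: iY => /integrableP[].
have mid : measurable_fun setT (fun y : R => y%:E) by exact/measurable_EFinP.
have EZ : (\int[m2]_y y%:E = (Ex P Z)%:E)%E.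
  by rewrite integral_distribution// Ex_fin.
have EY : (\int[m1]_y y%:E = (Ex P Y)%:E)%E.
  by rewrite integral_distribution// Ex_fin.
under eq_integral => x _.
  under eq_integral => y _ do rewrite /= EFinM.
  rewrite integralZl// EZ.
  over.
by rewrite integralZr// EY -EFinM.
Qed.

End independence.

Section density.
Context d (T : measurableType d) (R : realType) (mu m : {measure set T -> \bar R}).
Variable f : T -> R.
Hypothesis mf : measurable_fun setT f.
Hypothesis f0 : forall x, 0 <= f x.
Hypothesis mE : forall A, measurable A -> m A = (\int[mu]_(x in A) (f x)%:E)%E.

Import HBNNSimple.

Let density_nnsfun (h : {nnsfun T >-> R}) :
  (\int[m]_x (h x)%:E = \int[mu]_x ((h x)%:E * (f x)%:E))%E.
Proof.
under [LHS]eq_integral do rewrite fimfunE -fsumEFin//.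
rewrite [LHS]ge0_integral_fsum//; last 2 first.
  - by move=> r; exact/measurable_EFinP/measurableT_comp.
  - by move=> n x _; rewrite EFinM nnfun_muleindic_ge0.
under [RHS]eq_integral.
  move=> x _; rewrite fimfunE -fsumEFin// ge0_mule_fsuml; last first.
    by move=> r; rewrite EFinM nnfun_muleindic_ge0.
  over.
rewrite [RHS]ge0_integral_fsum//; last 2 first.
  - move=> r; apply: emeasurable_funM; last exact/measurable_EFinP.
    by apply/measurable_EFinP; apply/measurableT_comp => //.
  - move=> n x _; rewrite mule_ge0//; last by rewrite lee_fin.
    by rewrite EFinM nnfun_muleindic_ge0.
apply: eq_fsbigr => r _.
have [r0|r0] := ltP r 0.
  rewrite preimage_nnfun0//.
  by rewrite !integral0_eq// => x _; rewrite indic0 mulr0// mul0e.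
rewrite integralZl_indic_nnsfun//= integral_indic//= setIT mE//.
rewrite -ge0_integralZl//; last 2 first.
  - by apply/measurable_EFinP; exact: measurable_funTS.
  - by move=> x _; rewrite lee_fin.
rewrite integral_mkcond; apply: eq_integral => x _.
rewrite patchE indicE; case: ifPn => _; first by rewrite mulr1.
by rewrite mulr0 mul0e.
Qed.

(** Simple functions first, then monotone convergence on both sides. *)
Lemma ge0_integral_density (g : T -> \bar R) : measurable_fun setT g ->
  (forall x, 0 <= g x)%E -> (\int[m]_x g x = \int[mu]_x (g x * (f x)%:E))%E.
Proof.
move=> mg g0; pose g_ := nnsfun_approx measurableT mg.
transitivity (lim (\int[m]_x (g_ n x)%:E @[n --> \oo])%E).
  rewrite -monotone_convergence//=.
  - apply: eq_integral => ? /[!inE] xD; apply/esym/cvg_lim => //=.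
    exact: cvg_nnsfun_approx.
  - by move=> n; exact/measurable_EFinP/measurable_funTS.
  - by move=> n ? _; rewrite lee_fin.
  - by move=> ? _ ? ? mn; rewrite lee_fin; exact/lefP/nd_nnsfun_approx.
transitivity (lim (\int[mu]_x ((g_ n x)%:E * (f x)%:E) @[n --> \oo])%E).
  by apply: congr_lim; apply/funext => n; exact: density_nnsfun.
rewrite -monotone_convergence//=.
- apply: eq_integral => x _; apply/cvg_lim => //.
  apply: cvgeZr => //; exact: cvg_nnsfun_approx.
- move=> n; apply: emeasurable_funM; last exact/measurable_EFinP.
  exact/measurable_EFinP/measurable_funTS.
- by move=> n x _; rewrite mule_ge0 ?lee_fin.
- move=> x _ a b ab; apply: lee_wpmul2r; first by rewrite lee_fin.
  by rewrite lee_fin; exact/lefP/nd_nnsfun_approx.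
Qed.

End density.

Section gaussian_moments.
Context d (T : measurableType d) (R : realType) (P : probability T R).
Variables (X : T -> R) (s : R).
Hypothesis mX : measurable_fun setT X.
Hypothesis s0 : 0 < s.
Hypothesis XE : forall B : set R, measurable B ->
  P (X @^-1` B) = normal_prob 0 s B.

Let mX' : @measurable_fun _ _ T (measurableTypeR R) setT X := mX.
Let X' : {mfun T >-> measurableTypeR R} :=
  @mfun_Sub _ _ T (measurableTypeR R) X (mem_set mX').

Let ge0_integral_gauss (g : R -> \bar R) : measurable_fun setT g ->
  (forall x, 0 <= g x)%E ->
  (\int[P]_w g (X w) = \int[lebesgue_measure]_x (g x * (normal_pdf 0 s x)%:E))%E.
Proof.
move=> mg g0.
transitivity (\int[distribution P X']_x g x)%E.
  by rewrite ge0_integral_distribution.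
transitivity (\int[normal_prob 0 s]_x g x)%E.
  apply: eq_measure_integral.
  by move=> A mA _; exact: XE.
apply: (@ge0_integral_density _ _ _ lebesgue_measure (normal_prob 0 s)) => //.
- exact: measurable_normal_pdf.
- by move=> x; exact: normal_pdf_ge0.
Qed.

(** Times the exponential, the density of N(0, s^2) becomes (1 + dl)^(-1/2) times the density of
    N(0, s'^2) with s' = s / sqrt(1 + dl), which integrates to 1. *)
Let gauss_laplace (dl : R) : 0 < dl ->
  (\int[P]_w (expR (- (dl * (X w ^+ 2 / (s ^+ 2 *+ 2)))))%:E =
     ((Num.sqrt (1 + dl))^-1)%:E)%E.
Proof.
move=> dl0; have q0 : 0 < 1 + dl by rewrite addr_gt0.
pose s' := s / Num.sqrt (1 + dl).
have sq0 : 0 < Num.sqrt (1 + dl) by rewrite sqrtr_gt0.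
have s'0 : 0 < s' by rewrite divr_gt0.
rewrite (@ge0_integral_gauss (fun x => (expR (- (dl * (x ^+ 2 / (s ^+ 2 *+ 2)))))%:E)); last 2 first.
- apply/measurable_EFinP; apply: measurableT_comp => //.
  apply: measurableT_comp => //; apply: measurable_funM => //.
  by apply: measurable_funM => //; exact: measurable_funX.
- by move=> x; rewrite lee_fin expR_ge0.
rewrite (_ : (fun x => _) = (fun x => ((Num.sqrt (1 + dl))^-1)%:E *
    (normal_pdf 0 s' x)%:E)%E); last first.
  apply/funext => x; rewrite -!EFinM; congr EFin.
  rewrite !normal_pdfE ?lt0r_neq0// /normal_fun /normal_peak.
  rewrite !subr0 mulrCA -expRD [RHS]mulrA.
  have -> : - (dl * (x ^+ 2 / (s ^+ 2 *+ 2))) + - x ^+ 2 / (s ^+ 2 *+ 2) =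
      - x ^+ 2 / (s' ^+ 2 *+ 2).
    rewrite /s' expr_div_n sqr_sqrtr ?(ltW q0)//.
    by field; rewrite !lt0r_neq0.
  congr (_ * _); rewrite /s' expr_div_n sqr_sqrtr ?(ltW q0)//.
  have -> : s ^+ 2 / (1 + dl) * pi *+ 2 = s ^+ 2 * pi *+ 2 / (1 + dl).
    by rewrite mulrAC mulrnAl.
  have hp : 0 <= s ^+ 2 * pi *+ 2 by rewrite mulrn_wge0// mulr_ge0 ?sqr_ge0 ?pi_ge0.
  rewrite sqrtrM// sqrtrV ?(ltW q0)// invfM invrK mulrC mulrA.
  by rewrite [RHS]mulrCA mulVf ?mulr1// lt0r_neq0.
rewrite ge0_integralZl//; last 2 first.
- have h : measurable_fun [set: R] (EFin \o normal_pdf 0 s').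
    by apply/measurable_EFinP; exact: measurable_normal_pdf.
  exact: h.
- by move=> x _; rewrite lee_fin normal_pdf_ge0.
by rewrite integral_normal_pdf mule1.
Qed.

(** The second moment is read off the Laplace transform of y = X^2 / (2 s^2) near 0 without
    differentiating: y / (1 + dl y) <= (1 - exp(-dl y)) / dl, the mean (1 - (1 + dl)^(-1/2)) / dl of
    the right side is at most 1/2, and the left side increases to y as dl decreases to 0. *)
Lemma gauss_sqr : intg P (fun w => X w ^+ 2) /\ Ex P (fun w => X w ^+ 2) <= s ^+ 2.
Proof.
have s2 : 0 < s ^+ 2 *+ 2 by rewrite mulrn_wgt0// exprn_gt0.
pose y w := X w ^+ 2 / (s ^+ 2 *+ 2).
have y0 w : 0 <= y w by rewrite divr_ge0 ?sqr_ge0// ltW.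
have my : measurable_fun setT y by apply: measurable_funM => //; exact: measurable_funX.
pose dl (n : nat) : R := n.+1%:R^-1.
have dl0 n : 0 < dl n by rewrite invr_gt0.
have yd n w : 0 < 1 + dl n * y w by rewrite ltr_pwDl// mulr_ge0// ltW.
pose g n w : R := y w / (1 + dl n * y w).
have g0 n w : 0 <= g n w by rewrite divr_ge0// ltW.
have me n : measurable_fun setT (fun w => expR (- (dl n * y w))).
  by apply: measurableT_comp => //; apply: measurableT_comp => //; exact: measurable_funM.
have mg n : measurable_fun setT (g n).
  apply: measurable_funM => //; apply: (@measurable_comp _ _ _ _ _ _ [set r : R | r != 0]) => //=.
  - by apply: open_measurable; exact: open_neq.
  - by move=> _ [w _ <-] /=; rewrite lt0r_neq0.
  - apply: open_continuous_measurable_fun; first exact: open_neq.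
    by move=> r /set_mem /= r0; exact: inv_continuous.
  - by apply: measurable_funD => //; exact: measurable_funM.
have intE n : (\int[P]_w (g n w)%:E <= (2^-1)%:E)%E.
  have ie : intg P (fun w => expR (- (dl n * y w))).
    apply: (@intg_bounded _ _ _ _ _ 1) => // w.
    by rewrite ger0_norm ?expR_ge0// expR_le1 oppr_le0 mulr_ge0// ltW.
  have i1 : intg P (fun w => (dl n)^-1 * (1 - expR (- (dl n * y w)))).
    by apply: intgZ; apply: intgB => //; exact: intg_cst.
  apply: (@le_trans _ _ (\int[P]_w ((dl n)^-1 * (1 - expR (- (dl n * y w))))%:E)%E).
    apply: ge0_le_integral => //.
    - by move=> w _; rewrite lee_fin.
    - exact/measurable_EFinP.
    - by apply/measurable_EFinP; exact: intg_measurable i1.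
    - move=> w _; rewrite lee_fin /g.
      have t0 : 0 <= dl n * y w by rewrite mulr_ge0// ltW.
      rewrite -(ler_pM2l (dl0 n)) mulVKf ?lt0r_neq0// mulrA.
      rewrite ler_pdivrMr// -subr_ge0.
      have e1 : expR (- (dl n * y w)) * (1 + dl n * y w) <= 1.
        rewrite expRN -ler_pdivlMl ?invr_gt0 ?expR_gt0// invrK mulr1.
        exact: expR_ge1Dx.
      by nra.
  rewrite Ex_fin// lee_fin ExZ ?ExB//; last 2 first.
  - exact: intg_cst.
  - by apply: intgB => //; exact: intg_cst.
  rewrite (Ex_cst P 1) (Ex_eq (gauss_laplace (dl0 n))).
  rewrite ler_pdivrMl//.
  have q0 : 0 < 1 + dl n by rewrite addr_gt0.
  set r := Num.sqrt (1 + dl n).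
  have r0 : 0 < r by rewrite sqrtr_gt0.
  have r2 : r ^+ 2 = 1 + dl n by rewrite sqr_sqrtr// ltW.
  have r1 : r <= 1 + dl n / 2.
    rewrite -(ler_pXn2r (ltn0Sn 1)) ?nnegrE ?(ltW r0)//; last by rewrite addr_ge0// divr_ge0// ltW.
    by rewrite r2; have := sqr_ge0 (dl n); lra.
  have := dl0 n; rewrite lerBlDr -lerBlDl => d0.
  by rewrite -(ler_pM2r r0) mulVf ?lt0r_neq0//; nra.
have gcv w : (g n w)%:E @[n --> \oo] --> (y w)%:E.
  apply/fine_cvgP; split; first exact: nearW.
  apply/cvgrPdist_le => e e0.
  have y21 : 0 < y w ^+ 2 + 1 by rewrite ltr_wpDl ?sqr_ge0.
  near=> n.
  have dn : dl n <= e / (y w ^+ 2 + 1).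
    rewrite /dl -[leRHS]invrK lef_pV2 ?posrE ?invr_gt0 ?divr_gt0//.
    rewrite (le_trans (ltW (archi_boundP _)))//; first by rewrite invr_ge0 divr_ge0// ltW.
    by rewrite ler_nat ltnW// ltnS; near: n; exact: nbhs_infty_ge.
  have gy : g n w <= y w by rewrite ler_pdivrMr// ler_peMr// lerDl mulr_ge0// ltW.
  rewrite ger0_norm ?subr_ge0//.
  have -> : y w - g n w = dl n * y w ^+ 2 / (1 + dl n * y w).
    by rewrite /g; field; rewrite lt0r_neq0.
  rewrite ler_pdivrMr//.
  have h : dl n * (y w ^+ 2 + 1) <= e by rewrite -ler_pdivlMr.
  have := mulr_ge0 (ltW (dl0 n)) (y0 w); have := dl0 n; nra.
have intY : (\int[P]_w (y w)%:E <= (2^-1)%:E)%E.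
  have cv : (\int[P]_w (g n w)%:E)%E @[n --> \oo] --> (\int[P]_w (y w)%:E)%E.
    have -> : (\int[P]_w (y w)%:E = \int[P]_w (limn (fun n => (g n w)%:E)))%E.
      by apply: eq_integral => w _; apply/esym/cvg_lim => //; exact: gcv.
    apply: cvg_monotone_convergence => //.
    - by move=> n; exact/measurable_EFinP.
    - by move=> n w _; rewrite lee_fin.
    - move=> w _ m n mn; rewrite lee_fin /g ler_wpM2l// lef_pV2 ?posrE// lerD2l.
      by rewrite ler_wpM2r// /dl lef_pV2 ?posrE// ler_nat.
  apply: (cvge_le _ cv); exact: nearW.
have iy : intg P y.
  by apply: intg_ge0 => //; rewrite (le_lt_trans intY)// ltry.
have XyE : (fun w => X w ^+ 2) = (fun w => (s ^+ 2 *+ 2) * y w).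
  by apply/funext => w; rewrite /y mulrCA mulfV ?mulr1// lt0r_neq0.
rewrite XyE; split; first exact: intgZ.
move: intY; rewrite Ex_fin// lee_fin ExZ// => h.
by rewrite -mulr_natr -mulrA ler_piMr ?sqr_ge0//; lra.
Unshelve. all: by end_near. Qed.

(** The centred normal law is symmetric, so X and -X have equal means. *)
Lemma gauss_mean : Ex P X = 0.
Proof.
have [iX2 _] := gauss_sqr; have iX := intg_sqr mX iX2.
have mN : measurable_fun setT (fun w => - X w) by exact: measurableT_comp.
have mN' : @measurable_fun _ _ T (measurableTypeR R) setT (fun w => - X w) := mN.
pose N' : {mfun T >-> measurableTypeR R} :=
  @mfun_Sub _ _ T (measurableTypeR R) (fun w => - X w) (mem_set mN').
have symm (B : set R) : measurable B ->
    distribution P N' B = distribution P X' B.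
  move=> mB; rewrite /distribution /pushforward/=.
  have mNB : measurable (-%R @^-1` B : set R).
    by rewrite -[X in measurable X]setTI; exact: oppr_measurable.
  rewrite -[LHS]/(P (X @^-1` (-%R @^-1` B))) -[RHS]/(P (X @^-1` B)) !XE//.
  rewrite /normal_prob.
  transitivity (\int[pushforward lebesgue_measure (-%R : R -> measurableTypeR R)]_(x in B)
     (normal_pdf 0 s x)%:E)%E; last first.
    by apply: eq_measure_integral => A mA _; exact: lebesgue_measureN.
  rewrite ge0_integral_pushforward//=; last 2 first.
  - by apply/measurable_EFinP/measurable_funTS; exact: measurable_normal_pdf.
  - by move=> x _; rewrite lee_fin normal_pdf_ge0.
  apply: eq_integral => x _ /=; congr EFin.
  by rewrite !normal_pdfE ?lt0r_neq0// /normal_fun !subr0 sqrrN.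
have : (\int[distribution P N']_x x%:E = \int[distribution P X']_x x%:E)%E.
  by apply: eq_measure_integral => A mA _; exact: symm.
rewrite !integral_distribution//=; first last.
- exact: intgN.
- rewrite (_ : (fun w => _) = (EFin \o (fun w => - X w)))//.
rewrite !Ex_fin//; last exact: intgN.
by rewrite ExN// => -[]; lra.
Qed.

End gaussian_moments.

Section poisson_moments.
Context d (T : measurableType d) (R : realType) (P : probability T R).
Variables (N : T -> \bar R) (r : R).
Hypothesis mN : measurable_fun setT N.
Hypothesis r0 : 0 <= r.
Hypothesis NE : forall k : nat,
  P [set w | N w = (k%:R)%:E] = poisson_prob r 0%N [set k].

Let A k := [set w | N w = (k%:R)%:E].
Let p k : R := fine (poisson_prob r 0%N [set k]).

Let mA k : measurable (A k).
Proof.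
rewrite (_ : A k = N @^-1` [set (k%:R)%:E])//.
by rewrite -[X in measurable X]setTI; apply: mN => //; exact: emeasurable_set1.
Qed.

Let tA : trivIset setT A.
Proof.
apply/trivIsetP => i j _ _ ij; rewrite -subset0 => w; rewrite /A => -[/= ->].
by move=> /eqP; rewrite eqe eqr_nat (negbTE ij).
Qed.

Let pE k : P (A k) = (p k)%:E.
Proof.
rewrite /A NE /p fineK//.
exact: (@fin_num_measure _ _ _ (poisson_prob r 0%N) [set k]).
Qed.

Let p0 k : 0 <= p k. Proof. by rewrite fine_ge0. Qed.

Let p_sum : (\sum_(k <oo) (p k)%:E = 1)%E.
Proof.
have := @probability_setT _ _ _ (poisson_prob r 0%N).
rewrite (_ : [set: nat] = \bigcup_k [set k]); last first.
  by apply/seteqP; split=> // k _; exists k.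
rewrite measure_bigcup//=; last first.
  by apply/trivIsetP => i j _ _ ij; apply/seteqP; split=> // x [/= -> /eqP]; rewrite (negbTE ij).
move=> <-; rewrite [RHS]eseries_mkcond; apply: eq_eseriesr => k _.
by rewrite -pE in_setT /A NE.
Qed.

(** Index shift behind both moments. The rate 0 is a separate branch of [poisson_prob], where the
    law is the Dirac mass at 0. *)
Let p_rec k : k.+1%:R * p k.+1 = r * p k.
Proof.
rewrite /p /poisson_prob; case: ifPn => rpos.
  rewrite !esum_set1 ?lee_fin ?poisson_pmf_ge0//= /poisson_pmf rpos.
  rewrite factS natrM exprS.
  have : k`!%:R != 0 :> R by rewrite pnatr_eq0 -lt0n fact_gt0.
  have : k.+1%:R != 0 :> R by rewrite pnatr_eq0.
  move: (k.+1%:R) (k`!%:R) => q f q0 f0; field; by rewrite f0 q0.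
have -> : r = 0 by apply/eqP; rewrite eq_le r0 andbT leNgt.
by rewrite mul0r /dirac /= indicE memNset//= mulr0.
Qed.

Let full : P (~` \bigcup_k A k) = 0.
Proof.
have mU : measurable (\bigcup_k A k) by exact: bigcupT_measurable.
rewrite probability_setC// measure_bigcup//=.
have -> : \big[+%E/0%R]_(0 <= k <oo | k \in [set: nat]) P (A k) = 1%E.
  rewrite -p_sum [LHS]eseries_mkcond; apply: eq_eseriesr => k _.
  by rewrite in_setT pE.
by rewrite subee.
Qed.

(** Only the probabilities of the single integers are known; they sum to 1, which leaves a null set
    for every other value, infinity included. *)
Lemma poisson_ae_nat : {ae P, forall w, exists k : nat, N w = (k%:R)%:E}.
Proof.
have mU : measurable (\bigcup_k A k) by exact: bigcupT_measurable.
exists (~` \bigcup_k A k); split; [exact: measurableC|exact: full|].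
by move=> w /= h [k _ Nk]; apply: h; exists k.
Qed.

Let integral_poisson (g : nat -> R) (G : T -> R) : (forall k, 0 <= g k) ->
  measurable_fun setT G -> (forall w, 0 <= G w) ->
  (forall k w, A k w -> G w = g k) ->
  (\int[P]_w (G w)%:E = \sum_(k <oo) (g k * p k)%:E)%E.
Proof.
move=> g0 mG G0 Gg.
have mU : measurable (\bigcup_k A k) by exact: bigcupT_measurable.
have mUC := measurableC mU.
have mGE D : measurable_fun D (fun w => (G w)%:E).
  by apply/measurable_EFinP; exact: measurable_funTS.
rewrite (@ge0_negligible_integral _ _ _ _ _ (~` \bigcup_k A k)) => //; last first.
  by move=> w _; rewrite lee_fin.
rewrite setTD setCK ge0_integral_bigcup//; last by move=> w _; rewrite lee_fin.
apply: eq_eseriesr => k _.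
transitivity (\int[P]_(w in A k) (cst (g k)%:E w))%E.
  by apply: eq_integral => w /set_mem /Gg ->.
transitivity ((g k)%:E * P (A k))%E; first by rewrite integral_cst.
by rewrite pE EFinM.
Qed.

Let sum_first : (\sum_(k <oo) (k%:R * p k)%:E = r%:E)%E.
Proof.
rewrite nneseries_recl//; last by move=> k _; rewrite lee_fin mulr_ge0.
rewrite mul0r add0e -(@nneseries_addn _ _ 1); last by move=> k; rewrite lee_fin mulr_ge0.
rewrite (eq_eseriesr (g := fun k => (r%:E * (p k)%:E)%E)); last first.
  by move=> k _; rewrite addn1 p_rec EFinM.
by rewrite nneseriesZl ?p_sum ?mule1// => k _; rewrite lee_fin.
Qed.

Let sum_second : (\sum_(k <oo) (k%:R ^+ 2 * p k)%:E = (r + r ^+ 2)%:E)%E.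
Proof.
rewrite nneseries_recl//; last by move=> k _; rewrite lee_fin mulr_ge0// sqr_ge0.
rewrite expr0n/= mul0r add0e -(@nneseries_addn _ _ 1); last first.
  by move=> k; rewrite lee_fin mulr_ge0// sqr_ge0.
rewrite (eq_eseriesr (g := fun k => (r%:E * (k%:R * p k)%:E + r%:E * (p k)%:E)%E)); last first.
  move=> k _; rewrite addn1 -!EFinM -EFinD; congr EFin.
  by rewrite expr2 -mulrA p_rec -natr1; ring.
rewrite nneseriesD; last 2 first.
- by move=> k _ _; rewrite mule_ge0 ?lee_fin// mulr_ge0.
- by move=> k _ _; rewrite mule_ge0 ?lee_fin.
rewrite !nneseriesZl; last 2 first.
- by move=> k _; rewrite lee_fin.
- by move=> k _; rewrite lee_fin mulr_ge0.
by rewrite sum_first p_sum mule1 -EFinM -EFinD addrC expr2.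
Qed.

Hypothesis N0 : forall w, (0 <= N w)%E.

Let mfN : measurable_fun setT (fun w => fine (N w)).
Proof. by apply: measurableT_comp => //; exact: fine_measurable. Qed.

Lemma poisson_sqr : intg P (fun w => fine (N w) ^+ 2) /\
  Ex P (fun w => fine (N w) ^+ 2) = r + r ^+ 2.
Proof.
have h : (\int[P]_w (fine (N w) ^+ 2)%:E = (r + r ^+ 2)%:E)%E.
  rewrite (@integral_poisson (fun k => k%:R ^+ 2)) ?sum_second//.
  - exact: measurable_funX.
  - by move=> w; rewrite sqr_ge0.
  - by move=> k w; rewrite /A /= => ->.
split; last exact: Ex_eq.
apply: intg_ge0; first exact: measurable_funX.
  by move=> w; rewrite sqr_ge0.
by rewrite h ltry.
Qed.

Lemma poisson_mean : Ex P (fun w => fine (N w)) = r.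
Proof.
apply: Ex_eq; rewrite (@integral_poisson (fun k => k%:R)) ?sum_first//.
- by move=> w; rewrite fine_ge0.
- by move=> k w; rewrite /A /= => ->.
Qed.

Lemma poisson_compensated : let M := fun w => fine (N w) - r in
  [/\ measurable_fun setT M, intg P (fun w => M w ^+ 2), Ex P M = 0 &
      Ex P (fun w => M w ^+ 2) = r].
Proof.
move=> M; have [i2 e2] := poisson_sqr; have i1 := intg_sqr mfN i2.
have ME : (fun w => M w ^+ 2) =
    (fun w => fine (N w) ^+ 2 + ((- (2 * r)) * fine (N w) + cst (r ^+ 2) w)).
  by apply/funext => w; rewrite /M /=; ring.
have i3 : intg P (fun w => - (2 * r) * fine (N w) + cst (r ^+ 2) w).
  by apply: intgD; [exact: intgZ | exact: intg_cst].
split.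
- by apply: measurable_funB => //; exact: measurable_cst.
- by rewrite ME; exact: intgD.
- rewrite (ExB (Z := cst r))//; last exact: intg_cst.
  by rewrite poisson_mean Ex_cst subrr.
- rewrite ME ExD// ExD//; [|exact: intgZ|exact: intg_cst].
  by rewrite e2 ExZ// poisson_mean Ex_cst; ring.
Qed.

End poisson_moments.

(** * Integrals of simple integrands *)

Section adapted_functions.
Context d (T : measurableType d) (R : realType) (F : R -> set (set T)).
Hypothesis F_sigma : forall t : R, 0 <= t -> sigma_algebra setT (F t) /\ F t `<=` measurable.
Hypothesis F_mono : forall s t : R, 0 <= s -> s <= t -> F s `<=` F t.

(* [T] seen as a measurable space with the sigma-algebra [F t]. *)
Definition at_time (t : R) := g_sigma_algebraType (F t).

Definition known (t : R) (Y : T -> R) := measurable_fun setT (Y : at_time t -> R).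

Lemma known_measurable_wrt t Y : 0 <= t -> known t Y -> measurable_wrt (F t) Y.
Proof.
move=> t0 kY _ [B mB <-]; rewrite setTI.
have := kY measurableT B mB; rewrite setTI.
by rewrite /measurable/= sigma_algebra_id//; exact: (F_sigma t0).1.
Qed.

Lemma measurable_wrt_at_time d' (E : measurableType d') t (Y : T -> E) :
  measurable_wrt (F t) Y -> measurable_fun setT (Y : at_time t -> E).
Proof.
by move=> mY _ B mB; apply: sub_sigma_algebra; apply: mY; exists B.
Qed.

Lemma known_measurable t Y : 0 <= t -> known t Y -> measurable_fun setT Y.
Proof.
move=> t0 kY _ B mB; apply: (F_sigma t0).2; apply: (known_measurable_wrt t0 kY).
by exists B.
Qed.

Lemma at_time_measurable d' (E : measurableType d') t (Y : T -> E) : 0 <= t ->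
  measurable_fun setT (Y : at_time t -> E) -> measurable_fun setT Y.
Proof.
move=> t0 kY _ B mB; have := kY measurableT B mB; rewrite setTI.
rewrite /measurable/= sigma_algebra_id; last exact: (F_sigma t0).1.
exact: (F_sigma t0).2.
Qed.

Lemma at_time_le d' (E : measurableType d') s t (Y : T -> E) : 0 <= s -> s <= t ->
  measurable_fun setT (Y : at_time s -> E) -> measurable_fun setT (Y : at_time t -> E).
Proof.
move=> s0 st kY _ B mB; apply: sub_sigma_algebra; apply: (F_mono s0 st).
have := kY measurableT B mB.
by rewrite /measurable/= sigma_algebra_id//; exact: (F_sigma s0).1.
Qed.

Lemma known_le s t Y : 0 <= s -> s <= t -> known s Y -> known t Y.
Proof. exact: at_time_le. Qed.

Lemma known_indic t (A : set T) : F t A -> known t (\1_A : T -> R).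
Proof.
move=> FA; apply: measurable_indic; exact: sub_sigma_algebra.
Qed.

End adapted_functions.

Section noise.
Context d (T : measurableType d) (R : realType) (P : probability T R)
  (F : R -> set (set T)).
Hypothesis F_sigma : forall t : R, 0 <= t -> sigma_algebra setT (F t) /\ F t `<=` measurable.
Hypothesis F_mono : forall s t : R, 0 <= s -> s <= t -> F s `<=` F t.
Context (L : finType) (xi : L -> R -> R -> T -> R) (V : L -> L -> R).

(** Covariation per unit time of sum_l a_l xi_l. It is the squared norm of a for Brownian
    coordinates ([quad_brownian]) and the squared L2 norm of a simple function of the marks for
    compensated Poisson counts ([quad_overlap]). *)
Definition quad (a : L -> R) : R := \sum_l \sum_k V l k * (a l * a k).

(* Increments over ]s, t] of a family of orthogonal-increment martingales with
   covariation density [V]. *)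
Record noise : Prop := {
  noise_quad : forall a, 0 <= quad a ;
  noise_known : forall l s t, 0 <= s -> s <= t -> known F t (xi l s t) ;
  noise_sqr : forall l s t, 0 <= s -> s <= t -> intg P (fun w => xi l s t w ^+ 2) ;
  noise_add : forall l r s t, 0 <= r -> r <= s -> s <= t ->
    {ae P, forall w, xi l r t w = xi l r s w + xi l s t w} ;
  noise_mean : forall l s t Z, 0 <= s -> s <= t -> known F s Z -> intg P Z ->
    intg P (fun w => Z w * xi l s t w) /\ Ex P (fun w => Z w * xi l s t w) = 0 ;
  noise_cov : forall s t (a : L -> T -> R) M, 0 <= s -> s <= t ->
    (forall l, known F s (a l)) -> (forall l w, `|a l w| <= M) ->
    Ex P (fun w => (\sum_l a l w * xi l s t w) ^+ 2) <=
    (t - s) * Ex P (fun w => quad (fun l => a l w)) }.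

Hypothesis nz : noise.

Lemma noise_measurable l s t : 0 <= s -> s <= t -> measurable_fun setT (xi l s t).
Proof. by move=> s0 st; apply: known_measurable (le_trans s0 st) (noise_known nz l s0 st). Qed.

Lemma known_quad s (a : L -> T -> R) : (forall l, known F s (a l)) ->
  known F s (fun w => quad (fun l => a l w)).
Proof.
move=> ka; apply: measurable_sum => l; apply: measurable_sum => k.
apply: measurable_funM; first exact: measurable_cst.
by apply: measurable_funM; exact: ka.
Qed.

Lemma quad_bounded (a : L -> R) M : (forall l, `|a l| <= M) ->
  `|quad a| <= \sum_l \sum_k `|V l k| * (M * M).
Proof.
move=> aM; rewrite (le_trans (ler_norm_sum _ _ _))//; apply: ler_sum => l _.
rewrite (le_trans (ler_norm_sum _ _ _))//; apply: ler_sum => k _.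
by rewrite normrM ler_wpM2l// normrM ler_pM.
Qed.

Context (D : finType) (s : nat -> R) (C : nat -> L -> D -> T -> R) (n : nat) (B : R).
Hypothesis s0 : 0 <= s 0%N.
Hypothesis s_le : forall p, s p <= s p.+1.
Hypothesis C_known : forall p l j, known F (s p) (C p l j).
Hypothesis C_bounded : forall p l j w, `|C p l j w| <= B.

Let sge0 p : 0 <= s p.
Proof. by elim: p => // p ih; exact: le_trans (s_le p). Qed.

Let s_homo p q : (p <= q)%N -> s p <= s q.
Proof. by move=> pq; exact: (homo_leq lexx le_trans s_le). Qed.

Definition step_integral (G : nat -> L -> D -> T -> R) q j w : R :=
  \sum_(p < q) \sum_l G p l j w * xi l (s p) (s p.+1) w.

Definition step_bracket (G : nat -> L -> D -> T -> R) q w : R :=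
  \sum_(p < q) (s p.+1 - s p) * \sum_j quad (fun l => G p l j w).

Lemma known_step_integral G : (forall p l j, known F (s p) (G p l j)) ->
  forall q j, known F (s q) (step_integral G q j).
Proof.
move=> kG q j; apply: measurable_sum => p; apply: measurable_sum => l.
have pq : s p.+1 <= s q by apply: s_homo.
apply: measurable_funM.
  by apply: (known_le F_sigma F_mono (sge0 p) _ (kG p l j)); exact: le_trans pq.
apply: (known_le F_sigma F_mono (sge0 p.+1) pq); exact: (noise_known nz).
Qed.

(** Ito isometry, as an inequality because [noise_cov] is one. The cross term with the last
    increment has mean 0: its factor, a coefficient times the integral so far, is known at the left
    end of the step. *)
Lemma step_integral_sqr G M : (forall p l j, known F (s p) (G p l j)) ->
  (forall p l j w, `|G p l j w| <= M) -> forall q,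
  (forall j, intg P (fun w => step_integral G q j w ^+ 2)) /\
  Ex P (fun w => \sum_j step_integral G q j w ^+ 2) <= Ex P (step_bracket G q).
Proof.
move=> kG GM; elim=> [|q [ihi ih]].
  have E j : (fun w => step_integral G 0 j w ^+ 2) = cst 0.
    by apply/funext => w; rewrite /step_integral big_ord0 expr0n.
  split=> [j|]; first by rewrite E; exact: intg_cst.
  rewrite (_ : (fun w => _) = cst 0); last first.
    by apply/funext => w; rewrite big1// => j _; rewrite (congr1 (@^~ w) (E j)).
  by rewrite Ex_cst Ex_ge0// => w; rewrite /step_bracket big_ord0.
have mM j : measurable_fun setT (step_integral G q j).
  exact: (known_measurable F_sigma (sge0 q) (known_step_integral kG j)).
have iM j := intg_sqr (mM j) (ihi j).
pose inc j w := \sum_l G q l j w * xi l (s q) (s q.+1) w.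
have mG l j : measurable_fun setT (G q l j).
  exact: (known_measurable F_sigma (sge0 q) (kG q l j)).
have mxi l : measurable_fun setT (xi l (s q) (s q.+1)) by exact: noise_measurable.
have iGx l j : intg P (fun w => (G q l j w * xi l (s q) (s q.+1) w) ^+ 2).
  under eq_fun do rewrite exprMn.
  apply: (@intg_mul_bounded _ _ _ _ _ _ (M ^+ 2)).
  - exact: measurable_funX.
  - by move=> w; rewrite normrX ler_pXn2r ?nnegrE// (le_trans _ (GM q l j w)).
  - exact: (noise_sqr nz).
have iinc j : intg P (fun w => inc j w ^+ 2).
  under eq_fun do rewrite expr2 mulr_suml.
  apply: intg_sum => l; under eq_fun do rewrite mulr_sumr.
  apply: intg_sum => k; apply: intg_mul_sqr => //; exact: measurable_funM.
have minc j : measurable_fun setT (inc j).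
  by apply: measurable_sum => l; exact: measurable_funM.
have SE j w : step_integral G q.+1 j w = step_integral G q j w + inc j w.
  by rewrite /step_integral big_ord_recr.
have SE2 j : (fun w => step_integral G q.+1 j w ^+ 2) = (fun w =>
    step_integral G q j w ^+ 2 + (2 * (step_integral G q j w * inc j w) + inc j w ^+ 2)).
  by apply/funext => w; rewrite SE; ring.
have cross j : intg P (fun w => step_integral G q j w * inc j w) /\
    Ex P (fun w => step_integral G q j w * inc j w) = 0.
  have E : (fun w => step_integral G q j w * inc j w) =
      (fun w => \sum_l (G q l j w * step_integral G q j w) * xi l (s q) (s q.+1) w).
    by apply/funext => w; rewrite /inc mulr_sumr; apply: eq_bigr => l _; ring.
  have h l := @noise_mean nz l (s q) (s q.+1)
     (fun w => G q l j w * step_integral G q j w) (sge0 q) (s_le q) _ _.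
  have kk l : known F (s q) (fun w => G q l j w * step_integral G q j w).
    by apply: measurable_funM; [exact: kG | exact: known_step_integral].
  have ii l : intg P (fun w => G q l j w * step_integral G q j w).
    exact: (@intg_mul_bounded _ _ _ _ _ _ M).
  rewrite E; split; first by apply: intg_sum => l; exact: (h kk ii l).1.
  rewrite Ex_sum; last by move=> l; exact: (h kk ii l).1.
  by rewrite big1// => l _; exact: (h kk ii l).2.
have iS j : intg P (fun w => step_integral G q.+1 j w ^+ 2).
  rewrite SE2; apply: intgD => //; apply: intgD => //.
  by apply: intgZ; exact: (cross j).1.
split=> //.
rewrite Ex_sum// (eq_bigr (fun j => Ex P (fun w => step_integral G q j w ^+ 2) +
    Ex P (fun w => inc j w ^+ 2))); last first.
  move=> j _; rewrite SE2 ExD//; last first.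
    by apply: intgD => //; apply: intgZ; exact: (cross j).1.
  rewrite ExD//; last by apply: intgZ; exact: (cross j).1.
  by rewrite ExZ ?(cross j).1// (cross j).2 mulr0 add0r.
rewrite big_split/= -Ex_sum//.
have iq j : intg P (fun w => quad (fun l => G q l j w)).
  apply: (@intg_bounded _ _ _ _ _ (\sum_l \sum_k `|V l k| * (M * M))).
    exact: (known_measurable F_sigma (sge0 q) (known_quad (a := fun l w => G q l j w) (fun l => kG q l j))).
  by move=> w; exact: quad_bounded.
have iqs p : intg P (fun w => \sum_j quad (fun l => G p l j w)).
  apply: intg_sum => j.
  apply: (@intg_bounded _ _ _ _ _ (\sum_l \sum_k `|V l k| * (M * M))).
    exact: (known_measurable F_sigma (sge0 p) (known_quad (a := fun l w => G p l j w) (fun l => kG p l j))).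
  by move=> w; exact: quad_bounded.
have BE : step_bracket G q.+1 = (fun w => step_bracket G q w +
    (s q.+1 - s q) * \sum_j quad (fun l => G q l j w)).
  by apply/funext => w; rewrite /step_bracket big_ord_recr.
rewrite BE ExD; last 2 first.
- by apply: intg_sum => p; exact: intgZ.
- exact: intgZ.
rewrite lerD// ExZ// Ex_sum// mulr_sumr; apply: ler_sum => j _.
exact: (noise_cov nz (M := M)).
Qed.

Lemma step_bracket_mono w : {homo (step_bracket C)^~ w : p q / (p <= q)%N >-> p <= q}.
Proof.
apply: homo_leq => //; first exact: le_trans.
move=> p; rewrite /step_bracket big_ord_recr/= lerDl mulr_ge0 ?subr_ge0//.
by apply: sumr_ge0 => j _; exact: (noise_quad nz).
Qed.

Let sqM q w := \sum_j step_integral C q j w ^+ 2.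

(* Lenglart's inequality; the integrand is stopped as soon as the integral
   exceeds [eta] or the bracket is about to exceed [c]. *)
Lemma step_lenglart (eta c : R) : 0 < eta -> 0 <= c ->
  (P ([set w | exists2 q, (q <= n)%N & (eta <= sqM q w)%R] `&`
      [set w | (step_bracket C n w < c)%R]) <= (c / eta)%:E)%E.
Proof.
move=> eta0 c0.
have ksqM q : known F (s q) (sqM q).
  by apply: measurable_sum => j; apply: measurable_funX; exact: (known_step_integral C_known j).
have msqM q : measurable_fun setT (sqM q) by exact: (known_measurable F_sigma (sge0 q) (ksqM q)).
have kquad p j : known F (s p) (fun w => quad (fun l => C p l j w)).
  exact (known_quad (a := fun l w => C p l j w) (fun l => @C_known p l j)).
have kbr q : known F (s q) (step_bracket C q.+1).
  apply: measurable_sum => p; apply: measurable_funM => //.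
  apply: measurable_sum => j.
  have pq : (p <= q)%N by rewrite -ltnS.
  exact (known_le F_sigma F_mono (sge0 p) (s_homo pq) (kquad p j)).
have measurable_bracket : measurable_fun setT (step_bracket C n).
  apply: measurable_sum => p; apply: measurable_funM => //.
  apply: measurable_sum => j; exact: (known_measurable F_sigma (sge0 p) (kquad p j)).
(* The bracket including step p is already known at time [s p], since the coefficients are; this
   makes it possible to stop before the bracket exceeds c. *)
pose S (p : nat) : set T := [set w | (forall q : 'I_p.+1, sqM q w < eta) /\ step_bracket C p.+1 w < c].
have FS p : F (s p) (S p).
  have : (measurable : set (set (at_time F (s p)))) (S p).
    rewrite (_ : S p = (\bigcap_(q in [set: 'I_p.+1]) [set w | sqM q w < eta]) `&`
        [set w | step_bracket C p.+1 w < c]); last first.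
      apply/seteqP; split => w [h1 h2]; split => // q; first by move=> _; exact: h1.
      exact: h1 q I.
    apply: measurableI; last first.
      by rewrite -[X in measurable X]setTI; exact: (measurable_fun_ltr (kbr p) (measurable_cst _)).
    apply: fin_bigcap_measurable => // q _.
    have kq : known F (s p) (sqM q).
      by apply: (@known_le _ _ _ _ F_sigma F_mono (s q)) => //; apply: s_homo; rewrite -ltnS.
    by rewrite -[X in measurable X]setTI; exact: (measurable_fun_ltr kq (measurable_cst _)).
  by rewrite /measurable/= sigma_algebra_id//; exact: (F_sigma (sge0 p)).1.
pose G p l j w := \1_(S p) w * C p l j w.
have kG p l j : known F (s p) (G p l j).
  have k1 : known F (s p) (\1_(S p) : T -> R) by apply: known_indic; exact: FS.
  have k2 := @C_known p l j.
  by apply: (@measurable_funM _ (at_time F (s p)) R setT _ _ k1 k2).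
have GM p l j w : `|G p l j w| <= B.
  rewrite /G normrM -[leRHS]mul1r ler_pM// indicE; by case: (_ \in _); rewrite ?normr1 ?normr0.
have [iG EG] := step_integral_sqr kG GM n.
(* A step contributes to the stopped bracket only if the full bracket after it is still below c, so
   the bound holds for every path. *)
have brG w : step_bracket G n w <= c.
  suff h q : (q <= n)%N -> step_bracket G q w <= step_bracket C q w /\ step_bracket G q w <= c.
    by have [] := h n (leqnn n).
  elim: q => [_|q ih qn]; first by rewrite /step_bracket !big_ord0.
  have [ih1 ih2] := ih (ltnW qn).
  have GE : \sum_j quad (fun l => G q l j w) = \1_(S q) w * \sum_j quad (fun l => C q l j w).
    rewrite /G indicE; case: (_ \in _) => /=.
      rewrite mul1r; apply: eq_bigr => j _; congr quad; apply/funext => l; by rewrite mul1r.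
    rewrite mul0r big1// => j _; rewrite /quad big1// => l _; rewrite big1// => k _.
    by rewrite mul0r mul0r mulr0.
  have Cge : 0 <= \sum_j quad (fun l => C q l j w).
    by apply: sumr_ge0 => j _; exact: (noise_quad nz).
  have ds : 0 <= s q.+1 - s q by rewrite subr_ge0.
  have e1 : step_bracket G q.+1 w = step_bracket G q w + (s q.+1 - s q) * \sum_j quad (fun l => G q l j w).
    by rewrite /step_bracket big_ord_recr.
  have e2 : step_bracket C q.+1 w = step_bracket C q w + (s q.+1 - s q) * \sum_j quad (fun l => C q l j w).
    by rewrite /step_bracket big_ord_recr.
  rewrite e1 e2 GE indicE; case: (boolP (w \in S q)) => wS /=; last first.
    rewrite mul0r mulr0 addr0; split => //; rewrite (le_trans ih1)// lerDl mulr_ge0//.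
  rewrite mul1r; split; first by rewrite lerD2r.
  move: wS; rewrite inE => -[_]; rewrite e2 => /ltW; apply: le_trans; by rewrite lerD2r.
have iGS : intg P (fun w => \sum_j step_integral G n j w ^+ 2) by exact: intg_sum.
have EGc : Ex P (fun w => \sum_j step_integral G n j w ^+ 2) <= c.
  apply: (le_trans EG); rewrite -[leRHS](Ex_cst P); apply: Ex_le => //; last exact: intg_cst.
  apply: intg_sum => p; apply: intgZ; apply: intg_sum => j.
  apply: (@intg_bounded _ _ _ _ _ (\sum_l \sum_k `|V l k| * (B * B))).
    exact: (known_measurable F_sigma (sge0 p) (known_quad (a := fun l w => G p l j w) (fun l => kG p l j))).
  by move=> w; exact: quad_bounded.
apply: (@le_trans _ _ (P [set w | (eta <= \sum_j step_integral G n j w ^+ 2)%R])); last first.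
  apply: (le_trans (markov_Ex iGS _ eta0)).
    by move=> w; apply: sumr_ge0 => j _; exact: sqr_ge0.
  by rewrite lee_fin ler_pM2r// invr_gt0.
apply: le_measure.
- rewrite inE; apply: measurableI.
    rewrite (_ : [set w | _] = \bigcup_(q in `I_n.+1) [set w | eta <= sqM q w]).
      by apply: bigcup_measurable => q _; exact: measurable_ge_set.
    by apply/seteqP; split => [w [q qn h]|w [q qn h]]; exists q.
  rewrite -[X in measurable X]setTI.
  exact: (measurable_fun_ltr measurable_bracket (measurable_cst _)).
- by rewrite inE; apply: measurable_ge_set; exact: intg_measurable iGS.
move=> w [[q qn hq] hc] /=.
have : exists q, (q <= n)%N && (eta <= sqM q w) by exists q; rewrite qn.
(* At the first crossing q0 the stopped and the original integral agree, as all earlier steps are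
   active; no later step is, so the stopped integral keeps this value until n. *)
move=> /ex_minnP[q0 /andP[q0n hq0] q0min].
suff h : forall r, (q0 <= r)%N -> (r <= n)%N -> forall j, step_integral G r j w = step_integral C q0 j w.
  by rewrite (eq_bigr (fun j => step_integral C q0 j w ^+ 2))// => j _; rewrite h.
have inS p : (p < q0)%N -> w \in S p.
  move=> pq0; rewrite inE; split=> [r|].
    rewrite ltNge; apply/negP => hr; have := q0min r; rewrite hr andbT.
    have rp : (r <= p)%N by rewrite -ltnS.
    have rq0 : (r < q0)%N by exact: leq_ltn_trans pq0.
    by rewrite (leq_trans (ltnW rq0) q0n) => /(_ isT); rewrite leqNgt rq0.
  by apply: le_lt_trans hc; apply: step_bracket_mono; exact: leq_trans q0n.
have notS p : (q0 <= p)%N -> w \notin S p.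
  move=> q0p; apply/negP; rewrite inE => -[+ _].
  by move=> /(_ (Ordinal (q0p : (q0 < p.+1)%N))); rewrite ltNge hq0.
elim=> [|r ih].
  rewrite leqn0 => /eqP q00 _ j; rewrite q00.
  by rewrite /step_integral !big_ord0.
rewrite leq_eqVlt => /orP[/eqP <- _ j|q0r rn j].
  apply: eq_bigr => p _; apply: eq_bigr => l _.
  by rewrite /G indicE (inS p) ?mul1r.
have e1 : step_integral G r.+1 j w = step_integral G r j w +
    \sum_l G r l j w * xi l (s r) (s r.+1) w by rewrite /step_integral big_ord_recr.
rewrite e1 ih//; last exact: ltnW.
rewrite big1 ?addr0// => l _.
by rewrite /G indicE (negbTE (notS r q0r)) !mul0r.
Qed.

End noise.

Lemma probability_le_ae d (T : measurableType d) (R : realType) (P : probability T R)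
    (A B : set T) : measurable A -> measurable B ->
  {ae P, forall w, A w -> B w} -> (P A <= P B)%E.
Proof.
move=> mA mB [N [mN N0 AN]]; rewrite -[leRHS]adde0 -N0.
apply: le_trans (measureU2 _ mB mN); apply: le_measure; rewrite ?inE//.
  exact: measurableU.
move=> w Aw; case: (pselect (B w)) => Bw; [left|right] => //.
by apply: AN => /= /(_ Aw).
Qed.

Lemma ae_forall_fin d (T : measurableType d) (R : realType) (P : probability T R)
    (I : finType) (Q : I -> T -> Prop) :
  (forall i, {ae P, forall w, Q i w}) -> {ae P, forall w, forall i, Q i w}.
Proof.
move=> h; have : {ae P, forall w, forall i : I, i \in enum I -> Q i w}.
  elim: (enum I) => [|i s ih]; first exact: nearW.
  by apply: filterS2 ih (h i) => w h1 h2 j; rewrite inE => /orP[/eqP ->|/h1].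
by apply: filterS => w hw i; apply: hw; rewrite mem_enum.
Qed.

(** Common refinement of finitely many times. Beyond index n the sequence is constantly [T0], the
    default of [nth]; hence it is nondecreasing everywhere but reflects the order of indices only up
    to n. *)
Lemma time_grid (R : realType) (T0 : R) (pts : seq R) : 0 <= T0 ->
  (forall x, x \in pts -> 0 <= x <= T0) ->
  exists (s : nat -> R) (n : nat),
    [/\ s 0%N = 0, s n = T0, forall p, s p <= s p.+1,
        forall p q, (p <= n)%N -> (q <= n)%N -> (s p <= s q) = (p <= q)%N
      & forall x, x \in pts -> exists2 q, (q <= n)%N & x = s q].
Proof.
move=> T00 hpts; pose gs := sort <=%O (undup (0 :: T0 :: pts)).
have gsP x : x \in gs -> 0 <= x <= T0.
  rewrite mem_sort mem_undup !inE => /orP[/eqP ->|/orP[/eqP ->|/hpts]//].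
    by rewrite lexx.
  by rewrite T00 lexx.
have sg : sorted <%O gs by rewrite sort_lt_sorted undup_uniq.
have g0 : 0 \in gs by rewrite mem_sort mem_undup inE eqxx.
have gT : T0 \in gs by rewrite mem_sort mem_undup !inE eqxx orbT.
have sz : (0 < size gs)%N by move: g0; case: (gs).
pose s := nth T0 gs; pose n := (size gs).-1.
have nsz : n.+1 = size gs by rewrite prednK.
have sle p q : (p <= n)%N -> (q <= n)%N -> (s p <= s q) = (p <= q)%N.
  by move=> pn qn; rewrite [s p <= s q](lt_sorted_leq_nth T0 sg) ?inE -?nsz ?ltnS.
have s0 : s 0%N = 0.
  have := nth_index T0 g0; rewrite -index_mem -nsz ltnS in g0.
  move: g0; set q := index _ _ => qn sq.
  apply/eqP; rewrite eq_le; apply/andP; split; last first.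
    by have /andP[] := gsP (s 0%N) (mem_nth _ sz).
  have h : s 0%N <= s q by rewrite sle.
  by rewrite (le_trans h)// /s sq.
have sT : s n = T0.
  have iT : (index T0 gs <= n)%N by rewrite -ltnS nsz index_mem.
  have e : s (index T0 gs) = T0 by exact: nth_index.
  apply/eqP; rewrite eq_le -{2}e sle// iT andbT.
  have nm : (n < size gs)%N by rewrite -nsz.
  by have /andP[] := gsP (s n) (mem_nth _ nm).
have sS p : s p <= s p.+1.
  case: (ltnP p n) => pn; first by rewrite sle// ltnW.
  have -> : s p.+1 = T0 by rewrite /s nth_default// -nsz.
  move: pn; rewrite leq_eqVlt => /orP[/eqP <-|pn]; first by rewrite sT.
  by rewrite /s nth_default// -nsz.
exists s, n; split => // x xp; exists (index x gs).
  by rewrite -ltnS nsz index_mem mem_sort mem_undup !inE xp !orbT.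
by rewrite /s nth_index// mem_sort mem_undup !inE xp !orbT.
Qed.

Lemma integral_step (R : realType) (s : nat -> R) (n : nat) (g : R -> R) (v : nat -> R) :
  (forall p, s p <= s p.+1) -> (forall r, 0 <= g r) ->
  (forall p r, (p < n)%N -> s p < r -> r <= s p.+1 -> g r = v p) ->
  (\int[lebesgue_measure]_(r in `]s 0%N, s n]) (g r)%:E =
   (\sum_(p < n) (s p.+1 - s p) * v p)%:E)%E.
Proof.
move=> sS g0 gv.
have shomo a b : (a <= b)%N -> s a <= s b.
  by move=> ab; exact: (homo_leq lexx le_trans sS).
have cat q : `]s 0%N, s q.+1]%classic = `]s 0%N, s q]%classic `|` `]s q, s q.+1]%classic :> set R.
  apply/seteqP; split=> r /=; rewrite !in_itv/=.
    by move=> /andP[h1 h2]; case: (leP r (s q)) => rb; [left | right]; apply/andP.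
  case=> /andP[h1 h2]; apply/andP; split => //.
    exact: le_trans (sS q).
  exact: le_lt_trans (shomo _ _ (leq0n q)) h1.
have piece q : (q < n)%N -> measurable_fun (`]s q, s q.+1] : set R) (fun r => (g r)%:E) /\
    (\int[lebesgue_measure]_(r in `]s q, s q.+1]) (g r)%:E = ((s q.+1 - s q) * v q)%:E)%E.
  move=> qn; have E : {in `]s q, s q.+1]%classic : set R, (fun r => (g r)%:E) =1 cst (v q)%:E}.
    by move=> r; rewrite inE/= in_itv/= => /andP[h1 h2]; rewrite (gv q).
  split; first by apply: (@eq_measurable_fun _ _ _ _ _ (cst (v q)%:E)) => // r rq; rewrite E.
  rewrite (eq_integral (cst (v q)%:E))// integral_cst//= lebesgue_measure_itv/= lte_fin.
  case: ltP => h; first by rewrite -EFinB -EFinM mulrC.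
  have -> : s q.+1 = s q by apply/eqP; rewrite eq_le h sS.
  by rewrite subrr mul0r mule0.
have main q : (q <= n)%N -> measurable_fun (`]s 0%N, s q] : set R) (fun r => (g r)%:E) /\
   (\int[lebesgue_measure]_(r in `]s 0%N, s q]) (g r)%:E = (\sum_(p < q) (s p.+1 - s p) * v p)%:E)%E.
  elim: q => [_|q ih qn].
    by rewrite set_itvoc0 integral_set0 big_ord0; split => //; exact: measurable_fun_set0.
  have [ih1 ih2] := ih (ltnW qn); have [p1 p2] := piece q qn.
  have mU : measurable_fun (`]s 0%N, s q.+1] : set R) (fun r => (g r)%:E).
    by rewrite cat; apply/measurable_funU.
  split => //; rewrite cat ge0_integral_setU//.
  - by rewrite ih2 p2 big_ord_recr/= EFinD.
  - by rewrite -cat.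
  - by move=> r _; rewrite lee_fin.
  - apply/disj_setPS => r [] /=; rewrite !in_itv/= => /andP[_ h1] /andP[h2 _].
    by have := le_lt_trans h1 h2; rewrite ltxx.
by have [_ ->] := main n (leqnn n).
Qed.

(** * Simple integrals over arbitrary intervals *)

Section simple_integrals.
Context d (T : measurableType d) (R : realType) (P : probability T R)
  (F : R -> set (set T)).
Hypothesis F_sigma : forall t : R, 0 <= t -> sigma_algebra setT (F t) /\ F t `<=` measurable.
Hypothesis F_mono : forall s t : R, 0 <= s -> s <= t -> F s `<=` F t.
Context (L : finType) (xi : L -> R -> R -> T -> R) (V : L -> L -> R).
Hypothesis nz : noise P F xi V.
Context (I D : finType) (from to : I -> R) (coef : I -> L -> D -> T -> R) (B : R).
Hypothesis from_ge0 : forall i, 0 <= from i.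
Hypothesis from_to : forall i, from i <= to i.
Hypothesis coef_known : forall i l j, known F (from i) (coef i l j).
Hypothesis coef_bounded : forall i l j w, `|coef i l j w| <= B.

Definition simple_sum t j w : R :=
  \sum_i \sum_l coef i l j w * xi l (Num.min (from i) t) (Num.min (to i) t) w.

Definition simple_value r l j w : R := \sum_(i | from i < r <= to i) coef i l j w.

Let min_ge0 i t : 0 <= t -> 0 <= Num.min (from i) t.
Proof. by move=> t0; rewrite le_min from_ge0. Qed.

Let min_le i t : Num.min (from i) t <= Num.min (to i) t.
Proof. by rewrite le_min !ge_min from_to lexx orbT. Qed.

Lemma measurable_simple_sum t j : 0 <= t -> measurable_fun setT (simple_sum t j).
Proof.
move=> t0; apply: measurable_sum => i; apply: measurable_sum => l.
apply: measurable_funM.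
  exact: (known_measurable F_sigma (from_ge0 i) (@coef_known i l j)).
exact: (noise_measurable F_sigma nz l (min_ge0 i t0) (min_le i t)).
Qed.

Lemma noise_telescope (s : nat -> R) l (p q : nat) : 0 <= s 0%N ->
  (forall k, s k <= s k.+1) -> (p <= q)%N ->
  {ae P, forall w, xi l (s p) (s q) w = \sum_(p <= k < q) xi l (s k) (s k.+1) w}.
Proof.
move=> s0 sS; have sge k : 0 <= s k by elim: k => // k ih; exact: le_trans (sS k).
have shomo a b : (a <= b)%N -> s a <= s b.
  by move=> ab; exact: (homo_leq lexx le_trans sS).
elim: q => [|q ih].
  rewrite leqn0 => /eqP ->.
  (* Additivity with three equal times reads xi = xi + xi, so an empty increment vanishes. *)
  have := noise_add nz l (sge 0%N) (lexx _) (lexx _).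
  by apply: filterS => w h; rewrite big_geq//; move: h; lra.
rewrite leq_eqVlt => /orP[/eqP <-|pq].
  have := noise_add nz l (sge p) (lexx _) (lexx _).
  by apply: filterS => w h; rewrite big_geq//; move: h; lra.
have := noise_add nz l (sge p) (shomo _ _ (pq : (p <= q)%N)) (sS q).
by apply: filterS2 (ih pq) => w h ->; rewrite big_nat_recr//= h.
Qed.

(** The intervals of the integrand are arbitrary; their endpoints, cut at [T0], and the sampling
    times are merged into one grid, on which the integral becomes a step integral. Measurability of
    the event is part of the claim because the bracket appears as a time integral. *)
Lemma simple_lenglart (T0 : R) (ts : seq R) (eta c : R) : 0 <= T0 ->
  (forall t, t \in ts -> 0 <= t <= T0) -> 0 < eta -> 0 <= c ->
  let E := [set w | exists2 t, t \in ts & eta <= \sum_j simple_sum t j w ^+ 2] `&`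
    [set w | (\int[lebesgue_measure]_(r in `]0%R, T0])
       (\sum_j quad V (fun l => simple_value r l j w))%:E < c%:E)%E] in
  measurable E /\ (P E <= (c / eta)%:E)%E.
Proof.
move=> T00 tsT eta0 c0 E.
pose pts := [seq Num.min (from i) T0 | i <- enum I] ++
  [seq Num.min (to i) T0 | i <- enum I] ++ ts.
have [] := @time_grid _ T0 pts T00.
  move=> x; rewrite !mem_cat => /orP[/mapP[i _ ->]|/orP[/mapP[i _ ->]|/tsT//]].
    by rewrite ge_min lexx orbT min_ge0.
  by rewrite ge_min lexx orbT andbT (le_trans (min_ge0 i T00)).
move=> s [n [s0 sn sS sle spts]].
have /choice[al alP] : forall i, exists q, (q <= n)%N /\ Num.min (from i) T0 = s q.
  move=> i; have [|q ? ?] := spts (Num.min (from i) T0); last by exists q.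
  by rewrite mem_cat (map_f (fun i => Num.min (from i) T0)) ?mem_enum.
have /choice[be beP] : forall i, exists q, (q <= n)%N /\ Num.min (to i) T0 = s q.
  move=> i; have [|q ? ?] := spts (Num.min (to i) T0); last by exists q.
  by rewrite !mem_cat (map_f (fun i => Num.min (to i) T0)) ?mem_enum ?orbT.
have albe i : (al i <= be i)%N.
  rewrite -sle ?(alP i).1 ?(beP i).1// -(alP i).2 -(beP i).2; exact: min_le.
have slt p : (p < n)%N -> s p < T0.
  by move=> pn; rewrite -sn ltNge sle// -?ltnNge// ltnW.
have sp1 p : (p < n)%N -> s p.+1 <= T0 by move=> pn; rewrite -sn sle.
have sge p : 0 <= s p by rewrite -s0; exact: (homo_leq lexx le_trans sS).
have alE i p : (p < n)%N -> (from i <= s p) = (al i <= p)%N.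
  move=> pn; rewrite -sle ?(alP i).1 1?ltnW// -(alP i).2 ge_min.
  by rewrite (leNgt T0) (slt _ pn) orbF.
have beE i p : (p < n)%N -> (s p.+1 <= to i) = (p < be i)%N.
  move=> pn; rewrite -sle ?(beP i).1// -(beP i).2 le_min.
  by rewrite (sp1 _ pn) andbT.
(* An interval is active on a cell when it contains the cell; no endpoint falls strictly inside a
   cell, so intervals never cut one. *)
pose act p i := (from i <= s p) && (s p.+1 <= to i).
pose C p l j w := \sum_(i | act p i) coef i l j w.
have kC p l j : known F (s p) (C p l j).
  rewrite /C (_ : (fun w => _) = (fun w => \sum_i (if act p i then coef i l j w else 0))).
    apply: measurable_sum => i; case: (boolP (act p i)) => [/andP[h _]|_]; last exact: measurable_cst.
    exact: (known_le F_sigma F_mono (from_ge0 i) h (@coef_known i l j)).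
  by apply/funext => w; rewrite big_mkcond.
have CB p l j w : `|C p l j w| <= \sum_(i : I) `|B|.
  rewrite (le_trans (ler_norm_sum _ _ _))// big_mkcond/=; apply: ler_sum => i _.
  by case: ifP => // _; exact: le_trans (coef_bounded _ _ _ _) (ler_norm _).
have sums0 : 0 <= s 0%N by [].
have len := step_lenglart F_sigma F_mono nz n sums0 sS kC CB eta0 c0.
(* on the grid both integrals agree almost surely *)
have agree : {ae P, forall w, forall k : 'I_n.+1, forall j,
    simple_sum (s k) j w = step_integral xi s C k j w}.
  have h : {ae P, forall w, forall kil : 'I_n.+1 * (I * L),
      xi kil.2.2 (s (minn (al kil.2.1) kil.1)) (s (minn (be kil.2.1) kil.1)) w =
      \sum_(minn (al kil.2.1) kil.1 <= k < minn (be kil.2.1) kil.1)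
         xi kil.2.2 (s k) (s k.+1) w}.
    apply: ae_forall_fin => -[k [i l]]; apply: noise_telescope => //=.
    by rewrite leq_min !geq_min albe leqnn orbT.
  apply: filterS h => w h k j.
  have kn : (k <= n)%N by rewrite -ltnS.
  have mins q : (q <= n)%N -> Num.min (s q) (s k) = s (minn q k).
    move=> qn; case: (leqP q k) => qk; first by rewrite min_l// sle.
    by rewrite min_r// sle// ltnW.
  have minT x : Num.min x (s k) = Num.min (Num.min x T0) (s k).
    by rewrite -minA; congr Num.min; rewrite min_r// -sn sle.
  transitivity (\sum_i \sum_l coef i l j w * \sum_(p < k | act p i) xi l (s p) (s p.+1) w).
    apply: eq_bigr => i _; apply: eq_bigr => l _; congr (_ * _).
    rewrite (minT (from i)) (minT (to i)) (alP i).2 (beP i).2 !mins ?(alP i).1 ?(beP i).1//.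
    rewrite (h (k, (i, l)))/=.
    rewrite -(big_mkord (fun p => act p i) (fun p => xi l (s p) (s p.+1) w)).
    rewrite [LHS](@big_nat_widenl _ _ _ _ 0%N)// [LHS](@big_nat_widen _ _ _ _ (minn (be i) k) k) ?geq_minr//.
    rewrite big_nat_cond [RHS]big_nat_cond; apply: eq_bigl => p /=.
    case: (ltnP p k) => //= pk; have pn := leq_trans pk kn; rewrite /act alE// beE//.
    by rewrite geq_min (leqNgt k) pk orbF leq_min pk andbT.
  transitivity (\sum_(p < k) \sum_l \sum_(i | act p i) coef i l j w * xi l (s p) (s p.+1) w).
    under eq_bigr => i _ do under eq_bigr => l _ do rewrite mulr_sumr big_mkcond.
    under [RHS]eq_bigr => p _ do under eq_bigr => l _ do rewrite big_mkcond.
    rewrite exchange_big [RHS]exchange_big/=; apply: eq_bigr => l _.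
    by rewrite exchange_big.
  by apply: eq_bigr => p _; apply: eq_bigr => l _; rewrite /C mulr_suml.
have valE p r l j w : (p < n)%N -> s p < r -> r <= s p.+1 -> simple_value r l j w = C p l j w.
  move=> pn spr rsp; apply: eq_bigl => i; rewrite /act; congr (_ && _).
    apply/idP/idP => [fr|fs]; last exact: le_lt_trans spr.
    rewrite alE// leqNgt; apply/negP => pa.
    have : s p.+1 <= s (al i) by rewrite sle// (alP i).1.
    rewrite -(alP i).2 le_min => /andP[+ _] => /(le_trans rsp).
    by rewrite leNgt fr.
  apply/idP/idP => [rt|st]; last exact: le_trans st.
  rewrite beE// ltnNge; apply/negP => bp.
  have : s (be i) <= s p by rewrite sle ?(beP i).1// ltnW.
  rewrite -(beP i).2 ge_min (leNgt T0) (slt _ pn) orbF => /(le_trans rt).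
  by rewrite leNgt spr.
have intE w : (\int[lebesgue_measure]_(r in `]0%R, T0])
    (\sum_j quad V (fun l => simple_value r l j w))%:E = (step_bracket V s C n w)%:E)%E.
  have := @integral_step _ s n (fun r => \sum_j quad V (fun l => simple_value r l j w))
    (fun p => \sum_j quad V (fun l => C p l j w)).
  rewrite s0 sn; apply => //.
  - move=> r; apply: sumr_ge0 => j _; exact: (noise_quad nz).
  - move=> p r pn h1 h2; apply: eq_bigr => j _; congr quad; apply/funext => l.
    exact: valE.
have mM t : 0 <= t -> measurable_fun setT (fun w => \sum_j simple_sum t j w ^+ 2).
  move=> t0; apply: measurable_sum => j; apply: measurable_funX.
  exact: measurable_simple_sum.
have mbr : measurable_fun setT (step_bracket V s C n).
  apply: measurable_sum => p; apply: measurable_funM => //.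
  apply: measurable_sum => j.
  exact: (known_measurable F_sigma (sge p) (known_quad V (a := fun l w => C p l j w) (fun l => kC p l j))).
have mE : measurable E.
  apply: measurableI; last first.
    under eq_set do rewrite intE lte_fin.
    by rewrite -[X in measurable X]setTI; exact: (measurable_fun_ltr mbr (measurable_cst _)).
  rewrite (_ : [set w | _] = \bigcup_(t in [set` ts])
      [set w | eta <= \sum_j simple_sum t j w ^+ 2]); last first.
    by apply/seteqP; split => w [t h1 h2]; exists t.
  apply: fin_bigcup_measurable; first exact: finite_seq.
  move=> t /= /tsT /andP[t0 _]; exact: measurable_ge_set (mM t t0).
split => //; apply: le_trans len.
have ksi := known_step_integral F_sigma F_mono nz sums0 sS kC.
have mst q : measurable_fun setT (fun w => \sum_j step_integral xi s C q j w ^+ 2).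
  apply: measurable_sum => j; apply: measurable_funX.
  exact: (known_measurable F_sigma (sge q) (ksi q j)).
apply: probability_le_ae => //.
  apply: measurableI.
    rewrite (_ : [set w | _] = \bigcup_(q in `I_n.+1)
        [set w | eta <= \sum_j step_integral xi s C q j w ^+ 2]).
      by apply: bigcup_measurable => q _; exact: measurable_ge_set.
    by apply/seteqP; split => [w [q qn h]|w [q qn h]]; exists q.
  by rewrite -[X in measurable X]setTI; exact: (measurable_fun_ltr mbr (measurable_cst _)).
apply: filterS agree => w h [[t tts ht]]; rewrite /= intE lte_fin => hb; split => //.
have [|q qn tq] := spts t; first by rewrite !mem_cat tts !orbT.
exists q => //; move: ht; rewrite tq.
rewrite (eq_bigr (fun j => step_integral xi s C q j w ^+ 2))// => j _.
by rewrite (h (Ordinal (qn : (q < n.+1)%N))).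
Qed.

End simple_integrals.

(** * Brownian and compensated Poisson increments as noises *)

Section independent_noise.
Context d (T : measurableType d) (R : realType) (P : probability T R)
  (F : R -> set (set T)).
Hypothesis F_sigma : forall t : R, 0 <= t -> sigma_algebra setT (F t) /\ F t `<=` measurable.
Context (L : finType) (xi : L -> R -> R -> T -> R) (V : L -> L -> R)
  (G : R -> R -> set (set T)).

(** Once the increments are independent of the past, every martingale property reduces to first and
    second moments. Independence is available for s < t, so empty increments are treated apart. *)
Lemma noise_of_independence :
  (forall a, 0 <= quad V a) ->
  (forall l s t, 0 <= s -> s <= t -> known F t (xi l s t)) ->
  (forall l s w, 0 <= s -> xi l s s w = 0) ->
  (forall l r s t, 0 <= r -> r <= s -> s <= t ->
    {ae P, forall w, xi l r t w = xi l r s w + xi l s t w}) ->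
  (forall s t, 0 <= s -> s < t -> independent P (F s) (G s t)) ->
  (forall s t l, 0 <= s -> s < t -> measurable_wrt (G s t) (xi l s t)) ->
  (forall s t l k, 0 <= s -> s < t ->
    measurable_wrt (G s t) (fun w => xi l s t w * xi k s t w)) ->
  (forall s t l, 0 <= s -> s < t -> [/\ intg P (fun w => xi l s t w ^+ 2),
     Ex P (xi l s t) = 0 & Ex P (fun w => xi l s t w ^+ 2) <= (t - s) * V l l]) ->
  (forall s t l k, 0 <= s -> s < t -> l != k ->
     Ex P (fun w => xi l s t w * xi k s t w) = (t - s) * V l k) ->
  noise P F xi V.
Proof.
move=> V0 kxi xi0 xiD ind mG mG2 sqr cov.
have xi0E l s : 0 <= s -> xi l s s = cst 0.
  by move=> s0; apply/funext => w; rewrite xi0.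
have mxi l s t : 0 <= s -> s <= t -> measurable_fun setT (xi l s t).
  by move=> s0 st; apply: known_measurable (le_trans s0 st) (kxi l s t s0 st).
have sqrI l s t : 0 <= s -> s <= t -> intg P (fun w => xi l s t w ^+ 2).
  move=> s0; rewrite le_eqVlt => /orP[/eqP <-|st]; last by have [] := sqr s t l s0 st.
  by rewrite xi0E//=; exact: intg_cst.
split => //.
- move=> l s t Z s0; rewrite le_eqVlt => /orP[/eqP <-|st] kZ iZ.
    rewrite xi0E//= (_ : (fun _ => _) = cst 0); last by apply/funext => w; rewrite mulr0.
    by split; [exact: intg_cst | exact: Ex_cst].
  have ixi := intg_sqr (mxi l s t s0 (ltW st)) (sqrI l s t s0 (ltW st)).
  have [i e] := independent_Ex (ind s t s0 st) (known_measurable_wrt F_sigma s0 kZ)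
    (mG s t l s0 st) iZ ixi.
  by split => //; rewrite e; have [_ -> _] := sqr s t l s0 st; rewrite mulr0.
- move=> s t a M s0; rewrite le_eqVlt => /orP[/eqP <-|st] ka aM.
    rewrite subrr mul0r (_ : (fun _ => _) = cst 0) ?Ex_cst//.
    by apply/funext => w; rewrite big1 ?expr0n// => l _; rewrite xi0 ?mulr0.
  have ma l : measurable_fun setT (a l) by exact: known_measurable s0 (ka l).
  have iaa l k : intg P (fun w => a l w * a k w).
    apply: (@intg_bounded _ _ _ _ _ (M * M)); first exact: measurable_funM.
    by move=> w; rewrite normrM ler_pM.
  have kaa l k : known F s (fun w => a l w * a k w).
    exact (@measurable_funM _ (at_time F s) R setT _ _ (ka l) (ka k)).
  have ixx l k : intg P (fun w => xi l s t w * xi k s t w).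
    by apply: intg_mul_sqr; [exact: mxi (ltW _)|exact: mxi (ltW _)|exact: sqrI (ltW _)|exact: sqrI (ltW _)].
  have h l k := independent_Ex (ind s t s0 st) (known_measurable_wrt F_sigma s0 (kaa l k))
    (mG2 s t l k s0 st) (iaa l k) (ixx l k).
  have -> : (fun w => (\sum_l a l w * xi l s t w) ^+ 2) = (fun w =>
     \sum_l \sum_k (a l w * a k w) * (xi l s t w * xi k s t w)).
    apply/funext => w; rewrite expr2 mulr_suml; apply: eq_bigr => l _.
    by rewrite mulr_sumr; apply: eq_bigr => k _; ring.
  rewrite Ex_sum; last by move=> l; apply: intg_sum => k; exact: (h l k).1.
  rewrite (_ : Ex P (fun w => quad _ _) = \sum_l \sum_k V l k * Ex P (fun w => a l w * a k w)); last first.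
    rewrite /quad Ex_sum; last by move=> l; apply: intg_sum => k; exact: intgZ.
    apply: eq_bigr => l _; rewrite Ex_sum; last by move=> k; exact: intgZ.
    by apply: eq_bigr => k _; rewrite ExZ.
  rewrite mulr_sumr; apply: ler_sum => l _.
  rewrite Ex_sum; last by move=> k; exact: (h l k).1.
  rewrite mulr_sumr; apply: ler_sum => k _; rewrite (h l k).2.
  case: (eqVneq l k) => [<-|lk]; last by rewrite cov// mulrC -mulrA.
  rewrite mulrA [leRHS]mulrC ler_wpM2l//.
    by apply: Ex_ge0 => w; rewrite -expr2 sqr_ge0.
  by have [_ _] := sqr s t l s0 st.
Qed.

End independent_noise.

Section brownian_noise.
Context (R : realType) (d : nat) disp (T : measurableType disp) (P : probability T R)
  (F : R -> set (set T)) (W : R -> T -> 'cV[R]_d).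
Hypothesis F_sigma : forall t : R, 0 <= t -> sigma_algebra setT (F t) /\ F t `<=` measurable.
Hypothesis F_mono : forall s t : R, 0 <= s -> s <= t -> F s `<=` F t.
Hypothesis bm : brownian_motion P F W.

Definition brownian_increment (l : 'I_d) (s t : R) (w : T) : R := (W t w - W s w) l ord0.

Lemma known_brownian l t : 0 <= t -> known F t (fun w => W t w l ord0).
Proof.
move=> t0; have := measurable_wrt_at_time (bm_adapted bm t0).
exact: measurable_entry.
Qed.

Lemma brownian_increment_normal l s t B : 0 <= s -> s < t -> measurable B ->
  P (brownian_increment l s t @^-1` B) = normal_prob 0 (Num.sqrt (t - s)) B.
Proof.
move=> s0 st mB.
have := bm_normal bm s0 st (B := fun i => if i == l then B else setT).
rewrite (bigD1 l)//= eqxx big1 ?mule1; last first.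
  by move=> i /negPf ->; rewrite probability_setT.
move=> <-; last by move=> i; case: ifP.
congr (P _); apply/seteqP; split => w.
  by move=> h i; case: eqP => // ->.
by move=> /(_ l); rewrite eqxx.
Qed.

(** Both the joint and the single probabilities are normal probabilities of rectangles whose
    remaining sides are the whole line. *)
Lemma brownian_independent_coordinates l k s t : 0 <= s -> s < t -> l != k ->
  independent P (preimage_set_system setT (brownian_increment l s t) measurable)
    (preimage_set_system setT (brownian_increment k s t) measurable).
Proof.
move=> s0 st lk _ _ [A mA <-] [B mB <-]; rewrite !setTI.
rewrite (brownian_increment_normal l s0 st mA) (brownian_increment_normal k s0 st mB).
have := bm_normal bm s0 st (B := fun i => if i == l then A else if i == k then B else setT).
have kl : (k == l) = false by rewrite eq_sym (negPf lk).
rewrite (bigD1 l)//= eqxx (bigD1 k) ?kl//= eqxx big1 ?mule1; last first.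
  by move=> i /andP[/negPf -> /negPf ->]; rewrite probability_setT.
move=> <-; last by move=> i; case: ifP => // _; case: ifP.
congr (P _); apply/seteqP; split => w /=.
  by move=> [h1 h2] i; case: eqP => [->//|_]; case: eqP => // ->.
by move=> h; have := h l; have := h k; rewrite !eqxx kl.
Qed.

Lemma brownian_noise : noise P F brownian_increment (fun l k => (l == k)%:R).
Proof.
have ki l s t : 0 <= s -> s <= t -> known F t (brownian_increment l s t).
  move=> s0 st; rewrite /brownian_increment; under eq_fun do rewrite !mxE.
  have k1 := known_brownian l (le_trans s0 st).
  have k2 := known_le F_sigma F_mono s0 st (known_brownian l s0).
  exact (@measurable_funB _ (at_time F t) R setT _ _ k1 k2).
have mi l s t : 0 <= s -> s <= t -> measurable_fun setT (brownian_increment l s t).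
  by move=> s0 st; exact: (known_measurable F_sigma (le_trans s0 st) (ki l s t s0 st)).
have wrt s t (g : 'cV[R]_d -> R) : continuous g ->
  measurable_wrt (preimage_set_system setT (fun w => W t w - W s w : borel 'cV[R]_d) measurable)
    (fun w => g (W t w - W s w)).
  move=> cg _ [B mB <-].
  have := @measurable_borel_real R d 1 _ (borel 'cV[R]_d) g id cg.
  move=> /(_ (@measurable_id _ _ _) measurableT B mB); rewrite setTI => h.
  by exists (g @^-1` B).
have sq l s t : 0 <= s -> s < t ->
    intg P (fun w => brownian_increment l s t w ^+ 2) /\
    Ex P (fun w => brownian_increment l s t w ^+ 2) <= t - s.
  move=> s0 st; have st' : 0 < Num.sqrt (t - s) by rewrite sqrtr_gt0 subr_gt0.
  have := gauss_sqr (mi l s t s0 (ltW st)) st' (fun B => @brownian_increment_normal l s t B s0 st).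
  by rewrite sqr_sqrtr// subr_ge0 ltW.
have mean l s t : 0 <= s -> s < t -> Ex P (brownian_increment l s t) = 0.
  move=> s0 st; have st' : 0 < Num.sqrt (t - s) by rewrite sqrtr_gt0 subr_gt0.
  exact: gauss_mean (mi l s t s0 (ltW st)) st' (fun B => @brownian_increment_normal l s t B s0 st).
apply: (@noise_of_independence _ _ _ _ _ F_sigma _ _ _
  (fun s t => preimage_set_system setT (fun w => W t w - W s w : borel 'cV[R]_d) measurable)).
- move=> a; rewrite /quad; apply: sumr_ge0 => l _; rewrite (bigD1 l)//= eqxx mul1r big1 ?addr0.
    by rewrite -expr2 sqr_ge0.
  by move=> k; rewrite eq_sym => /negPf ->; rewrite mul0r.
- exact: ki.
- by move=> l s w s0; rewrite /brownian_increment subrr mxE.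
- by move=> l r s t _ _ _; apply: nearW => w; rewrite /brownian_increment !mxE; ring.
- exact: bm_independent bm.
- by move=> s t l _ _; apply: (wrt s t (fun x => x l ord0)); exact: continuous_entry.
- move=> s t l k _ _; apply: (wrt s t (fun x => x l ord0 * x k ord0)) => x.
  by apply: continuousM; apply: continuous_entry.
- move=> s t l s0 st; have [h1 h2] := sq l s t s0 st; split=> //; first exact: mean.
  by rewrite eqxx mulr1.
- move=> s t l k s0 st lk; rewrite (negPf lk) mulr0.
  have i j := intg_sqr (mi j s t s0 (ltW st)) (sq j s t s0 st).1.
  have [_ ->] := independent_Ex (brownian_independent_coordinates s0 st lk)
    (fun _ => id) (fun _ => id) (i l) (i k).
  by rewrite mean// mul0r.
Qed.

End brownian_noise.

Section poisson_noise.
Context (R : realType) disp (T : measurableType disp) (P : probability T R)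
  (F : R -> set (set T)) dispU (U : measurableType dispU)
  (nu : {sigma_finite_measure set U -> \bar R}) (N : R.-ker T ~> (R * U)%type).
Hypothesis F_sigma : forall t : R, 0 <= t -> sigma_algebra setT (F t) /\ F t `<=` measurable.
Hypothesis F_mono : forall s t : R, 0 <= s -> s <= t -> F s `<=` F t.
Hypothesis prm : poisson_random_measure P F nu N.

Let mN A : measurable A -> measurable_fun setT (fun w => N w A).
Proof. exact: measurable_kernel. Qed.

Let nonneg : set (R * U) := `[0, +oo[ `*` setT.
Let m_nonneg : measurable nonneg.
Proof. by apply: measurableX. Qed.

Lemma intensity_ge0 A : (0 <= intensity nu A)%E.
Proof. exact: measure_ge0. Qed.

Lemma intensityU A B : measurable A -> measurable B -> A `&` B = set0 ->
  intensity nu (A `|` B) = (intensity nu A + intensity nu B)%E.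
Proof.
move=> mA mB AB; rewrite /intensity setIUl measureU//; try exact: measurableI.
by rewrite setIACA AB set0I.
Qed.

Lemma intensity_le A B : measurable A -> measurable B -> A `<=` B ->
  (intensity nu A <= intensity nu B)%E.
Proof.
by move=> mA mB AB; apply: le_measure; rewrite ?inE; [exact: measurableI| exact: measurableI| exact: setSI].
Qed.

Lemma intensity_rectangle s t A : 0 <= s -> s <= t -> measurable A ->
  intensity nu (`]s, t] `*` A) = ((t - s)%:E * nu A)%E.
Proof.
move=> s0 st mA; rewrite /intensity -setXI setIT (_ : _ `&` _ = `]s, t]%classic); last first.
  apply/seteqP; split => r /=; rewrite !in_itv/= ?andbT; first by case.
  by move=> /andP[h1 h2]; rewrite h1 h2 (le_trans s0)// ltW.
rewrite product_measure1E//=; congr (_ * _)%E.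
rewrite lebesgue_measure_itv/= lte_fin; case: ltP => h; first by rewrite EFinB.
by have -> : t = s by [apply/eqP; rewrite eq_le h st]; rewrite subrr.
Qed.

Lemma poisson_count_nat A : measurable A -> (intensity nu A < +oo)%E ->
  {ae P, forall w, exists k : nat, N w A = (k%:R)%:E}.
Proof.
move=> mA fA; apply: (@poisson_ae_nat _ _ _ _ (fun w => N w A) (fine (intensity nu A))).
- exact: mN.
- by move=> k; exact: (prm_poisson prm).
Qed.

Lemma compensated_moments A : measurable A -> (intensity nu A < +oo)%E ->
  [/\ measurable_fun setT (compensated nu N A),
     intg P (fun w => compensated nu N A w ^+ 2),
     Ex P (compensated nu N A) = 0
   & Ex P (fun w => compensated nu N A w ^+ 2) = fine (intensity nu A)].
Proof.
move=> mA fA; apply: (@poisson_compensated _ _ _ _ (fun w => N w A) (fine (intensity nu A))).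
- exact: mN.
- by rewrite fine_ge0// intensity_ge0.
- by move=> k; exact: (prm_poisson prm).
- by move=> w; exact: measure_ge0.
Qed.

(** Only an almost sure identity: counts are extended real numbers, and [fine] is additive where
    they are finite. *)
Lemma compensatedU A B : measurable A -> measurable B -> A `&` B = set0 ->
  (intensity nu A < +oo)%E -> (intensity nu B < +oo)%E ->
  {ae P, forall w, compensated nu N (A `|` B) w = compensated nu N A w + compensated nu N B w}.
Proof.
move=> mA mB AB fA fB.
apply: filterS2 (poisson_count_nat mA fA) (poisson_count_nat mB fB) => w [i iE] [j jE].
have fA' : intensity nu A \is a fin_num by rewrite ge0_fin_numE// intensity_ge0.
have fB' : intensity nu B \is a fin_num by rewrite ge0_fin_numE// intensity_ge0.
have NE : N w (A `|` B) = ((i + j)%:R)%:E by rewrite natrD EFinD -iE -jE measureU.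
by rewrite /compensated intensityU// NE iE jE (fineD fA' fB')/= natrD; ring.
Qed.

Lemma compensated_orthogonal A B : measurable A -> measurable B -> A `&` B = set0 ->
  (intensity nu A < +oo)%E -> (intensity nu B < +oo)%E ->
  Ex P (fun w => compensated nu N A w * compensated nu N B w) = 0.
Proof.
move=> mA mB AB fA fB.
have [mcA iA eA _] := compensated_moments mA fA.
have [mcB iB eB _] := compensated_moments mB fB.
have ind : independent P (preimage_set_system setT (compensated nu N A) measurable)
    (preimage_set_system setT (compensated nu N B) measurable).
  move=> _ _ [C mC <-] [D mD <-]; rewrite !setTI.
  pose AA (i : 'I_2) := if i == ord0 then A else B.
  pose g E (y : \bar R) : R := fine y - fine (intensity nu E).
  have mg E : measurable_fun setT (g E).
    by apply: measurable_funB => //; exact: measurable_cst.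
  pose BB (i : 'I_2) := if i == ord0 then g A @^-1` C else g B @^-1` D.
  have := prm_independent prm (A := AA) _ _ (B := BB).
  rewrite big_ord_recl big_ord1 /AA /BB/= => <-.
  - congr (P _); apply/seteqP; split => w.
      by move=> [h1 h2] i; case: eqP.
    by move=> h; have := h ord0; have := h (lift ord0 ord0).
  - by move=> i; case: ifP.
  - move=> i j _ _ [w]; case: (unliftP ord0 i) => [i'|] ->; case: (unliftP ord0 j) => [j'|] -> //=;
      rewrite ?(ord1 i') ?(ord1 j')//=; rewrite ?eqxx/= => -[h1 h2].
      by have : (A `&` B) w by []; rewrite AB.
    by have : (A `&` B) w by []; rewrite AB.
  - move=> i; case: ifP => _; rewrite -[X in measurable X]setTI; exact: mg.
have [_ ->] := independent_Ex ind (fun _ => id) (fun _ => id) (intg_sqr mcA iA) (intg_sqr mcB iB).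
by rewrite eA mul0r.
Qed.

Lemma Ex_orthogonal (a b c : T -> R) :
  measurable_fun setT a -> measurable_fun setT b -> measurable_fun setT c ->
  intg P (fun w => a w ^+ 2) -> intg P (fun w => b w ^+ 2) -> intg P (fun w => c w ^+ 2) ->
  Ex P (fun w => a w * b w) = 0 -> Ex P (fun w => a w * c w) = 0 -> Ex P (fun w => b w * c w) = 0 ->
  Ex P (fun w => (a w + b w) * (a w + c w)) = Ex P (fun w => a w ^+ 2).
Proof.
move=> ma mb mc ia ib ic ab ac bc.
have iab := intg_mul_sqr ma mb ia ib; have iac := intg_mul_sqr ma mc ia ic.
have ibc := intg_mul_sqr mb mc ib ic.
rewrite (_ : (fun w => _) = (fun w => a w ^+ 2 + (a w * c w + (a w * b w + b w * c w)))); last first.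
  by apply/funext => w; ring.
rewrite (ExD ia (intgD iac (intgD iab ibc))) (ExD iac (intgD iab ibc)) (ExD iab ibc) ab ac bc.
by rewrite !addr0.
Qed.

(** Split A and B into their intersection and the two differences. Compensated counts of disjoint
    sets are independent and centred, so only the square of the common part survives. *)
Lemma compensated_covariance A B : measurable A -> measurable B ->
  (intensity nu A < +oo)%E -> (intensity nu B < +oo)%E ->
  Ex P (fun w => compensated nu N A w * compensated nu N B w) =
  fine (intensity nu (A `&` B)).
Proof.
move=> mA mB fA fB.
have mI := measurableI _ _ mA mB; have mD := measurableD mA mB; have mD' := measurableD mB mA.
have fI : (intensity nu (A `&` B) < +oo)%E by apply: le_lt_trans fA; exact: intensity_le.
have fD : (intensity nu (A `\` B) < +oo)%E by apply: le_lt_trans fA; exact: intensity_le.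
have fD' : (intensity nu (B `\` A) < +oo)%E by apply: le_lt_trans fB; exact: intensity_le.
have [mcI iI _ eI] := compensated_moments mI fI.
have [mcD iD _ _] := compensated_moments mD fD.
have [mcD' iD' _ _] := compensated_moments mD' fD'.
have [mcA iA _ _] := compensated_moments mA fA.
have [mcB iB _ _] := compensated_moments mB fB.
have o1 : (A `&` B) `&` (A `\` B) = set0 by apply/seteqP; split => // w [[_ ?] [_]].
have o2 : (A `&` B) `&` (B `\` A) = set0 by apply/seteqP; split => // w [[? _] [_]].
have o3 : (A `\` B) `&` (B `\` A) = set0 by apply/seteqP; split => // w [[? _] [_]].
have eA : (A `&` B) `|` (A `\` B) = A by rewrite setUIDK.
have eB : (A `&` B) `|` (B `\` A) = B by rewrite [A `&` B]setIC setUIDK.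
have := compensatedU mI mD' o2 fI fD'; have := compensatedU mI mD o1 fI fD.
rewrite eA eB => e1 e2.
pose Z w := (compensated nu N (A `&` B) w + compensated nu N (A `\` B) w) *
  (compensated nu N (A `&` B) w + compensated nu N (B `\` A) w).
have mZ : measurable_fun setT Z := measurable_funM (measurable_funD mcI mcD) (measurable_funD mcI mcD').
have eZ : {ae P, forall w, compensated nu N A w * compensated nu N B w = Z w}.
  by apply: filterS2 e1 e2 => w -> ->.
have [_ <-] := Ex_ae (measurable_funM mcA mcB) mZ eZ (intg_mul_sqr mcA mcB iA iB).
by rewrite (Ex_orthogonal mcI mcD mcD' iI iD iD') ?eI// compensated_orthogonal.
Qed.

Context (L : finType) (A : L -> set U).
Hypothesis mA : forall l, measurable (A l).
Hypothesis fA : forall l, (nu (A l) < +oo)%E.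

Definition poisson_increment (l : L) (s t : R) : T -> R :=
  compensated nu N (`]s, t] `*` A l).

Definition overlap (l k : L) : R := fine (nu (A l `&` A k)).

Lemma fin_overlap l k : (nu (A l `&` A k) < +oo)%E.
Proof.
apply: le_lt_trans (fA l); apply: le_measure; rewrite ?inE//; exact: measurableI.
Qed.

(** Expand the square. The sets may overlap, which is what the off-diagonal entries of [overlap]
    record; the family used later for the jump integral mixes two unrelated collections of mark
    sets. *)
Lemma quad_overlap (a : L -> R) :
  (\int[nu]_u ((\sum_(l | u \in A l) a l) ^+ 2)%:E = (quad overlap a)%:E)%E.
Proof.
have int1 l k : nu.-integrable setT (fun u => (\1_(A l `&` A k) u)%:E).
  apply/integrableP; split; first by apply/measurable_EFinP; apply: measurable_indic; exact: measurableI.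
  under eq_integral do rewrite gee0_abs ?lee_fin//.
  by rewrite integral_indic ?setIT ?fin_overlap//; exact: measurableI.
have iI l k : nu.-integrable setT (fun u => ((a l * a k) * \1_(A l `&` A k) u)%:E).
  under eq_fun do rewrite EFinM; exact: integrableZl.
rewrite (eq_integral (fun u => \sum_l \sum_k ((a l * a k) * \1_(A l `&` A k) u)%:E)%E); last first.
  move=> u _; rewrite expr2 big_mkcond/= mulr_suml -sumEFin; apply: eq_bigr => l _.
  rewrite mulr_sumr -sumEFin; apply: eq_bigr => k _; congr EFin.
  rewrite indicE in_setI; case: (u \in A l); case: (u \in A k); rewrite /= ?mulr1 ?mul0r ?mulr0//.
rewrite integral_sum//; last by move=> l; apply: integrable_sum => // k _; exact: iI.
rewrite /quad -sumEFin; apply: eq_bigr => l _.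
rewrite integral_sum// -sumEFin; apply: eq_bigr => k _.
under eq_integral do rewrite EFinM.
rewrite integralZl//.
rewrite integral_indic ?setIT//; last exact: measurableI.
by rewrite [X in _ = X%:E]mulrC [RHS]EFinM /overlap fineK// ge0_fin_numE// fin_overlap.
Qed.

Lemma poisson_noise : noise P F poisson_increment overlap.
Proof.
have mR s t l : measurable (`]s, t] `*` A l : set (R * U)) by exact: measurableX.
have fR s t l : 0 <= s -> s <= t -> (intensity nu (`]s, t] `*` A l) < +oo)%E.
  move=> s0 st; rewrite intensity_rectangle// lte_mul_pinfty// ?lee_fin ?subr_ge0//.
(* All counts after time s: the increments over ]s, t] are among them, and this family is
   independent of the past at s. *)
pose G (s t : R) := generated [set A : set (R * U) | measurable A /\ A `<=` `]s, +oo[ `*` setT]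
                 (fun A w => N w A).
have wrtG s t l : measurable_fun setT (poisson_increment l s t : g_sigma_algebraType (G s t) -> R).
  apply: measurable_funB; last exact: measurable_cst.
  apply: measurableT_comp => //.
  move=> _ B mB; apply: sub_sigma_algebra; apply: sub_sigma_algebra.
  exists (`]s, t] `*` A l); last by exists B.
  split; first exact: mR.
  by move=> [r u] [/= + _]; rewrite !in_itv/= andbT => /andP[].
have toG s t (Y : T -> R) : measurable_fun setT (Y : g_sigma_algebraType (G s t) -> R) ->
    measurable_wrt (G s t) Y.
  move=> mY _ [B mB <-]; have := mY measurableT B mB.
  by rewrite /measurable/= sigma_algebra_id//; exact: smallest_sigma_algebra.
apply: (@noise_of_independence _ _ _ _ _ F_sigma _ _ _ G).
- move=> a; rewrite -lee_fin -quad_overlap; apply: integral_ge0 => u _.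
  by rewrite lee_fin sqr_ge0.
- move=> l s t s0 st; rewrite /known /poisson_increment /compensated.
  have := measurable_wrt_at_time (prm_adapted prm (le_trans s0 st) (mR s t l) _).
  move=> h; apply: measurable_funB; last exact: measurable_cst.
  apply: measurableT_comp => //; apply: h.
  move=> [r u] [/= + _]; rewrite !in_itv/= => /andP[h1 h2].
  by split => //=; apply/andP; split; rewrite ?bnd_simp ?h2// (le_trans s0)// ltW.
- move=> l s w s0; rewrite /poisson_increment /compensated set_itvoc0 set0X measure0.
  by rewrite /intensity set0I measure0/= subrr.
- move=> l r s t r0 rs st; rewrite /poisson_increment.
  have -> : `]r, t] `*` A l = (`]r, s] `*` A l) `|` (`]s, t] `*` A l).
    apply/seteqP; split => -[x u]; rewrite /= !in_itv/=.
      by move=> [/andP[h1 h2] uA]; have [h|h] := leP x s; [left|right]; rewrite ?h1 ?h2.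
    move=> [[/andP[h1 h2] uA]|[/andP[h1 h2] uA]]; rewrite ?h1 ?h2 ?andbT/=; split => //.
      exact: le_trans st.
    exact: le_lt_trans h1.
  apply: compensatedU.
  + exact: mR.
  + exact: mR.
  + apply/seteqP; split => // -[x u] [[/= + _] [/= + _]]; rewrite !in_itv/= => /andP[_ h1] /andP[h2 _].
    by have := le_lt_trans h1 h2; rewrite ltxx.
  + exact: fR.
  + by apply: fR => //; exact: le_trans rs.
- by move=> s t s0 st; exact: (prm_future prm).
- by move=> s t l s0 st; apply: toG; exact: wrtG.
- by move=> s t l k s0 st; apply: toG; apply: measurable_funM; exact: wrtG.
- move=> s t l s0 st; have [_ h1 h2 h3] := compensated_moments (mR s t l) (fR s t l s0 (ltW st)).
  split => //; rewrite h3 (intensity_rectangle s0 (ltW st) (mA l)) /overlap setIid fineM//.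
  by rewrite ge0_fin_numE.
- move=> s t l k s0 st _; rewrite /poisson_increment compensated_covariance//; try exact: fR (ltW _).
  rewrite -setXI setIid (intensity_rectangle s0 (ltW st)); last exact: measurableI.
  by rewrite fineM// ge0_fin_numE// fin_overlap.
Qed.

End poisson_noise.

Lemma probability_bigcup_seq d (T : measurableType d) (R : realType) (P : probability T R)
    (I : choiceType) (s : seq I) (B : I -> set T) : (forall i, i \in s -> measurable (B i)) ->
  (P (\bigcup_(i in [set` s]) B i) <= \sum_(i <- s) P (B i))%E.
Proof.
rewrite bigcup_seq; elim: s => [|t s ih] mB; first by rewrite !big_nil measure0.
have ms u : u \in s -> measurable (B u) by move=> us; apply: mB; rewrite inE us orbT.
rewrite !big_cons; apply: (le_trans (measureU2 _ _ _)).
- exact: mB (mem_head _ _).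
- by rewrite big_seq; apply: bigsetU_measurable.
- by apply: leeD => //; exact: ih.
Qed.

(** * Lenglart's inequality for limits of simple integrals *)

Section simple_limits.
Context d (T : measurableType d) (R : realType) (P : probability T R)
  (F : R -> set (set T)).
Hypothesis F_sigma : forall t : R, 0 <= t -> sigma_algebra setT (F t) /\ F t `<=` measurable.
Hypothesis F_mono : forall s t : R, 0 <= s -> s <= t -> F s `<=` F t.
Context (L : nat -> finType) (xi : forall n, L n -> R -> R -> T -> R)
  (V : forall n, L n -> L n -> R).
Hypothesis nz : forall n, noise P F (@xi n) (@V n).
Context (D : finType) (I : nat -> finType) (from to : forall n, I n -> R)
  (coef : forall n, I n -> L n -> D -> T -> R).
Hypothesis from_ge0 : forall n (i : I n), 0 <= from i.
Hypothesis from_to : forall n (i : I n), from i <= to i.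
Hypothesis coef_known : forall n (i : I n) (l : L n) j, known F (from i) (coef i l j).
Hypothesis coef_bounded : forall n, exists B, forall (i : I n) (l : L n) j w, `|coef i l j w| <= B.
Variables (M : R -> D -> T -> R) (p : nat -> T -> \bar R) (q : T -> \bar R) (tau : R).

Let Sn n t j w := simple_sum (@xi n) (@from n) (@to n) (@coef n) t j w.

(** A stochastic integral is known only through simple integrals converging to it in probability at
    each fixed time; finitely many times can be handled at once. The factor 16 is 4 times 4: if
    |M|^2 >= eta and |S - M|^2 < eta / 4 then |S|^2 >= eta / 4, and the bracket of S is below 2c +
    2c. The noise is allowed to vary with n because each simple integrand brings its own mark
    sets. *)
Lemma simple_limit_lenglart (ts : seq R) (A : set T) (eta c : R) : 0 <= tau ->
  (forall t, t \in ts -> 0 <= t <= tau) ->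
  (forall t j, 0 <= t -> measurable_fun setT (M t j)) ->
  (forall n, measurable_fun setT (p n)) -> measurable_fun setT q -> measurable A ->
  (forall n w, A w -> (\int[lebesgue_measure]_(r in `]0%R, tau])
       (\sum_j quad (@V n) (fun l => simple_value (@from n) (@to n) (@coef n) r l j w))%:E <=
     2%:E * p n w + 2%:E * q w)%E) ->
  (forall e : R, 0 < e -> P [set w | (e%:E <= p n w)%E] @[n --> \oo] --> 0%E) ->
  (forall t e : R, t \in ts -> 0 < e -> P [set w | e <= \sum_j (Sn n t j w - M t j w) ^+ 2]
     @[n --> \oo] --> 0%E) ->
  0 < eta -> 0 < c ->
  let E := A `&` [set w | exists2 t, t \in ts & eta <= \sum_j M t j w ^+ 2] `&`
    [set w | (q w < c%:E)%E] in
  measurable E /\ (P E <= (16 * c / eta)%:E)%E.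
Proof.
move=> tau0 tsT mM mp mq mA qle pcvg Scvg eta0 c0 E.
have mMs t : 0 <= t -> measurable_fun setT (fun w => \sum_j M t j w ^+ 2).
  by move=> t0; apply: measurable_sum => j; apply: measurable_funX; exact: mM.
have mE : measurable E.
  apply: measurableI; first apply: measurableI => //.
    rewrite (_ : [set w | _] = \bigcup_(t in [set` ts]) [set w | eta <= \sum_j M t j w ^+ 2]).
      apply: fin_bigcup_measurable; first exact: finite_seq.
      by move=> t /= /tsT /andP[t0 _]; exact: measurable_ge_set (mMs t t0).
    by apply/seteqP; split => w [t h1 h2]; exists t.
  rewrite -[X in measurable X]setTI; exact: emeasurable_fun_infty_o.
split => //.
pose err n t w := \sum_j (Sn n t j w - M t j w) ^+ 2.
have mSn n t j : 0 <= t -> measurable_fun setT (Sn n t j).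
  move=> t0; exact: (measurable_simple_sum F_sigma (nz n) (@from_ge0 n) (@from_to n) (@coef_known n) j t0).
have merr n t : 0 <= t -> measurable_fun setT (err n t).
  move=> t0; apply: measurable_sum => j; apply: measurable_funX; apply: measurable_funB.
    exact: mSn.
  exact: mM.
pose B1 n t := [set w | eta / 4 <= err n t w].
pose B2 n := [set w | (c%:E <= p n w)%E].
have mB1 n t : t \in ts -> measurable (B1 n t).
  by move=> /tsT/andP[t0 _]; exact: measurable_ge_set (merr n t t0).
have mB2 n : measurable (B2 n).
  by rewrite -[X in measurable X]setTI; exact: emeasurable_fun_c_infty.
have bound n : (P E <= \sum_(t <- ts) P (B1 n t) + P (B2 n) + (16 * c / eta)%:E)%E.
  have [B HB] := coef_bounded n.
  have eta4 : 0 < eta / 4 by rewrite divr_gt0.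
  have c4 : 0 <= 4 * c by rewrite mulr_ge0// ltW.
  have := simple_lenglart F_sigma F_mono (nz n) (@from_ge0 n) (@from_to n) (@coef_known n) HB
    tau0 tsT eta4 c4.
  set X := (_ `&` _) => -[mX PX].
  have mU : measurable (\bigcup_(t in [set` ts]) B1 n t).
    by apply: fin_bigcup_measurable; [exact: finite_seq | move=> t /= /mB1].
  have PU : (P (\bigcup_(t in [set` ts]) B1 n t) <= \sum_(t <- ts) P (B1 n t))%E.
    by apply: probability_bigcup_seq => t /mB1.
  have sub : E `<=` (\bigcup_(t in [set` ts]) B1 n t `|` B2 n) `|` X.
    move=> w [[Aw [t tts Mt]] /= qc].
    have [h1|h1] := leP (eta / 4) (err n t w); first by left; left; exists t.
    have [h2|h2] := leP c%:E (p n w); first by left; right.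
    right; split.
      exists t => //.
      have : \sum_j M t j w ^+ 2 <= \sum_j (2 * (Sn n t j w - M t j w) ^+ 2 + 2 * Sn n t j w ^+ 2).
        apply: ler_sum => j _; have := sqr_ge0 (2 * Sn n t j w - M t j w); nra.
      rewrite big_split/= -!mulr_sumr -/(err n t w) -/(Sn n t); move: Mt h1.
      rewrite /Sn; lra.
    rewrite /=; apply: (le_lt_trans (qle n w Aw)).
    rewrite (_ : (4 * c)%:E = 2%:E * c%:E + 2%:E * c%:E)%E; last first.
      by rewrite -!EFinM -EFinD; congr EFin; ring.
    by apply: lteD; rewrite lte_pmul2l.
  apply: (@le_trans _ _ (P ((\bigcup_(t in [set` ts]) B1 n t `|` B2 n) `|` X))).
    by apply: le_measure; rewrite ?inE//; do 2 apply: measurableU => //.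
  apply: (le_trans (measureU2 _ _ _)) => //; first exact: measurableU.
  apply: leeD; last first.
    by rewrite (le_trans PX)// lee_fin (_ : 4 * c / (eta / 4) = 16 * c / eta)//; field; rewrite gt_eqF.
  apply: (le_trans (measureU2 _ _ _)) => //; exact: leeD.
have lim0 : (\sum_(t <- ts) P (B1 n t) + P (B2 n) + (16 * c / eta)%:E)%E @[n --> \oo] -->
    (0 + 0 + (16 * c / eta)%:E)%E.
  apply: cvgeD => //; last exact: cvg_cst.
  apply: cvgeD => //; last exact: pcvg.
  have : {subset ts <= ts} by [].
  elim: {-2}ts => [|t s ih] sts.
    by under eq_fun do rewrite big_nil; exact: cvg_cst.
  have h1 := Scvg t (eta / 4) (sts t (mem_head _ _)) (divr_gt0 eta0 (ltr0Sn _ 3)).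
  have h2 : {subset s <= ts} by move=> u us; apply: sts; rewrite inE us orbT.
  under eq_fun do rewrite big_cons.
  have := cvgeD _ h1 (ih h2); rewrite adde0; exact.
rewrite !add0e in lim0; rewrite -(cvg_lim _ lim0)//; apply: lime_ge.
  by apply/cvg_ex; eexists; exact: lim0.
by apply: nearW.
Qed.

End simple_limits.

(** * Riemann sums along cadlag paths *)

Section cadlag_paths.
Context (R : realType) (d : nat) (x : R -> 'cV[R]_d).
Hypothesis cx : cadlag x.

Lemma cadlag_right t e : 0 <= t -> 0 < e ->
  exists2 r, 0 < r & forall s, t < s -> s < t + r -> enorm (x s - x t) < e.
Proof.
move=> t0 e0; have /cvg_enormP/(_ e e0)[r /= r0 h] := cx.1 t t0.
exists r => // s ts str; rewrite -enormN opprB; apply: h => //=.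
by rewrite ltr_norml; apply/andP; split; lra.
Qed.

Lemma cadlag_left t e : 0 < t -> 0 < e ->
  exists2 r, 0 < r & forall s, s < t -> t - r < s -> enorm (x s - left_limit x t) < e.
Proof.
move=> t0 e0; have /cvg_enormP/(_ e e0)[r /= r0 h] := cx.2 t t0.
exists r => // s ts str; rewrite -enormN opprB; apply: h => //=.
by rewrite ltr_norml; apply/andP; split; lra.
Qed.

(** Around each time the path is controlled by its left limit and its value, to which it is right
    continuous; compactness of the segment, in the form of near coverings with a parameter tending
    to infinity, makes one bound work everywhere. *)
Lemma cadlag_bounded tau : exists M, forall t, 0 <= t -> t <= tau -> enorm (x t) <= M.
Proof.
have /compact_near_coveringP := @segment_compact R 0 tau.
move=> /(_ _ (pinfty_nbhs R) (fun K t => 0 <= t -> enorm (x t) <= K) _) h.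
have [t|M [_ /(_ (M + 1))]] := h.
  rewrite /= in_itv/= => /andP[t0 _].
  have [r r0 hr] := cadlag_right t0 ltr01.
  have [r' r'0 [K hK]] : exists2 r' : R, 0 < r' & exists K, forall s, s < t -> t - r' < s -> 0 <= s ->
      enorm (x s) <= K.
    move: t0; rewrite le_eqVlt => /orP[/eqP <-|t0].
      by exists 1 => //; exists 0 => s s0 _ /(lt_le_trans s0); rewrite ltxx.
    have [r' r'0 hr'] := cadlag_left t0 ltr01; exists r' => //.
    exists (enorm (left_limit x t) + 1) => s st rs _.
    have := ler_enormD (x s - left_limit x t) (left_limit x t); rewrite subrK.
    by have := hr' s st rs; lra.
  exists ([set s | `|t - s| < Num.min r r'], [set M | Num.max K (enorm (x t) + 1) <= M]) => /=.
    split; first by exists (Num.min r r'); rewrite /= ?lt_min ?r0.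
    exists (Num.max K (enorm (x t) + 1)); split; first exact: num_real.
    by move=> y /ltW.
  move=> [s M] /= [+ +] s0; rewrite lt_min !ltr_norml ge_max => /andP[/andP[h1 h2] /andP[h3 h4]].
  move=> /andP[KM xM]; have [st|st|->] := ltgtP s t.
  - by apply: le_trans KM; apply: hK => //; lra.
  - apply: le_trans xM; have := ler_enormD (x s - x t) (x t); rewrite subrK.
    by have := hr s st; lra.
  - by apply: le_trans xM; rewrite lerDl.
move=> hM; exists (M + 1) => t t0 tt; apply: hM => //=; first by rewrite ltrDl.
by rewrite in_itv/= t0.
Qed.

Lemma left_limit_bounded K t : 0 < t ->
  (forall s, 0 <= s -> s < t -> enorm (x s) <= K) -> enorm (left_limit x t) <= K.
Proof.
move=> t0 h; apply/ler_addgt0Pr => e e0; have [r r0 hr] := cadlag_left t0 e0.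
pose s := Num.max (t / 2) (t - r / 2).
have st : s < t by rewrite gt_max; apply/andP; split; lra.
have rs : t - r < s by rewrite lt_max; apply/orP; right; lra.
have s0 : 0 <= s by rewrite le_max; apply/orP; left; lra.
have := ler_enormD (left_limit x t - x s) (x s); rewrite subrK (enormB (left_limit x t)).
by have := hr s st rs; have := h s s0 st; lra.
Qed.

(** A jump in some coordinate, up to sign, passes above a rational level: on a rational interval
    around t the coordinate stays below the level before t and above it from t on. These rational
    data determine t, so the jump times inject into a countable set. *)
Lemma cadlag_countable_jumps : countable [set t | 0 < t /\ left_limit x t <> x t].
Proof.
pose key : Type := ('I_d * bool * rat * rat * rat)%type.
(* The sign turns a downward jump into an upward one. *)
pose y (b : bool) s i := (-1) ^+ b * x s i (ord0 : 'I_1).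
pose Q (k : key) t := let: (i, b, q, p, p') := k in
  [/\ ratr p < t, t < ratr p', forall s, ratr p <= s -> s < t -> y b s i < ratr q &
      forall s, t <= s -> s < ratr p' -> ratr q < y b s i].
have ex t : exists k : option key, 0 < t /\ left_limit x t <> x t -> exists2 k0, k = Some k0 & Q k0 t.
  have [[t0 lx]|h] := pselect (0 < t /\ left_limit x t <> x t); last by exists None.
  have [i [b lti]] : exists i (b : bool), (-1) ^+ b * left_limit x t i ord0 < y b t i.
    apply: contrapT => h; apply: lx; apply/matrixP => i j; rewrite ord1.
    apply/eqP; rewrite eq_le; apply/andP; split; rewrite leNgt; apply/negP => lt.
      by apply: h; exists i, true; rewrite /y expr1 !mulN1r ltrN2.
    by apply: h; exists i, false; rewrite /y expr0 !mul1r.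
  have [q] := rat_in_itvoo lti; rewrite in_itv/= => /andP[lq qx].
  have close s z (e : R) : enorm (x s - z) < e -> `|y b s i - (-1) ^+ b * z i ord0| < e.
    apply: le_lt_trans; rewrite /y -mulrBr normrM normrX normrN1 expr1n mul1r.
    by have := ler_entry_enorm (x s - z) i ord0; rewrite !mxE.
  have lq0 : 0 < ratr q - (-1) ^+ b * left_limit x t i ord0 by rewrite subr_gt0.
  have qx0 : 0 < y b t i - ratr q by rewrite subr_gt0.
  have [r r0 hr] := cadlag_left t0 lq0; have [r' r'0 hr'] := cadlag_right (ltW t0) qx0.
  have tr : t - r < t by lra.
  have tr' : t < t + r' by lra.
  have [p] := rat_in_itvoo tr; rewrite in_itv/= => /andP[pr pt].
  have [p'] := rat_in_itvoo tr'; rewrite in_itv/= => /andP[tp p'r].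
  exists (Some (i, b, q, p, p')) => _; exists (i, b, q, p, p') => //; split => // s h1 h2.
    have := close _ _ _ (hr s h2 (lt_le_trans pr h1)); rewrite ltr_norml => /andP[_]; lra.
  move: h1; rewrite le_eqVlt => /orP[/eqP <-//|ts].
  have := close _ _ _ (hr' s ts (lt_trans h2 p'r)); rewrite ltr_norml -/(y b t i) => /andP[+ _].
  by rewrite /y; lra.
have [f fP] := choice ex.
apply/countable_injP; exists (pickle \o f) => s t.
rewrite !inE/= => As At /(pcan_inj pickleK) fst.
have [k fsk Qs] := fP s As; have [k' ftk Qt] := fP t At.
move: Qt; have -> : k' = k by move: fst; rewrite fsk ftk => -[].
case: k Qs {fsk ftk k'} => [[[[i b] q] p] p'] [a1 a2 a3 a4] [b1 b2 b3 b4].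
apply/eqP; rewrite eq_le; apply/andP; split; rewrite leNgt; apply/negP => st.
  have := a3 t (ltW b1) st; have := b4 t (lexx t) b2; lra.
have := b3 s (ltW a1) st; have := a4 s (lexx s) a2; lra.
Qed.

End cadlag_paths.

Section cadlag_process.
Context (R : realType) (D : nat) d (T : measurableType d) (P : probability T R)
  (X : R -> T -> 'cV[R]_D) (tau : R).
Hypothesis tau0 : 0 < tau.

Definition grid m j : R := j%:R * (tau / m.+1%:R).

Definition left_step m r w : 'cV[R]_D :=
  \sum_(j < m.+1 | grid m j < r <= grid m j.+1) X (grid m j) w.

Definition right_step m r w : 'cV[R]_D :=
  \sum_(j < m.+1 | grid m j < r <= grid m j.+1) X (grid m j.+1) w.

(** Zero outside ]0, tau], as the step processes are, so that these converge at every point. *)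
Definition left_value r w : 'cV[R]_D :=
  if 0 < r <= tau then left_limit (X ^~ w) r else 0.

Definition value r w : 'cV[R]_D := if 0 < r <= tau then X r w else 0.

Let mesh_gt0 m : 0 < tau / m.+1%:R :> R.
Proof. by rewrite divr_gt0. Qed.

Lemma gridS m j : grid m j.+1 = grid m j + tau / m.+1%:R.
Proof. by rewrite /grid -natr1 mulrDl mul1r. Qed.

Lemma grid_ge0 m j : 0 <= grid m j.
Proof. by rewrite mulr_ge0// ltW. Qed.

Lemma grid_last m : grid m m.+1 = tau.
Proof. by rewrite /grid mulrCA divff ?mulr1. Qed.

Lemma ler_grid m i j : (grid m i <= grid m j) = (i <= j)%N.
Proof. by rewrite /grid ler_pM2r// ler_nat. Qed.

Lemma grid_le_tau m j : (j <= m.+1)%N -> grid m j <= tau.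
Proof. by move=> jm; rewrite -(grid_last m) ler_grid. Qed.

Lemma grid_cell m r : 0 < r -> r <= tau ->
  exists j : 'I_m.+1, forall k : 'I_m.+1, (grid m k < r <= grid m k.+1) = (k == j).
Proof.
move=> r0 rt; have ex : exists n, r <= grid m n by exists m.+1; rewrite grid_last.
case: (ex_minnP ex) => -[|n] rn nmin.
  by move: rn; rewrite /grid mul0r leNgt r0.
have nm : (n < m.+1)%N by apply: nmin; rewrite grid_last.
have gn : grid m n < r by rewrite ltNge; apply/negP => /nmin; rewrite ltnn.
exists (Ordinal nm) => k; apply/andP/eqP => [[kr rk]|->//].
apply/val_inj/eqP; rewrite /= eqn_leq -[(n <= k)%N]ltnS (nmin _ rk) andbT -ltnS.
by rewrite ltnNge -(ler_grid m) -ltNge (lt_le_trans kr).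
Qed.

Lemma stepE m r : 0 < r -> r <= tau -> exists j : 'I_m.+1,
  [/\ grid m j < r, r <= grid m j.+1, forall w, left_step m r w = X (grid m j) w &
      forall w, right_step m r w = X (grid m j.+1) w].
Proof.
move=> r0 rt; have [j jP] := grid_cell m r0 rt.
have /andP[h1 h2] : grid m j < r <= grid m j.+1 by rewrite jP.
by exists j; split => // w; exact: (big_pred1 j).
Qed.

Lemma step_out m r w : ~~ (0 < r <= tau) -> left_step m r w = 0 /\ right_step m r w = 0.
Proof.
move=> h; split; apply: big_pred0 => j; apply/negbTE; apply: contra h => /andP[h1 h2];
  rewrite (le_lt_trans (grid_ge0 m j) h1)/= (le_trans h2)// grid_le_tau// ltn_ord.
Qed.

Lemma left_step_grid m (j : 'I_m.+1) r w : grid m j < r -> r <= grid m j.+1 ->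
  left_step m r w = X (grid m j) w.
Proof.
move=> h1 h2; have r0 : 0 < r by exact: le_lt_trans (grid_ge0 m j) h1.
have rt : r <= tau by rewrite (le_trans h2)// grid_le_tau.
have [i iP] := grid_cell m r0 rt; rewrite [left_step _ _ _](big_pred1 i)//.
by have := iP j; rewrite h1 h2 => /esym/eqP ->.
Qed.

Lemma mesh_small e : 0 < e -> \forall m \near \oo, tau / m.+1%:R < e.
Proof.
move=> e0; have et0 : 0 < e / tau by rewrite divr_gt0.
have := near_infty_natSinv_lt (PosNum et0); apply: filterS => m /= h.
by rewrite mulrC -ltr_pdivlMr.
Qed.

Hypothesis X_cadlag : forall w, cadlag (X ^~ w).

(** The left end of the cell containing r lies strictly before r, hence the left limit; the right
    end, in [right_step_cvg], is at or after r, hence the value. *)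
Lemma left_step_cvg r w : left_step m r w @[m --> \oo] --> left_value r w.
Proof.
rewrite /left_value; case: ifPn => [/andP[r0 rt]|h]; last first.
  by under eq_fun do rewrite (step_out _ _ h).1; exact: cvg_cst.
apply/cvg_enormP => e e0; have [rad rad0 hr] := cadlag_left (X_cadlag w) r0 e0.
apply: filterS (mesh_small rad0) => m hm.
have [j [h1 h2 -> _]] := stepE m r0 rt; rewrite enormB; apply: hr => //.
by move: h2 hm; rewrite gridS; set q := tau / _; lra.
Qed.

Lemma right_step_cvg r w : right_step m r w @[m --> \oo] --> value r w.
Proof.
rewrite /value; case: ifPn => [/andP[r0 rt]|h]; last first.
  by under eq_fun do rewrite (step_out _ _ h).2; exact: cvg_cst.
apply/cvg_enormP => e e0; have [rad rad0 hr] := cadlag_right (X_cadlag w) (ltW r0) e0.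
apply: filterS (mesh_small rad0) => m hm.
have [j [h1 h2 _ ->]] := stepE m r0 rt; rewrite enormB.
move: h2; rewrite le_eqVlt => /orP[/eqP <-|h2]; first by rewrite subrr enorm0.
by apply: hr => //; move: h1 hm; rewrite gridS; set q := tau / _; lra.
Qed.

Hypothesis mX : forall t, 0 <= t -> measurable_fun setT (X t : T -> borel 'cV[R]_D).

Lemma measurable_step_sum (m : nat) (s : nat -> R) : (forall j, 0 <= s j) ->
  measurable_fun setT (fun p : R * T =>
    \sum_(j < m.+1 | grid m j < p.1 <= grid m j.+1) X (s j) p.2 : borel 'cV[R]_D).
Proof.
move=> s0; apply: measurable_entries => i k.
rewrite (_ : (fun _ => _) = (fun p : R * T => \sum_(j < m.+1)
    \1_(`]grid m j, grid m j.+1]%classic) p.1 * X (s j) p.2 i k)); last first.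
  apply/funext => p; rewrite big_mkcond summxE; apply: eq_bigr => j _.
  rewrite indicE mem_setE in_itv/=; case: ifP => _; rewrite ?mul1r//.
  by rewrite mul0r mxE.
apply: measurable_sum => j; apply: measurable_funM.
  by apply: measurableT_comp => //; exact: measurable_indic.
by apply: (measurableT_comp (measurable_entry i k (mX (s0 j)))).
Qed.

Lemma measurable_left_step m :
  measurable_fun setT (fun p : R * T => left_step m p.1 p.2 : borel 'cV[R]_D).
Proof. by apply: measurable_step_sum => j; exact: grid_ge0. Qed.

(** Joint measurability in time and chance, obtained for a pointwise limit of step processes. The
    time integrals below are random variables because of it. *)
Lemma measurable_left_value :
  measurable_fun setT (fun p : R * T => left_value p.1 p.2 : borel 'cV[R]_D).
Proof.
apply: measurable_entries => i k.
apply: (measurable_fun_cvg (h := fun m p => left_step m p.1 p.2 i k)) => [m|p _].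
  exact: measurable_entry (measurable_left_step m).
by apply: cvg_entry; exact: left_step_cvg.
Qed.

Lemma measurable_value :
  measurable_fun setT (fun p : R * T => value p.1 p.2 : borel 'cV[R]_D).
Proof.
apply: measurable_entries => i k.
apply: (measurable_fun_cvg (h := fun m p => right_step m p.1 p.2 i k)) => [m|p _].
  apply: measurable_entry.
  by apply: (@measurable_step_sum m (fun j => grid m j.+1)) => j; exact: grid_ge0.
by apply: cvg_entry; exact: right_step_cvg.
Qed.

(** The two processes differ at jump times only, and these are countable. *)
Lemma left_value_ae w : {ae (@lebesgue_measure R), forall r, left_value r w = value r w}.
Proof.
exists [set t | 0 < t /\ left_limit (X ^~ w) t <> X t w].
have cnt := cadlag_countable_jumps (X_cadlag w); split.
- exact: countable_measurable.
- exact: countable_lebesgue_measure0.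
- move=> r /=; rewrite /left_value /value; case: ifP => //= /andP[r0 _] h.
  by split => // e; apply: h; rewrite e.
Qed.

Definition ball_event (K : R) : set T :=
  [set w | forall s, 0 <= s -> s <= tau -> enorm (X s w) <= K].

(** Right continuity lets a countable set of times decide. The times are rational multiples of
    [tau], so that the end [tau] itself, where nothing to the right is available, belongs to
    them. *)
Lemma ball_eventE K : ball_event K =
  \bigcap_(q in [set q : rat | 0 <= ratr q * tau <= tau]) [set w | enorm (X (ratr q * tau) w) <= K].
Proof.
apply/seteqP; split => w h; first by move=> q /= /andP[q0 qt]; exact: h.
move=> s s0 st; rewrite leNgt; apply/negP => sK.
move: st; rewrite le_eqVlt => /orP[/eqP st|st].
  have := h 1%Q; rewrite /= rmorph1 mul1r (ltW tau0) lexx => /(_ isT).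
  by rewrite -st leNgt sK.
have e0 : 0 < enorm (X s w) - K by rewrite subr_gt0.
have [r r0 hr] := cadlag_right (X_cadlag w) s0 e0.
have : s / tau < Num.min (s + r) tau / tau.
  by rewrite ltr_pM2r ?invr_gt0// lt_min st andbT ltrDl.
move=> /rat_in_itvoo[q]; rewrite in_itv/= ltr_pdivrMr// ltr_pdivlMr// lt_min => /andP[h1 /andP[h2 h3]].
have := h q; rewrite /= (ltW h3) (ltW (le_lt_trans s0 h1)) => /(_ isT).
have := hr _ h1 h2; have := ler_enormD (X s w - X (ratr q * tau) w) (X (ratr q * tau) w).
by rewrite subrK (enormB (X s w)); lra.
Qed.

Lemma measurable_ball_event K : measurable (ball_event K).
Proof.
rewrite ball_eventE; rewrite -[X in measurable X]setCK setC_bigcap; apply: measurableC.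
rewrite bigcup_mkcond; apply: bigcupT_measurable_rat => q.
case: ifPn; last by move=> _; exact: measurable0.
rewrite inE/= => /andP[q0 _]; apply: measurableC.
have := measurable_borel_real (@continuous_enorm R D 1) (mX q0) => mn.
rewrite -[X in measurable X]setTI; exact: measurable_fun_ler.
Qed.

(** Every path is bounded on the segment, so the complementary events for integer radii decrease to
    the empty set. *)
Lemma ball_event_large (e : R) : 0 < e -> exists2 K, 0 < K & (P (~` ball_event K) <= e%:E)%E.
Proof.
move=> e0.
have h : P (~` ball_event n%:R) @[n --> \oo] --> P (\bigcap_n (~` ball_event n%:R)).
  apply: nonincreasing_cvg_mu.
  - by rewrite (le_lt_trans (probability_le1 _ _)) ?ltry//; apply: measurableC; exact: measurable_ball_event.
  - by move=> n; apply: measurableC; exact: measurable_ball_event.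
  - by apply: bigcapT_measurable => n; apply: measurableC; exact: measurable_ball_event.
  - move=> m n mn; apply/subsetPset; apply: subsetC => w h s s0 st.
    by rewrite (le_trans (h s s0 st))// ler_nat.
have E : \bigcap_n (~` ball_event n%:R) = set0 :> set T.
  apply/seteqP; split => // w hw.
  have [M hM] := cadlag_bounded (X_cadlag w) tau.
  apply: (hw (Num.Def.truncn M).+1 I) => s s0 st; rewrite (le_trans (hM s s0 st))// ltW//.
  exact: truncnS_gt.
rewrite E measure0 in h.
have /fine_cvgP[_ /cvgrPdist_lt/(_ _ e0)[n _ hn]] := h.
exists n.+1%:R => //; have := hn n.+1 (leqnSn n).
rewrite sub0r normrN /= => lt.
rewrite -[leLHS]fineK ?lee_fin; first by rewrite ltW// (le_lt_trans (ler_norm _)).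
by rewrite fin_num_measure//; apply: measurableC; exact: measurable_ball_event.
Qed.

End cadlag_process.

Lemma bounded_convergence0 d (T : measurableType d) (R : realType)
    (mu : {measure set T -> \bar R}) (D : set T) (f : nat -> T -> R) (C : R) :
  measurable D -> (mu D < +oo)%E -> (forall n, measurable_fun D (f n)) ->
  (forall n x, D x -> 0 <= f n x <= C) -> (forall x, D x -> f n x @[n --> \oo] --> 0) ->
  (\int[mu]_(x in D) (f n x)%:E)%E @[n --> \oo] --> 0%E.
Proof.
move=> mD fD mf fC f0.
have [] := @dominated_convergence _ _ _ mu D mD (fun n x => (f n x)%:E) (cst 0%E) (cst C%:E).
- by move=> n; apply/measurable_EFinP.
- exact: measurable_cst.
- by apply: nearW => x Dx; apply: cvg_EFin; [exact: nearW | exact: f0].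
- apply/integrableP; split; first exact: measurable_cst.
  rewrite (eq_integral (cst `|C%:E|%E))// integral_cst//=.
  by rewrite lte_mul_pinfty.
- apply: nearW => x n Dx; have /andP[h1 h2] := fC n x Dx.
  by rewrite abse_EFin lee_fin ger0_norm.
by move=> _ _; rewrite integral0.
Qed.

Section time_integral.
Context (R : realType) d (T : measurableType d) (tau : R).

Lemma measurable_section (g : R * T -> R) w : measurable_fun setT g ->
  measurable_fun setT (fun r => g (r, w)).
Proof. by move=> mg; apply: (measurableT_comp mg); exact: measurable_pair2. Qed.

Lemma measurable_time_integral_ereal (g : R * T -> \bar R) : measurable_fun setT g ->
  (forall p, (0 <= g p)%E) ->
  measurable_fun setT (fun w => \int[lebesgue_measure]_(r in `]0%R, tau]) g (r, w))%E.
Proof.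
move=> mg g0.
pose f (p : R * T) := ((\1_(`]0, tau]%classic : set R) p.1)%:E * g p)%E.
have mf : measurable_fun setT f.
  apply: emeasurable_funM => //; apply/measurable_EFinP.
  by apply: measurableT_comp => //; exact: measurable_indic.
have := @measurable_fun_fubini_tonelli_G _ _ _ _ _ (@lebesgue_measure R) f mf.
rewrite /fubini_G; move=> /(_ _).
have f0 p : (0 <= f p)%E by rewrite mule_ge0// lee_fin.
move=> /(_ f0); congr measurable_fun; apply/funext => w.
rewrite [RHS]integral_mkcond; apply: eq_integral => r _.
by rewrite /f patchE indicE; case: ifP => _; rewrite ?mul1e ?mul0e.
Qed.

Lemma measurable_time_integral (g : R * T -> R) : measurable_fun setT g -> (forall p, 0 <= g p) ->
  measurable_fun setT (fun w => \int[lebesgue_measure]_(r in `]0%R, tau]) (g (r, w))%:E)%E.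
Proof.
move=> mg g0; apply: (measurable_time_integral_ereal (g := fun p => (g p)%:E)) => //.
exact/measurable_EFinP.
Qed.

End time_integral.

Section step_riemann.
Context (R : realType) (D : nat) d (T : measurableType d) (P : probability T R)
  (X : R -> T -> 'cV[R]_D) (tau : R).
Hypothesis tau0 : 0 < tau.
Hypothesis X_cadlag : forall w, cadlag (X ^~ w).
Hypothesis mX : forall t, 0 <= t -> measurable_fun setT (X t : T -> borel 'cV[R]_D).
Variables (psi : 'cV[R]_D -> 'cV[R]_D -> R).
Hypothesis mpsi : measurable_fun setT (fun p : borel 'cV[R]_D * borel 'cV[R]_D => psi p.1 p.2).
Hypothesis psi_ge0 : forall y z, 0 <= psi y z.

Definition step_error m w : \bar R :=
  (\int[lebesgue_measure]_(r in `]0%R, tau]) (psi (left_value X tau r w) (left_step X tau m r w))%:E)%E.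

Let mpsiX m : measurable_fun setT (fun p : R * T =>
  psi (left_value X tau p.1 p.2) (left_step X tau m p.1 p.2)).
Proof.
have m1 := measurable_left_value tau0 X_cadlag mX.
have m2 := measurable_left_step tau0 mX m.
exact: (measurableT_comp mpsi (measurable_fun_pair m1 m2)).
Qed.

Lemma measurable_step_error m : measurable_fun setT (step_error m).
Proof.
by apply: (measurable_time_integral tau (g := fun p => psi (left_value X tau p.1 p.2) (left_step X tau m p.1 p.2))).
Qed.

Variables (K C e : R).
Hypothesis e_ge0 : 0 <= e.
Hypothesis psi_le : forall y z, enorm y <= K -> enorm z <= K -> psi y z <= C.
Hypothesis psi_cont : forall y (eps : R), enorm y <= K -> 0 < eps -> exists2 r : R, 0 < r &
  forall z, enorm z <= K -> enorm (y - z) < r -> psi y z <= e + eps.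

(** The integrand is not assumed continuous, only bounded and at most e + eps when its second
    argument is close to the first, because the coefficients of a scheme are step functions. Its
    excess over e tends to 0 by bounded convergence, in time and then over the probability space,
    and Markov's inequality applies to any threshold above e tau. *)
Lemma step_error_cvg c : e * tau < c ->
  P (ball_event X tau K `&` [set w | (c%:E <= step_error m w)%E]) @[m --> \oo] --> 0%E.
Proof.
move=> ec; pose B := ball_event X tau K.
have mB : measurable B by exact: measurable_ball_event.
have C0 w : B w -> 0 <= C.
  move=> Bw; apply: le_trans (psi_ge0 (X 0 w) (X 0 w)) _.
  by apply: psi_le; apply: Bw => //; exact: ltW.
pose C' := Num.max C 0.
(* The indicator of the ball event makes the excess bounded; the positive part removes the error e
   that does not vanish with the mesh. *)
pose phi m (p : R * T) := \1_B p.2 * (\1_(`]0, tau]%classic : set R) p.1 *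
  Num.max (psi (left_value X tau p.1 p.2) (left_step X tau m p.1 p.2) - e) 0).
have phi0 m p : 0 <= phi m p by rewrite !mulr_ge0// le_max lexx orbT.
have bnd w r : B w -> 0 < r <= tau -> enorm (left_value X tau r w) <= K /\
    (forall m, enorm (left_step X tau m r w) <= K).
  move=> Bw /andP[r0 rt]; split.
    rewrite /left_value r0 rt/=; apply: (left_limit_bounded (X_cadlag w) r0) => s s0 sr.
    by apply: Bw => //; rewrite (le_trans (ltW sr)).
  move=> m; have [j [h1 h2 -> _]] := stepE X tau0 m r0 rt; apply: Bw; first exact: grid_ge0.
  by rewrite (le_trans (ltW h1)).
have phiC m p : phi m p <= C'.
  rewrite /phi !indicE; have [/set_mem pB|_] := boolP (p.2 \in B); last first.
    by rewrite mul0r le_max lexx orbT.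
  have [/set_mem pr|_] := boolP (p.1 \in _); last by rewrite mul0r mulr0 le_max lexx orbT.
  rewrite !mul1r ge_max !le_max lexx orbT andbT; apply/orP; left.
  move: pr; rewrite /= in_itv/= => /(bnd _ _ pB)[h1 h2].
  by rewrite lerBlDr (le_trans (psi_le h1 (h2 m)))// lerDl.
have mphi m : measurable_fun setT (phi m).
  apply: measurable_funM; first by apply: measurableT_comp => //; exact: measurable_indic.
  apply: measurable_funM; first by apply: measurableT_comp => //; exact: measurable_indic.
  apply: measurable_maxr; last exact: measurable_cst.
  by apply: measurable_funB => //; exact: measurable_cst.
pose A m w := (\int[lebesgue_measure]_(r in `]0%R, tau]) (phi m (r, w))%:E)%E.
have mA m : measurable_fun setT (A m) by exact: measurable_time_integral.
have leb : (lebesgue_measure (`]0%R, tau]%classic : set R) = tau%:E :> \bar R)%E.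
  by rewrite lebesgue_measure_itv/= lte_fin tau0 sube0.
have Ale m w : (A m w <= (C' * tau)%:E)%E.
  apply: (@le_trans _ _ (\int[lebesgue_measure]_(r in `]0%R, tau]) (cst C'%:E r))%E).
    apply: ge0_le_integral => //.
    - by move=> r _; rewrite lee_fin.
    - by apply/measurable_EFinP; apply: measurable_funTS; exact: measurable_section.
    - by move=> r _; rewrite lee_fin phiC.
  by rewrite integral_cst//= leb EFinM.
have A0 m w : (0 <= A m w)%E by apply: integral_ge0 => r _; rewrite lee_fin.
have Afin m w : A m w \is a fin_num.
  by rewrite ge0_fin_numE// (le_lt_trans (Ale m w)) ?ltry.
have phi_cvg w r : 0 < r -> r <= tau -> phi m (r, w) @[m --> \oo] --> 0.
  move=> r0 rt; have [Bw|nB] := boolP (w \in B); last first.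
    by rewrite /phi/= indicE (negPf nB); under eq_fun do rewrite mul0r; exact: cvg_cst.
  have [y_le z_le] := bnd w r (set_mem Bw) (introT andP (conj r0 rt)).
  apply/cvgrPdist_le => eps eps0; have [rad rad0 hr] := psi_cont y_le eps0.
  have lc : left_step X tau m r w @[m --> \oo] --> left_value X tau r w by exact: left_step_cvg.
  have /cvg_enormP/(_ rad rad0) := lc.
  apply: filterS => m hm; rewrite sub0r normrN ger0_norm ?phi0//.
  rewrite /phi/= indicE Bw indicE mem_setE in_itv/= r0 rt !mul1r ge_max (ltW eps0) andbT.
  by rewrite lerBlDl; exact: hr.
pose a m w := fine (A m w).
have aE m w : (a m w)%:E = A m w by rewrite fineK.
have ma m : measurable_fun setT (a m) by apply: measurableT_comp.
have a0 m w : 0 <= a m w by rewrite fine_ge0.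
have aC m w : a m w <= C' * tau by rewrite -lee_fin aE.
have acvg w : a m w @[m --> \oo] --> 0.
  have := @bounded_convergence0 _ _ _ (@lebesgue_measure R) (`]0%R, tau]%classic : set R)
    (fun m r => phi m (r, w)) C'.
  have fl : (lebesgue_measure (`]0%R, tau]%classic : set R) < +oo :> \bar R)%E by rewrite leb ltry.
  move=> /(_ (measurable_itv _) fl) h.
  apply: (fine_cvg (a := 0)); apply: h.
  - by move=> m; apply: measurable_funTS; exact: measurable_section.
  - by move=> m r _; rewrite phi0 phiC.
  - by move=> r /=; rewrite in_itv/= => /andP[r0 rt]; exact: phi_cvg.
have Pcvg : (\int[P]_w (a m w)%:E)%E @[m --> \oo] --> 0%E.
  apply: (@bounded_convergence0 _ _ _ P setT a (C' * tau)) => //.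
  - by rewrite (le_lt_trans (probability_le1 _ _)) ?ltry.
  - by move=> m w _; rewrite a0 aC.
have ia m : intg P (a m).
  apply: (@intg_bounded _ _ _ _ _ (C' * tau)) => // w; by rewrite ger0_norm.
have c'0 : 0 < c - e * tau by rewrite subr_gt0.
have c'i : (c - e * tau)^-1%:E \is a fin_num by [].
have Pcvg' := cvgeZr c'i Pcvg; rewrite mul0e in Pcvg'.
apply: (squeeze_cvge _ (cvg_cst 0%E) Pcvg'); apply: nearW => m; rewrite measure_ge0/=.
have := markov_Ex (ia m) (a0 m) c'0.
rewrite EFinM -(Ex_fin (ia m)); apply: le_trans.
have mS : measurable [set w | (c%:E <= step_error m w)%E].
  by rewrite -[X in measurable X]setTI; apply: emeasurable_fun_c_infty => //; exact: measurable_step_error.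
apply: le_measure; rewrite ?inE//.
- exact: measurableI.
- exact: measurable_ge_set.
move=> w [Bw /= hc]; rewrite lerBlDr -lee_fin; apply: (le_trans hc).
rewrite EFinD aE /step_error.
have -> : (e * tau)%:E = (\int[lebesgue_measure]_(r in `]0%R, tau]) (cst e%:E r))%E.
  by rewrite integral_cst//= leb EFinM.
rewrite -ge0_integralD//; last 2 first.
- by move=> r _; rewrite lee_fin.
- by apply/measurable_EFinP; apply: measurable_funTS; exact: measurable_section.
apply: ge0_le_integral => //.
- by move=> r _; rewrite lee_fin.
- apply/measurable_EFinP; apply: measurable_funTS.
  exact: (measurable_section w (mpsiX m)).
- apply: emeasurable_funD => //; apply/measurable_EFinP; apply: measurable_funTS; exact: measurable_section.
move=> r; rewrite /= in_itv/= => rt; rewrite -EFinD lee_fin.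
rewrite /phi/= indicE mem_set// indicE mem_setE in_itv/= rt !mul1r.
by rewrite -lerBlDr le_max lexx.
Qed.

End step_riemann.

Lemma bounded_integrable_itv (R : realType) (s t M : R) (f : R -> R) :
  measurable_fun `]s, t] f -> (forall r, s < r -> r <= t -> `|f r| <= M) ->
  (@lebesgue_measure R).-integrable `]s, t] (EFin \o f).
Proof.
move=> mf fM; apply: measurable_bounded_integrable => //.
  have : (lebesgue_measure (`]s, t]%classic : set R) < +oo :> \bar R)%E.
    by rewrite lebesgue_measure_itv/=; case: ifP => _; rewrite ?ltry.
  exact.
exists M; split; first exact: num_real.
move=> y My r; rewrite /= in_itv/= => /andP[sr rt].
by rewrite (le_trans (fM r sr rt))// ltW.
Qed.

Lemma riemann_sum_error (R : realType) (s : nat -> R) (n : nat) (f g : R -> R) (v : nat -> R) (M : R) :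
  (forall p, s p <= s p.+1) ->
  measurable_fun `]s 0%N, s n] f -> measurable_fun `]s 0%N, s n] g ->
  (forall r, s 0%N < r -> r <= s n -> `|f r| <= M) ->
  (forall p r, (p < n)%N -> s p < r -> r <= s p.+1 -> g r = v p) ->
  (`|\int[lebesgue_measure]_(r in `]s 0%N, s n]) f r - \sum_(p < n) (s p.+1 - s p) * v p|%:E <=
   \int[lebesgue_measure]_(r in `]s 0%N, s n]) `|f r - g r|%:E)%E.
Proof.
move=> sS mf mg fM gv.
have shomo a b : (a <= b)%N -> s a <= s b.
  by move=> ab; exact: (homo_leq lexx le_trans sS).
have cat q : `]s 0%N, s q.+1]%classic = `]s 0%N, s q]%classic `|` `]s q, s q.+1]%classic :> set R.
  apply/seteqP; split=> r /=; rewrite !in_itv/=.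
    by move=> /andP[h1 h2]; case: (leP r (s q)) => rb; [left | right]; apply/andP.
  case=> /andP[h1 h2]; apply/andP; split => //; first exact: le_trans (sS q).
  exact: le_lt_trans (shomo _ _ (leq0n q)) h1.
have sub q q' : (q <= q')%N -> (q' <= n)%N -> `]s q, s q']%classic `<=` (`]s 0%N, s n]%classic : set R).
  move=> qq qn r /=; rewrite !in_itv/= => /andP[h1 h2]; apply/andP; split.
    exact: le_lt_trans (shomo _ _ (leq0n q)) h1.
  exact: le_trans (shomo _ _ qn).
have mfg : measurable_fun (`]s 0%N, s n]%classic : set R) (fun r => `|f r - g r|).
  by apply: measurableT_comp => //; exact: measurable_funB.
have ifq q q' : (q <= q')%N -> (q' <= n)%N ->
    (@lebesgue_measure R).-integrable `]s q, s q'] (EFin \o f).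
  move=> qq qn; apply: (bounded_integrable_itv (M := M)).
    by apply: measurable_funS mf => //; exact: sub.
  by move=> r h1 h2; apply: fM; have := sub q q' qq qn r; rewrite /= !in_itv/= h1 h2 => /(_ isT) /andP[].
suff: forall q, (q <= n)%N ->
  (`|\int[lebesgue_measure]_(r in `]s 0%N, s q]) f r - \sum_(p < q) (s p.+1 - s p) * v p|%:E <=
   \int[lebesgue_measure]_(r in `]s 0%N, s q]) `|f r - g r|%:E)%E by apply.
elim=> [_|q ih qn].
  by rewrite set_itvoc0 Rintegral_set0 integral_set0 big_ord0 subrr normr0.
have cell : (`|\int[lebesgue_measure]_(r in `]s q, s q.+1]) f r - (s q.+1 - s q) * v q|%:E <=
   \int[lebesgue_measure]_(r in `]s q, s q.+1]) `|f r - g r|%:E)%E.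
  have icst : (@lebesgue_measure R).-integrable `]s q, s q.+1] (EFin \o cst (v q)).
    by apply: (bounded_integrable_itv (M := `|v q|)) => //; exact: measurable_cst.
  have -> : (s q.+1 - s q) * v q = \int[lebesgue_measure]_(r in `]s q, s q.+1]) cst (v q) r.
    rewrite Rintegral_cst//= lebesgue_measure_itv/= lte_fin mulrC.
    case: ltP => h; first by rewrite -EFinB.
    have -> : s q.+1 = s q by apply/eqP; rewrite eq_le h sS.
    by rewrite subrr.
  rewrite -RintegralB//; last exact: ifq.
  have iB : (@lebesgue_measure R).-integrable `]s q, s q.+1] (EFin \o (fun r => f r - cst (v q) r)).
    under [X in _.-integrable _ X]eq_fun do rewrite /= EFinB.
    by apply: integrableB => //; exact: ifq.
  rewrite EFin_normr_Rintegral//; apply: le_trans (le_abse_integral _ _ _) _ => //.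
    by case/integrableP: iB.
  rewrite le_eqVlt; apply/orP; left; apply/eqP; apply: eq_integral => r.
  by rewrite inE/= in_itv/= => /andP[h1 h2]; rewrite (gv q).
have dis : [disjoint `]s 0%N, s q]%classic & `]s q, s q.+1]%classic : set R].
  apply/disj_setPS => r [] /=; rewrite !in_itv/= => /andP[_ h1] /andP[h2 _].
  by have := le_lt_trans h1 h2; rewrite ltxx.
rewrite cat Rintegral_setU//; last by rewrite -cat; exact: ifq.
rewrite ge0_integral_setU//; last first.
  by rewrite -cat; apply/measurable_EFinP; apply: measurable_funS mfg => //; exact: sub.
rewrite big_ord_recr/=.
apply: le_trans (leeD (ih (ltnW qn)) cell); rewrite -EFinD lee_fin.
by rewrite opprD addrACA ler_normD.
Qed.

(** * Schemes and their shadows *)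

(** The coefficients see the state through a measurable natural-number index: they take countably
    many values, with one bound for all, and composing them with a measurable path needs
    measurability of the index alone. Finitely many disjoint mark sets of finite measure make the
    jumps a finite family of Poisson counts. *)
Record scheme (R : realType) (D : nat) (dispU : measure_display)
    (U : measurableType dispU) (nu : {sigma_finite_measure set U -> \bar R}) := Scheme {
  sch_index : 'cV[R]_D -> nat ;
  sch_drift : nat -> 'cV[R]_D ;
  sch_diffusion : nat -> 'M[R]_D ;
  sch_mark : finType ;
  sch_set : sch_mark -> set U ;
  sch_jump : nat -> sch_mark -> 'cV[R]_D ;
  sch_bound : R ;
  measurable_sch_index : measurable_fun setT (sch_index : borel 'cV[R]_D -> nat) ;
  measurable_sch_set : forall j, measurable (sch_set j) ;
  fin_sch_set : forall j, (nu (sch_set j) < +oo)%E ;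
  trivIset_sch_set : trivIset setT sch_set ;
  sch_drift_le : forall i, enorm (sch_drift i) <= sch_bound ;
  sch_diffusion_le : forall i, enorm (sch_diffusion i) <= sch_bound ;
  sch_jump_le : forall i j, enorm (sch_jump i j) <= sch_bound }.

Section scheme_theory.
Context (R : realType) (D : nat) (dispU : measure_display)
  (U : measurableType dispU) (nu : {sigma_finite_measure set U -> \bar R}).
Context (b : 'cV[R]_D -> 'cV[R]_D) (sigma : 'cV[R]_D -> 'M[R]_D)
  (c : 'cV[R]_D -> U -> 'cV[R]_D).

Definition jump_function (S : scheme D nu) i u : 'cV[R]_D :=
  \sum_(j | u \in sch_set (s := S) j) sch_jump i j.

Definition fine_scheme (K delta : R) (S : scheme D nu) : Prop :=
  forall x, enorm x <= K ->
    [/\ enorm (sch_drift S (sch_index S x) - b x) <= delta,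
        enorm (sch_diffusion S (sch_index S x) - sigma x) <= delta &
        (\int[nu]_u (enorm (jump_function S (sch_index S x) u - c x u) ^+ 2)%:E
           <= (delta ^+ 2)%:E)%E].

Variable S : scheme D nu.

Lemma measurable_sch_comp d' (E : measurableType d') (g : nat -> E) :
  measurable_fun setT (fun y : borel 'cV[R]_D => g (sch_index S y)).
Proof.
by apply: (measurableT_comp (f := g) _ (measurable_sch_index S)).
Qed.

Lemma measurable_jump_function i :
  measurable_fun setT (jump_function S i : U -> borel 'cV[R]_D).
Proof.
apply: measurable_entries => k l.
rewrite (_ : (fun _ => _) = (fun u => \sum_j \1_(sch_set (s := S) j) u * sch_jump (s := S) i j k l)).
  apply: measurable_sum => j; apply: measurable_funM => //.
  by apply: measurable_indic; exact: measurable_sch_set.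
apply/funext => u; rewrite /jump_function summxE big_mkcond; apply: eq_bigr => j _.
by rewrite indicE; case: ifP; rewrite ?mul1r ?mul0r.
Qed.

Lemma jump_function_in i j u : sch_set (s := S) j u -> jump_function S i u = sch_jump i j.
Proof.
move=> uj; rewrite /jump_function (big_pred1 j)// => k; apply/idP/eqP => [|->]; last exact/mem_set.
move=> /set_mem uk; apply: (trivIset_sch_set (s := S)) => //; by exists u.
Qed.

Lemma jump_function_out i u : (forall j, ~ sch_set (s := S) j u) -> jump_function S i u = 0.
Proof.
by move=> h; rewrite /jump_function big_pred0// => j; apply/negbTE/negP => /set_mem /h.
Qed.

Definition increment (T : Type) (W : R -> T -> 'cV[R]_D) (Nc : sch_mark S -> R -> R -> T -> R)
    (i : nat) (s t : R) (w : T) : 'cV[R]_D :=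
  (t - s) *: sch_drift S i + sch_diffusion S i *m (W t w - W s w) +
  \sum_j Nc j s t w *: sch_jump i j.

End scheme_theory.

Section solution.
Context (R : realType) (D : nat) d (T : measurableType d) (P : probability T R)
  (F : R -> set (set T)) (dispU : measure_display)
  (U : measurableType dispU) (nu : {sigma_finite_measure set U -> \bar R})
  (b : 'cV[R]_D -> 'cV[R]_D) (sigma : 'cV[R]_D -> 'M[R]_D)
  (c : 'cV[R]_D -> U -> 'cV[R]_D) (x0 : 'cV[R]_D)
  (W : R -> T -> 'cV[R]_D) (N : R.-ker T ~> (R * U)%type) (X : R -> T -> 'cV[R]_D).
Hypothesis b_continuous : continuous b.
Hypothesis sol : solves_sde P F nu b sigma c x0 W N X.

Lemma solution_sigma (t : R) : 0 <= t -> sigma_algebra setT (F t) /\ F t `<=` measurable.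
Proof. by have [h _ _ _] := sde_filtration sol; exact: h. Qed.

Lemma solution_mono (s t : R) : 0 <= s -> s <= t -> F s `<=` F t.
Proof. by have [_ h _ _] := sde_filtration sol; exact: h. Qed.

Lemma solution_at_time t : 0 <= t ->
  measurable_fun setT (X t : at_time F t -> borel 'cV[R]_D).
Proof. by move=> t0; exact: measurable_wrt_at_time (sde_adapted sol t0). Qed.

Lemma solution_measurable t : 0 <= t -> measurable_fun setT (X t : T -> borel 'cV[R]_D).
Proof. by move=> t0; exact: (at_time_measurable solution_sigma t0 (solution_at_time t0)). Qed.

Context (tau : R) (S : scheme D nu).
Hypothesis tau0 : 0 < tau.

Let cad := sde_cadlag sol.

Definition drift_gap (y z : 'cV[R]_D) : R := enorm (b y - sch_drift S (sch_index S z)).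

Lemma measurable_drift_gap : measurable_fun setT
  (fun p : borel 'cV[R]_D * borel 'cV[R]_D => drift_gap p.1 p.2).
Proof.
apply: measurable_enormB.
  by apply: measurable_borel_comp => //; exact: measurable_fst.
exact: (measurableT_comp (measurable_sch_comp S (sch_drift S : nat -> borel _)) measurable_snd).
Qed.

(** The equation integrates b along X, while the step error compares left limits with values at left
    ends of cells; along X and along its left limits the integrands differ at the jump times only, a
    countable set. *)
Lemma drift_riemann_sum K m k w i : ball_event X tau K w -> (k <= m.+1)%N ->
  (`|\int[lebesgue_measure]_(r in `[0, grid tau m k]) (b (X r w) i ord0) -
    \sum_(j < k) (grid tau m j.+1 - grid tau m j) *
      sch_drift S (sch_index S (X (grid tau m j) w)) i ord0|%:E <=
   step_error X tau drift_gap m w)%E.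
Proof.
move=> Bw km; have [M M0 bM] := continuous_ball_bounded K b_continuous.
pose s := grid tau m.
have s0 : s 0%N = 0 by rewrite /s /grid mul0r.
have sS p : s p <= s p.+1 by rewrite ler_grid.
have sub : `]0, s k]%classic `<=` (`]0, tau]%classic : set R).
  move=> r /=; rewrite !in_itv/= => /andP[-> h]; rewrite (le_trans h)//.
  exact: grid_le_tau.
pose f r := b (left_value X tau r w) i ord0.
pose f1 r := b (value X tau r w) i ord0.
pose g r := sch_drift S (sch_index S (left_step X tau m r w)) i ord0.
have sec (h : R * T -> 'cV[R]_D) : measurable_fun setT (h : _ -> borel 'cV[R]_D) ->
    measurable_fun setT (fun r => h (r, w) : borel 'cV[R]_D).
  by move=> mh; apply: (measurableT_comp mh); exact: measurable_pair2.
have mgap : measurable_fun setT (fun r => drift_gap (left_value X tau r w) (left_step X tau m r w)).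
  have m1 := sec _ (measurable_left_value tau0 cad solution_measurable).
  have m2 := sec _ (measurable_left_step tau0 solution_measurable m).
  exact: (measurableT_comp measurable_drift_gap (measurable_fun_pair m1 m2)).
have mf : measurable_fun setT f.
  apply: measurable_entry; apply: measurable_borel_comp => //.
  exact: sec (measurable_left_value tau0 cad solution_measurable).
have mf1 : measurable_fun setT f1.
  apply: measurable_entry; apply: measurable_borel_comp => //.
  exact: sec (measurable_value tau0 cad solution_measurable).
have mg : measurable_fun setT g.
  apply: measurable_entry.
  apply: (measurableT_comp (measurable_sch_comp S (sch_drift S : nat -> borel _))).
  exact: sec (measurable_left_step tau0 solution_measurable m).
have fM r : s 0%N < r -> r <= s k -> `|f r| <= M.
  rewrite s0 => r0 rk; have /sub : `]0, s k]%classic r by rewrite /= in_itv/= r0.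
  rewrite /= in_itv/= => /andP[_ rt]; rewrite (le_trans (ler_entry_enorm _ _ _))// bM//.
  rewrite /left_value r0 rt; apply: (left_limit_bounded (cad w) r0) => q q0 qr.
  by apply: Bw => //; rewrite (le_trans (ltW qr)).
have f1M r : 0 < r -> r <= s k -> `|f1 r| <= M.
  move=> r0 rk; have /sub : `]0, s k]%classic r by rewrite /= in_itv/= r0.
  rewrite /= in_itv/= => /andP[_ rt]; rewrite (le_trans (ler_entry_enorm _ _ _))// bM//.
  by rewrite /value r0 rt; apply: Bw => //; exact: ltW.
have E1 : \int[lebesgue_measure]_(r in `[0, s k]) (b (X r w) i ord0) =
    \int[lebesgue_measure]_(r in `]0, s k]) f r.
  have eX : {in (`]0, s k]%classic : set R), (fun r => b (X r w) i ord0) =1 f1}.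
    by move=> r /set_mem/sub; rewrite /= in_itv/= => h; rewrite /f1 /value h.
  have mX1 : measurable_fun (`]0, s k]%classic : set R) (fun r => b (X r w) i ord0).
    apply: (eq_measurable_fun f1) => [r h|]; first by rewrite eX.
    exact: measurable_funTS.
  rewrite -Rintegral_itv_obnd_cbnd; last first.
    apply: (bounded_integrable_itv (M := M)) => // r r0 rk.
    have := f1M r r0 rk; rewrite -eX// inE/= in_itv/= r0; exact.
  transitivity (\int[lebesgue_measure]_(r in `]0, s k]) f1 r); first exact: eq_Rintegral.
  rewrite /Rintegral; congr fine; apply: ae_eq_integral => //.
  - by apply/measurable_EFinP; exact: measurable_funTS.
  - by apply/measurable_EFinP; exact: measurable_funTS.
  - have [A [mA A0 hA]] := left_value_ae tau cad w; exists A; split => // r h.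
    by apply: hA => /= e; apply: h => _; rewrite /f1 /f e.
rewrite E1; have := @riemann_sum_error R s k f g
  (fun j => sch_drift S (sch_index S (X (grid tau m j) w)) i ord0) M sS.
rewrite s0; move=> /(_ (measurable_funTS mf) (measurable_funTS mg)) h.
apply: (le_trans (h _ _)).
- by move=> r r0 rk; apply: fM; rewrite ?s0.
- by move=> p r pk h1 h2; rewrite /g (@left_step_grid _ _ _ _ X tau tau0 m (Ordinal (leq_trans pk km)) r w h1 h2).
apply: (@le_trans _ _ (\int[lebesgue_measure]_(r in `]0%R, s k])
   (drift_gap (left_value X tau r w) (left_step X tau m r w))%:E)%E).
  apply: ge0_le_integral => //.
  - by apply/measurable_EFinP; apply: measurable_funTS; apply: measurableT_comp => //; exact: measurable_funB.
  - apply/measurable_EFinP; apply: measurable_funTS.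
    exact: mgap.
  - move=> r _; rewrite lee_fin /f /g.
    by have := ler_entry_enorm (b (left_value X tau r w) - sch_drift S (sch_index S (left_step X tau m r w))) i ord0; rewrite !mxE.
apply: ge0_subset_integral => //.
- apply/measurable_EFinP; apply: measurable_funTS.
  exact: mgap.
- by move=> r _; rewrite lee_fin enorm_ge0.
Qed.

End solution.

Lemma cvg_probability_sqr d (T : measurableType d) (R : realType) (P : probability T R)
    (Y : nat -> T -> R) : (forall n w, 0 <= Y n w) ->
  cvg_probability_0 P (fun n w => (Y n w)%:E) -> forall e : R, 0 < e ->
  P [set w | e <= Y n w ^+ 2] @[n --> \oo] --> 0%E.
Proof.
move=> Y0 h e e0; have := h (Num.sqrt e); rewrite sqrtr_gt0 => /(_ e0).
rewrite (_ : (fun n => P [set w | e <= _]) = (fun n => P [set w | ((Num.sqrt e)%:E <= (Y n w)%:E)%E]))//.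
apply/funext => n; congr (P _); apply/funext => w /=; congr is_true.
by rewrite lee_fin -[X in X <= Y n w ^+ 2](sqr_sqrtr (ltW e0)) ler_sqr ?nnegrE ?sqrtr_ge0.
Qed.

Lemma sqr_enorm_col (R : realType) (D : nat) (v : 'cV[R]_D) :
  enorm v ^+ 2 = \sum_i v i ord0 ^+ 2.
Proof. by rewrite sqr_enormE; apply: eq_bigr => i _; rewrite big_ord1. Qed.

Lemma le_integral_split d (T : measurableType d) (R : realType) (mu : {measure set T -> \bar R})
    (A : set T) (f g h : T -> R) : measurable A -> measurable_fun A f ->
  measurable_fun A g -> measurable_fun A h -> (forall x, 0 <= f x) ->
  (forall x, 0 <= g x) -> (forall x, 0 <= h x) ->
  (forall x, A x -> f x <= 2 * g x + 2 * h x) ->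
  (\int[mu]_(x in A) (f x)%:E <= 2%:E * \int[mu]_(x in A) (g x)%:E +
    2%:E * \int[mu]_(x in A) (h x)%:E)%E.
Proof.
move=> mA mf mg mh f0 g0 h0 fgh.
rewrite -!ge0_integralZl//; try exact/measurable_EFinP; try (by move=> x _; rewrite lee_fin).
rewrite -ge0_integralD//; last 4 first.
- by move=> x _; rewrite -EFinM lee_fin mulr_ge0.
- by apply/measurable_EFinP; apply: measurable_funM => //; exact: measurable_cst.
- by move=> x _; rewrite -EFinM lee_fin mulr_ge0.
- by apply/measurable_EFinP; apply: measurable_funM => //; exact: measurable_cst.
apply: ge0_le_integral => //.
- by move=> x _; rewrite lee_fin.
- exact/measurable_EFinP.
- apply: emeasurable_funD; apply/measurable_EFinP; apply: measurable_funM => //; exact: measurable_cst.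
Qed.

(** * Diffusion part of the shadow *)

Section diffusion_part.
Context (R : realType) (D : nat) d (T : measurableType d) (P : probability T R)
  (F : R -> set (set T)) (dispU : measure_display)
  (U : measurableType dispU) (nu : {sigma_finite_measure set U -> \bar R})
  (b : 'cV[R]_D -> 'cV[R]_D) (sigma : 'cV[R]_D -> 'M[R]_D)
  (c : 'cV[R]_D -> U -> 'cV[R]_D) (x0 : 'cV[R]_D)
  (W : R -> T -> 'cV[R]_D) (N : R.-ker T ~> (R * U)%type) (X : R -> T -> 'cV[R]_D).
Hypothesis sigma_continuous : continuous sigma.
Hypothesis sol : solves_sde P F nu b sigma c x0 W N X.
Context (tau : R) (S : scheme D nu).
Hypothesis tau0 : 0 < tau.

Let cad := sde_cadlag sol.
Let F_sigma := solution_sigma sol.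
Let F_mono := solution_mono sol.
Let mX := solution_measurable sol.

Definition diffusion_gap (y z : 'cV[R]_D) : R :=
  enorm (sigma y - sch_diffusion S (sch_index S z)) ^+ 2.

Lemma measurable_diffusion_gap : measurable_fun setT
  (fun p : borel 'cV[R]_D * borel 'cV[R]_D => diffusion_gap p.1 p.2).
Proof.
apply: measurable_funX; apply: measurable_enormB.
  by apply: measurable_borel_comp => //; exact: measurable_fst.
exact: (measurableT_comp (measurable_sch_comp S (sch_diffusion S : nat -> borel _)) measurable_snd).
Qed.

Definition diffusion_sum m t w : 'cV[R]_D := \sum_(j < m.+1)
  sch_diffusion S (sch_index S (X (grid tau m j) w)) *m
    (W (Num.min (grid tau m j.+1) t) w - W (Num.min (grid tau m j) t) w).

Lemma measurable_brownian t : 0 <= t -> measurable_fun setT (W t : T -> borel 'cV[R]_D).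
Proof.
move=> t0; apply: (at_time_measurable F_sigma t0).
exact: measurable_wrt_at_time (bm_adapted (sde_brownian sol) t0).
Qed.

Lemma scheme_coef_at_time d' (E : measurableType d') (g : nat -> E) t : 0 <= t ->
  measurable_fun setT ((fun w => g (sch_index S (X t w))) : at_time F t -> E).
Proof.
by move=> t0; exact: (measurableT_comp (measurable_sch_comp S g) (solution_at_time sol t0)).
Qed.

Lemma measurable_diffusion_sum m t : 0 <= t ->
  measurable_fun setT (diffusion_sum m t : T -> borel 'cV[R]_D).
Proof.
move=> t0; apply: measurable_entries => i k; rewrite /diffusion_sum.
under eq_fun do rewrite summxE; apply: measurable_sum => j.
under eq_fun do rewrite mxE; apply: measurable_sum => l; apply: measurable_funM.
  have h := scheme_coef_at_time (fun n => sch_diffusion S n i l) (grid_ge0 tau0 m j).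
  exact: (at_time_measurable F_sigma (grid_ge0 tau0 m j) h).
under eq_fun do rewrite !mxE.
have mW s : 0 <= s -> measurable_fun setT (fun w => W s w l k).
  by move=> s0; exact: measurable_entry (measurable_brownian s0).
by apply: measurable_funB; apply: mW; rewrite le_min t0 grid_ge0.
Qed.

Lemma quad_brownian (a : 'I_D -> R) : quad (fun l k : 'I_D => (l == k)%:R) a = \sum_l a l ^+ 2.
Proof.
apply: eq_bigr => l _; rewrite (bigD1 l)//= eqxx mul1r big1 ?addr0//.
by move=> k; rewrite eq_sym => /negPf ->; rewrite mul0r.
Qed.

Section bound.
Variables (I : R -> T -> 'cV[R]_D) (m : nat).
Hypothesis ito : is_ito_integral P F W (fun t w => sigma (X t w)) I.

(** The difference between the Ito integral and the sum over the grid is a limit of simple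
    integrals: a simple integrand approximating sigma(X) minus the scheme coefficient frozen on each
    cell. Lenglart's inequality then bounds it, at all grid times together, through the time
    integral of the squared coefficient difference, which is the step error. *)
Lemma diffusion_sum_bound (eta cc : R) : 0 < eta -> 0 < cc ->
  let E := [set w | exists2 k, (k <= m.+1)%N &
      eta <= enorm (diffusion_sum m (grid tau m k) w - I (grid tau m k) w) ^+ 2] `&`
    [set w | (step_error X tau diffusion_gap m w < cc%:E)%E] in
  measurable E /\ (P E <= (16 * cc / eta)%:E)%E.
Proof.
move=> eta0 cc0; have [adI _ [Hn HnI]] := ito.
have mI t : 0 <= t -> measurable_fun setT (I t : T -> borel 'cV[R]_D).
  move=> t0; apply: (at_time_measurable F_sigma t0).
  exact: measurable_wrt_at_time (adI t t0).
(* One simple integrand for the difference: its intervals are those of the n-th approximation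
   together with the cells of the grid, the latter with the opposite sign. *)
pose In (n : nat) : finType := ('I_(si_size (Hn n)) + 'I_m.+1)%type.
pose from n (i : In n) : R := match i with inl i => si_from i | inr j => grid tau m j end.
pose to n (i : In n) : R := match i with inl i => si_to i | inr j => grid tau m j.+1 end.
pose coef n (i : In n) (l j : 'I_D) w : R := match i with
  | inl i => si_coef i w j l
  | inr k => - sch_diffusion S (sch_index S (X (grid tau m k) w)) j l end.
pose p n w := (\int[lebesgue_measure]_(r in `]0%R, tau])
  (enorm (si_val (Hn n) r w - sigma (left_value X tau r w)) ^+ 2)%:E)%E.
pose M t j w := (I t w - diffusion_sum m t w) j (ord0 : 'I_1).
have msi n : measurable_fun setT (fun q : R * T => si_val (Hn n) q.1 q.2 : borel 'M[R]_D).
  apply: measurable_entries => i k.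
  rewrite (_ : (fun _ => _) = (fun q : R * T => \sum_(j < si_size (Hn n))
    \1_(`]si_from j, si_to j]%classic : set R) q.1 * si_coef j q.2 i k)); last first.
    apply/funext => q; rewrite /si_val big_mkcond summxE; apply: eq_bigr => j _.
    by rewrite indicE mem_setE in_itv/=; case: ifP => _; rewrite ?mul1r// mul0r mxE.
  apply: measurable_sum => j; apply: measurable_funM.
    by apply: measurableT_comp => //; exact: measurable_indic.
  have mc : measurable_fun setT (si_coef j : T -> borel 'M[R]_D).
    apply: (at_time_measurable F_sigma (si_from_ge0 j)).
    exact: (measurable_wrt_at_time (@si_adapted _ _ _ _ _ _ j)).
  exact: (measurableT_comp (measurable_entry i k mc) measurable_snd).
have msl : measurable_fun setT (fun q : R * T => sigma (left_value X tau q.1 q.2) : borel 'M[R]_D).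
  by apply: measurable_borel_comp => //; exact: measurable_left_value.
have mgn n : measurable_fun setT (fun q : R * T =>
    enorm (si_val (Hn n) q.1 q.2 - sigma (left_value X tau q.1 q.2)) ^+ 2).
  by apply: measurable_funX; exact: measurable_enormB.
have mp n : measurable_fun setT (p n).
  exact: (measurable_time_integral tau (mgn n) (fun _ => sqr_ge0 _)).
have mq : measurable_fun setT (step_error X tau diffusion_gap m).
  exact: (measurable_step_error tau0 cad mX measurable_diffusion_gap (fun _ _ => sqr_ge0 _)).
pose ts := [seq grid tau m k | k <- iota 0 m.+2].
have from0 n (i : In n) : 0 <= from n i by case: i => [i|j]; [exact: si_from_ge0 | exact: grid_ge0].
have fromto n (i : In n) : from n i <= to n i.
  by case: i => [i|j]; [exact: si_from_to | rewrite ler_grid].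
have ck n (i : In n) l j : known F (from n i) (coef n i l j).
  case: i => [i|k].
    exact: (measurable_entry j l (measurable_wrt_at_time (@si_adapted _ _ _ _ _ _ i))).
  exact: (scheme_coef_at_time (fun n => - sch_diffusion S n j l) (grid_ge0 tau0 m k)).
have cb n : exists B, forall (i : In n) l j w, `|coef n i l j w| <= B.
  have [f fP] := choice (fun i => @si_bounded _ _ _ _ _ (Hn n) i).
  exists (\sum_i `|f i| + sch_bound S) => -[i|k] l j w.
    rewrite (le_trans (ler_entry_enorm _ _ _))// (le_trans (fP i w))//.
    rewrite (bigD1 i)//= -addrA -[leLHS]addr0 lerD ?ler_norm// addr_ge0//.
      exact: sumr_ge0.
    by rewrite (le_trans (enorm_ge0 _) (sch_drift_le S 0)).
  rewrite normrN (le_trans (ler_entry_enorm _ _ _))// (le_trans (sch_diffusion_le _ _))//.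
  by rewrite lerDr sumr_ge0.
have tsT t : t \in ts -> 0 <= t <= tau.
  move=> /mapP[k]; rewrite mem_iota add0n => /andP[_ km] ->.
  by rewrite grid_ge0//= grid_le_tau.
have mM t j : 0 <= t -> measurable_fun setT (M t j).
  move=> t0; rewrite /M; under eq_fun do rewrite !mxE.
  apply: measurable_funB; apply: measurable_entry; first exact: mI.
  exact: measurable_diffusion_sum.
have svE n r l j w : 0 < r -> r <= tau -> simple_value (@from n) (@to n) (@coef n) r l j w =
    (si_val (Hn n) r w - sch_diffusion S (sch_index S (left_step X tau m r w))) j l.
  move=> r0 rt; rewrite /simple_value big_sumType/= /si_val !mxE summxE; congr (_ + _).
  have [k kP] := grid_cell tau0 m r0 rt; rewrite (big_pred1 k)//.
  have /andP[h1 h2] : grid tau m k < r <= grid tau m k.+1 by rewrite kP.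
  by rewrite (left_step_grid X tau0 w h1 h2).
have qle n w : [set: T] w -> (\int[lebesgue_measure]_(r in `]0%R, tau])
    (\sum_j quad (fun l k : 'I_D => (l == k)%:R) (fun l => simple_value (@from n) (@to n) (@coef n) r l j w))%:E <=
     2%:E * p n w + 2%:E * step_error X tau diffusion_gap m w)%E.
  move=> _; pose g r := enorm (si_val (Hn n) r w - sch_diffusion S (sch_index S (left_step X tau m r w))) ^+ 2.
  have mgs : measurable_fun setT (fun q : R * T => sch_diffusion S (sch_index S (left_step X tau m q.1 q.2)) : borel 'M[R]_D).
    exact: (measurableT_comp (measurable_sch_comp S (sch_diffusion S : nat -> borel _)) (measurable_left_step tau0 mX m)).
  have mg : measurable_fun setT g.
    apply: (measurable_section (g := fun q : R * T => enorm (si_val (Hn n) q.1 q.2 - sch_diffusion S (sch_index S (left_step X tau m q.1 q.2))) ^+ 2)).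
    by apply: measurable_funX; exact: measurable_enormB.
  rewrite (_ : (\int[lebesgue_measure]_(r in _) _)%E = (\int[lebesgue_measure]_(r in `]0%R, tau]) (g r)%:E)%E); last first.
    apply: eq_integral => r; rewrite inE/= in_itv/= => /andP[r0 rt]; congr EFin.
    rewrite /g sqr_enormE; apply: eq_bigr => j _; rewrite quad_brownian.
    by apply: eq_bigr => l _; rewrite svE.
  apply: le_integral_split => //.
  - exact: measurable_funTS.
  - by apply: measurable_funTS; exact: (measurable_section _ (mgn n)).
  - apply: measurable_funTS.
    apply: (measurable_section (g := fun q : R * T => diffusion_gap (left_value X tau q.1 q.2) (left_step X tau m q.1 q.2))).
    by apply: measurable_funX; exact: measurable_enormB.
  - by move=> r; exact: sqr_ge0.
  - by move=> r; exact: sqr_ge0.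
  - by move=> r; exact: sqr_ge0.
  - move=> r _; rewrite /g /diffusion_gap -[_ - sch_diffusion _ _](subrKA (sigma (left_value X tau r w))).
    exact: sqr_enormD_le.
have pcvg e : 0 < e -> P [set w | (e%:E <= p n w)%E] @[n --> \oo] --> 0%E.
  move=> e0; have [h _] := HnI tau (ltW tau0).
  (* The approximation is given along X on the closed interval, whereas [p] uses left limits on the
     half-open one; both changes affect a null set of times. *)
  suff pE n w : p n w = (\int[lebesgue_measure]_(r in `[0%R, tau])
      (enorm (si_val (Hn n) r w - sigma (X r w)) ^+ 2)%:E)%E.
    by under eq_fun do under eq_set do rewrite pE; exact: h e e0.
  rewrite /p.
  pose G r := enorm (si_val (Hn n) r w - sigma (value X tau r w)) ^+ 2.
  have mG : measurable_fun setT G.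
    apply: (measurable_section (g := fun q : R * T => enorm (si_val (Hn n) q.1 q.2 - sigma (value X tau q.1 q.2)) ^+ 2)).
    apply: measurable_funX; apply: measurable_enormB => //.
    by apply: measurable_borel_comp => //; exact: measurable_value.
  have eX : {in (`]0, tau]%classic : set R), (fun r => enorm (si_val (Hn n) r w - sigma (X r w)) ^+ 2) =1 G}.
    by move=> r; rewrite inE/= in_itv/= => rt; rewrite /G /value rt.
  rewrite -integral_itv_obnd_cbnd; last first.
    apply/measurable_EFinP; apply: (eq_measurable_fun G) => [r rt|]; first by rewrite eX.
    exact: measurable_funTS.
  transitivity (\int[lebesgue_measure]_(r in `]0%R, tau]) (G r)%:E)%E; last first.
    by apply: eq_integral => r rt; rewrite eX.
  apply: ae_eq_integral => //.
  - by apply/measurable_EFinP; apply: measurable_funTS; exact: (measurable_section _ (mgn n)).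
  - by apply/measurable_EFinP; exact: measurable_funTS.
  - have [A [mA A0 hA]] := left_value_ae tau cad w; exists A; split => // r hr.
    by apply: hA => /= er; apply: hr => _; rewrite /G er.
have Scvg t e : t \in ts -> 0 < e -> P [set w | e <= \sum_j
    (simple_sum (brownian_increment W) (@from n) (@to n) (@coef n) t j w - M t j w) ^+ 2] @[n --> \oo] --> 0%E.
  move=> /tsT/andP[t0 _] e0; have [_ h] := HnI t t0.
  suff SE n w : \sum_j (simple_sum (brownian_increment W) (@from n) (@to n) (@coef n) t j w - M t j w) ^+ 2 =
      enorm (si_integral (Hn n) W t w - I t w) ^+ 2.
    under eq_fun do under eq_set do rewrite SE.
    exact: (cvg_probability_sqr (fun _ _ => enorm_ge0 _) h e0).
  rewrite sqr_enorm_col; apply: eq_bigr => j _; congr (_ ^+ 2).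
  rewrite /M !mxE /si_integral /diffusion_sum !summxE /simple_sum big_sumType/=.
  have -> : \sum_(k < m.+1) \sum_l - sch_diffusion S (sch_index S (X (grid tau m k) w)) j l *
      brownian_increment W l (Num.min (grid tau m k) t) (Num.min (grid tau m k.+1) t) w =
    - \sum_(k < m.+1) (sch_diffusion S (sch_index S (X (grid tau m k) w)) *m
      (W (Num.min (grid tau m k.+1) t) w - W (Num.min (grid tau m k) t) w)) j ord0.
    rewrite -sumrN; apply: eq_bigr => k _; rewrite !mxE -sumrN; apply: eq_bigr => l _.
    by rewrite mulNr.
  rewrite opprB addrA subrK; congr (_ - _); apply: eq_bigr => i _.
  by rewrite mxE.
have [mE PE] := @simple_limit_lenglart _ _ _ P F F_sigma F_mono (fun=> 'I_D)
  (fun=> brownian_increment W) (fun=> (fun l k => (l == k)%:R))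
  (fun=> brownian_noise F_sigma F_mono (sde_brownian sol))
  'I_D In from to coef from0 fromto ck cb M p (step_error X tau diffusion_gap m) tau ts setT eta cc
  (ltW tau0) tsT mM mp mq measurableT qle pcvg Scvg eta0 cc0.
rewrite setTI in mE PE.
move=> E; have EE : E = [set w | exists2 t, t \in ts & eta <= \sum_j M t j w ^+ 2] `&`
    [set w | (step_error X tau diffusion_gap m w < cc%:E)%E].
  congr (_ `&` _); apply/seteqP; split => w [k h1 h2].
    exists (grid tau m k); first by rewrite map_f// mem_iota add0n.
    by move: h2; rewrite enormB sqr_enorm_col.
  move: h1 h2 => /mapP[j]; rewrite mem_iota add0n => /andP[_ jm] -> h2.
  by exists j => //; rewrite enormB sqr_enorm_col.
by rewrite EE.
Qed.

End bound.
End diffusion_part.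

Lemma le_integral_split_ereal d (T : measurableType d) (R : realType) (mu : {measure set T -> \bar R})
    (A : set T) (f g h : T -> \bar R) : measurable A -> measurable_fun A f ->
  measurable_fun A g -> measurable_fun A h -> (forall x, 0 <= f x)%E ->
  (forall x, 0 <= g x)%E -> (forall x, 0 <= h x)%E ->
  (forall x, A x -> f x <= 2%:E * g x + 2%:E * h x)%E ->
  (\int[mu]_(x in A) f x <= 2%:E * \int[mu]_(x in A) g x +
    2%:E * \int[mu]_(x in A) h x)%E.
Proof.
move=> mA mf mg mh f0 g0 h0 fgh.
have m2 (k : T -> \bar R) : measurable_fun A k -> measurable_fun A (fun x => 2%:E * k x)%E.
  by move=> mk; apply: emeasurable_funM => //; exact: measurable_cst.
rewrite -!ge0_integralZl//.
rewrite -ge0_integralD//; last 4 first.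
- by move=> x _; rewrite mule_ge0.
- exact: m2.
- by move=> x _; rewrite mule_ge0.
- exact: m2.
apply: ge0_le_integral => //; apply: emeasurable_funD; exact: m2.
Qed.

(** * Jump part of the shadow *)

Section jump_part.
Context (R : realType) (D : nat) d (T : measurableType d) (P : probability T R)
  (F : R -> set (set T)) (dispU : measure_display)
  (U : measurableType dispU) (nu : {sigma_finite_measure set U -> \bar R})
  (b : 'cV[R]_D -> 'cV[R]_D) (sigma : 'cV[R]_D -> 'M[R]_D)
  (c : 'cV[R]_D -> U -> 'cV[R]_D) (x0 : 'cV[R]_D)
  (W : R -> T -> 'cV[R]_D) (N : R.-ker T ~> (R * U)%type) (X : R -> T -> 'cV[R]_D).
Hypothesis c_measurable :
  measurable_fun setT (fun p : borel 'cV[R]_D * U => c p.1 p.2 : borel 'cV[R]_D).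
Hypothesis c2_finite : forall x, (\int[nu]_u (enorm (c x u) ^+ 2)%:E < +oo)%E.
Hypothesis sol : solves_sde P F nu b sigma c x0 W N X.
Context (tau : R) (S : scheme D nu).
Hypothesis tau0 : 0 < tau.

Let cad := sde_cadlag sol.
Let F_sigma := solution_sigma sol.
Let F_mono := solution_mono sol.
Let mX := solution_measurable sol.

(** Taken in the reals to fit [step_error]; no infinite value is lost, see [jump_gapE]. *)
Definition jump_gap (y z : 'cV[R]_D) : R :=
  fine (\int[nu]_u (enorm (c y u - jump_function S (sch_index S z) u) ^+ 2)%:E)%E.

Lemma measurable_coefficient y : measurable_fun setT (c y : U -> borel 'cV[R]_D).
Proof.
exact: (measurableT_comp c_measurable (measurable_pair1 (y : borel 'cV[R]_D))).
Qed.

(** At most one mark set contains u, so the squared jump is below the sum of the indicators times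
    the squared bound, and each set has finite measure. *)
Lemma jump_function_sqr_finite i :
  (\int[nu]_u (enorm (jump_function S i u) ^+ 2)%:E < +oo)%E.
Proof.
pose mu1 u := \sum_j \1_(sch_set (s := S) j) u * sch_bound S ^+ 2.
apply: (@le_lt_trans _ _ (\int[nu]_u (mu1 u)%:E)%E).
  apply: ge0_le_integral => //.
  - by move=> u _; rewrite lee_fin sqr_ge0.
  - apply/measurable_EFinP; apply: measurable_funX.
    exact: measurable_borel_real (@continuous_enorm _ _ _) (measurable_jump_function S i).
  - apply/measurable_EFinP; apply: measurable_sum => j; apply: measurable_funM => //.
    by apply: measurable_indic; exact: measurable_sch_set.
  - move=> u _; rewrite lee_fin /mu1.
    have [[j uj]|h] := pselect (exists j, sch_set (s := S) j u); last first.
      rewrite jump_function_out ?enorm0 ?expr0n/=; last by move=> j uj; apply: h; exists j.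
      by apply: sumr_ge0 => j _; rewrite mulr_ge0// sqr_ge0.
    rewrite (jump_function_in i uj) (bigD1 j)//= indicE mem_set// mul1r.
    rewrite -[leLHS]addr0 lerD//; last by apply: sumr_ge0 => k _; rewrite mulr_ge0// sqr_ge0.
    by rewrite ler_pXn2r ?nnegrE ?enorm_ge0 ?sch_jump_le// (le_trans (enorm_ge0 _) (sch_jump_le i j)).
rewrite /mu1; under eq_integral do rewrite -sumEFin.
rewrite ge0_integral_sum//; last 2 first.
- move=> j; apply/measurable_EFinP; apply: measurable_funM => //.
  by apply: measurable_indic; exact: measurable_sch_set.
- by move=> j u _; rewrite lee_fin mulr_ge0// sqr_ge0.
apply: lte_sum_pinfty => j _; under eq_integral do rewrite EFinM.
rewrite ge0_integralZr//; last first.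
- by rewrite lee_fin sqr_ge0.
- by apply/measurable_EFinP; apply: measurable_indic; exact: measurable_sch_set.
rewrite integral_indic ?setIT//; last exact: measurable_sch_set.
by rewrite lte_mul_pinfty ?lee_fin ?ltry// ?ge0_fin_numE ?fin_sch_set.
Qed.

Lemma jump_gapE y z :
  ((jump_gap y z)%:E = \int[nu]_u (enorm (c y u - jump_function S (sch_index S z) u) ^+ 2)%:E)%E.
Proof.
rewrite fineK// ge0_fin_numE; last by apply: integral_ge0 => u _; rewrite lee_fin sqr_ge0.
apply: (@le_lt_trans _ _ (2%:E * (\int[nu]_u (enorm (c y u) ^+ 2)%:E) +
   2%:E * (\int[nu]_u (enorm (jump_function S (sch_index S z) u) ^+ 2)%:E))%E); last first.
  by rewrite lte_add_pinfty// lte_mul_pinfty// ?jump_function_sqr_finite.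
have mc := measurable_coefficient y; have mj := measurable_jump_function S (sch_index S z).
apply: (@le_integral_split _ _ _ nu setT (fun u => enorm (c y u - jump_function S (sch_index S z) u) ^+ 2)
  (fun u => enorm (c y u) ^+ 2) (fun u => enorm (jump_function S (sch_index S z) u) ^+ 2)) => //.
- by apply: measurable_funX; exact: measurable_enormB.
- by apply: measurable_funX; exact: measurable_borel_real (@continuous_enorm _ _ _) mc.
- by apply: measurable_funX; exact: measurable_borel_real (@continuous_enorm _ _ _) mj.
- by move=> u; exact: sqr_ge0.
- by move=> u; exact: sqr_ge0.
- by move=> u; exact: sqr_ge0.
- by move=> u _; have := sqr_enormD_le (c y u) (- jump_function S (sch_index S z) u); rewrite enormN.
Qed.

Lemma measurable_jump_function2 d' (E : measurableType d') (z : E -> 'cV[R]_D) :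
  measurable_fun setT (z : E -> borel 'cV[R]_D) ->
  measurable_fun setT (fun p : E * U => jump_function S (sch_index S (z p.1)) p.2 : borel 'cV[R]_D).
Proof.
move=> mz; apply: measurable_entries => k l.
rewrite (_ : (fun _ => _) = (fun p : E * U =>
  \sum_j \1_(sch_set (s := S) j) p.2 * sch_jump (s := S) (sch_index S (z p.1)) j k l)).
  apply: measurable_sum => j; apply: measurable_funM.
    apply: measurableT_comp => //; apply: measurable_indic; exact: measurable_sch_set.
  have m1 := measurableT_comp mz (@measurable_fst _ _ E U).
  exact: (measurableT_comp (measurable_sch_comp S (fun i => sch_jump (s := S) i j k l)) m1).
apply/funext => p; rewrite /jump_function summxE big_mkcond; apply: eq_bigr => j _.
by rewrite indicE; case: ifP; rewrite ?mul1r ?mul0r.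
Qed.

Lemma measurable_coefficient2 d' (E : measurableType d') (y : E -> 'cV[R]_D) :
  measurable_fun setT (y : E -> borel 'cV[R]_D) ->
  measurable_fun setT (fun p : E * U => c (y p.1) p.2 : borel 'cV[R]_D).
Proof.
move=> my; have m1 := measurableT_comp my (@measurable_fst _ _ E U).
exact: (measurableT_comp c_measurable (measurable_fun_pair m1 measurable_snd)).
Qed.

Lemma measurable_mark_integral d' (E : measurableType d') (f g : E * U -> 'cV[R]_D) :
  measurable_fun setT (f : _ -> borel 'cV[R]_D) -> measurable_fun setT (g : _ -> borel 'cV[R]_D) ->
  measurable_fun setT (fun e => \int[nu]_u (enorm (f (e, u) - g (e, u)) ^+ 2)%:E)%E.
Proof.
move=> mf mg; pose k (p : E * U) := (enorm (f p - g p) ^+ 2)%:E.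
have mk : measurable_fun setT k.
  by apply/measurable_EFinP; apply: measurable_funX; exact: measurable_enormB.
have k0 p : (0 <= k p)%E by rewrite lee_fin sqr_ge0.
exact: (@measurable_fun_fubini_tonelli_F _ _ _ _ _ nu k mk k0).
Qed.

Lemma measurable_jump_gap : measurable_fun setT
  (fun p : borel 'cV[R]_D * borel 'cV[R]_D => jump_gap p.1 p.2).
Proof.
apply: measurableT_comp => //.
apply: (measurable_mark_integral
  (f := fun p : (borel 'cV[R]_D * borel 'cV[R]_D) * U => c p.1.1 p.2)
  (g := fun p : (borel 'cV[R]_D * borel 'cV[R]_D) * U => jump_function S (sch_index S p.1.2) p.2)).
  exact: measurable_coefficient2 measurable_fst.
exact: measurable_jump_function2 measurable_snd.
Qed.

Definition jump_sum m t w : 'cV[R]_D := \sum_(j < m.+1) \sum_k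
  compensated nu N (`]Num.min (grid tau m j) t, Num.min (grid tau m j.+1) t] `*` sch_set (s := S) k) w *:
    sch_jump (s := S) (sch_index S (X (grid tau m j) w)) k.

Lemma measurable_compensated A : measurable A -> measurable_fun setT (compensated nu N A).
Proof.
move=> mA; apply: measurable_funB; last exact: measurable_cst.
by apply: measurableT_comp => //; exact: measurable_kernel.
Qed.

Lemma measurable_jump_sum m t : 0 <= t ->
  measurable_fun setT (jump_sum m t : T -> borel 'cV[R]_D).
Proof.
move=> t0; apply: measurable_entries => i l; rewrite /jump_sum.
under eq_fun do rewrite summxE; apply: measurable_sum => j.
under eq_fun do rewrite summxE; apply: measurable_sum => k.
under eq_fun do rewrite mxE; apply: measurable_funM.
  by apply: measurable_compensated; apply: measurableX => //; exact: measurable_sch_set.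
have h := scheme_coef_at_time sol S (fun n => sch_jump (s := S) n k i l) (grid_ge0 tau0 m j).
exact: (at_time_measurable F_sigma (grid_ge0 tau0 m j) h).
Qed.

Section bound.
Variables (J : R -> T -> 'cV[R]_D) (m : nat).
Hypothesis jump : is_jump_integral P F nu N (fun t u w => c (left_limit (X ^~ w) t) u) J.

(** Parallel to [diffusion_sum_bound], with one noise per mark set. The family of mark sets changes
    with n: it joins the sets of the n-th approximation, which may overlap each other and everything
    else, to those of the scheme. *)
Lemma jump_sum_bound (eta cc : R) : 0 < eta -> 0 < cc ->
  let E := [set w | exists2 k, (k <= m.+1)%N &
      eta <= enorm (jump_sum m (grid tau m k) w - J (grid tau m k) w) ^+ 2] `&`
    [set w | (step_error X tau jump_gap m w < cc%:E)%E] in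
  measurable E /\ (P E <= (16 * cc / eta)%:E)%E.
Proof.
move=> eta0 cc0; have [adJ _ [Hn HnJ]] := jump.
have mJ t : 0 <= t -> measurable_fun setT (J t : T -> borel 'cV[R]_D).
  move=> t0; apply: (at_time_measurable F_sigma t0).
  exact: measurable_wrt_at_time (adJ t t0).
pose In (n : nat) : finType := ('I_(sj_size (Hn n)) + 'I_m.+1)%type.
pose Ln (n : nat) : finType := ('I_(sj_size (Hn n)) + sch_mark S)%type.
pose A n (l : Ln n) : set U := match l with inl i => sj_set i | inr k => sch_set (s := S) k end.
pose from n (i : In n) : R := match i with inl i => sj_from i | inr j => grid tau m j end.
pose to n (i : In n) : R := match i with inl i => sj_to i | inr j => grid tau m j.+1 end.
(* Rectangle i of the approximation acts on its own mark set only; a cell of the grid acts on all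
   sets of the scheme, with the opposite sign. *)
pose coef n (i : In n) (l : Ln n) (j : 'I_D) w : R := match i, l with
  | inl i, inl l => if l == i then sj_coef i w j ord0 else 0
  | inr p, inr k => - sch_jump (s := S) (sch_index S (X (grid tau m p) w)) k j ord0
  | _, _ => 0 end.
pose p n w := (\int[lebesgue_measure]_(r in `]0%R, tau])
  \int[nu]_u (enorm (sj_val (Hn n) r u w - c (left_value X tau r w) u) ^+ 2)%:E)%E.
pose M t j w := (J t w - jump_sum m t w) j (ord0 : 'I_1).
have mA n (l : Ln n) : measurable (A n l).
  by case: l => [i|k]; [exact: sj_measurable | exact: measurable_sch_set].
have fA n (l : Ln n) : (nu (A n l) < +oo)%E.
  by case: l => [i|k]; [exact: sj_finite | exact: fin_sch_set].
have mc (n : nat) (i : 'I_(sj_size (Hn n))) : measurable_fun setT (sj_coef i : T -> borel 'cV[R]_D).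
  apply: (at_time_measurable F_sigma (sj_from_ge0 i)).
  exact: (measurable_wrt_at_time (@sj_adapted _ _ _ _ _ _ _ _ _ i)).
have msj n : measurable_fun setT (fun q : (R * T) * U => sj_val (Hn n) q.1.1 q.2 q.1.2 : borel 'cV[R]_D).
  apply: measurable_entries => i k.
  rewrite (_ : (fun _ => _) = (fun q : (R * T) * U => \sum_(j < sj_size (Hn n))
    \1_(`]sj_from j, sj_to j]%classic : set R) q.1.1 * (\1_(sj_set j) q.2 * sj_coef j q.1.2 i k))); last first.
    apply/funext => q; rewrite /sj_val big_mkcond summxE; apply: eq_bigr => j _.
    rewrite !indicE mem_setE in_itv/=; case: ifP => [/andP[-> ->]|]; first by rewrite !mul1r.
    by move=> /negbT; rewrite negb_and mxE => /orP[] /negPf ->; rewrite !(mul0r, mulr0).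
  apply: measurable_sum => j; apply: measurable_funM; last apply: measurable_funM.
  - apply: measurableT_comp; first exact: measurable_indic.
    exact: (measurableT_comp measurable_fst measurable_fst).
  - apply: measurableT_comp => //; apply: measurable_indic; exact: sj_measurable.
  - have h := measurable_entry i k (mc n j).
    exact: (measurableT_comp h (measurableT_comp measurable_snd measurable_fst)).
have mcl : measurable_fun setT (fun q : (R * T) * U => c (left_value X tau q.1.1 q.1.2) q.2 : borel 'cV[R]_D).
  exact: (measurable_coefficient2 (measurable_left_value tau0 cad mX)).
have mjl : measurable_fun setT (fun q : (R * T) * U =>
    jump_function S (sch_index S (left_step X tau m q.1.1 q.1.2)) q.2 : borel 'cV[R]_D).
  exact: (measurable_jump_function2 (measurable_left_step tau0 mX m)).
pose g1 n (q : R * T) := (\int[nu]_u (enorm (sj_val (Hn n) q.1 u q.2 - c (left_value X tau q.1 q.2) u) ^+ 2)%:E)%E.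
pose g2 n (q : R * T) := (\int[nu]_u (enorm (sj_val (Hn n) q.1 u q.2 -
   jump_function S (sch_index S (left_step X tau m q.1 q.2)) u) ^+ 2)%:E)%E.
have sqi (f : U -> R) : (0 <= \int[nu]_u (f u ^+ 2)%:E)%E.
  by apply: integral_ge0 => u _; rewrite lee_fin sqr_ge0.
have mg1 n : measurable_fun setT (g1 n) by exact: (measurable_mark_integral (msj n) mcl).
have mg2 n : measurable_fun setT (g2 n) by exact: (measurable_mark_integral (msj n) mjl).
have mp n : measurable_fun setT (p n).
  by apply: (measurable_time_integral_ereal tau (mg1 n)) => q; exact: sqi.
have gap0 y z : 0 <= jump_gap y z by rewrite -lee_fin jump_gapE.
have mq : measurable_fun setT (step_error X tau jump_gap m).
  exact: (measurable_step_error tau0 cad mX measurable_jump_gap gap0).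
pose ts := [seq grid tau m k | k <- iota 0 m.+2].
have from0 n (i : In n) : 0 <= from n i by case: i => [i|j]; [exact: sj_from_ge0 | exact: grid_ge0].
have fromto n (i : In n) : from n i <= to n i.
  by case: i => [i|j]; [exact: sj_from_to | rewrite ler_grid].
have ck n (i : In n) (l : Ln n) j : known F (from n i) (coef n i l j).
  case: i => [i|k]; case: l => [l|l] /=; try exact: measurable_cst.
    rewrite /known /coef; case: (l == i); last exact: measurable_cst.
    exact: (measurable_entry j ord0 (measurable_wrt_at_time (@sj_adapted _ _ _ _ _ _ _ _ _ i))).
  exact: (scheme_coef_at_time sol S (fun n => - sch_jump (s := S) n l j ord0) (grid_ge0 tau0 m k)).
have cb n : exists B, forall (i : In n) (l : Ln n) j w, `|coef n i l j w| <= B.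
  have [f fP] := choice (fun i => @sj_bounded _ _ _ _ _ _ _ _ (Hn n) i).
  have sb0 : 0 <= sch_bound S by rewrite (le_trans (enorm_ge0 _) (sch_drift_le S 0)).
  have fs0 : 0 <= \sum_i `|f i| by exact: sumr_ge0.
  exists (\sum_i `|f i| + sch_bound S) => -[i|k] [l|l] j w /=; rewrite ?normr0 ?addr_ge0//.
    case: (l == i); last by rewrite normr0 addr_ge0.
    rewrite (le_trans (ler_entry_enorm _ _ _))// (le_trans (fP i w))//.
    rewrite (bigD1 i)//= -addrA -[leLHS]addr0 lerD ?ler_norm// addr_ge0//.
    exact: sumr_ge0.
  rewrite normrN (le_trans (ler_entry_enorm _ _ _))// (le_trans (sch_jump_le _ _))//.
  by rewrite lerDr.
have tsT t : t \in ts -> 0 <= t <= tau.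
  move=> /mapP[k]; rewrite mem_iota add0n => /andP[_ km] ->.
  by rewrite grid_ge0//= grid_le_tau.
have mM t j : 0 <= t -> measurable_fun setT (M t j).
  move=> t0; rewrite /M; under eq_fun do rewrite !mxE.
  apply: measurable_funB; apply: measurable_entry; first exact: mJ.
  exact: measurable_jump_sum.
(* By [quad_overlap] the bracket in coordinate j is the squared L2 norm over the marks of the
   difference of the two jump functions. *)
have svE n r j w : 0 < r -> r <= tau ->
    ((quad (overlap nu (A n)) (fun l => simple_value (@from n) (@to n) (@coef n) r l j w))%:E =
     \int[nu]_u (((sj_val (Hn n) r u w - jump_function S (sch_index S (left_step X tau m r w)) u) j ord0) ^+ 2)%:E)%E.
  move=> r0 rt; rewrite -(quad_overlap (mA n) (fA n)); apply: eq_integral => u _; congr (_ ^+ 2)%:E.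
  have [k kP] := grid_cell tau0 m r0 rt.
  have /andP[h1 h2] : grid tau m k < r <= grid tau m k.+1 by rewrite kP.
  rewrite big_sumType/= !mxE /sj_val /jump_function !summxE; congr (_ + _).
    rewrite big_mkcond [RHS]big_mkcond; apply: eq_bigr => i _.
    rewrite /simple_value big_sumType/= [X in _ + X]big1 ?addr0//.
    rewrite [in LHS]big_mkcond/= (bigD1 i)//= eqxx big1 ?addr0; last first.
      by move=> i'; rewrite eq_sym => /negPf ->; case: ifP.
    by case: (u \in _); rewrite ?andbT ?andbF.
  rewrite -sumrN; apply: eq_bigr => l _.
  rewrite /simple_value big_sumType/= big1 ?add0r// (big_pred1 k)//.
  by rewrite (left_step_grid X tau0 w h1 h2).
have qle n w : [set: T] w -> (\int[lebesgue_measure]_(r in `]0%R, tau])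
    (\sum_j quad (overlap nu (A n)) (fun l => simple_value (@from n) (@to n) (@coef n) r l j w))%:E <=
     2%:E * p n w + 2%:E * step_error X tau jump_gap m w)%E.
  move=> _.
  have sec (g : R * T -> \bar R) : measurable_fun setT g -> measurable_fun setT (fun r => g (r, w)).
    by move=> mg; apply: (measurableT_comp mg); exact: measurable_pair2.
  have sj r : measurable_fun setT (fun u => sj_val (Hn n) r u w : borel 'cV[R]_D).
    exact: (measurableT_comp (msj n) (measurable_pair1 (r, w))).
  rewrite (_ : (\int[lebesgue_measure]_(r in _) _)%E = (\int[lebesgue_measure]_(r in `]0%R, tau]) g2 n (r, w))%E); last first.
    apply: eq_integral => r; rewrite inE/= in_itv/= => /andP[r0 rt].
    rewrite -sumEFin (eq_bigr _ (fun j _ => svE n r j w r0 rt)) -ge0_integral_sum//.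
    - by apply: eq_integral => u _; rewrite sumEFin sqr_enorm_col.
    - move=> j; apply/measurable_EFinP; apply: measurable_funX; under eq_fun do rewrite !mxE.
      by apply: measurable_funB; apply: measurable_entry => //; exact: measurable_jump_function.
    - by move=> j u _; rewrite lee_fin sqr_ge0.
  apply: le_integral_split_ereal => //.
  - by apply: measurable_funTS; exact: sec (mg2 n).
  - by apply: measurable_funTS; exact: sec (mg1 n).
  - apply: measurable_funTS; apply/measurable_EFinP.
    apply: (measurable_section (g := fun q : R * T => jump_gap (left_value X tau q.1 q.2) (left_step X tau m q.1 q.2))).
    exact: (measurableT_comp measurable_jump_gap (measurable_fun_pair (measurable_left_value tau0 cad mX) (measurable_left_step tau0 mX m))).
  - by move=> r; exact: sqi.
  - by move=> r; rewrite lee_fin.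
  - move=> r _; rewrite jump_gapE /g2/=.
    have mj := measurable_jump_function S (sch_index S (left_step X tau m r w)).
    have mcc := measurable_coefficient (left_value X tau r w).
    apply: (@le_integral_split _ _ _ nu setT
      (fun u => enorm (sj_val (Hn n) r u w - jump_function S (sch_index S (left_step X tau m r w)) u) ^+ 2)
      (fun u => enorm (sj_val (Hn n) r u w - c (left_value X tau r w) u) ^+ 2)
      (fun u => enorm (c (left_value X tau r w) u - jump_function S (sch_index S (left_step X tau m r w)) u) ^+ 2)) => //.
    + by apply: measurable_funX; exact: measurable_enormB.
    + by apply: measurable_funX; exact: measurable_enormB.
    + by apply: measurable_funX; exact: measurable_enormB.
    + by move=> u; exact: sqr_ge0.
    + by move=> u; exact: sqr_ge0.
    + by move=> u; exact: sqr_ge0.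
    + move=> u _; rewrite -[_ - jump_function _ _ _](subrKA (c (left_value X tau r w) u)).
      exact: sqr_enormD_le.
have pcvg e : 0 < e -> P [set w | (e%:E <= p n w)%E] @[n --> \oo] --> 0%E.
  move=> e0; have [h _] := HnJ tau (ltW tau0).
  suff pE n w : p n w = (\int[lebesgue_measure]_(r in `]0%R, tau]) \int[nu]_u
      (enorm (sj_val (Hn n) r u w - c (left_limit (X ^~ w) r) u) ^+ 2)%:E)%E.
    by under eq_fun do under eq_set do rewrite pE; exact: h e e0.
  apply: eq_integral => r; rewrite inE/= in_itv/= => rt.
  by apply: eq_integral => u _; rewrite /left_value rt.
have Scvg t e : t \in ts -> 0 < e -> P [set w | e <= \sum_j
    (simple_sum (poisson_increment nu N (A n)) (@from n) (@to n) (@coef n) t j w - M t j w) ^+ 2] @[n --> \oo] --> 0%E.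
  move=> /tsT/andP[t0 _] e0; have [_ h] := HnJ t t0.
  suff SE n w : \sum_j (simple_sum (poisson_increment nu N (A n)) (@from n) (@to n) (@coef n) t j w - M t j w) ^+ 2 =
      enorm (sj_integral (Hn n) N t w - J t w) ^+ 2.
    under eq_fun do under eq_set do rewrite SE.
    exact: (cvg_probability_sqr (fun _ _ => enorm_ge0 _) h e0).
  rewrite sqr_enorm_col; apply: eq_bigr => j _; congr (_ ^+ 2).
  rewrite /M !mxE /sj_integral /jump_sum !summxE /simple_sum big_sumType/=.
  have -> : \sum_(q < m.+1) \sum_l coef n (inr q) l j w *
      poisson_increment nu N (A n) l (Num.min (grid tau m q) t) (Num.min (grid tau m q.+1) t) w =
    - \sum_(q < m.+1) (\sum_k
  compensated nu N (`]Num.min (grid tau m q) t, Num.min (grid tau m q.+1) t] `*` sch_set (s := S) k) w *: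
    sch_jump (s := S) (sch_index S (X (grid tau m q) w)) k) j ord0.
    rewrite -sumrN; apply: eq_bigr => q _; rewrite summxE -sumrN big_sumType/= big1 ?add0r; last first.
      by move=> i _; rewrite mul0r.
    by apply: eq_bigr => k _; rewrite mxE mulNr mulrC.
  rewrite opprB addrA subrK; congr (_ - _); apply: eq_bigr => i _.
  rewrite big_sumType/= [X in _ + X]big1 ?addr0; last by move=> k _; rewrite mul0r.
  rewrite (bigD1 i)//= eqxx big1 ?addr0; last by move=> l /negPf ->; rewrite mul0r.
  by rewrite mxE mulrC.
have [mE PE] := @simple_limit_lenglart _ _ _ P F F_sigma F_mono Ln
  (fun n => poisson_increment nu N (A n)) (fun n => overlap nu (A n))
  (fun n => poisson_noise F_sigma (sde_poisson sol) (mA n) (fA n))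
  'I_D In from to coef from0 fromto ck cb M p (step_error X tau jump_gap m) tau ts setT eta cc
  (ltW tau0) tsT mM mp mq measurableT qle pcvg Scvg eta0 cc0.
rewrite setTI in mE PE.
move=> E; have EE : E = [set w | exists2 t, t \in ts & eta <= \sum_j M t j w ^+ 2] `&`
    [set w | (step_error X tau jump_gap m w < cc%:E)%E].
  congr (_ `&` _); apply/seteqP; split => w [k h1 h2].
    exists (grid tau m k); first by rewrite map_f// mem_iota add0n.
    by move: h2; rewrite enormB sqr_enorm_col.
  move: h1 h2 => /mapP[j]; rewrite mem_iota add0n => /andP[_ jm] -> h2.
  by exists j => //; rewrite enormB sqr_enorm_col.
by rewrite EE.
Qed.

End bound.
End jump_part.

Lemma dominated_convergence0 d (T : measurableType d) (R : realType)
    (mu : {measure set T -> \bar R}) (f : nat -> T -> R) (g : T -> R) :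
  (forall n, measurable_fun setT (f n)) -> mu.-integrable setT (EFin \o g) ->
  (forall n x, 0 <= f n x <= g x) -> (forall x, f n x @[n --> \oo] --> 0) ->
  (\int[mu]_x (f n x)%:E)%E @[n --> \oo] --> 0%E.
Proof.
move=> mf ig fg f0.
have [] := @dominated_convergence _ _ _ mu setT measurableT (fun n x => (f n x)%:E) (cst 0%E) (EFin \o g).
- by move=> n; apply/measurable_EFinP.
- exact: measurable_cst.
- by apply: nearW => x Dx; apply: cvg_EFin; [exact: nearW | exact: f0].
- by [].
- apply: nearW => x n _; have /andP[h1 h2] := fg n x.
  by rewrite abse_EFin lee_fin ger0_norm.
by move=> _ _; rewrite integral0.
Qed.

(** * Continuity of the jump coefficient in L2 of the marks *)

Section coefficient_continuity.
Context (R : realType) (D : nat) (dispU : measure_display)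
  (U : measurableType dispU) (nu : {sigma_finite_measure set U -> \bar R})
  (c : 'cV[R]_D -> U -> 'cV[R]_D).
Hypothesis c_measurable :
  measurable_fun setT (fun p : borel 'cV[R]_D * U => c p.1 p.2 : borel 'cV[R]_D).
Hypothesis c_continuous : forall u, continuous (c ^~ u).
Hypothesis c2_finite : forall x, (\int[nu]_u (enorm (c x u) ^+ 2)%:E < +oo)%E.
Hypothesis c2_continuous : continuous (fun x => \int[nu]_u (enorm (c x u) ^+ 2)%:E)%E.

Let mc := measurable_coefficient c_measurable.

(** Pointwise convergence and convergence of the L2 norms imply L2 convergence (Riesz-Scheffe).
    Along a sequence z_n violating the claim, write F = |c(y)|^2, F_n = |c(z_n)|^2, G = |c(y) -
    c(z_n)|^2; then G + 2F <= min(G, 4F) + 2F_n + 2(F - F_n)^+, where the first and last terms on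
    the right are dominated by multiples of F and vanish in the limit. With a the integral of F, the
    limit of the integrals is eps + 2a <= 2a, a contradiction. *)
Lemma coefficient_L2_continuous y (eps : R) : 0 < eps -> exists2 r : R, 0 < r &
  forall z, enorm (y - z) < r -> (\int[nu]_u (enorm (c y u - c z u) ^+ 2)%:E <= eps%:E)%E.
Proof.
move=> eps0; apply: contrapT => hn.
have /choice[z zP] : forall n : nat, exists z, enorm (y - z) < n.+1%:R^-1 /\
    (eps%:E < \int[nu]_u (enorm (c y u - c z u) ^+ 2)%:E)%E.
  move=> n; apply: contrapT => h; apply: hn; exists n.+1%:R^-1 => // z hz.
  by rewrite leNgt; apply/negP => lt; apply: h; exists z.
have zy : z n @[n --> \oo] --> y.
  apply/cvg_enormP => e e0; have := near_infty_natSinv_lt (PosNum e0).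
  by apply: filterS => n /= h; exact: lt_trans (zP n).1 h.
pose F u := enorm (c y u) ^+ 2; pose Fn n u := enorm (c (z n) u) ^+ 2.
pose G n u := enorm (c y u - c (z n) u) ^+ 2.
pose p n u := Num.max (F u - Fn n u) 0; pose q n u := Num.min (G n u) (4 * F u).
have F0 u : 0 <= F u by exact: sqr_ge0.
have Fn0 n u : 0 <= Fn n u by exact: sqr_ge0.
have G0 n u : 0 <= G n u by exact: sqr_ge0.
have mF : measurable_fun setT F.
  by apply: measurable_funX; exact: measurable_borel_real (@continuous_enorm _ _ _) (mc y).
have mFn n : measurable_fun setT (Fn n).
  by apply: measurable_funX; exact: measurable_borel_real (@continuous_enorm _ _ _) (mc (z n)).
have mG n : measurable_fun setT (G n).
  by apply: measurable_funX; exact: measurable_enormB.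
have mp n : measurable_fun setT (p n).
  by apply: measurable_maxr; [exact: measurable_funB | exact: measurable_cst].
have mq n : measurable_fun setT (q n).
  by apply: measurable_minr => //; apply: measurable_funM => //; exact: measurable_cst.
have iF : nu.-integrable setT (EFin \o F).
  apply/integrableP; split; first exact/measurable_EFinP.
  rewrite (_ : (\int[nu]_u _)%E = (\int[nu]_u (F u)%:E)%E) ?c2_finite//.
  by apply: eq_integral => u _; rewrite /= ger0_norm.
have cz u : c (z n) u @[n --> \oo] --> c y u by exact: (cvg_comp z (c ^~ u) zy (@c_continuous u y)).
have Fcvg u : Fn n u @[n --> \oo] --> F u.
  have h : enorm (c (z n) u) @[n --> \oo] --> enorm (c y u).
    exact: (cvg_comp (fun n => c (z n) u) (@enorm R D 1) (cz u) (@continuous_enorm R D 1 (c y u))).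
  by rewrite /F /Fn expr2; under eq_fun do rewrite expr2; exact: cvgM.
have pcvg : (\int[nu]_u (p n u)%:E)%E @[n --> \oo] --> 0%E.
  apply: (dominated_convergence0 (g := F)) => //.
    by move=> n u; rewrite /p le_max lexx orbT/= ge_max F0 andbT lerBlDr lerDl.
  move=> u; apply/cvgrPdist_le => e e0.
  have /cvgrPdist_le/(_ e e0) := Fcvg u; apply: filterS => n h.
  rewrite sub0r normrN ger0_norm ?le_max ?lexx ?orbT// ge_max (ltW e0) andbT.
  exact: le_trans (ler_norm _) h.
have qcvg : (\int[nu]_u (q n u)%:E)%E @[n --> \oo] --> 0%E.
  apply: (dominated_convergence0 (g := fun u => 4 * F u)) => //.
  - by under [X in _.-integrable _ X]eq_fun do rewrite /= EFinM; exact: integrableZl.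
  - by move=> n u; rewrite /q le_min G0 mulr_ge0//= ge_min lexx orbT.
  move=> u; apply/cvgrPdist_le => e e0.
  have e1 : 0 < Num.min e 1 by rewrite lt_min e0 ltr01.
  have /cvg_enormP/(_ _ e1) := cz u; apply: filterS => n; rewrite lt_min => /andP[h1 h2].
  have q0 : 0 <= q n u by rewrite le_min G0 mulr_ge0.
  rewrite sub0r normrN ger0_norm// /q ge_min; apply/orP; left.
  by rewrite /G expr2 (le_trans _ (ltW h1))// ler_piMl ?enorm_ge0 ?ltW.
have acvg : (\int[nu]_u (Fn n u)%:E)%E @[n --> \oo] --> (\int[nu]_u (F u)%:E)%E.
  exact: (cvg_comp z (fun x => (\int[nu]_u (enorm (c x u) ^+ 2)%:E)%E) zy (@c2_continuous y)).
pose a := fine (\int[nu]_u (F u)%:E)%E.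
have aE : (\int[nu]_u (F u)%:E)%E = a%:E.
  by rewrite fineK// ge0_fin_numE ?c2_finite//; apply: integral_ge0 => u _; rewrite lee_fin.
have lim : (\int[nu]_u (q n u)%:E + (2%:E * \int[nu]_u (Fn n u)%:E + 2%:E * \int[nu]_u (p n u)%:E))%E
    @[n --> \oo] --> (0 + (2%:E * a%:E + 2%:E * 0))%E.
  rewrite aE in acvg.
  have f2 : (2%:E : \bar R) \is a fin_num by [].
  have h1 := cvgeZl f2 acvg; have h2 := cvgeZl f2 pcvg.
  apply: cvgeD; [exact: fin_num_adde_defr | exact: qcvg |].
  by apply: cvgeD; [rewrite mule0; exact: fin_num_adde_defl | exact: h1 | exact: h2].
have le2 n : ((eps + 2 * a)%:E <=
    \int[nu]_u (q n u)%:E + (2%:E * \int[nu]_u (Fn n u)%:E + 2%:E * \int[nu]_u (p n u)%:E))%E.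
  apply: (@le_trans _ _ (\int[nu]_u (G n u)%:E + 2%:E * \int[nu]_u (F u)%:E)%E).
    by rewrite aE EFinD EFinM leeD// ltW// (zP n).2.
  have p0 u : 0 <= p n u by rewrite le_max lexx orbT.
  have q0 u : 0 <= q n u by rewrite le_min G0 mulr_ge0.
  have m2 (k : U -> R) : measurable_fun setT k -> measurable_fun setT (fun u => 2%:E * (k u)%:E)%E.
    by move=> mk; apply: emeasurable_funM; [exact: measurable_cst | exact/measurable_EFinP].
  rewrite -!ge0_integralZl//; try exact/measurable_EFinP; try (by move=> u _; rewrite lee_fin).
  rewrite -!ge0_integralD//; try exact/measurable_EFinP; try exact: m2;
    try (by move=> u _; rewrite -?EFinM ?lee_fin ?mulr_ge0//).
  - apply: ge0_le_integral => //.
    + by move=> u _; rewrite -EFinM -EFinD lee_fin addr_ge0// mulr_ge0.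
    + by apply: emeasurable_funD; [exact/measurable_EFinP | exact: m2].
    + apply: emeasurable_funD; first exact/measurable_EFinP.
      by apply: emeasurable_funD; exact: m2.
    + move=> u _; rewrite -!EFinM -!EFinD lee_fin.
      have GF : G n u <= 2 * F u + 2 * Fn n u.
        by have := sqr_enormD_le (c y u) (- c (z n) u); rewrite enormN.
      have pF : F u - Fn n u <= p n u by rewrite le_max lexx.
      have aux (g f1 fn p1 : R) : g <= 2 * f1 + 2 * fn -> f1 - fn <= p1 -> 0 <= p1 ->
          g + 2 * f1 <= Num.min g (4 * f1) + (2 * fn + 2 * p1).
        by move=> h1 h2 h3; have [h|h] := leP g (4 * f1); lra.
      exact: aux GF pF (p0 u).
  - by move=> u _; rewrite -!EFinM -EFinD lee_fin addr_ge0// mulr_ge0.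
  - by apply: emeasurable_funD; exact: m2.
  - by move=> u _; rewrite mule_ge0// lee_fin.
  - by move=> u _; rewrite lee_fin.
  - by move=> u _; rewrite mule_ge0// lee_fin.
have : ((eps + 2 * a)%:E <= 0 + (2%:E * a%:E + 2%:E * 0))%E.
  rewrite -(cvg_lim _ lim)//; apply: lime_ge; last exact: nearW.
  by apply/cvg_ex; eexists; exact: lim.
by rewrite mule0 adde0 add0e -EFinM lee_fin; lra.
Qed.

End coefficient_continuity.

(** * The shadow and its distance to the solution *)

Section shadow.
Context (R : realType) (D : nat) d (T : measurableType d) (P : probability T R)
  (F : R -> set (set T)) (dispU : measure_display)
  (U : measurableType dispU) (nu : {sigma_finite_measure set U -> \bar R})
  (b : 'cV[R]_D -> 'cV[R]_D) (sigma : 'cV[R]_D -> 'M[R]_D)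
  (c : 'cV[R]_D -> U -> 'cV[R]_D) (x0 : 'cV[R]_D)
  (W : R -> T -> 'cV[R]_D) (N : R.-ker T ~> (R * U)%type) (X : R -> T -> 'cV[R]_D).
Hypothesis b_continuous : continuous b.
Hypothesis sigma_continuous : continuous sigma.
Hypothesis c_measurable :
  measurable_fun setT (fun p : borel 'cV[R]_D * U => c p.1 p.2 : borel 'cV[R]_D).
Hypothesis c_continuous : forall u, continuous (c ^~ u).
Hypothesis c2_finite : forall x, (\int[nu]_u (enorm (c x u) ^+ 2)%:E < +oo)%E.
Hypothesis c2_continuous : continuous (fun x => \int[nu]_u (enorm (c x u) ^+ 2)%:E)%E.
Hypothesis sol : solves_sde P F nu b sigma c x0 W N X.
Context (tau : R).
Hypothesis tau0 : 0 < tau.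

Let cad := sde_cadlag sol.
Let F_sigma := solution_sigma sol.
Let F_mono := solution_mono sol.
Let mX := solution_measurable sol.

(* The scheme driven by the same noise as [X] whose coefficients are evaluated
   along [X] instead of along the scheme itself. *)
Definition shadow (S : scheme D nu) m k w : 'cV[R]_D := x0 + \sum_(j < k)
  increment W (poisson_increment nu N (@sch_set _ _ _ _ _ S)) (sch_index S (X (grid tau m j) w))
    (grid tau m j) (grid tau m j.+1) w.

(** At a grid time the truncated sums lose exactly the cells from k on, whose increments collapse;
    the shadow then has the same three parts as the equation for X. *)
Lemma shadowE S m k w : (k <= m.+1)%N -> shadow S m k w = x0 +
  \sum_(j < k) (grid tau m j.+1 - grid tau m j) *: sch_drift S (sch_index S (X (grid tau m j) w)) +
  diffusion_sum W X tau S m (grid tau m k) w + jump_sum N X tau S m (grid tau m k) w.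
Proof.
move=> km.
have mins j : (j <= m.+1)%N -> Num.min (grid tau m j) (grid tau m k) = grid tau m (minn j k).
  move=> jm; case: (leqP j k) => jk; first by rewrite min_l// ler_grid.
  by rewrite min_r// ler_grid// ltnW.
have comp0 s A : compensated nu N (`]s, s] `*` A) w = 0.
  by rewrite /compensated set_itvoc0 set0X measure0 /intensity set0I measure0/= subrr.
have wid (f : nat -> 'cV[R]_D) : \sum_(j < k) f j = \sum_(j < m.+1 | (j < k)%N) f j.
  by rewrite (big_ord_widen _ f km).
rewrite /shadow /increment !big_split/= !addrA; congr (_ + _ + _); last first.
  rewrite /jump_sum (bigID (fun j : 'I_m.+1 => (j < k)%N))/= [X in _ = _ + X]big1 ?addr0; last first.
    move=> j; rewrite -leqNgt => kj; apply: big1 => l _.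
    rewrite !mins ?(ltnW (ltn_ord j))//.
    rewrite (minn_idPr kj) (minn_idPr (leq_trans kj (leqnSn j))).
    by rewrite comp0 scale0r.
  rewrite (wid (fun j => \sum_l poisson_increment nu N (@sch_set _ _ _ _ _ S) l (grid tau m j) (grid tau m j.+1) w *:
     sch_jump (s := S) (sch_index S (X (grid tau m j) w)) l)).
  apply: eq_bigr => j jk; apply: eq_bigr => l _.
  by rewrite (mins _ (ltn_ord j)) (mins _ (ltnW (ltn_ord j))) (minn_idPl (ltnW jk)) (minn_idPl jk).
rewrite /diffusion_sum (bigID (fun j : 'I_m.+1 => (j < k)%N))/= [X in _ = _ + X]big1 ?addr0; last first.
  move=> j; rewrite -leqNgt => kj.
  rewrite !mins ?(ltnW (ltn_ord j))//.
  rewrite (minn_idPr kj) (minn_idPr (leq_trans kj (leqnSn j))).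
  by rewrite subrr mulmx0.
rewrite (wid (fun j => sch_diffusion S (sch_index S (X (grid tau m j) w)) *m
   (W (grid tau m j.+1) w - W (grid tau m j) w))).
apply: eq_bigr => j jk.
rewrite !mins ?(ltnW (ltn_ord j))//.
by rewrite (minn_idPl (ltnW jk)) (minn_idPl jk).
Qed.

Lemma measurable_shadow S m k : (k <= m.+1)%N ->
  measurable_fun setT (shadow S m k : T -> borel 'cV[R]_D).
Proof.
move=> km; apply: measurable_entries => i l; under eq_fun do rewrite shadowE// !mxE summxE.
have gk := grid_ge0 tau0 m k.
apply: measurable_funD; first apply: measurable_funD; first apply: measurable_funD.
- exact: measurable_cst.
- apply: measurable_sum => j; under eq_fun do rewrite mxE; apply: measurable_funM => //.
  have h := scheme_coef_at_time sol S (fun n => sch_drift S n i l) (grid_ge0 tau0 m j).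
  exact: (at_time_measurable F_sigma (grid_ge0 tau0 m j) h).
- exact: measurable_entry (measurable_diffusion_sum sol S tau0 m gk).
- exact: measurable_entry (measurable_jump_sum sol S tau0 m gk).
Qed.

Definition shadow_error S K m (eta : R) := ball_event X tau K `&`
  [set w | exists2 k, (k <= m.+1)%N & eta <= enorm (shadow S m k w - X (grid tau m k) w)].

Lemma measurable_shadow_error S K m eta : measurable (shadow_error S K m eta).
Proof.
apply: measurableI; first exact: measurable_ball_event.
rewrite (_ : [set w | _] = \bigcup_(k in `I_m.+2)
    [set w | eta <= enorm (shadow S m k w - X (grid tau m k) w)]); last first.
  by apply/seteqP; split => w [k h1 h2]; exists k.
apply: bigcup_measurable => k /= km; apply: measurable_ge_set; apply: measurable_enormB.
  exact: measurable_shadow.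
exact: mX (grid_ge0 tau0 m k).
Qed.

End shadow.

Section shadow_close.
Context (R : realType) (D : nat) d (T : measurableType d) (P : probability T R)
  (F : R -> set (set T)) (dispU : measure_display)
  (U : measurableType dispU) (nu : {sigma_finite_measure set U -> \bar R})
  (b : 'cV[R]_D -> 'cV[R]_D) (sigma : 'cV[R]_D -> 'M[R]_D)
  (c : 'cV[R]_D -> U -> 'cV[R]_D) (x0 : 'cV[R]_D)
  (W : R -> T -> 'cV[R]_D) (N : R.-ker T ~> (R * U)%type) (X : R -> T -> 'cV[R]_D).
Hypothesis b_continuous : continuous b.
Hypothesis sigma_continuous : continuous sigma.
Hypothesis c_measurable :
  measurable_fun setT (fun p : borel 'cV[R]_D * U => c p.1 p.2 : borel 'cV[R]_D).
Hypothesis c_continuous : forall u, continuous (c ^~ u).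
Hypothesis c2_finite : forall x, (\int[nu]_u (enorm (c x u) ^+ 2)%:E < +oo)%E.
Hypothesis c2_continuous : continuous (fun x => \int[nu]_u (enorm (c x u) ^+ 2)%:E)%E.
Hypothesis sol : solves_sde P F nu b sigma c x0 W N X.
Context (tau : R).
Hypothesis tau0 : 0 < tau.

Let cad := sde_cadlag sol.
Let F_sigma := solution_sigma sol.
Let F_mono := solution_mono sol.
Let mX := solution_measurable sol.

Section fine.
Context (K delta : R) (S : scheme D nu).
Hypothesis delta0 : 0 < delta.
Hypothesis S_fine : fine_scheme b sigma c K delta S.

(** What remains as the mesh shrinks is the accuracy delta of the scheme itself, hence the threshold
    delta tau; in the two quadratic versions that follow it becomes 2 delta^2 tau. *)
Lemma drift_error_cvg a : delta * tau < a ->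
  P (ball_event X tau K `&` [set w | (a%:E <= step_error X tau (drift_gap b S) m w)%E])
    @[m --> \oo] --> 0%E.
Proof.
move=> da; have [M M0 bM] := continuous_ball_bounded K b_continuous.
have le y z : enorm z <= K -> drift_gap b S y z <= enorm (b y - b z) + delta.
  move=> zK; have [h _ _] := S_fine zK.
  by rewrite (le_trans (ler_enorm_distD _ (b z) _))// lerD2l enormB.
apply: (@step_error_cvg R D d T P X tau tau0 cad mX (drift_gap b S) (measurable_drift_gap b_continuous S)
  (fun _ _ => enorm_ge0 _) K (2 * M + delta) delta (ltW delta0) _ _ a da).
- move=> y z yK zK; rewrite (le_trans (le y z zK))// lerD2r.
  by rewrite (le_trans (ler_enormB _ _))// mulrDl mul1r lerD ?bM.
- move=> y eps yK eps0; have /continuous_enormP/(_ y eps eps0)[r r0 hr] := b_continuous.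
  exists r => // z zK yz; rewrite (le_trans (le y z zK))// addrC lerD2l ltW//.
  exact: hr.
Qed.

Lemma diffusion_error_cvg a : 2 * delta ^+ 2 * tau < a ->
  P (ball_event X tau K `&` [set w | (a%:E <= step_error X tau (diffusion_gap sigma S) m w)%E])
    @[m --> \oo] --> 0%E.
Proof.
move=> da; have [M M0 sM] := continuous_ball_bounded K sigma_continuous.
have le y z : enorm z <= K -> diffusion_gap sigma S y z <= 2 * enorm (sigma y - sigma z) ^+ 2 + 2 * delta ^+ 2.
  move=> zK; have [_ h _] := S_fine zK.
  rewrite /diffusion_gap -[_ - sch_diffusion _ _](subrKA (sigma z)) (le_trans (sqr_enormD_le _ _))//.
  by rewrite lerD2l ler_pM2l// enormB ler_pXn2r ?nnegrE ?enorm_ge0// ltW.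
have e0 : 0 <= 2 * delta ^+ 2 by rewrite mulr_ge0// sqr_ge0.
apply: (@step_error_cvg R D d T P X tau tau0 cad mX (diffusion_gap sigma S)
  (measurable_diffusion_gap sigma_continuous S) (fun _ _ => sqr_ge0 _) K
  (2 * (2 * M ^+ 2 + 2 * M ^+ 2) + 2 * delta ^+ 2) (2 * delta ^+ 2) e0 _ _ a da).
- move=> y z yK zK; rewrite (le_trans (le y z zK))// lerD2r ler_pM2l//.
  rewrite (le_trans (sqr_enormD_le _ _))// enormN lerD// ler_pM2l// ler_pXn2r ?nnegrE ?enorm_ge0 ?sM//; exact: ltW.
- move=> y eps yK eps0.
  have e1 : 0 < Num.min (eps / 2) 1 by rewrite lt_min divr_gt0//=.
  have /continuous_enormP/(_ y _ e1)[r r0 hr] := sigma_continuous.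
  exists r => // z zK yz; rewrite (le_trans (le y z zK))// addrC lerD2l.
  have := hr z yz; rewrite lt_min => /andP[h1 h2]; have h0 := enorm_ge0 (sigma y - sigma z).
  by rewrite expr2; nra.
Qed.

Lemma jump_error_cvg a : 2 * delta ^+ 2 * tau < a ->
  P (ball_event X tau K `&` [set w | (a%:E <= step_error X tau (jump_gap c S) m w)%E])
    @[m --> \oo] --> 0%E.
Proof.
move=> da.
have c2_ge0 x : (0 <= \int[nu]_u (enorm (c x u) ^+ 2)%:E)%E.
  by apply: integral_ge0 => u _; rewrite lee_fin sqr_ge0.
have [M M0 cM] := continuous_ereal_ball_bounded c2_ge0 c2_finite c2_continuous K.
have mc := measurable_coefficient c_measurable.
have msq (f : U -> 'cV[R]_D) : measurable_fun setT (f : U -> borel 'cV[R]_D) ->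
    measurable_fun setT (fun u => enorm (f u) ^+ 2).
  by move=> mf; apply: measurable_funX; exact: measurable_borel_real (@continuous_enorm _ _ _) mf.
have le y z : enorm z <= K -> ((jump_gap c S y z)%:E <=
    2%:E * \int[nu]_u (enorm (c y u - c z u) ^+ 2)%:E + (2 * delta ^+ 2)%:E)%E.
  move=> zK; have [_ _ h] := S_fine zK; rewrite (jump_gapE c_measurable c2_finite).
  pose f u := jump_function S (sch_index S z) u.
  apply: (@le_trans _ _ (2%:E * \int[nu]_u (enorm (c y u - c z u) ^+ 2)%:E +
     2%:E * \int[nu]_u (enorm (c z u - f u) ^+ 2)%:E)%E).
    have mf := measurable_jump_function S (sch_index S z).
    apply: (@le_integral_split _ _ _ nu setT (fun u => enorm (c y u - f u) ^+ 2)
      (fun u => enorm (c y u - c z u) ^+ 2) (fun u => enorm (c z u - f u) ^+ 2)) => //.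
    + by apply: measurable_funX; exact: measurable_enormB.
    + by apply: measurable_funX; exact: measurable_enormB.
    + by apply: measurable_funX; exact: measurable_enormB.
    + by move=> u; exact: sqr_ge0.
    + by move=> u; exact: sqr_ge0.
    + by move=> u; exact: sqr_ge0.
    + by move=> u _; rewrite -[c y u - f u](subrKA (c z u)); exact: sqr_enormD_le.
  have -> : (\int[nu]_u (enorm (c z u - f u) ^+ 2)%:E =
      \int[nu]_u (enorm (jump_function S (sch_index S z) u - c z u) ^+ 2)%:E)%E.
    by apply: eq_integral => u _; rewrite enormB.
  by rewrite leeD2l// EFinM lee_pmul2l.
have gap0 y z : 0 <= jump_gap c S y z.
  rewrite -lee_fin (jump_gapE c_measurable c2_finite).
  by apply: integral_ge0 => u _; rewrite lee_fin sqr_ge0.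
have e0 : 0 <= 2 * delta ^+ 2 by rewrite mulr_ge0// sqr_ge0.
apply: (@step_error_cvg R D d T P X tau tau0 cad mX (jump_gap c S) (measurable_jump_gap c_measurable S)
  gap0 K (2 * (2 * M + 2 * M) + 2 * delta ^+ 2) (2 * delta ^+ 2) e0 _ _ a da).
- move=> y z yK zK; rewrite -lee_fin (le_trans (le y z zK))// (EFinD (2 * (2 * M + 2 * M))).
  rewrite leeD2r//.
  rewrite EFinM lee_pmul2l//.
  apply: (@le_trans _ _ (2%:E * \int[nu]_u (enorm (c y u) ^+ 2)%:E +
     2%:E * \int[nu]_u (enorm (c z u) ^+ 2)%:E)%E).
    apply: (@le_integral_split _ _ _ nu setT (fun u => enorm (c y u - c z u) ^+ 2)
      (fun u => enorm (c y u) ^+ 2) (fun u => enorm (c z u) ^+ 2)) => //; try exact: msq.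
    + by apply: measurable_funX; exact: measurable_enormB.
    + by move=> u; exact: sqr_ge0.
    + by move=> u; exact: sqr_ge0.
    + by move=> u; exact: sqr_ge0.
    + by move=> u _; have := sqr_enormD_le (c y u) (- c z u); rewrite enormN.
  by rewrite (EFinD (2 * M)) (EFinM 2 M); apply: leeD; rewrite lee_pmul2l// cM.
- move=> y eps yK eps0; have eps2 : 0 < eps / 2 by rewrite divr_gt0.
  have [r r0 hr] := coefficient_L2_continuous c_measurable c_continuous c2_finite c2_continuous y eps2.
  exists r => // z zK yz; rewrite -lee_fin; apply: (le_trans (le y z zK)).
  rewrite (_ : (2 * delta ^+ 2 + eps)%:E = (2%:E * (eps / 2)%:E + (2 * delta ^+ 2)%:E)%E).
    by apply: leeD => //; rewrite lee_pmul2l// hr.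
  by rewrite -EFinM -EFinD; congr EFin; field.
Qed.

End fine.

(** On the ball event the shadow minus X splits at each grid time into a drift, a diffusion and a
    jump difference; outside it nothing is claimed, as the scheme is accurate on the ball only. *)
Lemma shadow_close K (eta theta : R) : 0 < eta -> 0 < theta ->
  exists2 delta, 0 < delta & forall S : scheme D nu, fine_scheme b sigma c K delta S ->
    \forall m \near \oo, (P (shadow_error x0 W N X tau S K m eta) <= theta%:E)%E.
Proof.
move=> eta0 theta0; pose eta2 : R := (eta / 3) ^+ 2.
have eta20 : 0 < eta2 by rewrite exprn_gt0// divr_gt0.
(* Drift: D coordinates with error [a] add up to at most eta / 4; diffusion and jumps get eta / 3
   each. The two Lenglart bounds are 16 cc / eta2 = theta / 4, and three events of probability at
   most theta / 8 complete the sum to 7 theta / 8. *)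
pose a := eta / (4 * D.+1%:R); pose cc := theta * eta2 / 64.
have a0 : 0 < a by rewrite divr_gt0// mulr_gt0.
have cc0 : 0 < cc by rewrite divr_gt0// mulr_gt0.
(* Both thresholds are met: delta tau <= a / 2 < a, and delta <= 1 gives 2 delta^2 tau <= cc / 2 <
   cc. *)
pose delta := Num.min 1 (Num.min (a / 2) (cc / 4) / tau).
have delta0 : 0 < delta.
  have a2 : 0 < Num.min (a / 2) (cc / 4) by rewrite lt_min; apply/andP; split; rewrite divr_gt0.
  by rewrite /delta lt_min ltr01 divr_gt0.
have dt : delta * tau <= Num.min (a / 2) (cc / 4).
  by rewrite -ler_pdivlMr// ge_min lexx orbT.
have dt1 : delta * tau < a.
  by apply: (le_lt_trans dt); rewrite gt_min; apply/orP; left; lra.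
have dt2 : 2 * delta ^+ 2 * tau < cc.
  have d1 : delta <= 1 by rewrite ge_min lexx.
  have h : delta * tau <= cc / 4 by apply: (le_trans dt); rewrite ge_min lexx orbT.
  have h2 : 0 < delta * tau by rewrite mulr_gt0.
  rewrite expr2; nra.
exists delta => // S Sf.
have [I [J [ito jump eqX]]] := sde_equation sol.
have th8 : 0 < theta / 8 by rewrite divr_gt0.
have evt (p : nat -> \bar R) : p @ \oo --> 0%E -> (forall m, 0 <= p m)%E ->
    \forall m \near \oo, (p m <= (theta / 8)%:E)%E.
  move=> /fine_cvgP[fp /cvgrPdist_le/(_ _ th8) h] p0.
  apply: filterS2 fp h => m fm; rewrite sub0r normrN => h.
  by rewrite -(fineK fm) lee_fin (le_trans (ler_norm _)).
have e1 := evt _ (drift_error_cvg delta0 Sf dt1) (fun=> measure_ge0 _ _).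
have e2 := evt _ (diffusion_error_cvg delta0 Sf dt2) (fun=> measure_ge0 _ _).
have e3 := evt _ (jump_error_cvg Sf dt2) (fun=> measure_ge0 _ _).
apply: filterS3 e1 e2 e3 => m h1 h2 h3.
have [mE4 h4] := diffusion_sum_bound sigma_continuous sol S tau0 m ito eta20 cc0.
have [mE5 h5] := jump_sum_bound c_measurable c2_finite sol S tau0 m jump eta20 cc0.
set E1 := _ `&` _ in h1; set E2 := _ `&` _ in h2; set E3 := _ `&` _ in h3.
set E4 := _ `&` _ in mE4 h4; set E5 := _ `&` _ in mE5 h5.
have mball := measurable_ball_event tau0 cad mX K.
have mse (psi : 'cV[R]_D -> 'cV[R]_D -> R) : measurable_fun setT (fun p : borel 'cV[R]_D * borel 'cV[R]_D => psi p.1 p.2) ->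
    (forall y z, 0 <= psi y z) -> forall r : R, measurable [set w | (r%:E <= step_error X tau psi m w)%E].
  move=> mpsi psi0 r; rewrite -[X in measurable X]setTI; apply: emeasurable_fun_c_infty => //.
  exact: measurable_step_error.
have mE1 : measurable E1.
  apply: measurableI => //; apply: mse; first exact: measurable_drift_gap.
  by move=> y z; exact: enorm_ge0.
have mE2 : measurable E2.
  apply: measurableI => //; apply: mse; first exact: measurable_diffusion_gap.
  by move=> y z; exact: sqr_ge0.
have mE3 : measurable E3.
  apply: measurableI => //; apply: mse; first exact: measurable_jump_gap.
  move=> y z; rewrite -lee_fin (jump_gapE c_measurable c2_finite).
  by apply: integral_ge0 => u _; rewrite lee_fin sqr_ge0.
have sub : {ae P, forall w, shadow_error x0 W N X tau S K m eta w ->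
    (E1 `|` (E2 `|` (E3 `|` (E4 `|` E5)))) w}.
  apply: filterS eqX => w eqw [Bw [k km etak]]; apply: contrapT => nE.
  have n1 : (step_error X tau (drift_gap b S) m w < a%:E)%E.
    by rewrite ltNge; apply/negP => h; apply: nE; left.
  have n2 : (step_error X tau (diffusion_gap sigma S) m w < cc%:E)%E.
    by rewrite ltNge; apply/negP => h; apply: nE; right; left.
  have n3 : (step_error X tau (jump_gap c S) m w < cc%:E)%E.
    by rewrite ltNge; apply/negP => h; apply: nE; right; right; left.
  set t := grid tau m k in etak *.
  have small (v : 'cV[R]_D) : ~ (eta2 <= enorm v ^+ 2) -> enorm v < eta / 3.
    move=> h; rewrite ltNge; apply/negP => h'; apply: h.
    by rewrite ler_pXn2r ?nnegrE ?enorm_ge0// divr_ge0// ltW.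
  have n4 : enorm (diffusion_sum W X tau S m t w - I t w) < eta / 3.
    by apply: small => h; apply: nE; right; right; right; left; split => //; exists k.
  have n5 : enorm (jump_sum N X tau S m t w - J t w) < eta / 3.
    by apply: small => h; apply: nE; right; right; right; right; split => //; exists k.
  pose dr := \sum_(j < k) (grid tau m j.+1 - grid tau m j) *: sch_drift S (sch_index S (X (grid tau m j) w)).
  pose ib := \col_(i < D) (\int[lebesgue_measure]_(r in `[0, t]) (b (X r w) i ord0))%R.
  have n6 : enorm (dr - ib) <= D%:R * a.
    rewrite (le_trans (ler_enorm_entries _))//.
    rewrite (_ : D%:R * a = \sum_(i < D) a); last by rewrite sumr_const card_ord mulr_natl.
    apply: ler_sum => i _; rewrite big_ord1 -lee_fin.
    apply: le_trans (ltW n1); apply: le_trans (drift_riemann_sum b_continuous sol S tau0 i Bw km).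
    rewrite lee_fin distrC !mxE summxE; under eq_bigr do rewrite mxE.
    by rewrite distrC.
  have := eqw t (grid_ge0 tau0 m k); rewrite -/ib => eX.
  move: etak; rewrite leNgt => /negP; apply.
  rewrite shadowE// -/t -/dr eX.
  have -> : x0 + dr + diffusion_sum W X tau S m t w + jump_sum N X tau S m t w -
      (x0 + ib + I t w + J t w) =
    (dr - ib) + ((diffusion_sum W X tau S m t w - I t w) + (jump_sum N X tau S m t w - J t w)).
    by rewrite !opprD; apply/matrixP => i l; rewrite !mxE; ring.
  apply: (le_lt_trans (ler_enormD _ _)); apply: (le_lt_trans (lerD n6 (ler_enormD _ _))).
  have Da : D%:R * a <= eta / 4.
    rewrite /a -[X in X <= _]mulr1 (_ : eta / (4 * D.+1%:R) = (eta / 4) / D.+1%:R); last first.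
      by rewrite invfM mulrA.
    rewrite mulr1 mulrCA ler_piMr ?divr_ge0 ?(ltW eta0)// ler_pdivrMr// mul1r ler_nat//.
  lra.
have mEE : measurable (E1 `|` (E2 `|` (E3 `|` (E4 `|` E5)))).
  by repeat apply: measurableU => //.
have msh := measurable_shadow_error sol tau0 S K m eta.
apply: (le_trans (probability_le_ae msh mEE sub)).
apply: (@le_trans _ _ (P E1 + (P E2 + (P E3 + (P E4 + P E5))))%E).
  apply: (le_trans (measureU2 _ _ _)) => //; first by repeat apply: measurableU => //.
  apply: leeD => //; apply: (le_trans (measureU2 _ _ _)) => //; first by repeat apply: measurableU => //.
  apply: leeD => //; apply: (le_trans (measureU2 _ _ _)) => //; first by repeat apply: measurableU => //.
  apply: leeD => //; exact: measureU2.
apply: (@le_trans _ _ ((theta / 8)%:E + ((theta / 8)%:E + ((theta / 8)%:E +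
   ((16 * cc / eta2)%:E + (16 * cc / eta2)%:E))))%E).
  by repeat apply: leeD => //.
rewrite -!EFinD lee_fin (_ : 16 * cc / eta2 = theta / 4); last first.
  by rewrite /cc; field; rewrite gt_eqF.
lra.
Qed.

End shadow_close.

(** * One step of the coupling *)

Lemma Ex_le_ae d (T : measurableType d) (R : realType) (P : probability T R) (Y Z : T -> R) :
  intg P Y -> intg P Z -> {ae P, forall w, Y w <= Z w} -> Ex P Y <= Ex P Z.
Proof.
move=> iY iZ YZ; have iB := intgB iZ iY; have mB := intg_measurable iB.
rewrite -subr_ge0 -ExB//.
have mM : measurable_fun setT (fun w => Num.max (Z w - Y w) 0).
  by apply: measurable_maxr => //; exact: measurable_cst.
have ae : {ae P, forall w, Z w - Y w = Num.max (Z w - Y w) 0}.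
  by apply: filterS YZ => w h; rewrite max_l// subr_ge0.
have [_ <-] := Ex_ae mB mM ae iB.
by apply: Ex_ge0 => w; rewrite le_max lexx orbT.
Qed.

Lemma continuous_snorm (R : realType) (D : nat) (e : R) : 0 < e ->
  continuous (fun x : 'cV[R]_D => snorm e x).
Proof.
move=> e0 x; apply/(@cvgrPdist_lt _ _ _ (nbhs x) (nbhs_filter x)) => eps eps0; near=> y.
have xy : enorm (x - y) < eps by near: y; exact: near_enorm.
have := snormD_le e0 y (x - y); have := snormD_le e0 x (y - x).
rewrite !subrKC enormB (ltr_norml (snorm e x - snorm e y)) => h1 h2.
by apply/andP; split; lra.
Unshelve. all: by end_near. Qed.

Section one_step.
Context (R : realType) (D : nat) d (T : measurableType d) (P : probability T R)
  (F : R -> set (set T)).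
Hypothesis F_sigma : forall t : R, 0 <= t -> sigma_algebra setT (F t) /\ F t `<=` measurable.
Context (xi : 'I_D -> R -> R -> T -> R) (J : finType) (pi : J -> R -> R -> T -> R)
  (lam : J -> R).
Hypothesis nzW : noise P F xi (fun l k => (l == k)%:R).
Hypothesis nzN : noise P F pi (fun j k => if j == k then lam j else 0).
Hypothesis lam_ge0 : forall j, 0 <= lam j.
Let cnt j s t w := pi j s t w + (t - s) * lam j.
Hypothesis cnt_nat : forall s t, 0 <= s -> s < t ->
  {ae P, forall w, forall j, exists k : nat, cnt j s t w = k%:R}.
Hypothesis cnt_xi : forall s t j l, 0 <= s -> s < t ->
  intg P (fun w => cnt j s t w * `|xi l s t w|) /\
  Ex P (fun w => cnt j s t w * `|xi l s t w|) = (t - s) * lam j * Ex P (fun w => `|xi l s t w|).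
Context (B e : R).
Hypothesis B_ge0 : 0 <= B.
Hypothesis e_gt0 : 0 < e.

Section step.
Context (s t : R).
Hypothesis s_ge0 : 0 <= s.
Hypothesis s_lt : s < t.
Context (A : set T) (v alpha : T -> 'cV[R]_D) (beta : T -> 'M[R]_D) (gam : J -> T -> 'cV[R]_D) (M : R).
Hypothesis FA : F s A.
Hypothesis v_known : forall i, known F s (fun w => v w i ord0).
Hypothesis alpha_known : forall i, known F s (fun w => alpha w i ord0).
Hypothesis beta_known : forall i l, known F s (fun w => beta w i l).
Hypothesis gam_known : forall j i, known F s (fun w => gam j w i ord0).
Hypothesis v_le : forall w, A w -> enorm (v w) <= M.
Hypothesis alpha_le : forall w, enorm (alpha w) <= B.
Hypothesis beta_le : forall w, enorm (beta w) <= B.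
Hypothesis gam_le : forall j w, enorm (gam j w) <= B.

Let h := t - s.
Let h_gt0 : 0 < h. Proof. by rewrite subr_gt0. Qed.
Let s_le : s <= t. Proof. exact: ltW. Qed.

Definition step_increment w : 'cV[R]_D := h *: alpha w +
  beta w *m (\col_l xi l s t w) + \sum_j pi j s t w *: gam j w.

(** Upper bound for the drift that Ito's formula gives for [snorm] of the gap at the start of the
    step: the negative second-order term is left out and the compensated jump part is replaced by
    [jump_size]. *)
Definition step_generator w : R := mdot (v w) (alpha w) / snorm e (v w) +
  enorm (beta w) ^+ 2 / (2 * snorm e (v w)) +
  \sum_j lam j * jump_size (snorm e (v w)) (enorm (gam j w)).

Let phi w := snorm e (v w).
Let phi_gt0 w : 0 < phi w. Proof. exact: snorm_gt0. Qed.
Let e_phi w : e <= phi w. Proof. exact: ler_snorm. Qed.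

(** Bounded functions known at time s: the admissible multipliers of a noise increment. *)
Let kb (Y : T -> R) := known F s Y /\ exists M, forall w, `|Y w| <= M.

Let kM (Y Z : T -> R) : known F s Y -> known F s Z -> known F s (fun w => Y w * Z w).
Proof. by move=> kY kZ; exact (@measurable_funM _ (at_time F s) R setT _ _ kY kZ). Qed.

Let kbM Y Z : kb Y -> kb Z -> kb (fun w => Y w * Z w).
Proof.
move=> [kY [MY hY]] [kZ [MZ hZ]]; split; first exact: kM.
by exists (MY * MZ) => w; rewrite normrM ler_pM.
Qed.

Let kbD Y Z : kb Y -> kb Z -> kb (fun w => Y w + Z w).
Proof.
move=> [kY [MY hY]] [kZ [MZ hZ]]; split.
  exact (@measurable_funD _ (at_time F s) R setT _ _ kY kZ).
by exists (MY + MZ) => w; rewrite (le_trans (ler_normD _ _))// lerD.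
Qed.

Let kb_cst (r : R) : kb (cst r).
Proof. by split; [exact: measurable_cst | exists `|r|]. Qed.

Let kb_sum (I : finType) (Y : I -> T -> R) : (forall i, kb (Y i)) -> kb (fun w => \sum_i Y i w).
Proof.
move=> kY; have [f hf] := choice (fun i => (kY i).2); split.
  by apply: measurable_sum => i; exact: (kY i).1.
exists (\sum_i f i) => w; rewrite (le_trans (ler_norm_sum _ _ _))//.
by apply: ler_sum => i _; exact: hf.
Qed.

Let kb_intg Y : kb Y -> intg P Y.
Proof.
move=> [kY [MY hY]]; apply: (@intg_bounded _ _ _ _ _ MY) => //.
exact: (known_measurable F_sigma s_ge0 kY).
Qed.

Let kb1 : kb (\1_A : T -> R).
Proof.
split; first exact: known_indic.
by exists 1 => w; rewrite indicE; case: (_ \in _); rewrite ?normr1 ?normr0.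
Qed.

Let kb_v i : kb (fun w => \1_A w * v w i ord0).
Proof.
split; first exact: kM kb1.1 (v_known i).
exists `|M| => w; rewrite normrM indicE.
case: (boolP (w \in A)) => [/set_mem wA|_]; last by rewrite normr0 mul0r.
by rewrite normr1 mul1r (le_trans (ler_entry_enorm _ _ _))// (le_trans (v_le wA))// ler_norm.
Qed.

Let kb_alpha i : kb (fun w => alpha w i ord0).
Proof. by split => //; exists B => w; rewrite (le_trans (ler_entry_enorm _ _ _)). Qed.

Let kb_beta i l : kb (fun w => beta w i l).
Proof. by split => //; exists B => w; rewrite (le_trans (ler_entry_enorm _ _ _)). Qed.

Let kb_gam j i : kb (fun w => gam j w i ord0).
Proof. by split => //; exists B => w; rewrite (le_trans (ler_entry_enorm _ _ _)). Qed.

Let v_at_time : measurable_fun setT (v : at_time F s -> borel 'cV[R]_D).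
Proof. by apply: measurable_entries => i j; rewrite (ord1 j); exact: v_known. Qed.

Let kb_phiV : kb (fun w => (phi w)^-1).
Proof.
split.
  have cV : continuous (fun x : 'cV[R]_D => (snorm e x)^-1).
    move=> x; apply: (@cvgV _ _ _ (nbhs_filter x)); first by rewrite gt_eqF// snorm_gt0.
    exact: continuous_snorm.
  exact: (measurable_borel_real cV v_at_time).
exists e^-1 => w; rewrite ger0_norm ?invr_ge0 ?(ltW (phi_gt0 _))//.
by rewrite lef_pV2 ?posrE.
Qed.

(** The factor 1 / (2 phi) of the quadratic diffusion term is moved inside the square, because
    [noise_cov] evaluates squares of linear combinations with known coefficients. *)
Let kb_phi_sqrt : kb (fun w => Num.sqrt ((2 * phi w)^-1)).
Proof.
split.
  have cV : continuous (fun x : 'cV[R]_D => Num.sqrt ((2 * snorm e x)^-1)).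
    move=> x; apply: (@continuous_comp _ _ _ (fun x : 'cV[R]_D => (2 * snorm e x)^-1) (@Num.sqrt R)).
      apply: (@cvgV _ _ _ (nbhs_filter x)).
        by rewrite gt_eqF// mulr_gt0// snorm_gt0.
      by apply: cvgMr; exact: continuous_snorm.
    exact: sqrt_continuous.
  exact: (measurable_borel_real cV v_at_time).
exists (Num.sqrt ((2 * e)^-1)) => w; rewrite ger0_norm ?sqrtr_ge0// ler_sqrt ?invr_ge0 ?mulr_ge0 ?(ltW e_gt0)//.
by rewrite lef_pV2 ?posrE ?mulr_gt0// ler_pM2l.
Qed.

Let kb_enorm_gam j : kb (fun w => enorm (gam j w)).
Proof.
split; last by exists B => w; rewrite ger0_norm ?enorm_ge0.
have mg : measurable_fun setT (gam j : at_time F s -> borel 'cV[R]_D).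
  by apply: measurable_entries => i k; rewrite (ord1 k); exact: gam_known.
exact: (measurable_borel_real (@continuous_enorm R D 1) mg).
Qed.

Let kb_jump j : kb (fun w => jump_size (phi w) (enorm (gam j w))).
Proof.
split; last first.
  exists (2 * B) => w; rewrite ger0_norm ?jump_size_ge0 ?enorm_ge0//.
  by rewrite ge_min; apply/orP; right; rewrite ler_pM2l.
have E : (fun w => jump_size (phi w) (enorm (gam j w))) =
    (fun w => Num.min ((enorm (gam j w) * enorm (gam j w)) * (2^-1 * (phi w)^-1)) (2 * enorm (gam j w))).
  by apply/funext => w; rewrite /jump_size expr2 invfM.
rewrite E; apply: (@measurable_minr _ (at_time F s)).
  have h1 := kbM (kbM (kb_enorm_gam j) (kb_enorm_gam j)) (kbM (kb_cst 2^-1) kb_phiV).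
  exact: h1.1.
have h2 := kbM (kb_cst 2) (kb_enorm_gam j); exact: h2.1.
Qed.

Let mart (I : finType) (zeta : I -> R -> R -> T -> R) (V : I -> I -> R) (nz : noise P F zeta V) i Y :
  kb Y -> intg P (fun w => Y w * zeta i s t w) /\ Ex P (fun w => Y w * zeta i s t w) = 0.
Proof. by move=> kY; apply: (noise_mean nz i s_ge0 s_le) (kb_intg kY); exact: kY.1. Qed.

Let Lam := \sum_j lam j.
Let Lam_ge0 : 0 <= Lam. Proof. exact: sumr_ge0. Qed.
Let C0 := B + Lam * B.

(** [noise_cov] with the coefficients that select the coordinate l. *)
Let xi_sqr l : Ex P (fun w => xi l s t w ^+ 2) <= h.
Proof.
have := @noise_cov _ _ _ _ _ _ _ _ nzW s t (fun k w => (k == l)%:R) 1 s_ge0 s_le _ _.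
rewrite (_ : (fun w => _) = (fun w => xi l s t w ^+ 2)); last first.
  apply/funext => w; rewrite (bigD1 l)//= eqxx mul1r big1 ?addr0// => k /negPf ->.
  by rewrite mul0r.
rewrite (_ : (fun w => quad _ _) = cst 1) ?Ex_cst ?mulr1; last first.
  apply/funext => w; rewrite /quad (bigD1 l)//= [X in _ + X]big1 ?addr0.
    rewrite (bigD1 l)//= big1 ?addr0 ?eqxx ?mulr1// => k /negPf kl.
    by rewrite kl mulr0 mulr0.
  by move=> k /negPf kl; rewrite big1// => k' _; rewrite kl mul0r mulr0.
apply.
  by move=> k; exact: measurable_cst.
by move=> k w; case: (k == l); rewrite ?normr1 ?normr0.
Qed.

Let mxi l : measurable_fun setT (xi l s t) := noise_measurable F_sigma nzW l s_ge0 s_le.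
Let mpi j : measurable_fun setT (pi j s t) := noise_measurable F_sigma nzN j s_ge0 s_le.
Let ixi l : intg P (xi l s t) := intg_sqr (mxi l) (noise_sqr nzW l s_ge0 s_le).
Let ipi j : intg P (pi j s t) := intg_sqr (mpi j) (noise_sqr nzN j s_ge0 s_le).

(** By the pointwise bound |x| <= x^2 / (2 sqrt h) + sqrt h / 2. *)
Let abs_xi l : Ex P (fun w => `|xi l s t w|) <= Num.sqrt h.
Proof.
have sh : 0 < Num.sqrt h by rewrite sqrtr_gt0.
have i1 : intg P (fun w => (2 * Num.sqrt h)^-1 * xi l s t w ^+ 2).
  by apply: intgZ; exact: (noise_sqr nzW l s_ge0 s_le).
have i2 : intg P (cst (Num.sqrt h / 2)) by exact: intg_cst.
apply: (le_trans (Ex_le (intg_norm (ixi l)) (intgD i1 i2) _)).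
  move=> w; rewrite -[xi l s t w ^+ 2]real_normK ?num_real//; set a := `|_|.
  have h1 : 0 <= (a - Num.sqrt h) ^+ 2 / (2 * Num.sqrt h).
    by rewrite divr_ge0 ?sqr_ge0// mulr_ge0// ltW.
  rewrite -subr_ge0 (_ : _ - a = (a - Num.sqrt h) ^+ 2 / (2 * Num.sqrt h))//.
  by rewrite /=; field; rewrite gt_eqF.
rewrite ExD// Ex_cst ExZ; last exact: (noise_sqr nzW l s_ge0 s_le).
have hE : (2 * Num.sqrt h)^-1 * h = Num.sqrt h / 2.
  by rewrite -{2}(sqr_sqrtr (ltW h_gt0)); field; rewrite gt_eqF.
have c0 : 0 <= (2 * Num.sqrt h)^-1 by rewrite invr_ge0 mulr_ge0// ltW.
by have := ler_wpM2l c0 (xi_sqr l); rewrite hE; lra.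
Qed.

Let sqsum (I : finType) (zeta : I -> R -> R -> T -> R) (V : I -> I -> R)
    (nz : noise P F zeta V) (a : I -> T -> R) : (forall l, kb (a l)) ->
  intg P (fun w => (\sum_l a l w * zeta l s t w) ^+ 2) /\
  Ex P (fun w => (\sum_l a l w * zeta l s t w) ^+ 2) <= h * Ex P (fun w => quad V (fun l => a l w)).
Proof.
move=> ka; have [f hf] := choice (fun l => (ka l).2); split; last first.
  apply: (noise_cov nz (M := \sum_l `|f l|) s_ge0 s_le) => [l|l w]; first exact: (ka l).1.
  rewrite (le_trans (hf l w))// (le_trans (ler_norm _))// (bigD1 l)//= lerDl.
  by apply: sumr_ge0.
have mz l : measurable_fun setT (zeta l s t) := noise_measurable F_sigma nz l s_ge0 s_le.
have ma l : measurable_fun setT (a l) := known_measurable F_sigma s_ge0 (ka l).1.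
have ii l : intg P (fun w => (a l w * zeta l s t w) ^+ 2).
  under eq_fun do rewrite exprMn.
  apply: (@intg_mul_bounded _ _ _ _ _ _ (f l ^+ 2)).
  - exact: measurable_funX.
  - by move=> w; rewrite normrX ler_pXn2r ?nnegrE// (le_trans _ (hf l w)).
  exact: (noise_sqr nz).
under eq_fun do rewrite expr2 mulr_suml.
apply: intg_sum => l; under eq_fun do rewrite mulr_sumr.
by apply: intg_sum => k; apply: intg_mul_sqr => //; exact: measurable_funM.
Qed.

Let quad_diag (I : finType) (V : I -> I -> R) (a : I -> R) :
  (forall i j, i != j -> V i j = 0) -> quad V a = \sum_i V i i * a i ^+ 2.
Proof.
move=> V0; apply: eq_bigr => i _; rewrite (bigD1 i)//= big1 ?addr0; first by ring.
by move=> j ji; rewrite V0 1?eq_sym//; ring.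
Qed.

(** [snorm_one_step] is integrated over A. The majorant Y separates terms known at time s,
    martingale increments with mean 0, the squared diffusion part, whose mean yields the
    second-order term of the generator, and remainders of order h^2 and h^(3/2): the square of the
    compensated drift, jumps meeting the rest of the increment, and pairs of jumps. *)
Lemma one_step_expectation :
  [/\ intg P (fun w => \1_A w * (snorm e (v w + step_increment w) - snorm e (v w))),
  intg P (fun w => \1_A w * step_generator w) &
  Ex P (fun w => \1_A w * (snorm e (v w + step_increment w) - snorm e (v w))) <=
  h * Ex P (fun w => \1_A w * step_generator w) +
  (C0 ^+ 2 / (2 * e) + 2 * C0 * Lam + 2 * B * Lam ^+ 2) * h ^+ 2 +
  (2 * D%:R ^+ 2 * B * Lam) * (h * Num.sqrt h)].
Proof.
(* The indicator is part of the weight because v is bounded on A only. *)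
pose psi w := \1_A w / phi w.
have psi0 w : 0 <= psi w by rewrite divr_ge0// ltW.
have psi_e w : psi w <= e^-1.
  rewrite /psi indicE; case: (_ \in _); rewrite ?mul1r ?mul0r ?invr_ge0 ?(ltW e_gt0)//.
  by rewrite lef_pV2 ?posrE.
have kpsi : kb psi by exact: kbM kb1 kb_phiV.
pose bx w : 'cV[R]_D := beta w *m (\col_l xi l s t w).
(* Jumps will be counted without compensation, so their compensator is subtracted from the drift. *)
pose c0 w : 'cV[R]_D := alpha w - \sum_j lam j *: gam j w.
pose a0 w : 'cV[R]_D := h *: c0 w + bx w.
pose Nn w := \sum_j cnt j s t w.
pose X1 w := \sum_l `|xi l s t w|.
pose Jj j w := jump_size (phi w) (enorm (gam j w)).
have kc0 i : kb (fun w => c0 w i ord0).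
  have E : (fun w => c0 w i ord0) = (fun w => alpha w i ord0 + \sum_j (- lam j) * gam j w i ord0).
    apply/funext => w; rewrite !mxE summxE -sumrN; congr (_ + _).
    by apply: eq_bigr => j _; rewrite mxE mulNr.
  by rewrite E; apply: kbD => //; apply: kb_sum => j; exact: kbM (kb_cst _) (kb_gam j i).
have c0C w : enorm (c0 w) <= C0.
  rewrite (le_trans (ler_enormB _ _))// lerD// (le_trans (ler_enorm_sum _ _ _))//.
  rewrite /Lam mulr_suml; apply: ler_sum => j _.
  by rewrite enormZ ger0_norm// ler_wpM2l.
have C00 : 0 <= C0 by rewrite addr_ge0// mulr_ge0.
have incE w : step_increment w = a0 w + \sum_j cnt j s t w *: gam j w.
  rewrite /step_increment /a0 /c0 scalerBr -/(bx w) scaler_sumr.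
  under [X in _ = _ + X]eq_bigr do rewrite /cnt scalerDl -scalerA.
  by rewrite big_split/=; apply/matrixP => i k; rewrite !mxE; ring.
have bxX w : enorm (bx w) <= D%:R * B * X1 w.
  rewrite (le_trans (ler_enorm_entries _))//.
  rewrite (_ : D%:R * B * X1 w = \sum_(i < D) B * X1 w); last first.
    by rewrite sumr_const card_ord -mulrA mulr_natl.
  apply: ler_sum => i _; rewrite big_ord1 mxE (le_trans (ler_norm_sum _ _ _))// /X1 mulr_sumr.
  apply: ler_sum => l _; rewrite mxE normrM ler_wpM2r//.
  by rewrite (le_trans (ler_entry_enorm _ _ _)).
pose q0 w := h * (psi w * mdot (v w) (alpha w)) + 2^-1 * psi w * (h ^+ 2 * enorm (c0 w) ^+ 2) +
  h * (\1_A w * \sum_j lam j * Jj j w).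
pose zl l w := \sum_i (psi w * v w i ord0 + h * (psi w * c0 w i ord0)) * beta w i l.
pose zj j w := psi w * mdot (v w) (gam j w) + \1_A w * Jj j w.
pose al i l w := (\1_A w * Num.sqrt ((2 * phi w)^-1)) * beta w i l.
pose S2 w := \sum_i (\sum_l al i l w * xi l s t w) ^+ 2.
pose R1 w := \sum_j ((2 * (h * C0)) * cnt j s t w +
  (2 * (D%:R * B)) * \sum_l cnt j s t w * `|xi l s t w|).
pose Spi w := \sum_j pi j s t w.
(* This is 2B Nn(Nn - 1) written with Nn = Spi + h Lam, where [Spi] is centred with variance at most
   h Lam; hence its mean is at most 2B (h Lam)^2. *)
pose R2 w := 2 * B * (Spi w ^+ 2 + (2 * (h * Lam) - 1) * Spi w + ((h * Lam) ^+ 2 - h * Lam)).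
pose Y w := q0 w + \sum_l zl l w * xi l s t w + \sum_j zj j w * pi j s t w + S2 w + R1 w + R2 w.
pose g1 w := psi w * mdot (v w) (alpha w).
pose g2 w := 2^-1 * psi w * enorm (beta w) ^+ 2.
pose g3 w := \1_A w * \sum_j lam j * Jj j w.
pose r0 w := 2^-1 * psi w * (h ^+ 2 * enorm (c0 w) ^+ 2).
have mdotc (x y : 'cV[R]_D) : mdot x y = \sum_i x i ord0 * y i ord0.
  by rewrite /mdot; apply: eq_bigr => i _; rewrite big_ord1.
have kext (Y1 Y2 : T -> R) : Y1 =1 Y2 -> kb Y1 -> kb Y2 by move=> /funext ->.
have kpv i : kb (fun w => psi w * v w i ord0).
  apply: (kext (fun w => (\1_A w * v w i ord0) * (phi w)^-1)); last exact: kbM (kb_v i) kb_phiV.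
  by move=> w; rewrite /psi mulrAC.
have kg1 : kb g1.
  apply: (kext (fun w => \sum_i (psi w * v w i ord0) * alpha w i ord0)).
    by move=> w; rewrite /g1 mdotc mulr_sumr; apply: eq_bigr => i _; rewrite mulrA.
  by apply: kb_sum => i; exact: kbM (kpv i) (kb_alpha i).
have kg2 : kb g2.
  apply: (kext (fun w => (2^-1 * psi w) * \sum_i \sum_l beta w i l * beta w i l)).
    by move=> w; rewrite /g2 sqr_enormE; congr (_ * _).
  apply: kbM; first exact: kbM (kb_cst _) kpsi.
  by apply: kb_sum => i; apply: kb_sum => l; exact: kbM (kb_beta i l) (kb_beta i l).
have kg3 : kb g3.
  by apply: kbM kb1 _; apply: kb_sum => j; exact: kbM (kb_cst _) (kb_jump j).
have kr0 : kb r0.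
  apply: (kext (fun w => (2^-1 * psi w) * (h ^+ 2 * \sum_i c0 w i ord0 * c0 w i ord0))).
    by move=> w; rewrite /r0 sqr_enorm mdotc.
  apply: kbM; first exact: kbM (kb_cst _) kpsi.
  by apply: kbM (kb_cst _) _; apply: kb_sum => i; exact: kbM (kc0 i) (kc0 i).
have kq0 : kb q0.
  apply: kbD; last exact: kbM (kb_cst _) kg3.
  by apply: kbD kr0; exact: kbM (kb_cst _) kg1.
have kzl l : kb (zl l).
  apply: kb_sum => i; apply: kbM (kb_beta i l); apply: kbD (kpv i) _.
  by apply: kbM (kb_cst _) _; exact: kbM kpsi (kc0 i).
have kzj j : kb (zj j).
  apply: kbD; last exact: kbM kb1 (kb_jump j).
  apply: (kext (fun w => \sum_i (psi w * v w i ord0) * gam j w i ord0)).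
    by move=> w; rewrite mdotc mulr_sumr; apply: eq_bigr => i _; rewrite mulrA.
  by apply: kb_sum => i; exact: kbM (kpv i) (kb_gam j i).
have kal i l : kb (al i l) by apply: kbM (kb_beta i l); exact: kbM kb1 kb_phi_sqrt.
have GE w : \1_A w * step_generator w = g1 w + g2 w + g3 w.
  rewrite /step_generator /g1 /g2 /g3 /psi -/(phi w) !mulrDr; congr (_ + _ + _).
    by rewrite mulrAC mulrA.
  by rewrite invfM; ring.
have aeY : {ae P, forall w, \1_A w * (snorm e (v w + step_increment w) - snorm e (v w)) <= Y w}.
  apply: filterS (cnt_nat s_ge0 s_lt) => w natw.
  have [n nE] := choice natw.
  have NnE : Nn w = \sum_j (n j)%:R by apply: eq_bigr => j _; rewrite nE.
  have NnZ : Nn w = (\sum_j n j)%:R by rewrite NnE natr_sum.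
  have Nn0 : 0 <= Nn w by rewrite NnZ.
  have NnN : 0 <= Nn w * (Nn w - 1).
    rewrite NnZ; case: (\sum_j n j)%N => [|k]; first by rewrite mul0r.
    by rewrite mulr_ge0// -natr1 addrK.
  have R1E : R1 w = Nn w * (2 * (h * C0 + D%:R * B * X1 w)).
    rewrite /R1 big_split/= -!mulr_sumr; under [X in _ + _ * X = _]eq_bigr do rewrite -mulr_sumr.
    by rewrite -mulr_suml -/(X1 w) -/(Nn w); ring.
  have X10 : 0 <= X1 w by apply: sumr_ge0.
  have R1ge : 2 * Nn w * enorm (a0 w) <= R1 w.
    rewrite R1E [leRHS]mulrCA -mulrA ler_pM2l// ler_wpM2l// (le_trans (ler_enormD _ _))// lerD//.
    by rewrite enormZ ger0_norm ?(ltW h_gt0)// ler_pM2l.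
  have NnS : Nn w = Spi w + h * Lam.
    by rewrite /Nn /cnt big_split/= mulr_sumr.
  have R2E : R2 w = 2 * B * (Nn w * (Nn w - 1)) by rewrite NnS /R2; ring.
  have R2ge : 0 <= R2 w by rewrite R2E mulr_ge0// mulr_ge0.
  have R1ge0 : 0 <= R1 w.
    by apply: le_trans R1ge; rewrite mulr_ge0 ?enorm_ge0// mulr_ge0.
  have S20 : 0 <= S2 w by apply: sumr_ge0 => i _; exact: sqr_ge0.
  (* Outside A the left side is 0, and so is Y up to [S2], [R1] and [R2], which are nonnegative. *)
  rewrite /Y; have [/set_mem wA|wA] := boolP (w \in A); last first.
    have i0 : \1_A w = 0 :> R by rewrite indicE (negPf wA).
    have psiw : psi w = 0 by rewrite /psi i0 mul0r.
    rewrite /q0 psiw i0 !(mul0r, mulr0) !add0r.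
    rewrite big1 ?add0r; last by move=> l _; rewrite /zl big1 ?mul0r// => i _; rewrite psiw; ring.
    rewrite big1 ?add0r; last by move=> j _; rewrite /zj psiw i0; ring.
    by rewrite !addr_ge0.
  have i1 : \1_A w = 1 :> R by rewrite indicE mem_set.
  have psiw : psi w = (phi w)^-1 by rewrite /psi i1 mul1r.
  have incn : step_increment w = a0 w + \sum_j (n j)%:R *: gam j w.
    by rewrite incE; congr (_ + _); apply: eq_bigr => j _; rewrite nE.
  have := snorm_one_step e_gt0 (v w) B_ge0 (fun j => gam_le j w) incn NnE.
  rewrite -/(phi w) i1 mul1r lerBlDl => /le_trans; apply.
  rewrite -R2E.
  have e1 : mdot (v w) (step_increment w) / phi w = h * g1 w +
      psi w * mdot (v w) (bx w) + \sum_j psi w * mdot (v w) (gam j w) * pi j s t w.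
    rewrite /step_increment -/(bx w) !mdotDr mdotZr mdot_sumr /g1 psiw.
    rewrite (mulrDl _ (\sum_j _)) mulr_suml (mulrDl (h * _)).
    congr (_ + _ + _); [by rewrite -mulrA; congr (_ * _); exact: mulrC|exact: mulrC|].
    by apply: eq_bigr => j _; rewrite mdotZr mulrC mulrCA mulrC.
  have e2 : enorm (a0 w) ^+ 2 / (2 * phi w) = r0 w + h * (psi w * mdot (c0 w) (bx w)) +
      2^-1 * psi w * enorm (bx w) ^+ 2.
    rewrite /a0 sqr_enormD enormZ exprMn mdotZl psiw /r0 psiw real_normK ?num_real//.
    by field; rewrite gt_eqF.
  have e3 : \sum_l zl l w * xi l s t w = psi w * mdot (v w) (bx w) + h * (psi w * mdot (c0 w) (bx w)).
    have E (y : 'cV[R]_D) : mdot y (bx w) = \sum_l \sum_i y i ord0 * beta w i l * xi l s t w.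
      rewrite mdotc exchange_big/=; apply: eq_bigr => i _; rewrite mxE mulr_sumr.
      by apply: eq_bigr => l _; rewrite mxE mulrA.
    rewrite !E !mulr_sumr -big_split/=; apply: eq_bigr => l _.
    rewrite /zl mulr_suml !mulr_sumr -big_split/=; apply: eq_bigr => i _; ring.
  have e4 : S2 w = 2^-1 * psi w * enorm (bx w) ^+ 2.
    rewrite sqr_enormE mulr_sumr; apply: eq_bigr => i _; rewrite big_ord1 mxE.
    have -> : \sum_l al i l w * xi l s t w = Num.sqrt ((2 * phi w)^-1) * \sum_l beta w i l * xi l s t w.
      by rewrite mulr_sumr; apply: eq_bigr => l _; rewrite /al i1; ring.
    rewrite exprMn sqr_sqrtr ?invr_ge0 ?mulr_ge0 ?(ltW (phi_gt0 _))// psiw invfM.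
    by congr (_ * _ ^+ 2); apply: eq_bigr => l _; rewrite mxE.
  (* The compensated sum with coefficients [zj] and the jump part of the generator recombine into
     the first-order jump terms and the raw counts times [jump_size]. *)
  have e5 : \sum_j zj j w * pi j s t w + h * g3 w =
     \sum_j psi w * mdot (v w) (gam j w) * pi j s t w + \sum_j (n j)%:R * Jj j w.
    rewrite /g3 i1 mul1r mulr_sumr -!big_split/=; apply: eq_bigr => j _.
    by rewrite /zj i1 -nE /cnt /h; ring.
  have -> : q0 w = h * g1 w + r0 w + h * g3 w by [].
  rewrite e1 e2 e3 e4; move: e5 R1ge; rewrite /Jj.
  set z1 := \sum_j zj j w * _; set z2 := \sum_j psi w * _ * _; set z3 := \sum_j _ * jump_size _ _.
  set z4 := 2^-1 * _ * _; set z5 := 2 * Nn w * _; set z6 := h * (psi w * _); set z7 := psi w * _.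
  move: z1 z2 z3 z4 z5 z6 z7 (h * g1 w) (r0 w) (h * g3 w) (R1 w) (R2 w) (phi w) => *; lra.
have mv : measurable_fun setT (v : T -> borel 'cV[R]_D).
  by apply: measurable_entries => i j; rewrite (ord1 j); exact: (known_measurable F_sigma s_ge0 (v_known i)).
have minc : measurable_fun setT (fun w => v w + step_increment w : borel 'cV[R]_D).
  apply: measurable_entries => i j; rewrite (ord1 j).
  rewrite (_ : (fun w => _) = (fun w => v w i ord0 + (h * alpha w i ord0 +
     \sum_l beta w i l * xi l s t w + \sum_k pi k s t w * gam k w i ord0))); last first.
    apply/funext => w; rewrite !mxE summxE; congr (_ + (_ + _ + _)).
      by apply: eq_bigr => l _; rewrite mxE.
    by apply: eq_bigr => k _; rewrite mxE.
  apply: measurable_funD; first exact: (known_measurable F_sigma s_ge0 (v_known i)).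
  apply: measurable_funD.
    apply: measurable_funD.
      by apply: measurable_funM => //; exact: (known_measurable F_sigma s_ge0 (alpha_known i)).
    apply: measurable_sum => l; apply: measurable_funM => //.
    exact: (known_measurable F_sigma s_ge0 (beta_known i l)).
  apply: measurable_sum => k; apply: measurable_funM => //.
  exact: (known_measurable F_sigma s_ge0 (gam_known k i)).
have m1 : measurable_fun setT (\1_A : T -> R) := known_measurable F_sigma s_ge0 kb1.1.
have iX1 : intg P X1 by apply: intg_sum => l; exact: intg_norm.
have iL : intg P (fun w => \1_A w * (snorm e (v w + step_increment w) - snorm e (v w))).
  have iG : intg P (fun w => h * B + D%:R * B * X1 w + \sum_j B * `|pi j s t w|).
    apply: intgD; last by apply: intg_sum => j; exact/intgZ/intg_norm.
    by apply: intgD; [exact: intg_cst | exact: intgZ].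
  apply: (intg_le _ _ iG).
    apply: measurable_funM => //; apply: measurable_funB.
      exact: (measurable_borel_real (continuous_snorm e_gt0) minc).
    exact: (measurable_borel_real (continuous_snorm e_gt0) mv).
  move=> w; have : `|snorm e (v w + step_increment w) - snorm e (v w)| <= enorm (step_increment w).
    have := snormD_le e_gt0 (v w) (step_increment w).
    have := snormD_le e_gt0 (v w + step_increment w) (- step_increment w).
    rewrite addrK enormN ler_norml => h1 h2.
    by apply/andP; split; lra.
  have e1 : enorm (step_increment w) <= h * B + D%:R * B * X1 w + \sum_j B * `|pi j s t w|.
    rewrite (le_trans (ler_enormD _ _))// lerD//.
      rewrite (le_trans (ler_enormD _ _))// lerD//; last exact: bxX.
      by rewrite enormZ ger0_norm ?(ltW h_gt0)// ler_pM2l.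
    rewrite (le_trans (ler_enorm_sum _ _ _))//; apply: ler_sum => j _.
    by rewrite enormZ mulrC ler_wpM2r.
  move=> e2; rewrite normrM; apply: le_trans (le_trans e2 e1).
  by rewrite indicE; case: (w \in A); rewrite ?normr1 ?normr0 ?mul1r ?mul0r.
have izl l := mart nzW l (kzl l).
have izj j := mart nzN j (kzj j).
have iSi i := sqsum nzW (kal i).
have [iSpi ESpi] := sqsum nzN (fun _ => kb_cst 1).
have Spi1 : (fun w => (\sum_j cst 1 w * pi j s t w) ^+ 2) = (fun w => Spi w ^+ 2).
  by apply/funext => w; congr (_ ^+ 2); apply: eq_bigr => j _; rewrite /= mul1r.
move: iSpi ESpi; rewrite Spi1 => iSpi ESpi.
have {}ESpi : Ex P (fun w => Spi w ^+ 2) <= h * Lam.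
  apply: le_trans ESpi _; rewrite (_ : (fun w => quad _ _) = cst Lam) ?Ex_cst//.
  apply/funext => w; rewrite quad_diag => [|i j /negPf ->]//.
  by apply: eq_bigr => j _; rewrite eqxx expr1n mulr1.
have Epi j : Ex P (pi j s t) = 0.
  have [_] := mart nzN j (kb_cst 1); under eq_fun do rewrite /= mul1r.
  by [].
have iSp1 : intg P Spi by exact: intg_sum.
have ESp1 : Ex P Spi = 0 by rewrite /Spi Ex_sum// big1.
have iS2 : intg P S2 by apply: intg_sum => i; exact: (iSi i).1.
(* The covariance bound applies with the coefficients [al]; summing their squares gives back [g2]
   because an indicator equals its own square. *)
have ES2 : Ex P S2 <= h * Ex P g2.
  rewrite /S2 Ex_sum => [|i]; last exact: (iSi i).1.
  have kq i : kb (fun w => \sum_l al i l w * al i l w) by apply: kb_sum => l; exact: kbM.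
  have -> : g2 = (fun w => \sum_i \sum_l al i l w * al i l w).
    apply/funext => w; rewrite /g2 sqr_enormE mulr_sumr; apply: eq_bigr => i _.
    rewrite mulr_sumr; apply: eq_bigr => l _; rewrite /al.
    have hs : Num.sqrt ((2 * phi w)^-1) ^+ 2 = 2^-1 * (phi w)^-1.
      by rewrite sqr_sqrtr ?invr_ge0 ?mulr_ge0 ?(ltW (phi_gt0 _))// invfM.
    transitivity ((\1_A w * \1_A w) * Num.sqrt ((2 * phi w)^-1) ^+ 2 * beta w i l ^+ 2); last by ring.
    have b1 : \1_A w * \1_A w = \1_A w :> R by rewrite indicE -natrM; case: (w \in A).
    by rewrite b1 hs /psi; ring.
  rewrite Ex_sum => [|i]; last exact: kb_intg (kq i).
  rewrite mulr_sumr; apply: ler_sum => i _; rewrite (le_trans (iSi i).2)//.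
  rewrite le_eqVlt; apply/orP; left; apply/eqP; congr (_ * Ex P _); apply/funext => w.
  rewrite quad_diag => [|l k /negPf ->]//.
  by apply: eq_bigr => l _; rewrite eqxx mul1r expr2.
have icnt j : intg P (cnt j s t) by apply: intgD => //; exact: intg_cst.
have Ecnt j : Ex P (cnt j s t) = h * lam j.
  by rewrite ExD ?Epi ?add0r ?Ex_cst//; exact: intg_cst.
have icx j l : intg P (fun w => cnt j s t w * `|xi l s t w|) := (cnt_xi j l s_ge0 s_lt).1.
have iR1j j : intg P (fun w => (2 * (h * C0)) * cnt j s t w +
  (2 * (D%:R * B)) * \sum_l cnt j s t w * `|xi l s t w|).
  by apply: intgD; [exact: intgZ | apply/intgZ/intg_sum].
have iR1 : intg P R1 by apply: intg_sum.
have ER1 : Ex P R1 <= 2 * C0 * Lam * h ^+ 2 + 2 * D%:R ^+ 2 * B * Lam * (h * Num.sqrt h).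
  rewrite /R1 Ex_sum//.
  have -> : 2 * C0 * Lam * h ^+ 2 + 2 * D%:R ^+ 2 * B * Lam * (h * Num.sqrt h) =
    \sum_j (2 * C0 * h ^+ 2 + 2 * D%:R ^+ 2 * B * (h * Num.sqrt h)) * lam j.
    by rewrite -mulr_sumr -/Lam; ring.
  apply: ler_sum => j _; rewrite ExD; [|exact: intgZ|by apply/intgZ/intg_sum].
  rewrite ExZ// ExZ; last exact: intg_sum.
  rewrite Ecnt Ex_sum// (mulrDl (2 * C0 * h ^+ 2)); apply: lerD; first by rewrite le_eqVlt; apply/orP; left; apply/eqP; ring.
  have -> : 2 * D%:R ^+ 2 * B * (h * Num.sqrt h) * lam j =
    2 * (D%:R * B) * (\sum_(l < D) h * lam j * Num.sqrt h).
    by rewrite sumr_const card_ord -mulr_natl; ring.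
  rewrite ler_wpM2l ?mulr_ge0//; apply: ler_sum => l _.
  by rewrite (cnt_xi j l s_ge0 s_lt).2 ler_wpM2l// mulr_ge0// ltW.
have iR2a : intg P (fun w => Spi w ^+ 2 + (2 * (h * Lam) - 1) * Spi w).
  by apply: intgD => //; exact: intgZ.
have iR2b : intg P (fun w => Spi w ^+ 2 + (2 * (h * Lam) - 1) * Spi w + ((h * Lam) ^+ 2 - h * Lam)).
  by apply: intgD => //; exact: intg_cst.
have iR2 : intg P R2 by exact: intgZ.
have ER2 : Ex P R2 <= 2 * B * Lam ^+ 2 * h ^+ 2.
  rewrite /R2 ExZ// ExD//; last exact: intg_cst.
  rewrite ExD//; last exact: intgZ.
  rewrite ExZ// ESp1 mulr0 addr0 Ex_cst.
  have -> : 2 * B * Lam ^+ 2 * h ^+ 2 = 2 * B * (h * Lam) ^+ 2 by ring.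
  by rewrite ler_wpM2l ?mulr_ge0//; lra.
have ig1 := kb_intg kg1; have ig2 := kb_intg kg2; have ig3 := kb_intg kg3.
have ir0 := kb_intg kr0; have iq0 := kb_intg kq0.
have Er0 : Ex P r0 <= C0 ^+ 2 / (2 * e) * h ^+ 2.
  rewrite -(Ex_cst P (C0 ^+ 2 / (2 * e) * h ^+ 2)); apply: Ex_le => //; first exact: intg_cst.
  move=> w; rewrite /r0 /= invfM.
  have -> : C0 ^+ 2 * (2^-1 * e^-1) * h ^+ 2 = 2^-1 * e^-1 * (h ^+ 2 * C0 ^+ 2) by ring.
  apply: ler_pM; [by apply: mulr_ge0 | by apply: mulr_ge0; exact: sqr_ge0 | by rewrite ler_pM2l |].
  by apply: ler_wpM2l; rewrite ?sqr_ge0// ler_pXn2r ?nnegrE ?enorm_ge0.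
have Eq0 : Ex P q0 = h * Ex P g1 + Ex P r0 + h * Ex P g3.
  rewrite /q0 -/g1 ExD; [|by apply: intgD => //; exact: intgZ|exact: intgZ].
  by rewrite ExD ?ExZ//; exact: intgZ.
have iz1 : intg P (fun w => \sum_l zl l w * xi l s t w) by apply: intg_sum => l; exact: (izl l).1.
have iz2 : intg P (fun w => \sum_j zj j w * pi j s t w) by apply: intg_sum => l; exact: (izj l).1.
have Ez1 : Ex P (fun w => \sum_l zl l w * xi l s t w) = 0.
  by rewrite Ex_sum ?big1// => l *; have [] := izl l.
have Ez2 : Ex P (fun w => \sum_j zj j w * pi j s t w) = 0.
  by rewrite Ex_sum ?big1// => l *; have [] := izj l.
have iY1 := intgD iq0 iz1; have iY2 := intgD iY1 iz2; have iY3 := intgD iY2 iS2.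
have iY4 := intgD iY3 iR1; have iY := intgD iY4 iR2.
split => //.
  rewrite (_ : (fun w => _) = (fun w => g1 w + g2 w + g3 w)); last exact/funext.
  by apply: intgD => //; exact: intgD.
apply: (le_trans (Ex_le_ae iL iY aeY)).
rewrite (ExD iY4 iR2) (ExD iY3 iR1) (ExD iY2 iS2) (ExD iY1 iz2) (ExD iq0 iz1) Eq0 Ez1 Ez2.
have -> : Ex P (fun w => \1_A w * step_generator w) = Ex P g1 + Ex P g2 + Ex P g3.
  rewrite -(ExD ig1 ig2) -(ExD (intgD ig1 ig2) ig3); congr Ex; exact/funext.
rewrite !(mulrDr h) !(mulrDl _ _ (h ^+ 2)); move: ES2 ER1 ER2 Er0.
set z1 := 2 * C0 * _ * _; set z2 := 2 * _ * B * _ * _; set z3 := 2 * B * _ * _; set z4 := C0 ^+ 2 / _ * _.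
by lra.
Qed.

End step.
End one_step.

(** * Distance from the scheme to the solution *)

Section scheme_path.
Context (R : realType) (D : nat) (dispU : measure_display)
  (U : measurableType dispU) (nu : {sigma_finite_measure set U -> \bar R}) (S : scheme D nu).

Fixpoint scheme_path (T : Type) (W : R -> T -> 'cV[R]_D) (Nc : sch_mark S -> R -> R -> T -> R)
    (g : nat -> R) (y : 'cV[R]_D) k (w : T) : 'cV[R]_D :=
  if k is k'.+1 then let z := scheme_path W Nc g y k' w in
    z + increment W Nc (sch_index S z) (g k') (g k'.+1) w
  else y.

Definition mark_rate (j : sch_mark S) : R := fine (nu (sch_set j)).

(** The remainder of [one_step_expectation] per unit time. B is twice the bound of the scheme
    because the coefficients of the gap are differences of two values. *)
Definition discretization_error (e h : R) : R :=
  let B := 2 * sch_bound S in let Lam := \sum_j mark_rate j in let C := B + Lam * B in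
  (C ^+ 2 / (2 * e) + 2 * C * Lam + 2 * B * Lam ^+ 2) * h +
  (2 * D%:R ^+ 2 * B * Lam) * Num.sqrt h.

(** The mark sets are disjoint, so at any mark at most one term of each jump function is active, the
    same one for both indices; off all sets both functions vanish. *)
Lemma jump_size_integral (p : R) i i' : 0 < p ->
  (\int[nu]_u (jump_size p (enorm (jump_function S i u - jump_function S i' u)))%:E =
   (\sum_j mark_rate j * jump_size p (enorm (sch_jump i j - sch_jump i' j)))%:E)%E.
Proof.
move=> p0; pose q j := jump_size p (enorm (sch_jump (s := S) i j - sch_jump i' j)).
have q0 j : 0 <= q j by rewrite jump_size_ge0// enorm_ge0.
have pw u : jump_size p (enorm (jump_function S i u - jump_function S i' u)) =
    \sum_j q j * \1_(sch_set (s := S) j) u.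
  have [[j uj]|h] := pselect (exists j, sch_set (s := S) j u).
    rewrite (bigD1 j)//= big1 ?addr0 => [|k kj].
      by rewrite !(jump_function_in _ uj) indicE mem_set ?mulr1.
    rewrite indicE memNset ?mulr0// => uk; move/eqP: kj; apply.
    by apply: (trivIset_sch_set (s := S)) => //; exists u.
  have h' j : ~ sch_set (s := S) j u by move=> uj; apply: h; exists j.
  rewrite !jump_function_out// subrr enorm0 big1 => [|j _]; last by rewrite indicE memNset ?mulr0.
  by rewrite /jump_size expr0n/= mul0r mulr0 minxx.
under eq_integral do rewrite pw -sumEFin.
rewrite ge0_integral_sum//; last 2 first.
- move=> j; apply/measurable_EFinP; apply: measurable_funM => //.
  by apply: measurable_indic; exact: measurable_sch_set.
- by move=> j u _; rewrite lee_fin mulr_ge0.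
rewrite -sumEFin; apply: eq_bigr => j _.
under eq_integral do rewrite EFinM.
rewrite ge0_integralZl//; [|by apply/measurable_EFinP; apply: measurable_indic; exact: measurable_sch_set|by rewrite lee_fin].
rewrite integral_indic ?setIT//; last exact: measurable_sch_set.
rewrite EFinM /mark_rate fineK 1?muleC//.
by rewrite ge0_fin_numE// fin_sch_set.
Qed.

Lemma overlap_sch_set : overlap nu (@sch_set _ _ _ _ _ S) =
  (fun j k => if j == k then mark_rate j else 0).
Proof.
apply/funext => j; apply/funext => k; rewrite /overlap; case: eqVneq => [->|jk].
  by rewrite setIid.
rewrite (_ : _ `&` _ = set0) ?measure0//; apply/eqP/contraT => /set0P h.
by move/eqP: jk; case; apply: (trivIset_sch_set (s := S)).
Qed.

Lemma fine_scheme_le b sigma c (K K' delta delta' : R) : 0 <= delta' -> K' <= K -> delta' <= delta ->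
  fine_scheme b sigma c K delta' S -> fine_scheme b sigma c K' delta S.
Proof.
move=> d0 KK dd f x xK; have [h1 h2 h3] := f x (le_trans xK KK); split.
- exact: le_trans h1 dd.
- exact: le_trans h2 dd.
by rewrite (le_trans h3)// lee_fin ler_pXn2r ?nnegrE// (le_trans d0).
Qed.

End scheme_path.

Lemma measurable_generated I d d' (T : measurableType d) (E : measurableType d') (J : set I) (Y : I -> T -> E) i :
  J i -> measurable_fun setT (Y i : g_sigma_algebraType (generated J Y) -> E).
Proof.
by move=> Ji _ B mB; apply: sub_sigma_algebra; apply: sub_sigma_algebra; exists i => //; exists B.
Qed.

Lemma generated_wrt I d d' d'' (T : measurableType d) (E : measurableType d') (E' : measurableType d'')
    (J : set I) (Y : I -> T -> E) (Z : T -> E') :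
  measurable_fun setT (Z : g_sigma_algebraType (generated J Y) -> E') ->
  measurable_wrt (generated J Y) Z.
Proof.
move=> mZ _ [B mB <-]; have := mZ measurableT B mB.
by rewrite /measurable/= sigma_algebra_id//; exact: smallest_sigma_algebra.
Qed.

Lemma measurable_addmx (R : realType) m n d (T : measurableType d) (f g : T -> 'M[R]_(m, n)) :
  measurable_fun setT (f : T -> borel 'M[R]_(m, n)) ->
  measurable_fun setT (g : T -> borel 'M[R]_(m, n)) ->
  measurable_fun setT ((fun w => f w + g w) : T -> borel 'M[R]_(m, n)).
Proof.
move=> mf mg; apply: measurable_entries => i j; under eq_fun do rewrite mxE.
by apply: measurable_funD; exact: measurable_entry.
Qed.

Lemma measurable_submx (R : realType) m n d (T : measurableType d) (f g : T -> 'M[R]_(m, n)) :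
  measurable_fun setT (f : T -> borel 'M[R]_(m, n)) ->
  measurable_fun setT (g : T -> borel 'M[R]_(m, n)) ->
  measurable_fun setT ((fun w => f w - g w) : T -> borel 'M[R]_(m, n)).
Proof.
move=> mf mg; apply: measurable_entries => i j; under eq_fun do rewrite !mxE.
by apply: measurable_funB; exact: measurable_entry.
Qed.

Section coupling.
Context (R : realType) (D : nat) d (T : measurableType d) (P : probability T R)
  (F : R -> set (set T)) (dispU : measure_display)
  (U : measurableType dispU) (nu : {sigma_finite_measure set U -> \bar R})
  (b : 'cV[R]_D -> 'cV[R]_D) (sigma : 'cV[R]_D -> 'M[R]_D)
  (c : 'cV[R]_D -> U -> 'cV[R]_D) (x0 : 'cV[R]_D)
  (W : R -> T -> 'cV[R]_D) (N : R.-ker T ~> (R * U)%type) (X : R -> T -> 'cV[R]_D).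
Hypothesis b_continuous : continuous b.
Hypothesis sigma_continuous : continuous sigma.
Hypothesis c_measurable :
  measurable_fun setT (fun p : borel 'cV[R]_D * U => c p.1 p.2 : borel 'cV[R]_D).
Hypothesis c_continuous : forall u, continuous (c ^~ u).
Hypothesis c2_finite : forall x, (\int[nu]_u (enorm (c x u) ^+ 2)%:E < +oo)%E.
Hypothesis c2_continuous : continuous (fun x => \int[nu]_u (enorm (c x u) ^+ 2)%:E)%E.
Hypothesis sol : solves_sde P F nu b sigma c x0 W N X.
Context (tau : R).
Hypothesis tau0 : 0 < tau.

Let cad := sde_cadlag sol.
Let F_sigma := solution_sigma sol.
Let F_mono := solution_mono sol.
Let mX := solution_measurable sol.

Section scheme.
Context (S : scheme D nu).
Let A := @sch_set _ _ _ _ _ S.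
Let mA : forall j, measurable (A j) := @measurable_sch_set _ _ _ _ _ S.
Let fA : forall j, (nu (A j) < +oo)%E := @fin_sch_set _ _ _ _ _ S.
Let xi := brownian_increment W.
Let pi := poisson_increment nu N A.
Let nzW : noise P F xi (fun l k => (l == k)%:R) := brownian_noise F_sigma F_mono (sde_brownian sol).
Let nzN : noise P F pi (fun j k => if j == k then mark_rate j else 0).
Proof. by have := poisson_noise F_sigma (sde_poisson sol) mA fA; rewrite overlap_sch_set. Qed.

Let cnt j s t w := pi j s t w + (t - s) * mark_rate j.

Let cntE j s t w : 0 <= s -> s <= t -> cnt j s t w = fine (N w (`]s, t] `*` A j)).
Proof.
move=> s0 st; rewrite /cnt /pi /poisson_increment /compensated intensity_rectangle//.
by rewrite fineM//= ?ge0_fin_numE// ?fA// subrK.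
Qed.

Let mR s t j : measurable (`]s, t] `*` A j : set (R * U)).
Proof. exact: measurableX. Qed.

Let fR s t j : 0 <= s -> s <= t -> (intensity nu (`]s, t] `*` A j) < +oo)%E.
Proof. by move=> s0 st; rewrite intensity_rectangle// lte_mul_pinfty// ?lee_fin ?subr_ge0. Qed.

Let cnt_nat s t : 0 <= s -> s < t ->
  {ae P, forall w, forall j, exists k : nat, cnt j s t w = k%:R}.
Proof.
move=> s0 st; apply: ae_forall_fin => j.
apply: filterS (poisson_count_nat (sde_poisson sol) (mR s t j) (fR j s0 (ltW st))) => w [k kE].
by exists k; rewrite cntE ?(ltW st)// kE.
Qed.

(** The Brownian motion and the Poisson measure are independent, so the mean of the mixed product
    factorizes. *)
Let cnt_xi s t j l : 0 <= s -> s < t ->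
  intg P (fun w => cnt j s t w * `|xi l s t w|) /\
  Ex P (fun w => cnt j s t w * `|xi l s t w|) = (t - s) * mark_rate j * Ex P (fun w => `|xi l s t w|).
Proof.
move=> s0 st; have stw := ltW st.
have ixi : intg P (xi l s t).
  exact: intg_sqr (noise_measurable F_sigma nzW l s0 stw) (noise_sqr nzW l s0 stw).
have ipi : intg P (pi j s t).
  exact: intg_sqr (noise_measurable F_sigma nzN j s0 stw) (noise_sqr nzN j s0 stw).
have icnt : intg P (cnt j s t) by apply: intgD => //; exact: intg_cst.
have Ecnt : Ex P (cnt j s t) = (t - s) * mark_rate j.
  rewrite ExD ?Ex_cst//; last exact: intg_cst.
  have [_] := @noise_mean _ _ _ _ _ _ _ _ nzN j s t (cst 1) s0 stw (measurable_cst _) (intg_cst _ _).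
  by under eq_fun do rewrite mul1r; move=> ->; rewrite add0r.
have mW r : 0 <= r -> measurable_fun setT
    ((fun w => W r w l ord0) : g_sigma_algebraType (generated `[0, +oo[ (W : R -> T -> borel 'cV[R]_D)) -> R).
  move=> r0; apply: measurable_entry; apply: measurable_generated.
  by rewrite /= in_itv/= r0.
have mx : measurable_wrt (generated `[0, +oo[ (W : R -> T -> borel 'cV[R]_D)) (fun w => `|xi l s t w|).
  apply: generated_wrt; apply: measurableT_comp => //; rewrite /xi /brownian_increment.
  rewrite (_ : (fun w => _) = (fun w => W t w l ord0 - W s w l ord0)); last first.
    by apply/funext => w; rewrite !mxE.
  apply: measurable_funB; apply: mW => //.
  exact: le_trans stw.
have mc : measurable_wrt (generated [set A : set (R * U) | measurable A] (fun A w => N w A)) (cnt j s t).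
  apply: generated_wrt; apply: measurable_funD; last exact: measurable_cst.
  apply: measurable_funB; last exact: measurable_cst.
  apply: measurableT_comp => //; apply: (measurable_generated (Y := fun (A : set (R * U)) w => N w A)).
  exact: mR.
have [h1 h2] := independent_Ex (sde_independent sol) mx mc (intg_norm ixi) icnt.
split; first by under eq_fun do rewrite mulrC.
by under eq_fun do rewrite mulrC; rewrite h2 Ecnt mulrC.
Qed.

Lemma at_time_increment (Z : T -> 'cV[R]_D) s t : 0 <= s -> s <= t ->
  measurable_fun setT (Z : at_time F s -> borel 'cV[R]_D) ->
  measurable_fun setT ((fun w => increment W pi (sch_index S (Z w)) s t w) : at_time F t -> borel 'cV[R]_D).
Proof.
move=> s0 st /(at_time_le F_sigma F_mono s0 st) mZ.
have mcoef (g : nat -> R) : measurable_fun setT ((fun w => g (sch_index S (Z w))) : at_time F t -> R).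
  exact: (measurableT_comp (measurable_sch_comp S g) mZ).
apply: measurable_entries => i k; rewrite (ord1 k) /increment.
under eq_fun do rewrite !mxE summxE.
apply: measurable_funD; first apply: measurable_funD.
- by apply: measurable_funM => //; exact: (mcoef (fun n => sch_drift S n i ord0)).
- apply: measurable_sum => l; apply: measurable_funM.
    exact: (mcoef (fun n => sch_diffusion S n i l)).
  exact: (noise_known nzW l s0 st).
- apply: measurable_sum => j; under eq_fun do rewrite mxE; apply: measurable_funM.
    exact: (noise_known nzN j s0 st).
  exact: (mcoef (fun n => sch_jump n j i ord0)).
Qed.

Context (m : nat) (y : 'cV[R]_D).
Let g := grid tau m.
Let g0 k : 0 <= g k. Proof. exact: grid_ge0. Qed.
Let h := tau / m.+1%:R.
Let h0 : 0 < h. Proof. by rewrite divr_gt0. Qed.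
Let gS k : g k.+1 - g k = h. Proof. by rewrite /g gridS addrAC subrr add0r. Qed.
Let g_lt k : g k < g k.+1. Proof. by rewrite -subr_gt0 gS. Qed.

Definition coupled k w : 'cV[R]_D := scheme_path W pi g y k w.

Let sh k := shadow x0 W N X tau S m k.

Let shS k w : sh k.+1 w = sh k w + increment W pi (sch_index S (X (g k) w)) (g k) (g k.+1) w.
Proof. by rewrite /sh /shadow big_ord_recr addrA. Qed.

Lemma at_time_coupled k : measurable_fun setT (coupled k : at_time F (g k) -> borel 'cV[R]_D).
Proof.
elim: k => [|k ih]; first exact: measurable_cst.
apply: measurable_addmx; first exact: (at_time_le F_sigma F_mono (g0 k) (ltW (g_lt k)) ih).
exact: at_time_increment (g0 k) (ltW (g_lt k)) ih.
Qed.

Lemma measurable_coupled k : measurable_fun setT (coupled k : T -> borel 'cV[R]_D).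
Proof.
exact: (at_time_measurable F_sigma (g0 k) (@at_time_coupled k)).
Qed.

Let at_time_shadow k : measurable_fun setT (sh k : at_time F (g k) -> borel 'cV[R]_D).
Proof.
elim: k => [|k ih].
  by rewrite /sh /shadow; under eq_fun do rewrite big_ord0; exact: measurable_cst.
rewrite (_ : sh k.+1 = (fun w => sh k w + increment W pi (sch_index S (X (g k) w)) (g k) (g k.+1) w)); last first.
  exact/funext/shS.
apply: measurable_addmx; first exact: (at_time_le F_sigma F_mono (g0 k) (ltW (g_lt k)) ih).
exact: at_time_increment (g0 k) (ltW (g_lt k)) (solution_at_time sol (g0 k)).
Qed.

Definition coupling_gap k w := sh k w - coupled k w.
Let gap := coupling_gap.

Definition coef_gap p q (f : nat -> 'M[R]_(p, q)) k w :=
  f (sch_index S (X (g k) w)) - f (sch_index S (coupled k w)).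

(** Shadow and scheme are driven by one noise, so the gap moves by an increment whose coefficients
    are differences, one value taken at X and the other at the scheme. *)
Let gapS k w : gap k.+1 w = gap k w + step_increment xi pi (g k) (g k.+1)
  (coef_gap (sch_drift S) k) (coef_gap (sch_diffusion S) k) (fun j => coef_gap ((@sch_jump _ _ _ _ _ S)^~ j) k) w.
Proof.
have coupledS : coupled k.+1 w = coupled k w +
  increment W pi (sch_index S (coupled k w)) (g k) (g k.+1) w by [].
have arrange (V : zmodType) (a a' p p' q q' r r' : V) :
    a + (p + q + r) - (a' + (p' + q' + r')) = a - a' + (p - p' + (q - q') + (r - r')).
  by rewrite !opprD addrACA; congr (_ + _); rewrite addrACA; congr (_ + _); rewrite addrACA.
rewrite /gap /coupling_gap shS coupledS /step_increment /increment /coef_gap.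
have -> : \col_l xi l (g k) (g k.+1) w = W (g k.+1) w - W (g k) w.
  by apply/matrixP => i l; rewrite (ord1 l) !mxE /xi /brownian_increment !mxE.
under [X in _ = _ + (_ + X)]eq_bigr do rewrite scalerBr.
by rewrite sumrB scalerBr mulmxBl arrange.
Qed.

Let at_time_coef_gap p q (f : nat -> 'M[R]_(p, q)) k i l : known F (g k) (fun w => coef_gap f k w i l).
Proof.
rewrite /known /coef_gap; under eq_fun do rewrite !mxE; apply: measurable_funB.
  exact: (measurableT_comp (measurable_sch_comp S (fun n => f n i l)) (solution_at_time sol (g0 k))).
exact: (measurableT_comp (measurable_sch_comp S (fun n => f n i l)) (@at_time_coupled k)).
Qed.

Let coef_gap_le p q (f : nat -> 'M[R]_(p, q)) k w : (forall n, enorm (f n) <= sch_bound S) ->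
  enorm (coef_gap f k w) <= 2 * sch_bound S.
Proof. by move=> fB; rewrite (le_trans (ler_enormB _ _))// mulrDl mul1r lerD. Qed.

Let at_time_gap k : measurable_fun setT (gap k : at_time F (g k) -> borel 'cV[R]_D).
Proof. exact: (measurable_submx (@at_time_shadow k) (@at_time_coupled k)). Qed.

Section stopped.
Context (K eta delta1 e : R).
Hypothesis e0 : 0 < e.

Let cond k : set T := [set w | enorm (X (g k) w) <= K] `&`
  [set w | enorm (sh k w - X (g k) w) <= eta] `&` [set w | enorm (gap k w) <= delta1].

Fixpoint stay k : set T := cond k `&` (if k is k'.+1 then stay k' else setT).

(** The value at the first grid time where [cond] fails is still recorded and then kept, so that
    leaving through the third bound of [cond] remains visible at the end. *)
Fixpoint stopped k w : R := if k is k'.+1 then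
   stopped k' w + \1_(stay k') w * (snorm e (gap k'.+1 w) - snorm e (gap k' w))
  else snorm e (gap 0 w).

Let F_stay k : F (g k) (stay k).
Proof.
have atF t A' : 0 <= t -> measurable (A' : set (at_time F t)) -> F t A'.
  by move=> t0; rewrite /measurable/= sigma_algebra_id//; exact: (F_sigma t0).1.
have le_set t (Z : T -> 'cV[R]_D) r : measurable_fun setT (Z : at_time F t -> borel 'cV[R]_D) ->
    measurable ([set w | enorm (Z w) <= r] : set (at_time F t)).
  move=> mZ; rewrite -[X in measurable X]setTI.
  apply: (@measurable_fun_ler _ (at_time F t) R setT (fun w => enorm (Z w)) (cst r)) => //.
  exact: (measurable_borel_real (@continuous_enorm R D 1) mZ).
have mc k' : measurable (cond k' : set (at_time F (g k'))).
  have mXk := solution_at_time sol (g0 k').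
  apply: measurableI; first apply: measurableI; apply: le_set => //.
  exact: (measurable_submx (@at_time_shadow k') mXk).
apply: (atF) => //; elim: k => [|k ih]; first by apply: measurableI => //; exact: mc.
apply: measurableI; first exact: mc.
apply: sub_sigma_algebra; apply: (F_mono (g0 k) (ltW (g_lt k))).
exact: atF.
Qed.

Let stay_le k k' w : (k <= k')%N -> stay k' w -> stay k w.
Proof.
elim: k' => [|k' ih]; first by rewrite leqn0 => /eqP ->.
by rewrite leq_eqVlt => /orP[/eqP ->//|/ih le [_ /le]].
Qed.

Lemma stay_bounds k w : stay k w -> [/\ enorm (X (g k) w) <= K,
  enorm (sh k w - X (g k) w) <= eta & enorm (gap k w) <= delta1].
Proof. by case: k => [|k] [[[]]]. Qed.

Let stopped_next k w : stopped k.+1 w =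
  stopped k w + \1_(stay k) w * (snorm e (gap k.+1 w) - snorm e (gap k w)).
Proof. by []. Qed.

Let stopped_stay k w : stay k w -> stopped k w = snorm e (gap k w).
Proof.
elim: k => [//|k ih] [_ sk]; rewrite stopped_next (ih sk) indicE mem_set// mul1r.
by rewrite addrC subrK.
Qed.

Let stoppedS k w : stay k w -> stopped k.+1 w = snorm e (gap k.+1 w).
Proof. by move=> sk; rewrite stopped_next stopped_stay// indicE mem_set// mul1r addrC subrK. Qed.

Let stopped_out k p w : ~ stay k w -> stopped (p + k) w = stopped k w.
Proof.
move=> nk; elim: p => [//|p ih]; rewrite addSn stopped_next ih indicE memNset ?mul0r ?addr0//.
by move=> /(stay_le (leq_addl p k)).
Qed.

(** The stopped process always equals the smoothed norm of the gap at some index. *)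
Lemma stopped_ge k w : e <= stopped k w.
Proof.
have [j ->] : exists j, stopped k w = snorm e (gap j w); last exact: ler_snorm.
elim: k => [|k [j ih]]; first by exists 0%N.
have [sk|nk] := pselect (stay k w); first by exists k.+1; exact: stoppedS.
by exists j; rewrite -ih; exact: (@stopped_out k 1).
Qed.

(** With the first two bounds of [cond] guaranteed, the first failure could only be a gap above
    [delta1]; the stopped process would then stay frozen above [delta1] until the end. *)
Lemma stopped_good w : (forall k, (k <= m.+1)%N -> enorm (X (g k) w) <= K /\ enorm (sh k w - X (g k) w) <= eta) ->
  enorm (x0 - y) <= delta1 -> stopped m.+1 w < delta1 -> enorm (gap m.+1 w) <= delta1.
Proof.
move=> good xy small; suff all_stay k : (k <= m.+1)%N -> stay k w by have [] := stay_bounds (all_stay _ (leqnn _)).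
elim: k => [_|k ih km].
  split => //; have [h1 h2] := good 0%N (leq0n _); split => //.
  by rewrite /= /gap /coupling_gap /sh /shadow big_ord0 addr0.
have sk := ih (ltnW km); split => //; have [h1 h2] := good k.+1 km; split => //=.
rewrite leNgt; apply/negP => big.
have nk : ~ stay k.+1 w by move=> /stay_bounds[_ _]; rewrite leNgt big.
have := stopped_out (m.+1 - k.+1) nk; rewrite subnK// (stoppedS sk) => E.
by move: small; rewrite E ltNge (le_trans (ltW big))// ler_enorm_snorm.
Qed.

Context (rho : R -> R) (kappa err : R).
Hypothesis rho_nondecreasing : forall r s : R, 0 <= r -> r <= s -> rho r <= rho s.
Hypothesis rho_ge0 : forall r : R, 0 <= r -> 0 <= rho r.
Hypothesis rho_concave :
    convex_function (`[0%R, +oo[ : set (convex_lmodType R^o)) (fun r => - rho r).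
Hypothesis kappa0 : 0 < kappa.
Hypothesis err0 : 0 <= err.
Hypothesis generator_le : forall k w, stay k w ->
  step_generator (@mark_rate _ _ _ _ _ S) e (gap k) (coef_gap (sch_drift S) k)
    (coef_gap (sch_diffusion S) k) (fun j => coef_gap ((@sch_jump _ _ _ _ _ S)^~ j) k) w <=
  kappa * rho (snorm e (gap k w)) + err.

Let B := 2 * sch_bound S.
Let B0 : 0 <= B.
Proof. by rewrite mulr_ge0// (le_trans _ (sch_drift_le S 0))// enorm_ge0. Qed.

Let rate0 (j : sch_mark S) : 0 <= mark_rate j. Proof. exact: fine_ge0. Qed.

(** While the path is still running, the generator bound is majorized through [concave_modulus_le]
    at s = u, the mean of the stopped process. The majorant is affine in the process, and its
    expectation is 2 kappa rho(u) + err. Once the path has stopped the increment is 0 and the affine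
    majorant is nonnegative. *)
Lemma stopped_expectation k : intg P (stopped k) /\
  Ex P (stopped k.+1) <= Ex P (stopped k) +
    h * (2 * kappa * rho (Ex P (stopped k)) + (err + discretization_error S e h)).
Proof.
have step k' : [/\ intg P (fun w => \1_(stay k') w * (snorm e (gap k'.+1 w) - snorm e (gap k' w))),
  intg P (fun w => \1_(stay k') w * step_generator (@mark_rate _ _ _ _ _ S) e (gap k') (coef_gap (sch_drift S) k')
    (coef_gap (sch_diffusion S) k') (fun j => coef_gap ((@sch_jump _ _ _ _ _ S)^~ j) k') w) &
  Ex P (fun w => \1_(stay k') w * (snorm e (gap k'.+1 w) - snorm e (gap k' w))) <=
  h * Ex P (fun w => \1_(stay k') w * step_generator (@mark_rate _ _ _ _ _ S) e (gap k') (coef_gap (sch_drift S) k')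
    (coef_gap (sch_diffusion S) k') (fun j => coef_gap ((@sch_jump _ _ _ _ _ S)^~ j) k') w) +
  h * discretization_error S e h].
  have [||||||||i1 i2 le] := @one_step_expectation _ _ _ _ _ _ F_sigma _ _ _ _ nzW nzN rate0 cnt_nat cnt_xi
    B e B0 e0 (g k') (g k'.+1) (g0 k') (g_lt k') (stay k') (gap k') (coef_gap (sch_drift S) k')
    (coef_gap (sch_diffusion S) k') (fun j => coef_gap ((@sch_jump _ _ _ _ _ S)^~ j) k') delta1 (@F_stay k').
  - by move=> i; apply: measurable_entry; exact: at_time_gap.
  - by move=> i; exact: at_time_coef_gap.
  - by move=> i l; exact: at_time_coef_gap.
  - by move=> j i; exact: at_time_coef_gap.
  - by move=> w /stay_bounds[].
  - by move=> w; apply: coef_gap_le => n; exact: sch_drift_le.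
  - by move=> w; apply: coef_gap_le => n; exact: sch_diffusion_le.
  - by move=> j w; apply: coef_gap_le => n; exact: sch_jump_le.
  have E : (fun w => \1_(stay k') w * (snorm e (gap k'.+1 w) - snorm e (gap k' w))) =
    (fun w => \1_(stay k') w * (snorm e (gap k' w + step_increment xi pi (g k') (g k'.+1)
  (coef_gap (sch_drift S) k') (coef_gap (sch_diffusion S) k') (fun j => coef_gap ((@sch_jump _ _ _ _ _ S)^~ j) k') w) - snorm e (gap k' w))).
    by apply/funext => w; rewrite gapS.
  split => //; rewrite E//; apply: le_trans le _; rewrite gS.
  rewrite -addrA lerD2l /discretization_error -/B le_eqVlt; apply/orP; left; apply/eqP; ring.
have int k' : intg P (stopped k').
  elim: k' => [|k' ih]; last by have [i1 _ _] := step k'; exact: intgD.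
  rewrite /stopped /gap /coupling_gap /sh /shadow; under eq_fun do rewrite big_ord0.
  exact: (intg_cst P (snorm e (x0 + 0 - y))).
split => //; have [i1 i2 le] := step k.
rewrite [X in Ex P X <= _](_ : _ = fun w => stopped k w + \1_(stay k) w * (snorm e (gap k.+1 w) - snorm e (gap k w)))//.
rewrite ExD// lerD2l; apply: (le_trans le); rewrite -mulrDr ler_pM2l// [leRHS]addrA lerD2r.
set u := Ex P (stopped k).
(* Division by u is possible because the smoothing keeps the process above e. *)
have u0 : 0 < u.
  apply: lt_le_trans e0 _; rewrite -(Ex_cst P e); by apply: Ex_le; [exact: intg_cst | exact: int | move=> w; exact: stopped_ge].
have i3 : intg P (fun w => kappa * (rho u * (1 + u^-1 * stopped k w)) + err).
  by apply: intgD; [apply/intgZ/intgZ/intgD; [exact: intg_cst|exact: intgZ]|exact: intg_cst].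
have -> : 2 * kappa * rho u + err = Ex P (fun w => kappa * (rho u * (1 + u^-1 * stopped k w)) + err).
  have j1 : intg P (fun w => 1 + u^-1 * stopped k w) by apply: intgD; [exact: intg_cst|exact: intgZ].
  rewrite ExD ?Ex_cst; [|by apply/intgZ/intgZ|exact: intg_cst].
  rewrite ExZ; last exact: intgZ.
  rewrite ExZ// ExD ?Ex_cst ?ExZ//; [|exact: intg_cst|exact: intgZ].
  by rewrite -/u mulVf ?gt_eqF//; ring.
apply: Ex_le => // w; have [sk|nk] := pselect (stay k w).
  rewrite indicE mem_set// mul1r (le_trans (generator_le sk))// lerD2r ler_pM2l// (stopped_stay sk).
  by rewrite [u^-1 * _]mulrC; apply: concave_modulus_le => //; exact: snorm_ge0.
rewrite indicE memNset// mul0r addr_ge0// mulr_ge0 ?(ltW kappa0)// mulr_ge0 ?rho_ge0 ?(ltW u0)//.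
apply: addr_ge0 => //; apply: mulr_ge0; first by rewrite invr_ge0 ltW.
exact: le_trans (ltW e0) (stopped_ge _ _).
Qed.

End stopped.

End scheme.
(** The factors of h and sqrt h are fixed by S and e; their absolute values plus 1 serve as positive
    divisors. *)
Lemma discretization_error_small (S : scheme D nu) (e r : R) : 0 < r ->
  \forall m \near \oo, discretization_error S e (tau / m.+1%:R) <= r.
Proof.
move=> r0; rewrite /discretization_error; set K1 := _ + 2 * _ * _ ^+ 2; set K2 := _ * \sum_j _.
have K1p : 0 < `|K1| + 1 by rewrite ltr_wpDl.
have K2p : 0 < `|K2| + 1 by rewrite ltr_wpDl.
have a0 : 0 < r / 2 / (`|K1| + 1) by rewrite !divr_gt0.
have b0 : 0 < r / 2 / (`|K2| + 1) by rewrite !divr_gt0.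
have small q r' : 0 < q -> r' <= r / 2 / q -> q * r' <= r / 2.
  by move=> q0 h'; rewrite mulrC -ler_pdivlMr.
apply: filterS2 (mesh_small tau0 a0) (mesh_small tau0 (exprn_gt0 2 b0)) => m.
have h0 : 0 < tau / m.+1%:R by rewrite divr_gt0.
move: h0; set h := tau / _ => h0 ha hb; rewrite [leRHS]splitr lerD//.
  apply: le_trans (small _ _ K1p (ltW ha)); rewrite ler_wpM2r ?(ltW h0)//.
  by rewrite (le_trans (ler_norm _))// lerDl.
have sb : Num.sqrt h <= r / 2 / (`|K2| + 1).
  by rewrite -(ger0_norm (ltW b0)) -sqrtr_sqr ler_sqrt ?sqr_ge0// ltW.
apply: le_trans (small _ _ K2p sb); rewrite ler_wpM2r ?sqrtr_ge0//.
by rewrite (le_trans (ler_norm _))// lerDl.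
Qed.

Context (delta0 : R) (rho : R -> R).
Hypothesis delta0_gt0 : 0 < delta0.
Hypothesis rho_ge0 : forall r : R, 0 <= r -> 0 <= rho r.
Hypothesis rho_nondecreasing : forall r s : R, 0 <= r -> r <= s -> rho r <= rho s.
Hypothesis rho_concave :
  convex_function (`[0%R, +oo[ : set (convex_lmodType R^o)) (fun r => - rho r).
Hypothesis rho_gt0 : forall r : R, 0 < r -> 0 < rho r.
Hypothesis rho_osgood : forall e : R, 0 < e ->
  (\int[lebesgue_measure]_(r in `]0%R, e]) ((rho r)^-1)%:E = +oo)%E.
Hypothesis coef_bound : forall K : R, 0 < K -> exists2 kappa : R, 0 < kappa &
  forall x z : 'cV[R]_D,
    Num.max (enorm x) (enorm z) <= K -> enorm (x - z) <= delta0 ->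
    (\int[nu]_u (Num.min (enorm (c x u - c z u) ^+ 2)
                         (4 * enorm (x - z) * enorm (c x u - c z u)))%:E
      + (2 * dotv (x - z) (b x - b z) + enorm (sigma x - sigma z) ^+ 2)%:E
     <= (2 * kappa * enorm (x - z) * rho (enorm (x - z)))%:E)%E.

(** The constants are fixed in the order delta1, K, kappa, the Osgood thresholds a and er, e, the
    accuracies eta1 and dg, eta, d2, delta. The mesh comes last, after the scheme and its starting
    point. The exceptional event has three parts of probability at most eps / 3: leaving the ball, a
    shadow error above eta, and a stopped value of at least delta1. *)
Lemma scheme_close (eps : R) : 0 < eps -> exists Kd : R * R, [/\ 0 < Kd.1, 0 < Kd.2 &
  forall S : scheme D nu, fine_scheme b sigma c Kd.1 Kd.2 S ->
  forall y, enorm (x0 - y) <= Kd.2 -> \forall m \near \oo,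
    (P [set w | (eps <= enorm (X tau w - coupled S m y m.+1 w))%R] <= eps%:E)%E].
Proof.
move=> eps0.
(* With eta <= eps / 4, the entry eps / 2 keeps the final distance below eps; delta0 / 2, here and
   in eta, keeps X and the scheme within the range of the coefficient condition; 1 is the bound on
   the gap asked by the generator estimate. *)
pose delta1 := Num.min (eps / 2) (Num.min (delta0 / 2) 1).
have d10 : 0 < delta1 by rewrite !lt_min !divr_gt0//=.
have [d1a d1b d1c] : [/\ delta1 <= eps / 2, delta1 <= delta0 / 2 & delta1 <= 1].
  by rewrite !ge_min !lexx !orbT.
clearbody delta1.
have eps30 : 0 < eps / 3 by rewrite divr_gt0.
have [K K0 ballK] := ball_event_large P tau0 cad mX eps30.
(* The scheme may lie outside the ball of radius K, but by at most eta + delta1 <= 2 as long as the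
   process is not stopped. *)
have K20 : 0 < K + 2 by rewrite addr_gt0.
have [kappa kappa0 cb] := coef_bound K20.
have C0 : 0 < 2 * kappa by rewrite mulr_gt0.
have [[a er] /= [a0 er0] osg] := osgood_iteration rho_nondecreasing rho_gt0 rho_osgood C0 tau0 (mulr_gt0 eps30 d10).
have er20 : 0 < er / 2 by rewrite divr_gt0.
have mc x : measurable_fun setT (c x : U -> borel 'cV[R]_D) := measurable_coefficient c_measurable x.
have [e1 e10 gen1] := generator_bound_approx b_continuous sigma_continuous mc rho_nondecreasing
  rho_ge0 kappa0 cb c2_finite c2_continuous er20.
(* The starting value of the process is at most |x0 - y| + e, and each summand is kept below a /
   2. *)
pose e := Num.min e1 (a / 2).
have e0 : 0 < e by rewrite lt_min e10 divr_gt0.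
have ee1 : e <= e1 by rewrite ge_min lexx.
have ea2 : e <= a / 2 by rewrite ge_min lexx orbT.
clearbody e.
have [[eta1 dg] /= [eta10 dg0] gen2] := gen1 e e0 ee1.
pose eta := Num.min eta1 (Num.min (eps / 4) (Num.min (delta0 / 2) 1)).
have eta0 : 0 < eta by rewrite !lt_min eta10 !divr_gt0//=.
have [ea eb ec ed] : [/\ eta <= eta1, eta <= eps / 4, eta <= delta0 / 2 & eta <= 1].
  by rewrite !ge_min !lexx !orbT.
clearbody eta.
have [d2 d20 shadowS] := shadow_close b_continuous sigma_continuous c_measurable c_continuous
  c2_finite c2_continuous sol tau0 K eta0 eps30.
pose delta := Num.min dg (Num.min d2 (Num.min (a / 2) delta1)).
have dl0 : 0 < delta by rewrite lt_min dg0 lt_min d20 lt_min d10 divr_gt0.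
have [da db dc dd] : [/\ delta <= dg, delta <= d2, delta <= a / 2 & delta <= delta1].
  by rewrite /delta; split; do ?[exact: lexx | rewrite ge_min; apply/orP; (by left) || right].
clearbody delta.
exists (K + 2, delta); split => //= S fS y xy.
have fS2 : fine_scheme b sigma c K d2 S by apply: fine_scheme_le (ltW dl0) _ db fS; rewrite lerDl.
apply: filterS2 (shadowS S fS2) (discretization_error_small S e er20) => m shm dm.
pose Z := stopped S m y K eta delta1 e.
have gen k w : stay S m y K eta delta1 k w ->
  step_generator (@mark_rate _ _ _ _ _ S) e (coupling_gap S m y k) (coef_gap S m y (sch_drift S) k)
    (coef_gap S m y (sch_diffusion S) k) (fun j => coef_gap S m y ((@sch_jump _ _ _ _ _ S)^~ j) k) w <=
  kappa * rho (snorm e (coupling_gap S m y k w)) + er / 2.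
  move=> /stay_bounds[]; set g := grid tau m k; set Y := coupled S m y k w; set s := shadow _ _ _ _ _ _ _ _ _.
  rewrite /coupling_gap -/s -/Y => XK sX sY.
  have XY : enorm (X g w - Y) <= eta + delta1.
    rewrite -(subrKA s) (le_trans (ler_enormD _ _))// lerD//; by rewrite enormB.
  have YK : enorm Y <= K + 2.
    have := ler_enormD (X g w) (Y - X g w); rewrite addrC subrK (enormB Y).
    by clearbody g Y; lra.
  have XK2 : enorm (X g w) <= K + 2 by rewrite (le_trans XK)// lerDl.
  have XYd : enorm (X g w - Y) <= delta0 by clearbody g Y; lra.
  have sY1 : enorm (s - Y) <= 1 by exact: le_trans d1c.
  have sX1 : enorm (s - Y - (X g w - Y)) <= eta1 by rewrite opprB addrA subrK (le_trans sX).
  have [f1 f2 f3] := fS _ XK2; have [f4 f5 f6] := fS _ YK.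
  have dsq : ((delta ^+ 2)%:E <= (dg ^+ 2)%:E)%E by rewrite lee_fin ler_pXn2r ?nnegrE// ltW.
  have := gen2 _ _ _ XK2 YK XYd sY1 sX1 _ _ _ _ _ _ (measurable_jump_function S (sch_index S (X g w)))
    (measurable_jump_function S (sch_index S Y)) (le_trans f1 da) (le_trans f4 da) (le_trans f2 da)
    (le_trans f5 da) (le_trans f3 dsq) (le_trans f6 dsq) _ erefl.
  rewrite jump_size_integral ?snorm_gt0// -EFinD lee_fin; apply: le_trans.
  by rewrite /step_generator /coef_gap -/g -/Y -/s [leRHS]addrC.
have hm : 0 < tau / m.+1%:R by rewrite divr_gt0.
have st := stopped_expectation e0 rho_nondecreasing rho_ge0 rho_concave kappa0 (ltW er20) gen.
have Zge w k : e <= Z k w by exact: stopped_ge.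
have EZ k : 0 <= Ex P (Z k) by apply: Ex_ge0 => w; rewrite (le_trans (ltW e0)).
(* Osgood's lemma with total time [tau]; er is shared equally by the generator and the
   discretization. The target carries the factor delta1 because Markov's inequality will divide by
   it. *)
have EZm : Ex P (Z m.+1) <= eps / 3 * delta1.
  apply: (osg m.+1 (tau / m.+1%:R) (fun k => Ex P (Z k)) (ltW hm)) => //.
  - by rewrite mulrCA divff ?mulr1.
  - rewrite /Z /= /coupling_gap /shadow; under eq_fun do rewrite big_ord0.
    rewrite (Ex_cst P (snorm e (x0 + 0 - y))) addr0 (le_trans (snorm_le e0 _))//.
    by lra.
  - move=> k _; apply: le_trans (st k).2 _; rewrite lerD2l ler_pM2l// lerD2l.
    by lra.
have mZ : measurable [set w | delta1 <= Z m.+1 w].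
  by apply: measurable_ge_set; exact: intg_measurable (st m.+1).1.
have mS : measurable (shadow_error x0 W N X tau S K m eta).
  exact: (measurable_shadow_error sol tau0 S K m eta).
have mB : measurable (~` ball_event X tau K) by apply: measurableC; exact: measurable_ball_event.
apply: (@le_trans _ _ (P (~` ball_event X tau K `|` shadow_error x0 W N X tau S K m eta `|`
    [set w | delta1 <= Z m.+1 w]))).
  apply: le_measure; rewrite ?inE.
  - apply: measurable_ge_set; apply: measurable_enormB; first exact: mX (ltW tau0).
    exact: measurable_coupled.
  - by apply: measurableU => //; exact: measurableU.
  move=> w /= big; apply: contrapT => /not_orP[/not_orP[/contrapT Bw nsh] /negP]; rewrite -ltNge => Zs.
  have good k : (k <= m.+1)%N -> enorm (X (grid tau m k) w) <= K /\ enorm (shadow x0 W N X tau S m k w - X (grid tau m k) w) <= eta.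
    move=> km; split; first by apply: Bw; [exact: grid_ge0 | exact: grid_le_tau].
    rewrite leNgt; apply/negP => bg; apply: nsh; split => //; exists k => //; exact: ltW.
  have xy1 : enorm (x0 - y) <= delta1 by exact: le_trans dd.
  have := stopped_good good xy1 Zs; rewrite /coupling_gap.
  have [_] := good _ (leqnn _); rewrite grid_last => h1 h2.
  have := ler_enormD (X tau w - shadow x0 W N X tau S m m.+1 w) (shadow x0 W N X tau S m m.+1 w - coupled S m y m.+1 w).
  rewrite subrKA (enormB (X tau w)) => h3.
  suff : enorm (X tau w - coupled S m y m.+1 w) < eps by rewrite ltNge big.
  by lra.
apply: (le_trans (measureU2 _ _ _)) => //; first exact: measurableU.
have PZ : (P [set w | (delta1 <= Z m.+1 w)%R] <= (eps / 3)%:E)%E.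
  apply: (le_trans (markov_Ex (st m.+1).1 _ d10)) => [w|]; first by rewrite (le_trans (ltW e0)).
  by rewrite lee_fin ler_pdivrMr.
have -> : eps%:E = ((eps / 3 + eps / 3)%:E + (eps / 3)%:E)%E by rewrite -EFinD; congr EFin; field.
apply: leeD PZ; apply: (le_trans (measureU2 _ _ _)) => //.
by rewrite EFinD; exact: leeD.
Qed.

End coupling.

(** * Existence of fine schemes *)

Section simple_approximation.
Import HBNNSimple.
Context (R : realType) d (U : measurableType d).

(** Differences of approximations of the positive and the negative part; since one of the two parts
    vanishes at each point, |g_n| and |g_n - f| are both at most |f|. The first bound will make
    nonzero level sets of finite measure, the second gives domination. *)
Lemma simple_approximation (f : U -> R) : measurable_fun setT f ->
  exists g : nat -> U -> R, [/\ forall n, measurable_fun setT (g n),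
    forall n, exists s : seq R, forall u, g n u \in s,
    forall n u, `|g n u| <= `|f u|,
    forall n u, `|g n u - f u| <= `|f u| & forall u, g n u @[n --> \oo] --> f u].
Proof.
move=> mf; have mp : measurable_fun setT (EFin \o f^\+) by apply/measurable_EFinP; exact: measurable_funrpos.
have mn : measurable_fun setT (EFin \o f^\-) by apply/measurable_EFinP; exact: measurable_funrneg.
have cvR (h : U -> R) (mh : measurable_fun setT (EFin \o h)) (h0 : forall u, 0 <= h u) u :
    nnsfun_approx measurableT mh n u @[n --> \oo] --> h u.
  exact: fine_cvg (cvg_nnsfun_approx measurableT mh (fun u _ => h0 u : (0%:E <= (h u)%:E)%E) (I : setT u)).
have approx (h : U -> R) (mh : measurable_fun setT (EFin \o h)) (h0 : forall u, 0 <= h u) n u :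
    nnsfun_approx measurableT mh n u <= h u.
  have cv := cvR h mh h0 u; rewrite -(cvg_lim _ cv)//.
  apply: nondecreasing_cvgn_le; last by apply/cvg_ex; exists (h u).
  by move=> i j ij; have /lefP := nd_nnsfun_approx measurableT mh ij; exact.
pose p := nnsfun_approx measurableT mp; pose q := nnsfun_approx measurableT mn.
have pf n u : p n u <= f^\+ u := approx _ mp (funrpos_ge0 f) n u.
have qf n u : q n u <= f^\- u := approx _ mn (funrneg_ge0 f) n u.
have bd n u : `|p n u - q n u| <= `|f u| /\ `|p n u - q n u - f u| <= `|f u|.
  have := pf n u; have := qf n u; have : 0 <= p n u by []; have : 0 <= q n u by [].
  rewrite /funrpos /funrneg; case: (lerP 0 (f u)) => fu; rewrite ?(max_l fu) ?(max_r (ltW fu)).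
    rewrite (max_r (_ : - f u <= 0)) ?oppr_le0// (ger0_norm fu) !ler_norml => h1 h2 h3 h4.
    by split; apply/andP; split; lra.
  rewrite (max_l (_ : 0 <= - f u)) ?oppr_ge0 ?(ltW fu)// (ltr0_norm fu) !ler_norml => h1 h2 h3 h4.
  by split; apply/andP; split; lra.
have fin (r : {nnsfun U >-> R}) : exists s : seq R, forall u, r u \in s.
  have /finite_seqP[s sE] : finite_set (range r) by exact: fimfunP.
  by exists s => u; have : range r (r u) by []; rewrite sE.
exists (fun n u => p n u - q n u); split.
- by move=> n; apply: measurable_funB.
- move=> n; have [s1 h1] := fin (p n); have [s2 h2] := fin (q n).
  by exists [seq x - y | x <- s1, y <- s2] => u; exact: allpairs_f.
- by move=> n u; have [] := bd n u.
- by move=> n u; have [] := bd n u.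
move=> u; have -> : f u = f^\+ u - f^\- u.
  rewrite /funrpos /funrneg; case: (lerP 0 (f u)) => fu.
    by rewrite max_r ?oppr_le0// subr0.
  by rewrite max_l ?oppr_ge0 ?(ltW fu)// sub0r opprK.
apply: cvgB; apply: cvR => v.
  exact: funrpos_ge0.
exact: funrneg_ge0.
Qed.

End simple_approximation.

Section cells.
Context (R : realType) d (U : measurableType d) (nu : {measure set U -> \bar R}).
Context (L : finType) (g f : L -> U -> R) (s : seq R).
Hypothesis mg : forall l, measurable_fun setT (g l).
Hypothesis mf : forall l, measurable_fun setT (f l).
Hypothesis g_le : forall l u, `|g l u| <= `|f l u|.
Hypothesis f_sqr : forall l, (\int[nu]_u (f l u ^+ 2)%:E < +oo)%E.
Hypothesis s_uniq : uniq s.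
Hypothesis g_s : forall l u, g l u \in s.

(* Level sets of the family [g], except the one where it vanishes, whose
   measure may be infinite. *)
Definition cell (k : {ffun L -> 'I_(size s)}) : set U :=
  [set u | forall l, g l u = nth 0 s (k l)] `&` [set u | exists l, g l u != 0].

Lemma measurable_cell k : measurable (cell k).
Proof.
have meq l r : measurable [set u | g l u = r].
  rewrite -[X in measurable X]setTI (_ : [set u | _] = g l @^-1` [set r])//; exact: mg.
apply: measurableI.
  rewrite (_ : [set u | _] = \bigcap_(l in [set: L]) [set u | g l u = nth 0 s (k l)]); last first.
    by apply/seteqP; split => u h l // *; exact: h.
  by apply: fin_bigcap_measurable => // l _; exact: meq.
rewrite (_ : [set u | _] = \bigcup_(l in [set: L]) ~` [set u | g l u = 0]); last first.
  by apply/seteqP; split => u [l]; [move=> /eqP h; exists l | move=> _ /eqP h; exists l].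
by apply: fin_bigcup_measurable => // l _; apply: measurableC.
Qed.

Lemma trivIset_cell : trivIset setT cell.
Proof.
move=> k k' _ _ [u [[h1 _] [h2 _]]]; apply/ffunP => l; apply/val_inj/eqP.
by rewrite -(nth_uniq 0 _ _ s_uniq) ?ltn_ord// -h1 -h2.
Qed.

(** Chebyshev: on a nonempty cell some [g l] has a constant value r different from 0, and |f l| >=
    |g l| = |r| there, with [f l] square integrable. *)
Lemma fin_cell k : (nu (cell k) < +oo)%E.
Proof.
have msq l : measurable_fun setT (fun u => (f l u ^+ 2)%:E).
  by apply/measurable_EFinP; exact: measurable_funX.
have [[l kl]|all0] := pselect (exists l, nth 0 s (k l) != 0); last first.
  rewrite (_ : cell k = set0) ?measure0//; apply/seteqP; split => // u [h [l gl]].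
  by apply: all0; exists l; rewrite -h.
set r := nth 0 s (k l) in kl; have r0 : 0 < r ^+ 2 by rewrite exprn_even_gt0.
have : ((r ^+ 2)%:E * nu (cell k) <= \int[nu]_u (f l u ^+ 2)%:E)%E.
  rewrite -integral_cst; last exact: measurable_cell.
  apply: (@le_trans _ _ (\int[nu]_(u in cell k) (f l u ^+ 2)%:E)%E).
    apply: ge0_le_integral => //; first exact: measurable_cell.
    - by move=> u _; rewrite lee_fin sqr_ge0.
    - exact: measurable_funTS.
    move=> u [/(_ l) h _]; rewrite lee_fin -[r ^+ 2]real_normK ?num_real//.
    by rewrite -[f l u ^+ 2]real_normK ?num_real// ler_pXn2r ?nnegrE// /r -h.
  apply: ge0_subset_integral => //; first exact: measurable_cell.
  by move=> u _; rewrite lee_fin sqr_ge0.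
move=> /le_lt_trans /(_ (f_sqr l)); move: (nu (cell k)) (measure_ge0 nu (cell k)) => [x _ _|_|//].
  exact: ltry.
by rewrite mulry gtr0_sg// mul1e.
Qed.

(** A point with some nonzero [g l] lies in exactly one cell; at any other point every [g l] is 0,
    which matches the empty sum. *)
Lemma cell_sum (a : {ffun L -> 'I_(size s)} -> R) l u : (forall k, a k = nth 0 s (k l)) ->
  \sum_(k | u \in cell k) a k = g l u.
Proof.
move=> aE; have sx l' : (index (g l' u) s < size s)%N by rewrite index_mem.
pose k0 := [ffun l' => Ordinal (sx l')].
have k0E l' : g l' u = nth 0 s (k0 l') by rewrite ffunE /= nth_index.
have [ex|nex] := pselect (exists l, g l u != 0).
  rewrite (bigD1 k0) ?inE//= aE -k0E big1 ?addr0// => k /andP[/set_mem uk] /eqP; case.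
  by apply: trivIset_cell => //; exists u; split.
rewrite big_pred0 => [|k]; last by apply/negbTE/negP => /set_mem[_].
by apply/esym/eqP/contraT => gl; case: nex; exists l.
Qed.

End cells.

Section scheme_exists.
Context (R : realType) (D : nat) (dispU : measure_display)
  (U : measurableType dispU) (nu : {sigma_finite_measure set U -> \bar R})
  (b : 'cV[R]_D -> 'cV[R]_D) (sigma : 'cV[R]_D -> 'M[R]_D)
  (c : 'cV[R]_D -> U -> 'cV[R]_D).
Hypothesis b_continuous : continuous b.
Hypothesis sigma_continuous : continuous sigma.
Hypothesis c_measurable :
  measurable_fun setT (fun p : borel 'cV[R]_D * U => c p.1 p.2 : borel 'cV[R]_D).
Hypothesis c_continuous : forall u, continuous (c ^~ u).
Hypothesis c2_finite : forall x, (\int[nu]_u (enorm (c x u) ^+ 2)%:E < +oo)%E.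
Hypothesis c2_continuous : continuous (fun x => \int[nu]_u (enorm (c x u) ^+ 2)%:E)%E.

Let mc := measurable_coefficient c_measurable.

(** One level-set decomposition has to serve all points [z i] and all coordinates, so the whole
    family indexed by pairs is approximated at once, with a common value list and a common n. *)
Lemma finite_L2_approximation (I : finType) (z : I -> 'cV[R]_D) (eps : R) : 0 < eps ->
  exists (J : finType) (A : J -> set U) (gam : I -> J -> 'cV[R]_D),
  [/\ forall j, measurable (A j), forall j, (nu (A j) < +oo)%E, trivIset setT A &
  forall i, (\int[nu]_u (enorm ((\sum_(j | u \in A j) gam i j) - c (z i) u) ^+ 2)%:E <= eps%:E)%E].
Proof.
move=> eps0; pose L : finType := (I * 'I_D)%type; pose f (l : L) u := c (z l.1) u l.2 ord0.
have mf l : measurable_fun setT (f l) by apply: measurable_entry; exact: mc.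
have [g gP] := choice (fun l => simple_approximation (mf l)).
have mgf l n : measurable_fun setT (g l n) by have [h _ _ _ _] := gP l; exact: h.
pose F n u := \sum_l (g l n u - f l u) ^+ 2; pose G u := \sum_l f l u ^+ 2.
have fc l u : f l u ^+ 2 <= enorm (c (z l.1) u) ^+ 2.
  by rewrite -real_normK ?num_real// ler_pXn2r ?nnegrE ?enorm_ge0// ler_entry_enorm.
have msq l : measurable_fun setT (fun u => f l u ^+ 2) by exact: measurable_funX.
have mc2 x : measurable_fun setT (fun u => (enorm (c x u) ^+ 2)%:E).
  apply/measurable_EFinP; apply: measurable_funX.
  exact: (measurable_borel_real (@continuous_enorm R D 1) (mc x)).
have f_sqr l : (\int[nu]_u (f l u ^+ 2)%:E < +oo)%E.
  apply: le_lt_trans (c2_finite (z l.1)); apply: ge0_le_integral => //.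
  - by move=> u _; rewrite lee_fin sqr_ge0.
  - exact/measurable_EFinP.
  - by move=> u _; rewrite lee_fin.
have iG : nu.-integrable setT (EFin \o G).
  rewrite (_ : EFin \o G = (fun u => \sum_(l <- index_enum L) (f l u ^+ 2)%:E)%E); last first.
    by apply/funext => u; rewrite /= sumEFin.
  apply: integrable_sum => // l _; apply/integrableP; split; first exact/measurable_EFinP.
  by under eq_integral do rewrite gee0_abs ?lee_fin ?sqr_ge0//.
have mF n : measurable_fun setT (F n).
  by apply: measurable_sum => l; apply: measurable_funX; exact: measurable_funB.
have FG n u : 0 <= F n u <= G u.
  apply/andP; split; first by apply: sumr_ge0 => l _; exact: sqr_ge0.
  apply: ler_sum => l _; rewrite -[leLHS]real_normK ?num_real// -[leRHS]real_normK ?num_real//.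
  by rewrite ler_pXn2r ?nnegrE//; have [_ _ _ h _] := gP l; exact: h.
have F0 u : F n u @[n --> \oo] --> 0.
  rewrite /F; elim: (index_enum L) => [|l t ih].
    by under eq_fun do rewrite big_nil; exact: cvg_cst.
  have h0 : g l n u - f l u @[n --> \oo] --> 0.
    by rewrite -(subrr (f l u)); apply: cvgB; [have [_ _ _ _ h] := gP l; exact: h|exact: cvg_cst].
  have lc : (g l n u - f l u) * (g l n u - f l u) + \sum_(l <- t) (g l n u - f l u) ^+ 2
    @[n --> \oo] --> (0 * 0 + 0 : R) by exact: (cvgD (cvgM h0 h0) ih).
  rewrite mul0r addr0 in lc; rewrite (_ : (fun n => _) = (fun n => (g l n u - f l u) * (g l n u - f l u) +
    \sum_(l <- t) (g l n u - f l u) ^+ 2))//.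
  by apply/funext => n; rewrite big_cons expr2.
have cv := dominated_convergence0 mF iG FG F0.
have : \forall n \near \oo, (\int[nu]_u (F n u)%:E <= eps%:E)%E.
  have : nbhs (0%E : \bar R) [set t | (t < eps%:E)%E].
    by apply: open_nbhs_nbhs; split; [exact: open_ereal_lt_ereal | rewrite /= lte_fin].
  by move=> /cv[N0 _ h]; exists N0 => // n /h /ltW.
move=> [n _ /(_ n (leqnn n)) /= nE].
have [s0 s0P] := choice (fun l => let: And5 _ h _ _ _ := gP l in h n).
pose s := undup (flatten [seq s0 l | l <- enum L]).
have s_uniq : uniq s by exact: undup_uniq.
have gs l u : g l n u \in s.
  rewrite mem_undup; apply/flatten_mapP; exists l; [by rewrite mem_enum | exact: s0P].
have gle l u : `|g l n u| <= `|f l u| by have [_ _ h _ _] := gP l.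
pose gn l := g l n; have mgn l : measurable_fun setT (gn l) by exact: mgf.
exists {ffun L -> 'I_(size s)}, (cell gn (s := s)),
  (fun i (k : {ffun L -> 'I_(size s)}) => \col_(l < D) nth 0 s (k (i, l))); split.
- by move=> k; exact: measurable_cell.
- by move=> k; exact: (fin_cell mgn mf gle f_sqr).
- exact: trivIset_cell.
move=> i; apply: le_trans nE.
have E u : enorm ((\sum_(j : {ffun L -> 'I_(size s)} | u \in cell gn j) \col_(l < D) nth 0 s (j (i, l))) -
    c (z i) u) ^+ 2 =
    \sum_l (g (i, l) n u - f (i, l) u) ^+ 2.
  rewrite sqr_enorm_col; apply: eq_bigr => l _; rewrite !mxE summxE; congr ((_ - _) ^+ 2).
  under eq_bigr do rewrite mxE.
  exact: (@cell_sum R _ U L gn s s_uniq gs (fun k => nth 0 s (k (i, l))) (i, l) u (fun k => erefl)).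
under eq_integral do rewrite E.
apply: ge0_le_integral => //.
- by move=> u _; rewrite lee_fin; apply: sumr_ge0 => l _; exact: sqr_ge0.
- by apply/measurable_EFinP; apply: measurable_sum => l; apply: measurable_funX; exact: measurable_funB.
- exact/measurable_EFinP.
move=> u _; rewrite lee_fin /F.
rewrite [leRHS](_ : _ = \sum_i' \sum_l (g (i', l) n u - f (i', l) u) ^+ 2); last first.
  by rewrite pair_bigA; apply: eq_bigr => -[].
rewrite (bigD1 i)//= lerDl.
by apply: sumr_ge0 => j _; apply: sumr_ge0 => l _; exact: sqr_ge0.
Qed.

(** The index of x is the position of the first net point whose ball contains x. Outside the ball of
    radius K the search may fail; the index is then the length of the net, and the coefficients at
    the default point 0 and zero jumps are used. *)
Lemma scheme_exists (K delta : R) : 0 < delta ->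
  exists S : scheme D nu, fine_scheme b sigma c K delta S.
Proof.
(* Two errors, from the net and from the simple functions, enter through |u + v|^2 <= 2|u|^2 +
   2|v|^2; a quarter of delta^2 for each adds up to delta^2. *)
move=> d0; have d20 : 0 < delta ^+ 2 / 4 by rewrite divr_gt0// exprn_gt0.
have /choice[r rP] : forall z, exists r : R, 0 < r /\ forall x, enorm (z - x) < r ->
   [/\ enorm (b z - b x) <= delta, enorm (sigma z - sigma x) <= delta &
       (\int[nu]_u (enorm (c z u - c x u) ^+ 2)%:E <= (delta ^+ 2 / 4)%:E)%E].
  move=> z; have [r1 r10 h1] := continuous_enormP b_continuous z d0.
  have [r2 r20 h2] := continuous_enormP sigma_continuous z d0.
  have [r3 r30 h3] := coefficient_L2_continuous c_measurable c_continuous c2_finite c2_continuous z d20.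
  exists (Num.min r1 (Num.min r2 r3)); rewrite !lt_min r10 r20 r30; split => // x.
  by rewrite !lt_min => /andP[l1 /andP[l2 l3]]; split; [exact/ltW/h1 | exact/ltW/h2 | exact: h3].
have [s sP] := @ball_net R D K r (fun z => (rP z).1).
pose idx x := find (fun z => enorm (z - x) < r z) s.
have idx_lt x : enorm x <= K -> (idx x < size s)%N.
  by move=> /sP[z zs zx]; rewrite /idx -has_find; apply/hasP; exists z.
have idxP x : enorm x <= K -> enorm (nth 0 s (idx x) - x) < r (nth 0 s (idx x)).
  by move=> /idx_lt h; have := nth_find 0 (_ : has (fun z => enorm (z - x) < r z) s); rewrite has_find; apply.
have midx : measurable_fun setT (idx : borel 'cV[R]_D -> nat).
  rewrite /idx; elim: (s) => [|z t ih] /=; first exact: measurable_cst.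
  apply: measurable_fun_ifT.
  - apply: measurable_fun_ltr => //.
    have mz : measurable_fun setT ((fun=> z) : borel 'cV[R]_D -> borel 'cV[R]_D) by exact: measurable_cst.
    have mi : measurable_fun setT (id : borel 'cV[R]_D -> borel 'cV[R]_D) by exact: measurable_id.
    exact: (measurable_enormB mz mi).
  - exact: measurable_cst.
  - exact: (measurableT_comp (f := S) _ ih).
have [J [A [gam [mA fA tA gP]]]] := finite_L2_approximation (fun i : 'I_(size s) => nth 0 s i) d20.
pose jump n j := if insub n is Some i then gam i j else 0.
pose B := \sum_(z <- 0 :: s) (enorm (b z) + enorm (sigma z)) + \sum_i \sum_j enorm (gam i j).
have in0s n : nth 0 s n \in 0 :: s.
  case: (ltnP n (size s)) => h; first by rewrite inE mem_nth ?orbT.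
  by rewrite nth_default// mem_head.
have G0 : 0 <= \sum_i \sum_j enorm (gam i j).
  by apply: sumr_ge0 => i _; apply: sumr_ge0 => j _; exact: enorm_ge0.
have z0 z : 0 <= enorm (b z) + enorm (sigma z) by rewrite addr_ge0 ?enorm_ge0.
have nB n : enorm (b (nth 0 s n)) + enorm (sigma (nth 0 s n)) <= B.
  rewrite /B (big_rem _ (in0s n))/= -addrA lerDl addr_ge0// sumr_ge0// => z _; exact: z0.
have jB n j : enorm (jump n j) <= B.
  have B1 : \sum_i \sum_j enorm (gam i j) <= B by rewrite lerDr sumr_ge0.
  rewrite /jump; case: insub => [i|]; last by rewrite enorm0 (le_trans G0).
  rewrite (le_trans _ B1)// (bigD1 i)//= (bigD1 j)//= -addrA lerDl addr_ge0 ?sumr_ge0// => *.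
    exact: enorm_ge0.
  by apply: sumr_ge0 => *; exact: enorm_ge0.
have bB n : enorm (b (nth 0 s n)) <= B by rewrite (le_trans _ (nB n))// lerDl enorm_ge0.
have sB n : enorm (sigma (nth 0 s n)) <= B by rewrite (le_trans _ (nB n))// lerDr enorm_ge0.
pose Sch := @Scheme R D dispU U nu idx (fun n => b (nth 0 s n)) (fun n => sigma (nth 0 s n)) J A jump B
  midx mA fA tA bB sB jB.
exists Sch => x xK /=.
have [h1 h2 h3] := (rP _).2 x (idxP x xK); split => //.
set i := Ordinal (idx_lt x xK).
have jE u : \sum_(j | u \in A j) jump (idx x) j = \sum_(j | u \in A j) gam i j.
  apply: eq_bigr => j _; rewrite /jump; case: insubP => [k _ kE|]; last by rewrite idx_lt.
  by congr gam; exact: val_inj.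
rewrite /jump_function /=; under eq_integral do rewrite jE.
have msum : measurable_fun setT (fun u => \sum_(j | u \in A j) gam i j : borel 'cV[R]_D).
  rewrite (_ : (fun u => _) = jump_function Sch (idx x)); first exact: measurable_jump_function.
  by apply/funext => u; rewrite /jump_function/= jE.
have m1 : measurable_fun setT (fun u => enorm (\sum_(j | u \in A j) gam i j - c x u) ^+ 2).
  by apply: measurable_funX; exact: measurable_enormB.
have m2 : measurable_fun setT (fun u => 2 * enorm (\sum_(j | u \in A j) gam i j - c (nth 0 s i) u) ^+ 2).
  by apply: measurable_funM => //; apply: measurable_funX; exact: measurable_enormB.
have m3 : measurable_fun setT (fun u => 2 * enorm (c (nth 0 s i) u - c x u) ^+ 2).
  by apply: measurable_funM => //; apply: measurable_funX; exact: measurable_enormB.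
apply: (@le_trans _ _ (\int[nu]_u (2 * enorm (\sum_(j | u \in A j) gam i j - c (nth 0 s i) u) ^+ 2)%:E +
   \int[nu]_u (2 * enorm (c (nth 0 s i) u - c x u) ^+ 2)%:E)%E).
  rewrite -ge0_integralD//; first last.
  - exact/measurable_EFinP.
  - by move=> u _; rewrite lee_fin mulr_ge0// sqr_ge0.
  - exact/measurable_EFinP.
  - by move=> u _; rewrite lee_fin mulr_ge0// sqr_ge0.
  apply: ge0_le_integral => //.
  - by move=> u _; rewrite lee_fin sqr_ge0.
  - exact/measurable_EFinP.
  - by apply: emeasurable_funD; exact/measurable_EFinP.
  move=> u _; rewrite -EFinD lee_fin -[X in enorm X](subrKA (c (nth 0 s i) u)); exact: sqr_enormD_le.
have tw (f : U -> R) : measurable_fun setT f -> (forall u, 0 <= f u) ->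
    (\int[nu]_u (f u)%:E <= (delta ^+ 2 / 4)%:E)%E -> (\int[nu]_u (2 * f u)%:E <= (delta ^+ 2 / 2)%:E)%E.
  move=> mf f0 le; under eq_integral do rewrite EFinM.
  rewrite ge0_integralZl//; [|exact/measurable_EFinP|by move=> *; rewrite lee_fin].
  have -> : delta ^+ 2 / 2 = 2 * (delta ^+ 2 / 4) by field.
  by rewrite (EFinM 2 (delta ^+ 2 / 4)) lee_wpmul2l// lee_fin.
have t1 := tw (fun u => enorm (\sum_(j | u \in A j) gam i j - c (nth 0 s i) u) ^+ 2)
  (measurable_funX 2 (measurable_enormB msum (mc _))) (fun u => sqr_ge0 _) (gP i).
have t2 := tw (fun u => enorm (c (nth 0 s i) u - c x u) ^+ 2)
  (measurable_funX 2 (measurable_enormB (mc _) (mc _))) (fun u => sqr_ge0 _) h3.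
by rewrite [in leRHS](splitr (delta ^+ 2)) EFinD; exact: leeD t1 t2.
Qed.

End scheme_exists.

(** * The law of the scheme *)

Section driven_path.
Context (R : realType) (D : nat) (dispU : measure_display)
  (U : measurableType dispU) (nu : {sigma_finite_measure set U -> \bar R}) (S : scheme D nu).

(** The scheme as a function of the increments alone, freed from any probability space. *)
Fixpoint driven_path (h : nat -> R) (dW : nat -> 'cV[R]_D) (dN : nat -> sch_mark S -> R)
    (y : 'cV[R]_D) k : 'cV[R]_D :=
  if k is k'.+1 then let z := driven_path h dW dN y k' in
    z + (h k' *: sch_drift S (sch_index S z) + sch_diffusion S (sch_index S z) *m dW k' +
         \sum_j dN k' j *: sch_jump (sch_index S z) j)
  else y.

Lemma scheme_pathE T (W : R -> T -> 'cV[R]_D) (Nc : sch_mark S -> R -> R -> T -> R) g y k w :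
  scheme_path W Nc g y k w = driven_path (fun k => g k.+1 - g k)
    (fun k => W (g k.+1) w - W (g k) w) (fun k j => Nc j (g k) (g k.+1) w) y k.
Proof. by elim: k => //= k ->. Qed.

Lemma eq_driven_path h dW dW' dN dN' y k : (forall i, (i < k)%N -> dW i = dW' i) ->
  (forall i j, (i < k)%N -> dN i j = dN' i j) ->
  driven_path h dW dN y k = driven_path h dW' dN' y k.
Proof.
elim: k => //= k ih eW eN; rewrite ih => [|i ik|i j ik]; [|exact/eW/ltnW|exact/eN/ltnW].
by rewrite eW//; under eq_bigr do rewrite eN//.
Qed.

Lemma measurable_driven_path d (T : measurableType d) h (dW : T -> nat -> 'cV[R]_D)
    (dN : T -> nat -> sch_mark S -> R) y k :
  (forall i, measurable_fun setT ((fun w => dW w i) : T -> borel 'cV[R]_D)) ->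
  (forall i j, measurable_fun setT (fun w => dN w i j)) ->
  measurable_fun setT ((fun w => driven_path h (dW w) (dN w) y k) : T -> borel 'cV[R]_D).
Proof.
move=> mW mN; elim: k => [|k mz]; first exact: measurable_cst.
have mcoef (g : nat -> R) : measurable_fun setT (fun w => g (sch_index S (driven_path h (dW w) (dN w) y k))).
  exact: (measurableT_comp (measurable_sch_comp S g) mz).
apply: (measurable_addmx mz); apply: measurable_entries => i l; rewrite (ord1 l).
under eq_fun do rewrite !mxE summxE.
apply: measurable_funD; first apply: measurable_funD.
- by apply: measurable_funM => //; exact: (mcoef (fun n => sch_drift S n i ord0)).
- apply: measurable_sum => q; apply: measurable_funM.
    exact: (mcoef (fun n => sch_diffusion S n i q)).
  exact: measurable_entry (mW k).
- apply: measurable_sum => j; under eq_fun do rewrite mxE; apply: measurable_funM => //.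
  exact: (mcoef (fun n => sch_jump n j i ord0)).
Qed.

End driven_path.

(** * Joint law of the driving increments *)

Lemma measurable_rectangle (R : realType) n (B : 'I_n -> set R) : (forall i, measurable (B i)) ->
  measurable ([set v : 'cV[R]_n | forall i : 'I_n, B i (v i ord0)] : set (borel 'cV[R]_n)).
Proof.
move=> mB; rewrite (_ : [set v | _] =
  \bigcap_(i in [set: 'I_n]) ((fun v : borel 'cV[R]_n => (v : 'cV[R]_n) i ord0) @^-1` (B i))); last first.
  by apply/seteqP; split => [v h i _|v h i]; exact: h.
apply: fin_bigcap_measurable => // i _; rewrite -[X in measurable X]setTI.
have mi : measurable_fun setT (id : borel 'cV[R]_n -> borel 'cV[R]_n) by exact: measurable_id.
have me : measurable_fun setT (fun v : borel 'cV[R]_n => (v : 'cV[R]_n) i ord0).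
  by apply: measurable_entry; exact: mi.
exact: me.
Qed.

(** Rectangles are stable under intersection, and they generate the Borel sets because the
    coordinates do; a finite measure is determined by its values on such a class. *)
Lemma rectangle_measure_unique (R : realType) n (m1 m2 : {measure set (borel 'cV[R]_n) -> \bar R}) :
  (m1 setT < +oo)%E ->
  (forall B : 'I_n -> set R, (forall i, measurable (B i)) ->
    m1 [set v : 'cV[R]_n | forall i, B i (v i ord0)] = m2 [set v : 'cV[R]_n | forall i, B i (v i ord0)]) ->
  forall A : set (borel 'cV[R]_n), measurable A -> m1 A = m2 A.
Proof.
move=> fin rect A mA.
pose rects : set (set (borel 'cV[R]_n)) := [set A | exists2 B : 'I_n -> set R,
  (forall i, measurable (B i)) & A = [set v : 'cV[R]_n | forall i, B i (v i ord0)]].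
have gen : measurable `<=` <<s rects >>.
  move=> C mC; have mi : measurable_fun setT (id : g_sigma_algebraType rects -> borel 'cV[R]_n).
    apply: measurable_entries => i k; rewrite (ord1 k) => _ C' mC'; rewrite setTI.
    apply: sub_sigma_algebra; exists (fun j => if j == i then C' else setT) => [j|]; first by case: ifP.
    apply/seteqP; split => v /=; first by move=> h j; case: eqVneq => [->|].
    by move=> /(_ i); rewrite eqxx.
  by have := mi measurableT C mC; rewrite setTI preimage_id.
apply: (@g_sigma_algebra_measure_unique _ _ _ rects _ (fun=> setT)) => //.
- by move=> _ [B mB ->]; exact: measurable_rectangle.
- move=> _; exists (fun=> setT) => //; by apply/seteqP; split.
- by apply/seteqP; split => // x _; exists 0%N.
- move=> _ _ [B mB ->] [B' mB' ->]; exists (fun i => B i `&` B' i).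
    by move=> i; exact: measurableI.
  by apply/seteqP; split => [v [h h'] i|v h]; [split|split => i; have [] := h i].
- by move=> _ [B mB ->]; exact: rect.
- exact: gen.
Qed.

Section noise_law.
Context (R : realType) (D : nat) d (T : measurableType d) (P : probability T R)
  (F : R -> set (set T)) (dispU : measure_display)
  (U : measurableType dispU) (nu : {sigma_finite_measure set U -> \bar R})
  (b : 'cV[R]_D -> 'cV[R]_D) (sigma : 'cV[R]_D -> 'M[R]_D)
  (c : 'cV[R]_D -> U -> 'cV[R]_D) (x0 : 'cV[R]_D)
  (W : R -> T -> 'cV[R]_D) (N : R.-ker T ~> (R * U)%type) (X : R -> T -> 'cV[R]_D).
Hypothesis sol : solves_sde P F nu b sigma c x0 W N X.
Context (g : nat -> R).
Hypothesis g0 : forall k, 0 <= g k.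
Hypothesis g_lt : forall k, g k < g k.+1.
Context (J : finType) (A : J -> set U).
Hypothesis mA : forall j, measurable (A j).
Hypothesis fA : forall j, (nu (A j) < +oo)%E.
Hypothesis tA : trivIset setT A.

Let F_sigma := solution_sigma sol.
Let F_mono := solution_mono sol.
Let bm := sde_brownian sol.
Let prm := sde_poisson sol.

Let g_le : {homo g : i j / (i <= j)%N >-> i <= j}.
Proof. by apply: homo_leq => //; [exact: le_trans | move=> k; exact: ltW]. Qed.

Let xi := brownian_increment W.

Let mxi l k q : (k < q)%N -> known F (g q) (xi l (g k) (g k.+1)).
Proof.
move=> kq; apply: (known_le F_sigma F_mono (g0 k.+1)); first exact: g_le.
exact: (noise_known (brownian_noise F_sigma F_mono bm) l (g0 k) (ltW (g_lt k))).
Qed.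

(** Induction on the number of steps: the last increment is independent of the filtration at its
    left end, to which the earlier ones belong. *)
Lemma brownian_law q (B : nat -> 'I_D -> set R) : (forall k l, measurable (B k l)) ->
  P [set w | forall k, (k < q)%N -> forall l, B k l (xi l (g k) (g k.+1) w)] =
  (\prod_(k < q) \prod_l normal_prob 0 (Num.sqrt (g k.+1 - g k)) (B k l))%E.
Proof.
move=> mB; elim: q => [|q ih].
  by rewrite big_ord0 (_ : [set w | _] = setT) ?probability_setT//; apply/seteqP; split.
rewrite big_ord_recr/= -ih -(bm_normal bm (g0 q) (g_lt q) (mB q)).
rewrite (_ : [set w | _] = [set w | forall k, (k < q)%N -> forall l, B k l (xi l (g k) (g k.+1) w)] `&`
    [set w | forall l, B q l ((W (g q.+1) w - W (g q) w) l ord0)]); last first.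
  apply/seteqP; split => w; first by move=> h; split => [k kq|]; apply: h => //; exact: ltnW.
  by move=> [h1 h2] k; rewrite ltnS leq_eqVlt => /orP[/eqP ->|]; [exact: h2 | exact: h1].
apply: (bm_independent bm (g0 q) (g_lt q)).
  have m1 : measurable ([set w | forall k, (k < q)%N -> forall l, B k l (xi l (g k) (g k.+1) w)]
      : set (at_time F (g q))).
    rewrite (_ : [set w | _] = \bigcap_(k in `I_q) \bigcap_(l in [set: 'I_D])
       (xi l (g k) (g k.+1) @^-1` (B k l))); last first.
      by apply/seteqP; split => [w h k kq l _|w h k kq l]; exact: h.
    apply: fin_bigcap_measurable => // k kq; apply: fin_bigcap_measurable => // l _.
    by rewrite -[X in measurable X]setTI; exact: mxi.
  by move: m1; rewrite /measurable/= sigma_algebra_id//; exact: (F_sigma (g0 q)).1.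
exists [set v : 'cV[R]_D | forall l, B q l (v l ord0)] => //; last by rewrite setTI.
exact: measurable_rectangle.
Qed.

Let block (p : nat * J) : set (R * U) := `]g p.1, g p.1.+1] `*` A p.2.

Let mblock p : measurable (block p). Proof. exact: measurableX. Qed.

Let fblock p : (intensity nu (block p) < +oo)%E.
Proof.
rewrite /block intensity_rectangle// ?(ltW (g_lt _))// lte_mul_pinfty// ?lee_fin ?subr_ge0//.
exact: ltW.
Qed.

Let Nfine p w : R := fine (N w (block p)).

Let mNE (B : set (R * U)) : measurable B -> measurable_fun setT (fun w => N w B).
Proof. by move=> mB; exact: measurable_kernel. Qed.

Let mNfine p : measurable_fun setT (Nfine p).
Proof. by apply: measurableT_comp => //; exact: mNE. Qed.

Definition poisson_mass (B : set R) (lam : R) : \bar R :=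
  (\sum_(k <oo | k \in [set k : nat | B k%:R]) poisson_prob lam 0%N [set k])%E.

Lemma poisson_law p (B : set R) : measurable B ->
  P (Nfine p @^-1` B) = poisson_mass B (fine (intensity nu (block p))).
Proof.
move=> mB; have mk (k : nat) : measurable [set w | N w (block p) = (k%:R)%:E].
  rewrite -[X in measurable X]setTI (_ : [set w | _] = (fun w => N w (block p)) @^-1` [set (k%:R)%:E])//.
  exact: mNE.
transitivity (P (\bigcup_(k in [set k : nat | B k%:R]) [set w | N w (block p) = (k%:R)%:E])).
  have m1 : measurable (Nfine p @^-1` B) by rewrite -[X in measurable X]setTI; exact: mNfine.
  have m2 := bigcup_measurable (P := [set k : nat | B k%:R]) (fun k _ => mk k).
  apply/eqP; rewrite eq_le; apply/andP; split; apply: probability_le_ae => //.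
    apply: filterS (poisson_count_nat prm (mblock p) (fblock p)) => w [k kE] /= h.
    by exists k => //=; move: h; rewrite /Nfine kE.
  by apply: nearW => w [k /= h kE]; rewrite /Nfine kE.
rewrite measure_bigcup//; last first.
  by move=> k k' _ _ [w [/= -> []]] /eqP; rewrite eqr_nat => /eqP.
by apply: eq_eseriesr => k _; exact: (prm_poisson prm).
Qed.

Let trivIset_block : trivIset setT block.
Proof.
move=> [k j] [k' j'] _ _ [[r u] [[/= h1 h2] [/= h3 h4]]].
have -> : j = j' by apply: tA => //; exists u.
suff -> : k = k' by [].
move: h1 h3; rewrite !in_itv/= => /andP[k1 k2] /andP[k3 k4].
case: (ltngtP k k') => // kk.
  by have := lt_le_trans k3 k2; rewrite ltNge g_le.
by have := lt_le_trans k1 k4; rewrite ltNge g_le.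
Qed.

(** The independence of counts is stated for families indexed by ordinals, hence the enumeration of
    I; injectivity of f makes the blocks disjoint. *)
Lemma poisson_joint_law (I : finType) (f : I -> nat * J) (B : I -> set R) : injective f ->
  (forall i, measurable (B i)) ->
  P [set w | forall i, B i (Nfine (f i) w)] =
  (\prod_(i < #|I|) poisson_mass (B (enum_val i)) (fine (intensity nu (block (f (enum_val i))))))%E.
Proof.
move=> f_inj mB.
have := prm_independent prm (n := #|I|) (A := fun i => block (f (enum_val i)))
  (fun i => mblock _) _ (B := fun i => (fine : \bar R -> R) @^-1` (B (enum_val i))) _.
have -> : [set w | forall i, B i (Nfine (f i) w)] =
  [set w | forall i : 'I_#|I|, (fine @^-1` B (enum_val i)) (N w (block (f (enum_val i))))].
  apply/seteqP; split => w h i; first exact: h.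
  by have := h (enum_rank i); rewrite enum_rankK.
move=> ->.
- by apply: eq_bigr => i _; rewrite -poisson_law.
- move=> i i' _ _ [x [h h']]; apply: enum_val_inj; apply: f_inj.
  by apply: trivIset_block => //; exists x.
- move=> i; rewrite -[X in measurable X]setTI; exact: fine_measurable.
Qed.

(** The right side mentions only the grid, the mark sets and nu: no trace of the solution is left.
    The product of the two kinds of noise comes from the independence of W and N. *)
Lemma noise_law q (B : 'I_q * ('I_D + J) -> set R) : (forall i, measurable (B i)) ->
  P [set w | forall k : 'I_q, (forall l, B (k, inl l) (xi l (g k) (g k.+1) w)) /\
                    (forall j, B (k, inr j) (Nfine (k : nat, j) w))] =
  ((\prod_(k < q) \prod_l normal_prob 0 (Num.sqrt (g k.+1 - g k)) (B (k, inl l))) *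
   \prod_(i < #|{: 'I_q * J}|) poisson_mass (B ((enum_val i).1, inr (enum_val i).2))
     (fine (intensity nu (block ((enum_val i).1 : nat, (enum_val i).2)))))%E.
Proof.
move=> mB; rewrite -(@poisson_joint_law ('I_q * J)%type (fun i => (i.1 : nat, i.2))
   (fun i => B (i.1, inr i.2))) => [|[k j] [k' j'] [/val_inj -> ->]|//]; last by [].
pose B' k l := if insub k is Some i then B (i, inl l) else setT.
have B'E (k : 'I_q) l : B' k l = B (k, inl l) by rewrite /B' valK.
have mB' k l : measurable (B' k l) by rewrite /B'; case: insub.
under [X in (X * _)%E]eq_bigr => k _ do under eq_bigr do rewrite -B'E.
rewrite -(brownian_law q mB').
rewrite (_ : [set w | _] = [set w | forall k, (k < q)%N -> forall l, B' k l (xi l (g k) (g k.+1) w)] `&`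
  [set w | forall i : 'I_q * J, B (i.1, inr i.2) (Nfine (i.1 : nat, i.2) w)]); last first.
  apply/seteqP; split => w.
    move=> h; split => [k kq l|[k j]]; last by have [_] := h k; exact.
    by have [h1 _] := h (Ordinal kq); rewrite (B'E (Ordinal kq)); exact: h1.
  move=> [h1 h2] k; split => [l|j]; last exact: (h2 (k, j)).
  by rewrite -B'E; exact: h1.
apply: (sde_independent sol).
  have m1 : measurable ([set w | forall k, (k < q)%N -> forall l, B' k l (xi l (g k) (g k.+1) w)]
      : set (g_sigma_algebraType (generated `[0, +oo[ (W : R -> T -> borel 'cV[R]_D)))).
    rewrite (_ : [set w | _] = \bigcap_(k in `I_q) \bigcap_(l in [set: 'I_D])
       (xi l (g k) (g k.+1) @^-1` (B' k l))); last first.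
      by apply/seteqP; split => [w h k kq l _|w h k kq l]; exact: h.
    apply: fin_bigcap_measurable => // k kq; apply: fin_bigcap_measurable => // l _.
    rewrite -[X in measurable X]setTI.
    suff mW : measurable_fun setT (xi l (g k) (g k.+1) :
      g_sigma_algebraType (generated `[0, +oo[ (W : R -> T -> borel 'cV[R]_D)) -> R) by exact: mW.
    rewrite (_ : xi l _ _ = (fun w => W (g k.+1) w l ord0 - W (g k) w l ord0)); last first.
      by apply/funext => w; rewrite /xi /brownian_increment !mxE.
    by apply: measurable_funB; apply: measurable_entry; apply: measurable_generated; rewrite /= in_itv/= g0.
  by move: m1; rewrite /measurable/= sigma_algebra_id//; exact: smallest_sigma_algebra.
have m1 : measurable ([set w | forall i : 'I_q * J, B (i.1, inr i.2) (Nfine (i.1 : nat, i.2) w)]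
    : set (g_sigma_algebraType (generated [set A : set (R * U) | measurable A] (fun A w => N w A)))).
  rewrite (_ : [set w | _] = \bigcap_(i in [set: 'I_q * J])
     (Nfine (i.1 : nat, i.2) @^-1` (B (i.1, inr i.2)))); last first.
    by apply/seteqP; split => [w h i _|w h i]; exact: h.
  apply: fin_bigcap_measurable => // i _; rewrite -[X in measurable X]setTI.
  suff mW : measurable_fun setT (Nfine (i.1 : nat, i.2) :
    g_sigma_algebraType (generated [set A : set (R * U) | measurable A] (fun A w => N w A)) -> R) by exact: mW.
  apply: measurableT_comp => //; apply: (measurable_generated (Y := fun (A : set (R * U)) w => N w A)).
  exact: mblock.
by move: m1; rewrite /measurable/= sigma_algebra_id//; exact: smallest_sigma_algebra.
Qed.

End noise_law.

Section noise_vector.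
Context (R : realType) (D : nat) d (T : measurableType d) (P : probability T R)
  (F : R -> set (set T)) (dispU : measure_display)
  (U : measurableType dispU) (nu : {sigma_finite_measure set U -> \bar R})
  (b : 'cV[R]_D -> 'cV[R]_D) (sigma : 'cV[R]_D -> 'M[R]_D)
  (c : 'cV[R]_D -> U -> 'cV[R]_D) (x0 : 'cV[R]_D)
  (W : R -> T -> 'cV[R]_D) (N : R.-ker T ~> (R * U)%type) (X : R -> T -> 'cV[R]_D).
Context (tau : R) (S : scheme D nu) (m : nat) (y : 'cV[R]_D).

Let g := grid tau m.
Let A := @sch_set _ _ _ _ _ S.
Let block (p : nat * sch_mark S) : set (R * U) := `]g p.1, g p.1.+1] `*` A p.2.
Let I : finType := ('I_m.+1 * ('I_D + sch_mark S))%type.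

(** All increments up to the last step collected in one column, so that a single uniqueness argument
    on the Borel sets of a Euclidean space settles their joint law. *)
Definition noise_vector w : 'cV[R]_#|I| := \col_(i < #|I|)
  let p : I := enum_val i in
  match p.2 with
  | inl l => brownian_increment W l (g p.1) (g p.1.+1) w
  | inr j => fine (N w (block (p.1 : nat, j)))
  end.

(** Counts are compensated here, so the vector holds the plain ones. [inord] gives meaningless
    indices beyond step m, which the path up to m + 1 never reads. *)
Definition noise_path (z : 'cV[R]_#|I|) : 'cV[R]_D :=
  driven_path (fun k => g k.+1 - g k)
    (fun k => \col_l z (enum_rank ((inord k, inl l) : I)) ord0)
    (fun k (j : sch_mark S) => z (enum_rank ((inord k, inr j) : I)) ord0 - fine (intensity nu (block (k, j))))
    y m.+1.

Lemma noise_vectorP w : coupled W N tau S m y m.+1 w = noise_path (noise_vector w).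
Proof.
rewrite /coupled scheme_pathE; apply: eq_driven_path => [k km|k j km].
  by apply/matrixP => l o; rewrite (ord1 o) mxE /noise_vector mxE enum_rankK/= inordK// /brownian_increment.
by rewrite /noise_vector mxE enum_rankK/= inordK.
Qed.

Lemma measurable_noise_path : measurable_fun setT (noise_path : borel 'cV[R]_#|I| -> borel 'cV[R]_D).
Proof.
have mi : measurable_fun setT (id : borel 'cV[R]_#|I| -> borel 'cV[R]_#|I|) by exact: measurable_id.
have me i : measurable_fun setT (fun z : borel 'cV[R]_#|I| => (z : 'cV[R]__) i ord0).
  by apply: measurable_entry; exact: mi.
apply: measurable_driven_path => [k|k j]; last by apply: measurable_funB; [exact: me | exact: measurable_cst].
by apply: measurable_entries => l o; under eq_fun do rewrite mxE; exact: me.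
Qed.

Hypothesis sol : solves_sde P F nu b sigma c x0 W N X.
Hypothesis tau0 : 0 < tau.

Lemma measurable_noise_vector : measurable_fun setT (noise_vector : T -> borel 'cV[R]_#|I|).
Proof.
have gz k : 0 <= g k by exact: grid_ge0.
apply: measurable_entries => i o; under eq_fun do rewrite mxE.
case: (enum_val i : I) => k [l|j] /=.
  have le : g k <= g k.+1 by rewrite ler_grid.
  exact: (noise_measurable (solution_sigma sol) (brownian_noise (solution_sigma sol) (solution_mono sol)
    (sde_brownian sol)) l (gz k) le).
apply: measurableT_comp => //; apply: measurable_kernel.
by apply: measurableX => //; exact: measurable_sch_set.
Qed.

Lemma noise_vector_law (B : 'I_#|I| -> set R) : (forall i, measurable (B i)) ->
  P [set w | forall i, B i (noise_vector w i ord0)] =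
  ((\prod_(k < m.+1) \prod_l normal_prob 0 (Num.sqrt (g k.+1 - g k)) (B (enum_rank ((k, inl l) : I)))) *
   \prod_(i < #|{: 'I_m.+1 * sch_mark S}|) poisson_mass (B (enum_rank (((enum_val i).1, inr (enum_val i).2) : I)))
     (fine (intensity nu (block ((enum_val i).1 : nat, (enum_val i).2)))))%E.
Proof.
move=> mB; have gz k : 0 <= g k by exact: grid_ge0.
have gl k : g k < g k.+1 by rewrite -subr_gt0 /g gridS addrAC subrr add0r divr_gt0.
rewrite -(noise_law sol gz gl (@measurable_sch_set _ _ _ _ _ S) (@fin_sch_set _ _ _ _ _ S)
  (@trivIset_sch_set _ _ _ _ _ S) (q := m.+1) (B := fun p => B (enum_rank (p : I)))) => [|p]; last exact: mB.
congr (P _); apply/seteqP; split => w /= h.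
  move=> k; split => [l|j].
    by have := h (enum_rank ((k, inl l) : I)); rewrite mxE enum_rankK.
  by have := h (enum_rank ((k, inr j) : I)); rewrite mxE enum_rankK.
move=> i; rewrite mxE -[i]enum_valK enum_rankK; case: (enum_val i : I) => k [l|j] /=.
  by have [h1 _] := h k; exact: h1.
by have [_ h1] := h k; exact: h1.
Qed.

End noise_vector.

(** Both schemes are images, under the same measurable [noise_path], of noise vectors whose laws
    agree on rectangles. *)
Lemma coupled_law (R : realType) (D : nat) d (T : measurableType d) (P : probability T R)
    (F : R -> set (set T)) d' (T' : measurableType d') (P' : probability T' R)
    (F' : R -> set (set T')) (dispU : measure_display)
    (U : measurableType dispU) (nu : {sigma_finite_measure set U -> \bar R})
    (b : 'cV[R]_D -> 'cV[R]_D) (sigma : 'cV[R]_D -> 'M[R]_D)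
    (c : 'cV[R]_D -> U -> 'cV[R]_D) (x x' : 'cV[R]_D) W W' N N' X X'
    (sol : solves_sde P F nu b sigma c x W N X) (sol' : solves_sde P' F' nu b sigma c x' W' N' X')
    (tau : R) (tau0 : 0 < tau) (S : scheme D nu) m y (B : set (borel 'cV[R]_D)) : measurable B ->
  P [set w | B (coupled W N tau S m y m.+1 w)] = P' [set w | B (coupled W' N' tau S m y m.+1 w)].
Proof.
move=> mB; have mZ := measurable_noise_vector (S := S) (m := m) sol tau0.
have mZ' := measurable_noise_vector (S := S) (m := m) sol' tau0.
pose Z : {mfun T >-> borel 'cV[R]_(#|{: 'I_m.+1 * ('I_D + sch_mark S)}|)} := mfun_Sub (mem_set mZ).
pose Z' : {mfun T' >-> borel 'cV[R]_(#|{: 'I_m.+1 * ('I_D + sch_mark S)}|)} := mfun_Sub (mem_set mZ').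
have mG : measurable ((@noise_path _ _ _ _ _ tau S m y : borel _ -> borel 'cV[R]_D) @^-1` B).
  by rewrite -[X in measurable X]setTI; exact: measurable_noise_path.
have key : distribution P Z ((@noise_path _ _ _ _ _ tau S m y : borel _ -> borel 'cV[R]_D) @^-1` B) =
    distribution P' Z' ((@noise_path _ _ _ _ _ tau S m y : borel _ -> borel 'cV[R]_D) @^-1` B).
  apply: rectangle_measure_unique mG.
    by rewrite (le_lt_trans (probability_le1 _ _)) ?ltry.
  move=> C mC; exact: etrans (noise_vector_law sol tau0 mC) (esym (noise_vector_law sol' tau0 mC)).
move: key; rewrite /distribution /pushforward /preimage /=.
under eq_set do rewrite -noise_vectorP.
by move=> ->; congr (P' _); apply/seteqP; split => w /=; rewrite noise_vectorP.
Qed.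

Lemma Ex_eq_law (R : realType) (D : nat) d (T : measurableType d) (P : probability T R)
    d' (T' : measurableType d') (P' : probability T' R) (Y : T -> 'cV[R]_D) (Y' : T' -> 'cV[R]_D)
    (f : 'cV[R]_D -> R) :
  measurable_fun setT (Y : T -> borel 'cV[R]_D) -> measurable_fun setT (Y' : T' -> borel 'cV[R]_D) ->
  (forall B : set (borel 'cV[R]_D), measurable B -> P [set w | B (Y w)] = P' [set w | B (Y' w)]) ->
  bounded_continuous f -> Ex P (fun w => f (Y w)) = Ex P' (fun w => f (Y' w)).
Proof.
move=> mY mY' law [fc [M fM]].
pose Z : {mfun T >-> borel 'cV[R]_D} := mfun_Sub (mem_set mY).
pose Z' : {mfun T' >-> borel 'cV[R]_D} := mfun_Sub (mem_set mY').
have mi : measurable_fun setT (id : borel 'cV[R]_D -> borel 'cV[R]_D) by exact: measurable_id.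
have mf : measurable_fun setT (f : borel 'cV[R]_D -> R) by exact: (measurable_borel_real fc mi).
have intf d0 (T0 : measurableType d0) (P0 : probability T0 R) (V : T0 -> 'cV[R]_D) :
    measurable_fun setT (V : T0 -> borel 'cV[R]_D) -> P0.-integrable setT ((EFin \o f) \o V).
  move=> mV; have mfV : measurable_fun setT (fun w => f (V w)) by exact: (measurable_borel_real fc mV).
  exact: (@intg_bounded _ _ _ P0 (fun w => f (V w)) M mfV (fun w => fM (V w))).
have mEf : measurable_fun setT ((EFin \o f) : borel 'cV[R]_D -> \bar R) by exact/measurable_EFinP.
rewrite /Ex /Rintegral; congr fine.
transitivity (\int[distribution P Z]_v (f v)%:E)%E.
  by rewrite (integral_distribution (X := Z) mEf)//; exact: intf.
transitivity (\int[distribution P' Z']_v (f v)%:E)%E.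
  by apply: eq_measure_integral => B mB _; exact: law.
by rewrite (integral_distribution (X := Z') mEf)//; exact: intf.
Qed.

(** * From closeness in probability to expectations *)

Section scheme_expectation.
Context (R : realType) (D : nat) d (T : measurableType d) (P : probability T R)
  (F : R -> set (set T)) (dispU : measure_display)
  (U : measurableType dispU) (nu : {sigma_finite_measure set U -> \bar R})
  (b : 'cV[R]_D -> 'cV[R]_D) (sigma : 'cV[R]_D -> 'M[R]_D)
  (c : 'cV[R]_D -> U -> 'cV[R]_D) (x0 : 'cV[R]_D)
  (W : R -> T -> 'cV[R]_D) (N : R.-ker T ~> (R * U)%type) (X : R -> T -> 'cV[R]_D).
Hypothesis sol : solves_sde P F nu b sigma c x0 W N X.

Lemma Ex_indic (A : set T) : measurable A -> Ex P (\1_A) = fine (P A).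
Proof. by move=> mA; rewrite /Ex /Rintegral integral_indic ?setIT. Qed.

Lemma uniformly_continuous_ball (f : 'cV[R]_D -> R) (K eps : R) : continuous f -> 0 < eps ->
  exists2 r : R, 0 < r & forall x y, enorm x <= K -> enorm (x - y) < r -> `|f x - f y| <= eps.
Proof.
move=> fc eps0; have e20 : 0 < eps / 2 by rewrite divr_gt0.
have /choice[r rP] : forall z, exists r : R, 0 < r /\ forall y, enorm (z - y) < 2 * r -> `|f z - f y| < eps / 2.
  move=> z; have := fc z; move=> /(@cvgrPdist_lt _ _ _ (nbhs z) (nbhs_filter z))/(_ _ e20).
  move=> /nbhs_enorm[r r0 h]; exists (r / 2); split; first by rewrite divr_gt0.
  by move=> y zy; apply: h; rewrite /= (lt_le_trans zy)// mulrC divfK.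
have [s sP] := @ball_net R D K r (fun z => (rP z).1).
have [r0 r00 r0P] : exists2 r0, 0 < r0 & forall z, z \in s -> r0 <= r z.
  elim: (s) => [|z t [r1 r10 h]]; first by exists 1.
  exists (Num.min (r z) r1); first by rewrite lt_min r10 (rP z).1.
  by move=> z'; rewrite inE ge_min => /orP[/eqP ->|/h ->]; rewrite ?lexx ?orbT.
exists r0 => // x y xK xy; have [z zs zx] := sP x xK.
have h1 := (rP z).2 x (lt_le_trans zx _); have h2 := (rP z).2 y.
rewrite -(subrKA (f z)) (le_trans (ler_normD _ _))// [leRHS]splitr lerD ?ltW//.
  by rewrite distrC; apply: h1; rewrite ler_peMl ?(ltW (rP z).1)// ler1n.
apply: h2; rewrite mulrDl mul1r -(subrKA x) (le_lt_trans (ler_enormD _ _))// ltrD//.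
exact: lt_le_trans xy (r0P _ zs).
Qed.

Hypothesis b_continuous : continuous b.
Hypothesis sigma_continuous : continuous sigma.
Hypothesis c_measurable :
  measurable_fun setT (fun p : borel 'cV[R]_D * U => c p.1 p.2 : borel 'cV[R]_D).
Hypothesis c_continuous : forall u, continuous (c ^~ u).
Hypothesis c2_finite : forall x, (\int[nu]_u (enorm (c x u) ^+ 2)%:E < +oo)%E.
Hypothesis c2_continuous : continuous (fun x => \int[nu]_u (enorm (c x u) ^+ 2)%:E)%E.
Context (delta0 : R) (rho : R -> R).
Hypothesis delta0_gt0 : 0 < delta0.
Hypothesis rho_ge0 : forall r : R, 0 <= r -> 0 <= rho r.
Hypothesis rho_nondecreasing : forall r s : R, 0 <= r -> r <= s -> rho r <= rho s.
Hypothesis rho_concave :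
  convex_function (`[0%R, +oo[ : set (convex_lmodType R^o)) (fun r => - rho r).
Hypothesis rho_gt0 : forall r : R, 0 < r -> 0 < rho r.
Hypothesis rho_osgood : forall e : R, 0 < e ->
  (\int[lebesgue_measure]_(r in `]0%R, e]) ((rho r)^-1)%:E = +oo)%E.
Hypothesis coef_bound : forall K : R, 0 < K -> exists2 kappa : R, 0 < kappa &
  forall x z : 'cV[R]_D,
    Num.max (enorm x) (enorm z) <= K -> enorm (x - z) <= delta0 ->
    (\int[nu]_u (Num.min (enorm (c x u - c z u) ^+ 2)
                         (4 * enorm (x - z) * enorm (c x u - c z u)))%:E
      + (2 * dotv (x - z) (b x - b z) + enorm (sigma x - sigma z) ^+ 2)%:E
     <= (2 * kappa * enorm (x - z) * rho (enorm (x - z)))%:E)%E.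

(** Outside a small event, X and the scheme are closer than the modulus of continuity of f on a ball
    containing X; on the event the difference is at most 2M. *)
Lemma scheme_expectation (tau eps : R) (f : 'cV[R]_D -> R) : 0 < tau -> 0 < eps ->
  bounded_continuous f -> exists Kd : R * R, [/\ 0 < Kd.1, 0 < Kd.2 &
  forall S : scheme D nu, fine_scheme b sigma c Kd.1 Kd.2 S ->
  forall y, enorm (x0 - y) <= Kd.2 -> \forall m \near \oo,
    `|Ex P (fun w => f (X tau w)) - Ex P (fun w => f (coupled W N tau S m y m.+1 w))| <= eps].
Proof.
move=> tau0 eps0 [fc [M fM]].
have M0 : 0 <= M by rewrite (le_trans _ (fM 0)).
have cad := sde_cadlag sol; have mX := solution_measurable sol.
(* The bad event has probability at most 2 theta, so its contribution 4M theta is at most eps / 2; M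
   + 1 avoids dividing by 0. *)
pose theta := eps / (8 * (M + 1)).
have theta0 : 0 < theta by rewrite divr_gt0// mulr_gt0// ltr_wpDl.
have [K K0 ballK] := ball_event_large P tau0 cad mX theta0.
have eps20 : 0 < eps / 2 by rewrite divr_gt0.
have [r r0 rP] := uniformly_continuous_ball K fc eps20.
pose e := Num.min r theta; have e0 : 0 < e by rewrite lt_min r0.
have [Kd [Kd1 Kd2 close]] := scheme_close b_continuous sigma_continuous c_measurable c_continuous
  c2_finite c2_continuous sol tau0 delta0_gt0 rho_ge0 rho_nondecreasing rho_concave rho_gt0 rho_osgood
  coef_bound e0.
exists Kd; split => // S fS y xy; apply: filterS (close S fS y xy) => m Pm.
set Y := coupled W N tau S m y m.+1 in Pm *.
have mY : measurable_fun setT (Y : T -> borel 'cV[R]_D) by exact: (measurable_coupled sol tau0).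
have mXt := mX tau (ltW tau0).
have mfX : measurable_fun setT (fun w => f (X tau w)) by exact: (measurable_borel_real fc mXt).
have mfY : measurable_fun setT (fun w => f (Y w)) by exact: (measurable_borel_real fc mY).
have iX : intg P (fun w => f (X tau w)) := intg_bounded P mfX (fun w => fM _).
have iY : intg P (fun w => f (Y w)) := intg_bounded P mfY (fun w => fM _).
pose bad := ~` ball_event X tau K `|` [set w | e <= enorm (X tau w - Y w)].
have m1 : measurable (~` ball_event X tau K) by apply: measurableC; exact: measurable_ball_event.
have m2 : measurable [set w | e <= enorm (X tau w - Y w)].
  by apply: measurable_ge_set; exact: measurable_enormB.
have mbad : measurable bad by exact: measurableU.
have Pbad : fine (P bad) <= 2 * theta.
  rewrite -lee_fin fineK; last exact: fin_num_measure.
  apply: (le_trans (measureU2 _ m1 m2)); rewrite mulrDl mul1r EFinD; apply: leeD => //.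
  by apply: (le_trans Pm); rewrite lee_fin ge_min lexx orbT.
have ibad : intg P (fun w => eps / 2 + 2 * M * \1_bad w).
  apply: intgD; first exact: intg_cst.
  apply: intgZ; apply: (@intg_bounded _ _ _ _ _ 1); first exact: measurable_indic.
  by move=> w; rewrite indicE; case: (_ \in _); rewrite ?normr1 ?normr0.
have i1 : intg P (\1_bad : T -> R).
  apply: (@intg_bounded _ _ _ _ _ 1); first exact: measurable_indic.
  by move=> w; rewrite indicE; case: (_ \in _); rewrite ?normr1 ?normr0.
have Ebad : Ex P (fun w => eps / 2 + 2 * M * \1_bad w) <= eps.
  rewrite ExD ?Ex_cst; [|exact: intg_cst|exact: intgZ].
  rewrite ExZ// Ex_indic//.
  apply: (@le_trans _ _ (eps / 2 + 2 * M * (2 * theta))).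
    by rewrite lerD2l ler_wpM2l// mulr_ge0.
  rewrite [leRHS]splitr lerD2l.
  have tE : 4 * (M + 1) * theta = eps / 2 by rewrite /theta; field; rewrite gt_eqF// ltr_wpDl.
  by move: theta0 tE; set th := theta; nra.
have pw w : `|f (X tau w) - f (Y w)| <= eps / 2 + 2 * M * \1_bad w.
  rewrite indicE; have [wb|wb] := boolP (w \in bad).
    rewrite mulr1 (le_trans (ler_normB _ _))//.
    by have := fM (X tau w); have := fM (Y w); move: eps20; lra.
  rewrite mulr0 addr0; apply: rP.
    apply: contrapT => h; move/negP: wb; apply; apply: mem_set; left => B.
    by apply: h; apply: B => //; exact: ltW.
  rewrite ltNge; apply/negP => h; move/negP: wb; apply; apply: mem_set; right => /=.
  by rewrite ge_min h.
rewrite -ExB// ler_norml; apply/andP; split.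
  rewrite lerNl -ExN; last exact: intgB.
  by apply: le_trans Ebad; apply: Ex_le => //; [apply/intgN/intgB | move=> w; rewrite (le_trans (ler_norm _))// normrN].
by apply: le_trans Ebad; apply: Ex_le => //; [exact: intgB | move=> w; rewrite (le_trans (ler_norm _))].
Qed.

End scheme_expectation.

(** * Feller continuity *)

Section feller_continuity.
Context (R : realType) (d : nat) (dispU : measure_display) (U : measurableType dispU)
  (nu : {sigma_finite_measure set U -> \bar R})
  (b : 'cV[R]_d -> 'cV[R]_d) (sigma : 'cV[R]_d -> 'M[R]_d) (c : 'cV[R]_d -> U -> 'cV[R]_d)
  (X : forall x, weak_solution nu b sigma c x).

Lemma semigroupE t f x : semigroup X t f x = Ex (ws_prob (X x)) (fun w => f (X x t w)).
Proof. by rewrite /semigroup unlock. Qed.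

Lemma intg_bounded_continuous t f x M : 0 <= t -> continuous f -> (forall y, `|f y| <= M) ->
  intg (ws_prob (X x)) (fun w => f (X x t w)).
Proof.
move=> t0 fc fM; have mX := solution_measurable (ws_solves (X x)) t0.
have mf : measurable_fun setT (fun w => f (X x t w)) by exact: (measurable_borel_real fc mX).
exact: (@intg_bounded _ _ _ _ _ M mf (fun w => fM _)).
Qed.

Lemma semigroup_bounded t f M x : 0 <= t -> continuous f -> (forall y, `|f y| <= M) ->
  `|semigroup X t f x| <= M.
Proof.
move=> t0 fc fM; have iX := intg_bounded_continuous x t0 fc fM.
rewrite semigroupE ler_norml; apply/andP; split.
  rewrite lerNl -ExN// -[leRHS](Ex_cst (ws_prob (X x)) M); apply: Ex_le; [exact: intgN|exact: intg_cst|].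
  by move=> w; rewrite (le_trans (ler_norm _))// normrN.
rewrite -[leRHS](Ex_cst (ws_prob (X x)) M); apply: Ex_le => //; first exact: intg_cst.
by move=> w; rewrite (le_trans (ler_norm _)).
Qed.

Lemma semigroup0 f x : bounded_continuous f -> semigroup X 0 f x = f x.
Proof.
move=> [fc [M fM]]; have iX := intg_bounded_continuous x (lexx 0) fc fM.
rewrite semigroupE -[RHS](Ex_cst (ws_prob (X x)) (f x)).
have ae0 : {ae ws_prob (X x), forall w, f (X x 0 w) = f x}.
  by apply: filterS (sde_start (ws_solves (X x))) => w ->.
by have [_ <-] := Ex_ae (intg_measurable iX) (measurable_cst (f x)) ae0 iX.
Qed.

End feller_continuity.

Theorem theorem4p4 (R : realType) (d : nat) (hd : (2 <= d)%N)
  (dispU : measure_display) (U : measurableType dispU)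
  (nu : {sigma_finite_measure set U -> \bar R})
  (b : 'cV[R]_d -> 'cV[R]_d) (sigma : 'cV[R]_d -> 'M[R]_d)
  (c : 'cV[R]_d -> U -> 'cV[R]_d)
  (b_measurable :
    measurable_fun setT (b : borel 'cV[R]_d -> borel 'cV[R]_d))
  (sigma_measurable :
    measurable_fun setT (sigma : borel 'cV[R]_d -> borel 'M[R]_d))
  (c_measurable :
    measurable_fun setT
      (fun p : borel 'cV[R]_d * U => c p.1 p.2 : borel 'cV[R]_d))
  (b_continuous : continuous b) (sigma_continuous : continuous sigma)
  (c_continuous : forall u, continuous (c ^~ u))
  (c2_finite : forall x, (\int[nu]_u (enorm (c x u) ^+ 2)%:E < +oo)%E)
  (c2_continuous : continuous (fun x => \int[nu]_u (enorm (c x u) ^+ 2)%:E)%E)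
  (X : forall x, weak_solution nu b sigma c x)
  (X_unique : forall x, unique_in_law nu b sigma c x)
  (delta0 : R) (delta0_gt0 : 0 < delta0)
  (rho : R -> R)
  (rho_ge0 : forall r : R, 0 <= r -> 0 <= rho r)
  (rho_nondecreasing : forall r s : R, 0 <= r -> r <= s -> rho r <= rho s)
  (rho_concave :
    convex_function (`[0%R, +oo[ : set (convex_lmodType R^o)) (fun r => - rho r))
  (rho_gt0 : forall r : R, 0 < r -> 0 < rho r)
  (rho_scaling : forall r : R, 0 < r ->
    rho r <= (1 + r) ^+ 2 * rho (r / (1 + r)))
  (rho_osgood : forall e : R, 0 < e ->
    (\int[lebesgue_measure]_(r in `]0%R, e]) ((rho r)^-1)%:E = +oo)%E)
  (coef_bound : forall K : R, 0 < K -> exists2 kappa : R, 0 < kappa &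
    forall x z : 'cV[R]_d,
      Num.max (enorm x) (enorm z) <= K -> enorm (x - z) <= delta0 ->
      (\int[nu]_u (Num.min (enorm (c x u - c z u) ^+ 2)
                           (4 * enorm (x - z) * enorm (c x u - c z u)))%:E
        + (2 * dotv (x - z) (b x - b z) + enorm (sigma x - sigma z) ^+ 2)%:E
       <= (2 * kappa * enorm (x - z) * rho (enorm (x - z)))%:E)%E) :
  Feller_continuous X.
Proof.
move=> t t0 f fbc; have [fc [M fM]] := fbc.
split; last by exists M => x; exact: semigroup_bounded.
(* The grid needs a positive horizon; at time 0 the semigroup is the identity. *)
move: t0; rewrite le_eqVlt => /orP[/eqP <-|t0].
  by rewrite (_ : semigroup X 0 f = f)//; apply/funext => x; exact: semigroup0.
have approx x eps (eps0 : 0 < eps) := scheme_expectation (ws_solves (X x)) b_continuous sigma_continuous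
  c_measurable c_continuous c2_finite c2_continuous delta0_gt0 rho_ge0 rho_nondecreasing
  rho_concave rho_gt0 rho_osgood coef_bound t0 eps0 fbc.
move=> x; apply/(@cvgrPdist_le _ _ _ (nbhs x) (nbhs_filter x)) => eps eps0.
have eps20 : 0 < eps / 2 by rewrite divr_gt0.
(* The neighbourhood of x is determined here, before z: [Kx.2] bounds the distance from x to the
   starting point z of the scheme that follows X^x. *)
have [Kx [Kx1 Kx2 hx]] := approx x _ eps20.
near=> z.
have xz : enorm (x - z) <= Kx.2 by apply: ltW; near: z; exact: near_enorm.
have [Kz [Kz1 Kz2 hz]] := approx z _ eps20.
have dl0 : 0 < Num.min Kx.2 Kz.2 by rewrite lt_min Kx2.
(* One scheme fine enough for both solutions; its accuracy may depend on z. *)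
have [S fS] := scheme_exists b_continuous sigma_continuous c_measurable c_continuous c2_finite
  c2_continuous (Num.max Kx.1 Kz.1) dl0.
have Sx : fine_scheme b sigma c Kx.1 Kx.2 S.
  by apply: fine_scheme_le (ltW dl0) _ _ fS; rewrite ?le_max ?ge_min lexx.
have Sz : fine_scheme b sigma c Kz.1 Kz.2 S.
  by apply: fine_scheme_le (ltW dl0) _ _ fS; rewrite ?le_max ?ge_min lexx orbT.
have zz : enorm (z - z) <= Kz.2 by rewrite subrr enorm0 ltW.
have [m _ /(_ m (leqnn m))[h1 h2]] := filterI (hx S Sx z xz) (hz S Sz z zz).
have sol := ws_solves (X x); have sol' := ws_solves (X z).
(* The scheme started at z has one law, whether driven by the noise of X^x or of X^z; the two
   comparisons are joined through its expectation. *)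
have law := Ex_eq_law (measurable_coupled sol t0 S m z m.+1) (measurable_coupled sol' t0 S m z m.+1)
  (fun B mB => coupled_law sol sol' t0 S m z mB) fbc.
rewrite !semigroupE; move: h1 h2; rewrite law => h1 h2.
set u := Ex (ws_prob (X z)) (fun w => f (coupled _ _ _ _ _ _ _ w)) in h1 h2.
by rewrite -(subrKA u) (le_trans (ler_normD _ _))// [leRHS]splitr lerD// distrC.
Unshelve. all: by end_near. Qed.
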